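(* Let $\mathrm{EXP}$ denote the class of problems solvable in exponential time by deterministic Turing machines. Then \[ \bigcup_a \mathrm{QIP}(\mathrm{poly},a,a-2^{-2^{\mathrm{poly}}}) \;=\; \mathrm{QIP}(3,1,1-2^{-2^{\mathrm{poly}}}) \;=\; \mathrm{EXP}, \] where the union is taken over all polynomial-time computable functions $a\colon\mathbb{N}\to(0,1]$. Explicitly, $\bigcup_a \mathrm{QIP}(\mathrm{poly},a,a-2^{-2^{\mathrm{poly}}})$ is the union over all such $a$ and all $m,p\in\mathrm{poly}$ of $\mathrm{QIP}(m,a,a-2^{-2^{p}})$, and $\mathrm{QIP}(3,1,1-2^{-2^{\mathrm{poly}}})=\bigcup_{p\in\mathrm{poly}}\mathrm{QIP}(3,1,1-2^{-2^{p}})$.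
   Context: $\mathbb{N}=\{0,1,2,\dots\}$. $\mathrm{poly}$ denotes the set of all functions $p\colon\mathbb{N}\to\mathbb{N}$ for which there is a polynomial-time deterministic Turing machine outputting $1^{p(n)}$ on input $1^n$ for all $n$. A function $f\colon\mathbb{N}\to[0,1]$ is polynomial-time computable if a polynomial-time deterministic Turing machine, on input $1^n$, outputs the rational number $f(n)$ as a ratio of integers in binary. Problems are promise problems $A=(A_{\mathrm{yes}},A_{\mathrm{no}})$. For $m\colon\mathbb{N}\to\mathbb{N}$ and $a,b\colon\mathbb{N}\to[0,1]$, $\mathrm{QIP}(m,a,b)$ is the class of promise problems $A$ having a (single-prover) quantum interactive proof system, with a polynomial-time quantum verifier whose circuits use the gate set consisting of Toffoli, Hadamard and $\pi/2$-phase-shift gates, exchanging $m(|x|)$ messages with the prover on input $x$, such that for every $x\in A_{\mathrm{yes}}$ some prover makes the verifier accept with probability at least $a(|x|)$ (completeness), and for every $x\in A_{\mathrm{no}}$ every prover makes the verifier accept with probability at most $b(|x|)$ (soundness). When sets of functions appear in place of $m,a,b$, a union over them is meant. *)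

(* Defs.v *)
From mathcomp Require Import all_boot all_algebra complex.
From mathcomp Require Import Rstruct.
From Stdlib Require Rdefinitions.
Notation R := Rdefinitions.R.
Set Implicit Arguments. Unset Strict Implicit. Unset Printing Implicit Defensive.
Import GRing.Theory Num.Theory.

(*    States 'I_(Q.+2): 0 = start, 1 = halt.  Symbols 'I_(S.+3): 0 = blank,   *)
(*    1 = bit false, 2 = bit true, others = work symbols.                     *)
(*    Moves 'I_3: 0 = left, 1 = stay, 2 = right.                              *)
Record TM := mkTM {
  tm_Q : nat;
  tm_S : nat;
  tm_delta : {ffun 'I_tm_Q.+2 * 'I_tm_S.+3 -> 'I_tm_Q.+2 * 'I_tm_S.+3 * 'I_3}
}.

(* configuration: (state, cells left of the head (nearest first),
                   cells from the head rightwards); missing cells are blank *)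
Definition config := (nat * seq nat * seq nat)%type.

Definition tm_step (M : TM) (c : config) : config :=
  let: (q, l, r) := c in
  if q == 1%N then c else
  let: (q', b, mv) := tm_delta M (inord q, inord (head 0%N r)) in
  let r1 := (b : nat) :: behead r in
  if (mv : nat) == 0%N then
    (match l with [::] => ((q' : nat), [::], 0%N :: r1)
                | x :: l' => ((q' : nat), l', x :: r1) end)
  else if (mv : nat) == 1%N then ((q' : nat), l, r1)
  else ((q' : nat), (b : nat) :: l, behead r).

Definition tm_run (M : TM) (t : nat) (c : config) : config := iter t (tm_step M) c.

Definition enc_bit (b : bool) : nat := if b then 2%N else 1%N.
Definition tm_init (x : seq bool) : config := (0%N, [::], map enc_bit x).

Fixpoint tape_out (s : seq nat) : seq bool :=
  match s with
  | 1%N :: s' => false :: tape_out s'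
  | 2%N :: s' => true :: tape_out s'
  | _ => [::]
  end.

Definition tm_outputs (M : TM) (x : seq bool) (t : nat) (y : seq bool) : Prop :=
  let: (q, _, r) := tm_run M t (tm_init x) in q = 1%N /\ tape_out r = y.

Definition polytime_fun (f : seq bool -> seq bool) : Prop :=
  exists (M : TM) (k : nat), forall x, tm_outputs M x (size x ^ k + k) (f x).

Definition in_poly (p : nat -> nat) : Prop :=
  exists (M : TM) (k : nat), forall n,
    tm_outputs M (nseq n true) (n ^ k + k) (nseq (p n) true).

Definition nat_of_bits (s : seq bool) : nat := foldl (fun acc (b : bool) => acc.*2 + b)%N 0%N s.

Definition polytime_real (f : nat -> R) : Prop :=
  exists (Mnum Mden : TM) (k : nat) (num den : nat -> seq bool),
    forall n,
      tm_outputs Mnum (nseq n true) (n ^ k + k) (num n) /\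
      tm_outputs Mden (nseq n true) (n ^ k + k) (den n) /\
      (0 < nat_of_bits (den n))%N /\
      f n = ((nat_of_bits (num n))%:R / (nat_of_bits (den n))%:R)%R.

Record promise := Promise { yes_inst : seq bool -> Prop; no_inst : seq bool -> Prop }.

Definition is_promise_problem (A : promise) : Prop :=
  forall x, yes_inst A x -> no_inst A x -> False.

Definition in_EXP (A : promise) : Prop :=
  exists (M : TM) (k : nat), forall x,
    exists y, tm_outputs M x (2 ^ (size x ^ k + k)) y /\
      (yes_inst A x -> y = [:: true]) /\ (no_inst A x -> y = [:: false]).

Local Open Scope ring_scope.
Local Open Scope complex_scope.

Notation C := (R[i])%C.

Inductive gate := Tof of nat & nat & nat | Had of nat | Ph of nat.

Definition basis (N : nat) := {ffun 'I_N -> bool}.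

Definition getq (N : nat) (i : nat) (b : basis N) : bool :=
  if insub i is Some k then b k else false.
Definition setq (N : nat) (i : nat) (v : bool) (b : basis N) : basis N :=
  [ffun j : 'I_N => if val j == i then v else b j].

(* a pure state of the N verifier qubits (verifier-private + message) together
   with the prover's private space of dimension D.+1 *)
Definition qstate (N D : nat) := basis N -> 'I_D.+1 -> C.

Definition apply_gate (N D : nat) (g : gate) (psi : qstate N D) : qstate N D :=
  match g with
  | Tof i j k =>
      if [&& (i < N)%N, (j < N)%N, (k < N)%N, i != j, j != k & i != k] then
        fun b e => psi (if getq i b && getq j b then setq k (~~ getq k b) b else b) e
      else psi
  | Had i =>
      if (i < N)%N then
        fun b e => ((Num.sqrt (2 : R))^-1)%:C *
          (psi (setq i false b) e + (if getq i b then -1 else 1) * psi (setq i true b) e)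
      else psi
  | Ph i =>
      if (i < N)%N then fun b e => (if getq i b then 'i else 1) * psi b e
      else psi
  end.

Definition apply_circuit (N D : nat) (c : seq gate) (psi : qstate N D) : qstate N D :=
  foldl (fun s g => apply_gate g s) psi c.

(* 4. Encoding of verifiers.  A verifier's output on x is read as a list of   *)
(*    natural numbers in unary (n is 1^n 0): [nv; nm; gate stream], where the *)
(*    verifier register is qubits 0..nv (qubit 0 is the output qubit), the    *)
(*    message register is qubits nv+1..nv+nm, and the gate stream is the      *)
(*    sequence of circuits V_0, V_1, ..., each terminated by token 0, gates   *)
(*    being 1 i j k (Toffoli), 2 i (Hadamard), 3 i (pi/2 phase shift).        *)
Fixpoint dec_unary (cur : nat) (s : seq bool) : seq nat :=
  match s with
  | [::] => [::]
  | true :: s' => dec_unary cur.+1 s'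
  | false :: s' => cur :: dec_unary 0 s'
  end.

Fixpoint parse_circuits (s : seq nat) (cur : seq gate) : seq (seq gate) :=
  match s with
  | [::] => [:: rev cur]
  | 0%N :: s' => rev cur :: parse_circuits s' [::]
  | 1%N :: i :: j :: k :: s' => parse_circuits s' (Tof i j k :: cur)
  | 2%N :: i :: s' => parse_circuits s' (Had i :: cur)
  | 3%N :: i :: s' => parse_circuits s' (Ph i :: cur)
  | _ :: s' => parse_circuits s' cur
  end.

Definition vd_nv (w : seq bool) : nat := nth 0%N (dec_unary 0 w) 0.
Definition vd_nm (w : seq bool) : nat := nth 0%N (dec_unary 0 w) 1.
Definition vd_circ (w : seq bool) : seq (seq gate) := parse_circuits (drop 2 (dec_unary 0 w)) [::].

Section Interaction.
Variables (nv nm D : nat).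
Let N := (nv.+1 + nm)%N.

Definition mpart (b : basis N) : basis nm := [ffun k : 'I_nm => getq (nv.+1 + k) b].
Definition setm (b : basis N) (c : basis nm) : basis N :=
  [ffun j : 'I_N => if (nv.+1 <= j)%N then
        (if (insub (j - nv.+1)%N : option 'I_nm) is Some k then c k else b j)
      else b j].

Definition prover_op := (basis nm * 'I_D.+1)%type -> (basis nm * 'I_D.+1)%type -> C.

Definition unitary (U : prover_op) : Prop :=
  forall y y', \sum_(x : basis nm * 'I_D.+1) (U x y)^* * U x y' = (y == y')%:R.

Definition apply_prover (U : prover_op) (psi : qstate N D) : qstate N D :=
  fun b e => \sum_(c : basis nm * 'I_D.+1) U (mpart b, e) c * psi (setm b c.1) c.2.

Definition init_state : qstate N D :=
  fun b e => if [forall j, b j == false] && (e == ord0) then 1 else 0.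

(* m messages, the last one sent by the prover, then the final verifier
   circuit; when m is odd the prover sends the first message. *)
Definition final_state (m : nat) (Vs : seq (seq gate)) (Ps : nat -> prover_op) : qstate N D :=
  let V j := apply_circuit (nth [::] Vs j) in
  let P j := apply_prover (Ps j) in
  let r := uphalf m in
  let psi := foldl (fun s j => if odd m then V j (P j s) else P j (V j s))
                   init_state (iota 0 r) in
  if odd m then psi else V r psi.

Definition normsq (z : C) : R := (complex.Re z) ^+ 2 + (complex.Im z) ^+ 2.

Definition accept_prob (m : nat) (Vs : seq (seq gate)) (Ps : nat -> prover_op) : R :=
  \sum_(b : basis N | getq 0 b) \sum_(e : 'I_D.+1) normsq (final_state m Vs Ps b e).

End Interaction.

Definition acc_prob (m : nat) (w : seq bool) (D : nat) (Ps : nat -> prover_op (vd_nm w) D) : R :=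
  @accept_prob (vd_nv w) (vd_nm w) D m (vd_circ w) Ps.

Definition in_QIP (m : nat -> nat) (a b : nat -> R) (A : promise) : Prop :=
  exists V : seq bool -> seq bool, polytime_fun V /\
  forall x,
    (yes_inst A x -> exists (D : nat) (Ps : nat -> prover_op (vd_nm (V x)) D),
        (forall j, unitary (Ps j)) /\ a (size x) <= @acc_prob (m (size x)) (V x) D Ps) /\
    (no_inst A x -> forall (D : nat) (Ps : nat -> prover_op (vd_nm (V x)) D),
        (forall j, unitary (Ps j)) -> @acc_prob (m (size x)) (V x) D Ps <= b (size x)).

Definition dexp_small (p : nat -> nat) (n : nat) : R := ((2 : R) ^+ (2 ^ p n)%N)^-1.

Definition in_QIP_poly_gap (A : promise) : Prop :=
  exists (a : nat -> R) (m p : nat -> nat),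
    polytime_real a /\ (forall n, 0 < a n <= 1) /\ in_poly m /\ in_poly p /\
    in_QIP m a (fun n => a n - dexp_small p n) A.

Definition in_QIP3_perfect (A : promise) : Prop :=
  exists p : nat -> nat, in_poly p /\
    in_QIP (fun _ => 3%N) (fun _ => 1) (fun n => 1 - dexp_small p n) A.

(* Main.v *)
(* Up to isometries on his private space, which only have to preserve the marginal seen by the
   verifier (Uhlmann), a prover is described by Gram matrices. So a proof system is a semidefinite
   program with exponentially many real unknowns; relaxing its equations by a doubly exponentially
   small amount gives a linear matrix inequality whose solutions contain a ball, for which the
   shrinking simplex method works with numbers of exponentially many digits.

   Conversely, an exponential-time computation is a table of cells indexed by (time, position)
   with local rules. The prover first sends a superposition of all windows of the table, each
   made of four cells with their indices. The verifier checks the window reversibly, keeps a copy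
   of one cell chosen by two quantum coins, reveals the coins and has the prover erase everything
   else, which he can do coherently only if the distribution of the kept cell does not depend on
   the coins; a Hadamard test of the coins verifies this. A loss of 2^-2^poly propagates through
   the exponentially many cells of the table and still contradicts a wrong final state. *)
From mathcomp Require Import all_boot all_order perm all_algebra complex.
From mathcomp Require Import zify ring lra Rstruct.
From Stdlib Require Import FunctionalExtensionality.
Require Import Defs.
Set Implicit Arguments. Unset Strict Implicit. Unset Printing Implicit Defensive.
Import Order.TTheory GRing.Theory Num.Theory.
Local Notation "n %:Z" := (Posz n) (only parsing) : nat_scope.

(** Three constructions carry the weight. First, exponential time is reached by padding: the
    algorithms are shown polynomial in their input together with a unary number of size [2 ^ poly],
    so that closure properties are needed for polynomial time only. Second, the semidefinite program
    asks only for an inequality between the reduced states before and after a move of the prover: a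
    positive surplus can be added to a solution afterwards and never lowers acceptance. Hence a
    solution with small negative eigenvalues is repaired by decreasing multiples of the identity, at
    the price of a slightly perturbed initial state. Third, the table of the computation is closed
    up cyclically in time and space. Each cell then occurs once in each of the four places of a
    window, so that the uniform superposition has the same marginal at every place, and the windows
    joining the last row to the first check the input and forbid a rejecting cell. If the machine
    rejects, the forbidden cell has small weight, comparison of neighbours gives all cells nearly
    equal weight, and the total weight cannot be close to 1. *)

Ltac funext x := apply: functional_extensionality => x.

(** * Stack machines on Turing machines *)
(* The tape seen from absolute coordinates: the head is at cell [p]. *)
Definition rept q (T : int -> nat) (p : int) (c : config) : Prop :=
 let: (q', l, r) := c in
 [/\ q' = q, forall k, nth 0 l k = T (p - 1 - k%:Z)%R & forall k, nth 0 r k = T (p + k%:Z)%R].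
Definition updt A T (p : int) b : int -> A :=
 fun x => if x == p then b else T x.
Lemma rep_ext q T T' p c : T =1 T' -> rept q T p c -> rept q T' p c.
by move: c=>[[q' l] r] E [? L Rr]; split=> // k; rewrite -E. Qed.
(** A left move from the empty left list creates a blank cell, so the tape is infinite in both
    directions; this is why cells are indexed by [int]. *)
Lemma rep_step M q T p c q' b mv : rept q T p c -> q != 1 ->
 tm_delta M (inord q, inord (T p)) = (q', b, mv) ->
 rept q' (updt T p (b : nat)) (p + (mv : nat)%:Z - 1) (tm_step M c).
move: c=>[[q0 l] r] [-> L Rr] q1 D; rewrite /tm_step (negbTE q1).
have -> : head 0 r = T p by rewrite -nth0 Rr; congr T; lia.
rewrite D.
have Rb k: nth 0 ((b : nat) :: behead r) k = updt T p (b : nat) (p + k%:Z).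
 case: k=>[|k]/=; rewrite /updt; first by rewrite ifT; lia.
 by rewrite nth_behead Rr ifF; lia.
have Lb k: nth 0 l k = updt T p (b : nat) (p - 1 - k%:Z).
 by rewrite L /updt ifF; lia.
case: ifP=> [/eqP m0|m0].
 have Lb0 k y: y = nth 0 l k -> y = updt T p (b : nat) (p - 1 - k%:Z) by move=> ->.
 case El: l Lb0=>[|x l'] Lb0/=; split=> //.
 - by move=> k; rewrite (Lb0 k.+1 (nth 0 [::] k)) ?nth_nil//; congr updt; lia.
 - case=> [|k]; last by rewrite/= Rb; congr updt; lia.
  by rewrite [LHS](Lb0 0 0)//; congr updt; lia.
 - by move=> k; rewrite (Lb0 k.+1 (nth 0 l' k))//; congr updt; lia.
 - case=> [|k]; last by rewrite/= Rb; congr updt; lia.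
  by rewrite (Lb0 0 x)//; congr updt; lia.
case: ifP=> [/eqP m1|m1]; split=> //.
all: try have m2: (mv : nat) = 2 by case: mv m0 m1 {D} => [[|[|[|m]]] Hm].
- by move=> k; rewrite Lb; congr updt; lia.
- by move=> k; rewrite Rb; congr updt; lia.
- case=> [|k]/=; last by rewrite Lb; congr updt; lia.
 by apply: (etrans (Rb 0)); congr updt; lia.
- by move=> k; apply: (etrans (Rb k.+1)); congr updt; lia.
Qed.
Definition store := seq (seq bool).
Definition sget (st : store) i : seq bool := nth [::] st i.
Definition sset (st : store) i s : store := set_nth [::] st i s.
Inductive instr := IPush of nat & bool & nat | IPop of nat & nat & nat & nat | IGoto of nat | IHalt.
Definition sm_step P c : nat * store :=
 let: (pc, st) := c in
 match nth IHalt P pc with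
 | IPush i b n => (n, sset st i (b :: sget st i))
 | IPop i n0 n1 n2 => match sget st i with
   | [::] => (n0, st)
   | false :: s => (n1, sset st i s)
   | true :: s => (n2, sset st i s) end
 | IGoto n => (n, st)
 | IHalt => c
 end.
Definition trit (o : option bool) : nat := if o is Some b then b.+1 else 0.
(** Column [x] of the tape holds the entries at depth [x] of all stacks, as digits in base 3 with 0
    for an absent entry. When only stack 0 is in use the codes are exactly the blank and bit symbols
    of the input alphabet, so that input and output need no conversion. The blank columns left of 0
    mark the tops. *)
Definition col (st : store) x : seq nat :=
 [seq (if x is Posz k then trit (onth s k) else 0) | s <- st].
Definition encs s : nat := foldr (fun a acc => a + 3 * acc) 0 s.
Fixpoint decs k n : seq nat := if k is k'.+1 then n %% 3 :: decs k' (n %/ 3) else [::].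
Lemma decsK s : all (fun a => a < 3) s -> decs (size s) (encs s) = s.
elim: s=> //= a s IH /andP [a3 s3].
by rewrite addnC mulnC modnMDl modn_small// divnMDl// divn_small// addn0 IH.
Qed.
Lemma encs_lt s : all (fun a => a < 3) s -> encs s < 3 ^ size s.
elim: s=> //= a s IH /andP [a3 s3]; rewrite expnS; lia. Qed.
Lemma encs0 s : (encs s == 0) = all (fun a => a == 0) s.
by elim: s=> //= a s <-; case: a=> //=; rewrite muln_eq0. Qed.
(* State 8 * pc + phase; phase 1 never occurs, so that state 1 (halt) is free.  A push carries
  the displaced symbols rightwards; a pop runs to the end of the track and shifts back. *)
Definition ftrans P q s : nat * seq nat * nat :=
 let pc := q %/ 8 in let ph := q %% 8 in
 let tgt n := 8 * minn n (size P) in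
 match nth IHalt P pc with
 | IPush i b n =>
   if ph == 4 then (if encs s == 0 then (tgt n, s, 2) else (q, s, 0)) else
   let c := if ph == 0 then (b : nat).+1 else ph.-1 in
   let s' := set_nth 0 s i c in
   if nth 0 s i == 0 then (8 * pc + 4, s', 1) else (8 * pc + (nth 0 s i).+1, s', 2)
 | IPop i n0 n1 n2 =>
   if ph == 0 then (if nth 0 s i == 0 then (8 * pc + 4, s, 0) else (q, s, 2)) else
   let c := ph - 4 in
   if encs s == 0 then (tgt (if c == 0 then n0 else if c == 1 then n1 else n2), s, 2)
   else (8 * pc + 4 + nth 0 s i, set_nth 0 s i c, 0)
 | IGoto n => (tgt n, s, 1)
 | IHalt => (1, s, 1)
 end.
(** The numbers give [8 * size P + 8] states, eight phases for every instruction and for the final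
    address, and 3 ^ 5 = 243 symbols, one for each possible column of five stacks. *)
Definition tm_of P : TM :=
 @mkTM (8 * size P + 6) 240
  [ffun x => let: (q, s, m) := ftrans P (x.1 : 'I__) (decs 5 (x.2 : 'I__)) in
        (inord q, inord (encs s), inord m)].
Definition goodc s := all (fun a => a < 3) s && (size s == 5).
Definition prun P q U p q' U' p' t : Prop :=
 forall c, rept q (fun x => encs (U x)) p c ->
  rept q' (fun x => encs (U' x)) p' (tm_run (tm_of P) t c).
Lemma prun_trans P q U p q1 U1 p1 q2 U2 p2 t t' :
 prun P q U p q1 U1 p1 t -> prun P q1 U1 p1 q2 U2 p2 t' -> prun P q U p q2 U2 p2 (t + t').
by move=> A B c /A /B; rewrite /tm_run addnC iterD. Qed.
Lemma prun_ext P q U p q1 U1 U2 p1 t :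
 prun P q U p q1 U1 p1 t -> U1 =1 U2 -> prun P q U p q1 U2 p1 t.
by move=> A E c /A; apply: rep_ext=> x; rewrite E. Qed.
Lemma prun_step P q U p q' s m :
 q != 1 -> q < 8 * size P + 8 -> goodc (U p) -> ftrans P q (U p) = (q', s, m) ->
 q' < 8 * size P + 8 -> goodc s -> m < 3 ->
 prun P q U p q' (updt U p s) (p + m%:Z - 1) 1.
move=> q1 qP /andP [gU /eqP sU] E q'P /andP [gs /eqP ss] m3 c Rc/=.
have := rep_step Rc q1 (M := tm_of P).
have D5: decs 5 (encs (U p)) = U p by rewrite -sU decsK.
rewrite ffunE !inordK; last 2 first.
- by have := encs_lt gU; rewrite sU.
- by lia.
rewrite D5 E=>/(_ _ _ _ erefl).
rewrite !inordK//; last 2 first.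
- by have := encs_lt gs; rewrite ss.
- by rewrite/=; lia.
apply: rep_ext=> x; rewrite /updt; by case: eqP.
Qed.
Lemma set_nth_id s i v : i < size s -> nth 0 s i = v -> set_nth 0 s i v = s.
move=> iS iv; apply: (@eq_from_nth _ 0); first by rewrite size_set_nth; lia.
by move=> k _; rewrite nth_set_nth/=; case: eqP=> // ->.
Qed.
Lemma good_set s i v : goodc s -> i < 5 -> v < 3 -> goodc (set_nth 0 s i v).
move=> /andP [/allP H /eqP S] i5 v3; apply/andP; split; last by rewrite size_set_nth; lia.
apply/(all_nthP 0)=> k; rewrite size_set_nth S nth_set_nth/= => kS; case: eqP=> // _.
by apply/H/mem_nth; rewrite S; move: kS; rewrite (maxn_idPr i5).
Qed.
Lemma encs_neq0 s i : nth 0 s i != 0 -> encs s != 0.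
rewrite encs0=> H; apply/negP=>/allP A; move/negP: H; apply.
by case: (ltnP i (size s))=> iS; [apply/A/mem_nth | rewrite nth_default].
Qed.
Lemma trit_lt o : trit o < 3. by case: o=>[[]|]. Qed.
(** Phase [b + 2] carries the displaced bit [b]; each cell receives what its left neighbour held,
    until the first free cell of track [i] absorbs the last bit. *)
Lemma run_carry P pc i b0 n : pc < size P -> nth IHalt P pc = IPush i b0 n -> i < 5 ->
 forall s (q : nat) (b : bool) U (x : int), (q == 8 * pc) && (b == b0) || (q == 8 * pc + b + 2) ->
 (forall y, goodc (U y)) -> (forall k, nth 0 (U (x + k%:Z)%R) i = trit (onth s k)) ->
 prun P q U x (8 * pc + 4)
  (fun y => if (x <= y)%R then set_nth 0 (U y) i (trit (onth (b :: s) `|y - x|)) else U y)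
  (x + (size s)%:Z) (size s).+1.
move=> pcP EP i5; elim=> [|a s IH] q b U x Q G Us.
 have E: ftrans P q (U x) = (8 * pc + 4, set_nth 0 (U x) i b.+1, 1).
  rewrite /ftrans (_ : q %/ 8 = pc) ?EP; last by lia.
  rewrite (_ : q %% 8 == 4 = false); last by lia.
  rewrite (_ : (if _ then _ else _) = b.+1); last by case: ifP Q; lia.
  by have := Us 0; rewrite addr0=> ->.
 have R1: prun P q U x (8 * pc + 4) (updt U x (set_nth 0 (U x) i b.+1)) (x + 1 - 1) 1.
  apply: prun_step=> //; try by lia.
  by apply: good_set=> //; case: (b).
 rewrite (_ : (x + 1 - 1 = x + 0%:Z)%R) in R1; last by lia.
 apply: (prun_ext R1)=> y; rewrite /updt; case: eqP=>[->|yx].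
  by rewrite lexx (_ : `|x - x| = 0)//; lia.
 case: ifP=> // xy; have [k Ek] : exists k : nat, (y = x + k.+1%:Z)%R.
  by exists (`|y - x|.-1); lia.
 rewrite (_ : `|y - x| = k.+1); last by lia.
 rewrite set_nth_id//; first by have /andP [_ /eqP ->] := G y.
 by rewrite Ek; case: k {Ek}.
have E: ftrans P q (U x) = (8 * pc + a + 2, set_nth 0 (U x) i b.+1, 2).
 rewrite /ftrans (_ : q %/ 8 = pc) ?EP; last by lia.
 rewrite (_ : q %% 8 == 4 = false); last by lia.
 rewrite (_ : (if _ then _ else _) = b.+1); last by case: ifP Q; lia.
 have := Us 0; rewrite addr0=> -> /=; congr (_, _, _); lia.
have G1 y: goodc (updt U x (set_nth 0 (U x) i b.+1) y).
 by rewrite /updt; case: eqP=> // _; apply: good_set=> //; case: (b).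
have R1: prun P q U x (8 * pc + a + 2) (updt U x (set_nth 0 (U x) i b.+1)) (x + 2 - 1) 1.
 apply: prun_step=> //; try by lia.
 - by apply: good_set=> //; case: (b).
have R2 := IH (8 * pc + a + 2) a (updt U x (set_nth 0 (U x) i b.+1)) (x + 1)%R _ G1 _.
rewrite (_ : (x + (size (a :: s))%:Z = x + 1 + (size s)%:Z)%R)/=; last by lia.
apply: prun_trans R1 _; rewrite (_ : (x + 2 - 1 = x + 1)%R); last by lia.
apply: prun_ext (R2 _ _) _; first by lia.
 move=> k; rewrite /updt ifF; last by lia.
 by have := Us k.+1; rewrite/= => <-; congr (nth _ (U _)); lia.
move=> y; rewrite /updt; case: (ltgtP x y)=> xy.
- rewrite (_ : (x + 1 <= y)%R); last by lia.
 by rewrite (_ : absz (y - x) = (absz (y - (x + 1))%R).+1)//; lia.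
- by rewrite ifF//; lia.
- by rewrite ifF -xy ?subrr//; lia.
Qed.
Lemma updt_id A (T : int -> A) p : updt T p (T p) =1 T.
by move=> x; rewrite /updt; case: eqP=> // ->. Qed.
(** After a push the columns up to the last one written are nonzero because track [i] is occupied
    there, so the first zero column met on the way back is column -1, whatever the other tracks
    contain. *)
Lemma run_return P pc i b0 n : pc < size P -> nth IHalt P pc = IPush i b0 n ->
 forall m U, (forall y, goodc (U y)) -> (forall k, k <= m -> encs (U k%:Z) != 0) ->
 encs (U (-1)%R) = 0 ->
 prun P (8 * pc + 4) U m%:Z (8 * minn n (size P)) U 0 m.+2.
move=> pcP EP m U G N Z.
have F x: ftrans P (8 * pc + 4) (U x) = if encs (U x) == 0 then (8 * minn n (size P), U x, 2)
  else (8 * pc + 4, U x, 0).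
 rewrite /ftrans (_ : (8 * pc + 4) %/ 8 = pc); last by lia.
 by rewrite EP (_ : ((8 * pc + 4) %% 8 == 4) = true); last by lia.
elim: m N=>[|m IH] N.
 apply: (@prun_trans P _ U _ (8 * pc + 4) U (-1) _ _ _ 1 1).
  have := @prun_step P (8 * pc + 4) U 0 (8 * pc + 4) (U 0) 0 _ _ (G _).
  rewrite F (negbTE (N 0 _))// => H; apply: prun_ext (H _ _ _ _ _ _) (updt_id _ _)=> //; lia.
 have := @prun_step P (8 * pc + 4) U (-1) (8 * minn n (size P)) (U (-1)%R) 2 _ _ (G _).
 rewrite F Z=> H; apply: prun_ext (H _ _ _ _ _ _) (updt_id _ _)=> //; lia.
apply: (@prun_trans P _ U _ (8 * pc + 4) U m%:Z _ _ _ 1 m.+2).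
 have := @prun_step P (8 * pc + 4) U m.+1%:Z (8 * pc + 4) (U m.+1%:Z) 0 _ _ (G _).
 rewrite F (negbTE (N _ _))// (_ : (m.+1%:Z + 0%:Z - 1)%R = m); last by lia.
 by move=> H; apply: prun_ext (H _ _ _ _ _ _) (updt_id _ _)=> //; lia.
by apply: IH=> k km; apply: N; lia.
Qed.
Lemma run_right P pc i n0 n1 n2 : pc < size P -> nth IHalt P pc = IPop i n0 n1 n2 ->
 forall s U (x : int), (forall y, goodc (U y)) ->
 (forall k, nth 0 (U (x + k%:Z)%R) i = trit (onth s k)) ->
 prun P (8 * pc) U x (8 * pc + 4) U (x + (size s)%:Z - 1) (size s).+1.
move=> pcP EP s U x G; elim: s x=>[|a s IH] x Us.
 have := @prun_step P (8 * pc) U x (8 * pc + 4) (U x) 0 _ _ (G _).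
 rewrite /ftrans mulKn// EP modnMr; have := Us 0; rewrite addr0=> -> H.
 by apply: prun_ext (H _ _ _ _ _ _) (updt_id _ _)=> //; lia.
apply: (@prun_trans P _ U _ (8 * pc) U (x + 1) _ _ _ 1 (size s).+1).
 have := @prun_step P (8 * pc) U x (8 * pc) (U x) 2 _ _ (G _).
 rewrite (_ : (x + 2%:Z - 1)%R = (x + 1)%R); last by lia.
 rewrite /ftrans mulKn// EP modnMr; have := Us 0; rewrite addr0=> -> H.
 by apply: prun_ext (H _ _ _ _ _ _) (updt_id _ _)=> //; lia.
rewrite (_ : (x + _ - 1)%R = (x + 1 + (size s)%:Z - 1)%R)/=; last by lia.
by apply: IH=> k; have := Us k.+1; rewrite/= => <-; congr (nth _ (U _)); lia.
Qed.
(** Phase [4 + c] carries the digit just read, and each cell receives the digit of its right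
    neighbour. The digit still carried at column -1 is the former top of the stack and selects the
    continuation; it is 0 when the stack was empty. *)
Lemma run_back P pc i n0 n1 n2 : pc < size P -> nth IHalt P pc = IPop i n0 n1 n2 -> i < 5 ->
 forall m c U, c < 3 -> (forall y, goodc (U y)) ->
 (forall k, k < m -> encs (U k%:Z) != 0) -> encs (U (-1)%R) = 0 ->
 let c' := if m is 0 then c else nth 0 (U 0%R) i in
 prun P (8 * pc + 4 + c) U (m%:Z - 1)
  (8 * minn (if c' == 0 then n0 else if c' == 1 then n1 else n2) (size P))
  (fun y => if (0 <= y)%R && (y < m%:Z)%R
    then set_nth 0 (U y) i (if (y + 1 < m%:Z)%R then nth 0 (U (y + 1)%R) i else c) else U y)
  0 m.+1.
move=> pcP EP i5 m c U c3 G N Z/=.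
have F x d: d < 3 -> ftrans P (8 * pc + 4 + d) (U x) = if encs (U x) == 0 then
  (8 * minn (if d == 0 then n0 else if d == 1 then n1 else n2) (size P), U x, 2)
  else (8 * pc + 4 + nth 0 (U x) i, set_nth 0 (U x) i d, 0).
 move=> d3; rewrite /ftrans (_ : (8 * pc + 4 + d) %/ 8 = pc); last by lia.
 rewrite EP (_ : (8 * pc + 4 + d) %% 8 = 4 + d); last by lia.
 by rewrite addKn.
elim: m c c3 U G N Z F=>[|m IH] c c3 U G N Z F.
 have := @prun_step P (8 * pc + 4 + c) U (-1) _ (U (-1)%R) 2 _ _ (G _).
 rewrite F// Z=> H.
 apply: prun_ext (H _ _ _ erefl _ _ _) _=> //; try lia.
 by move=> y; rewrite updt_id; case: ifP=> //; lia.
have i3 x: nth 0 (U x) i < 3.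
 by have /andP [/allP A /eqP S] := G x; apply/A/mem_nth; rewrite S.
have R1: prun P (8 * pc + 4 + c) U m%:Z (8 * pc + 4 + nth 0 (U m%:Z) i)
  (updt U m%:Z (set_nth 0 (U m%:Z) i c)) (m%:Z - 1) 1.
 have := @prun_step P (8 * pc + 4 + c) U m%:Z (8 * pc + 4 + nth 0 (U m%:Z) i)
  (set_nth 0 (U m%:Z) i c) 0 _ _ (G _).
 rewrite F// (negbTE (N _ _))// addr0; apply=> //; try by have := i3 m%:Z; lia.
 exact: good_set.
rewrite (_ : m.+1%:Z - 1 = m%:Z)%R; last by lia.
apply: prun_trans R1 _.
have R2 := IH (nth 0 (U m%:Z) i) (i3 _) (updt U m%:Z (set_nth 0 (U m%:Z) i c)).
have U1 x: (x < m%:Z)%R -> updt U m%:Z (set_nth 0 (U m%:Z) i c) x = U x.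
 by move=> xm; rewrite /updt ifF//; lia.
have := R2 _ _ _ _; rewrite (_ : (match m with 0=> _ | _=> _ end) = nth 0 (U 0) i); last first.
 by case: (m) U1=> // k U1.
move=> H; apply: prun_ext (H _ _ _ _) _.
- by move=> y; rewrite /updt; case: eqP=> // _; apply: good_set.
- by move=> k km; rewrite U1 ?N; lia.
- by [].
- move=> x d d3; rewrite /ftrans (_ : (8 * pc + 4 + d) %/ 8 = pc); last by lia.
 rewrite EP (_ : (8 * pc + 4 + d) %% 8 = 4 + d); last by lia.
 by rewrite addKn.
move=> y; case: (ltgtP y m%:Z)=> ym.
- rewrite (_ : (y < m.+1%:Z)%R); last by lia.
 rewrite (U1 _ ym).
 case: ifP=> // y0; rewrite (_ : (y + 1 < m.+1%:Z)%R); last by lia.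
 case: ifP=> y1; first by rewrite U1.
 by congr (set_nth _ _ _ (nth _ (U _) _)); lia.
- by rewrite /updt ?ifF//; lia.
- by rewrite ym andbF /updt eqxx ifT ?ifF//; lia.
Qed.
Definition idx_ok ins : bool :=
 match ins with IPush i _ _ => i < 5 | IPop i _ _ _ => i < 5 | _ => true end.
Definition ssz (st : store) : nat := sumn (map size st).
Lemma size_col st x : size (col st x) = size st. by rewrite size_map. Qed.
Lemma good_col st x : size st = 5 -> goodc (col st x).
move=> S; rewrite /goodc size_col S andbT all_map; apply/allP=> s _/=.
by case: x=> // k; apply: trit_lt.
Qed.
Lemma nth_col st i (k : nat) : nth 0 (col st k) i = trit (onth (sget st i) k).
rewrite /sget; case: (ltnP i (size st))=> H; first by rewrite (nth_map [::]).
by rewrite !nth_default ?size_col; case: k.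
Qed.
Lemma col_neg st x : (x < 0)%R -> encs (col st x) = 0.
by case: x=> // k _; apply/eqP; rewrite encs0 all_map; apply/allP. Qed.
Lemma size_sset st i s : i < size st -> size (sset st i s) = size st.
rewrite size_set_nth; lia. Qed.
Lemma col_set st i s (k : nat) : i < size st ->
 col (sset st i s) k = set_nth 0 (col st k) i (trit (onth s k)).
move=> H; apply: (@eq_from_nth _ 0); first by rewrite size_set_nth !size_col size_sset; lia.
move=> j _; rewrite nth_set_nth/= !nth_col /sget nth_set_nth/=.
by case: eqP.
Qed.
Lemma col_set_neg st i s x : i < size st -> (x < 0)%R -> col (sset st i s) x = col st x.
case: x=> // k H _; apply: (@eq_from_nth _ 0); first by rewrite !size_col size_sset.
move=> j; rewrite size_col size_sset// => J.
by rewrite !(nth_map [::])// size_sset.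
Qed.
Definition srep (P : seq instr) c cf : Prop :=
 rept (8 * minn c.1 (size P)) (fun x => encs (col c.2 x)) 0 cf.
Lemma sm_sim P pc st cf : size st = 5 -> all idx_ok P -> srep P (pc, st) cf ->
 exists2 t, t <= 2 * ssz st + 6 & srep P (sm_step P (pc, st)) (tm_run (tm_of P) t cf).
move=> S5 ok R0; rewrite /sm_step.
case: (ltnP pc (size P))=> pcP; last by rewrite nth_default//; exists 0.
have szi i: size (sget st i) <= ssz st.
 rewrite /ssz sumnE big_map /sget; case: (ltnP i (size st))=> iS; last by rewrite nth_default.
 by rewrite (big_nth [::]) big_mkord (bigD1 (Ordinal iS))//=; lia.
have := all_nthP IHalt ok pc pcP; rewrite /srep (minn_idPl (ltnW pcP)) in R0.
have Gc y: goodc (col st y) by apply: good_col.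
case EP: nth=>[i b n|i n0 n1 n2|n|]/= i5; last by exists 0; rewrite ?/srep ?(minn_idPl (ltnW pcP)).
- exists ((size (sget st i)).+1 + (size (sget st i)).+2); first by have := szi i; lia.
 have A := run_carry pcP EP i5 (s := sget st i) (q := 8 * pc) (b := b) (U := col st) (x := 0).
 rewrite !eqxx in A; have {A} := A isT Gc (fun k=> nth_col st i k); rewrite add0r=> A.
 have {}A := prun_ext A (U2 := col (sset st i (b :: sget st i))) _.
 have B := run_return pcP EP (m := size (sget st i)) (U := col (sset st i (b :: sget st i))).
 apply: (prun_trans (A _) (B _ _ _)) R0.
 + case=> k; last by rewrite col_set_neg ?S5.
  by rewrite col_set ?S5// (_ : absz (k%:Z - 0) = k)//; lia.
 + by move=> y; apply: good_col; rewrite size_sset ?S5.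
 + move=> k km; apply: (@encs_neq0 _ i); rewrite nth_col /sget nth_set_nth/= eqxx.
  by rewrite onthE (nth_map false).
 + by rewrite col_neg.
- set s := sget st i.
 exists ((size s).+1 + (size s).+1); first by have := szi i; rewrite -/s; lia.
 have A := run_right pcP EP Gc (x := 0) (s := s).
 have B := run_back pcP EP i5 (m := size s) (c := 0) isT Gc; rewrite addn0 in B.
 have ne k: k < size s -> encs (col st k%:Z) != 0.
  by move=> ks; apply: (@encs_neq0 _ i); rewrite nth_col onthE (nth_map false).
 have C := prun_trans (A (fun k=> nth_col st i k)) (B ne (col_neg _ _)).
 case Es: s C {A B ne} => [|b s']/= C.
  by apply: rep_ext (C isT cf R0)=> y; case: ifP=> //; lia.
 have {}C := C isT cf R0.
 rewrite nth_col -/s Es in C.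
 have E y: (if (0 <= y)%R && (y < (size s').+1%:Z)%R then set_nth 0 (col st y) i
   (if (y + 1 < (size s').+1%:Z)%R then nth 0 (col st (y + 1)) i else 0) else col st y)
   = col (sset st i s') y.
  case: y=>[k|k]; last by rewrite col_set_neg ?S5.
  rewrite col_set ?S5//=; have -> : (k%:Z + 1 = k.+1%:Z)%R by lia.
  rewrite !ltz_nat nth_col -/s Es; case: ltnP=> k1; last first.
   rewrite set_nth_id ?size_col ?S5// nth_col -/s Es !onthE !nth_default//= size_map; lia.
  by case: ltnP=> // k2; rewrite onthE nth_default// size_map.
 case: b C {Es} => /= C.
  by apply: rep_ext C=> y; rewrite E.
 by apply: rep_ext C=> y; rewrite E.
- have H: prun P (8 * pc) (col st) 0 (8 * minn n (size P)) (updt (col st) 0 (col st 0))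
   (0 + 1%:Z - 1) 1.
  apply: prun_step=> //; try lia; by rewrite /ftrans mulKn// EP.
 exists 1; first by lia.
 by apply: rep_ext (H _ R0)=> x; rewrite updt_id.
Qed.
Lemma tm_run_halt M t (c : config) : c.1.1 = 1 -> tm_run M t c = c.
by case: c=>[[q l] r]/= ->; elim: t=> // t IH; rewrite /tm_run iterS -/(tm_run _ _ _) IH. Qed.
Lemma tm_outputs_le M x t t' y : t <= t' -> tm_outputs M x t y -> tm_outputs M x t' y.
move=> tt; rewrite /tm_outputs -(subnK tt) /tm_run iterD -!/(tm_run _ _ _).
case E: (tm_run M t (tm_init x))=>[[q l] r] [q1 ty].
by rewrite tm_run_halt.
Qed.
Lemma tape_outE r y : (forall k, nth 0 r k = trit (onth y k)) -> tape_out r = y.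
elim: y r=>[|b y IH] r H.
 by case: r H=> // a r /(_ 0)/= ->.
case: r H=> [/(_ 0)//|a r H]; have/= -> := H 0.
by case: b H=> H/=; rewrite IH// => k; apply: (H k.+1).
Qed.
Definition st1 s : store := [:: s; [::]; [::]; [::]; [::]].
Lemma ssz_step P c : all idx_ok P -> size c.2 = 5 ->
 size (sm_step P c).2 = 5 /\ ssz (sm_step P c).2 <= (ssz c.2).+1.
case: c=> pc st ok S5/=; case: (ltnP pc (size P))=> pcP; last by rewrite nth_default.
have ssz_set i s: i < 5 -> ssz (sset st i s) + size (sget st i) = ssz st + size s.
 move=> i5; rewrite /ssz; have: i < size st by rewrite S5.
 by elim: (st) i {i5 S5} => // a st' IH [|i]/= iS; [lia | have := IH i iS; lia].
have := all_nthP IHalt ok pc pcP; case: nth=>[i b n|i n0 n1 n2|n|]//= i5.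
 by rewrite size_sset ?S5; have := ssz_set i (b :: sget st i) i5; rewrite/=; lia.
case E: sget=>[|b s]//.
have := ssz_set i s i5; rewrite E.
by case: b {E} => /=; rewrite size_sset ?S5; lia.
Qed.
(** After [m] steps the stacks hold at most [size x + m] bits, because a step pushes at most one;
    each step costs two sweeps over one track, whence the quadratic bound. One extra step enters the
    halting state and leaves the head on column 0. *)
Lemma sm_to_tm P x y n : all idx_ok P ->
 iter n (sm_step P) (0, st1 x) = (size P, st1 y) ->
 tm_outputs (tm_of P) x (n * (2 * (size x + n) + 6)).+1 y.
move=> ok E.
have G m: exists t, [/\ t <= m*(2*(size x + m) + 6),
  srep P (iter m (sm_step P) (0, st1 x)) (tm_run (tm_of P) t (tm_init x)),
  size (iter m (sm_step P) (0, st1 x)).2 = 5 & ssz (iter m (sm_step P) (0, st1 x)).2 <= size x + m].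
 elim: m=>[|m [t [t1 R1 S1 Z1]]].
  exists 0; split=>//.
  rewrite/= min0n; split=> // k.
   by rewrite nth_nil -[RHS]/(encs (col (st1 x) _)) col_neg; lia.
  have N j: onth (@nil bool) j = None by case: j.
  rewrite !N.
  by elim: x k {E} => [|b x IH] [|k]//=; case: b.
 rewrite iterS; case: (iter m) R1 S1 Z1=> pc st R1 S1 Z1.
 have [t2 t2b R2] := sm_sim S1 ok R1.
 exists (t + t2); have [? Z2] := ssz_step ok S1; split=> //.
 - by lia.
 - by move: R2; rewrite /tm_run -iterD addnC.
 - by rewrite/= in Z1 Z2 *; lia.
have [t [tb R1 _ _]] := G n; rewrite E in R1.
apply: (@tm_outputs_le _ _ t.+1)=> //.
have H: prun P (8 * size P) (col (st1 y)) 0 1 (updt (col (st1 y)) 0 (col (st1 y) 0))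
   (0 + 1%:Z - 1) 1.
 by apply: prun_step=> //; try lia; rewrite ?good_col// /ftrans mulKn// nth_default.
rewrite /srep minnn in R1; rewrite /tm_outputs.
have := H _ R1; rewrite/=.
case: (tm_step)=>[[q l] r] [-> _ Rr]; split=>//; apply: tape_outE=> k.
rewrite Rr updt_id.
have N j: onth (@nil bool) j = None by case: j.
by rewrite/= !N addn0.
Qed.

(** * Tree programs *)
(** [Loop] pops a stack, runs the body selected by the outcome (empty, false, true) and repeats when
    the flag of that body is set. With all three flags false it is a conditional, so no other
    branching is needed. *)
Inductive cmd := Skip | Push of nat & bool | Seq of cmd & cmd
 | Loop of nat & cmd & bool & cmd & bool & cmd & bool.
Definition pop st i : option bool * store :=
 if sget st i is b :: s then (Some b, sset st i s) else (None, st).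
Definition branch A x0 x1 x2 (o : option bool) : A :=
 match o with None => x0 | Some false => x1 | Some true => x2 end.
Inductive exec : cmd -> store -> store -> nat -> Prop :=
| ESkip st : exec Skip st st 0
| EPush i b st : exec (Push i b) st (sset st i (b :: sget st i)) 1
| ESeq c1 c2 st st1 st2 n1 n2 : exec c1 st st1 n1 -> exec c2 st1 st2 n2 ->
  exec (Seq c1 c2) st st2 (n1 + n2)
| EExit i c0 (b0 : bool) c1 (b1 : bool) c2 (b2 : bool) st st1 n : branch b0 b1 b2 (pop st i).1 = false ->
  exec (branch c0 c1 c2 (pop st i).1) (pop st i).2 st1 n ->
  exec (Loop i c0 b0 c1 b1 c2 b2) st st1 (n + 2)
| EAgain i c0 (b0 : bool) c1 (b1 : bool) c2 (b2 : bool) st st1 st2 n m : branch b0 b1 b2 (pop st i).1 ->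
  exec (branch c0 c1 c2 (pop st i).1) (pop st i).2 st1 n ->
  exec (Loop i c0 b0 c1 b1 c2 b2) st1 st2 m ->
  exec (Loop i c0 b0 c1 b1 c2 b2) st st2 (n + 2 + m).
Fixpoint cmd_ok c : bool :=
 match c with
 | Skip => true | Push i _ => i < 5 | Seq c1 c2 => cmd_ok c1 && cmd_ok c2
 | Loop i c0 _ c1 _ c2 _ => [&& i < 5, cmd_ok c0, cmd_ok c1 & cmd_ok c2]
 end.
Fixpoint clen c : nat :=
 match c with
 | Skip => 0 | Push _ _ => 1 | Seq c1 c2 => clen c1 + clen c2
 | Loop _ c0 _ c1 _ c2 _ => clen c0 + clen c1 + clen c2 + 4
 end.
Fixpoint compile p c : seq instr :=
 match c with
 | Skip => [::]
 | Push i b => [:: IPush i b p.+1]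
 | Seq c1 c2 => compile p c1 ++ compile (p + clen c1) c2
 | Loop i c0 b0 c1 b1 c2 b2 =>
   let a0 := p + 1 in let a1 := a0 + clen c0 + 1 in let a2 := a1 + clen c1 + 1 in
   let e := a2 + clen c2 + 1 in
   IPop i a0 a1 a2 :: compile a0 c0 ++ IGoto (if b0 then p else e) ::
    compile a1 c1 ++ IGoto (if b1 then p else e) ::
    compile a2 c2 ++ [:: IGoto (if b2 then p else e)]
 end.
Lemma size_compile p c : size (compile p c) = clen c.
elim: c p=> //= [c1 I1 c2 I2|i c0 I0 b0 c1 I1 b1 c2 I2 b2] p; first by rewrite size_cat I1 I2.
by rewrite !size_cat/= !size_cat/= size_cat I0 I1 I2/=; lia.
Qed.
Lemma compile_ok p c : cmd_ok c -> all idx_ok (compile p c).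
elim: c p=> //= [i b p ->|c1 I1 c2 I2 p /andP [A B]|i c0 I0 b0 c1 I1 b1 c2 I2 b2 p /and4P [A B C D]]//.
 by rewrite all_cat I1 ?I2.
by rewrite A !all_cat/= all_cat/= all_cat I0 ?I1 ?I2.
Qed.
Definition code_at P p l := forall k, k < size l -> nth IHalt P (p + k) = nth IHalt l k.
Lemma code_at_cat P p l1 l2 : code_at P p (l1 ++ l2) -> code_at P p l1 /\ code_at P (p + size l1) l2.
split=> k kl.
 by rewrite H ?size_cat ?nth_cat ?kl//; lia.
by rewrite -addnA H ?size_cat ?nth_cat ?ltn_add2l// ltnNge leq_addr addKn.
Qed.
Lemma code_at_cons P p a l : code_at P p (a :: l) -> nth IHalt P p = a /\ code_at P (p + 1) l.
split; first by have/= := H 0 isT; rewrite addn0.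
by move=> k kl; rewrite -addnA; apply: H.
Qed.
Lemma exec_compile c st st' n : exec c st st' n -> forall P p, code_at P p (compile p c) ->
 iter n (sm_step P) (p, st) = (p + clen c, st').
have it P m k x: iter (m + k) (sm_step P) x = iter k (sm_step P) (iter m (sm_step P) x).
 by rewrite addnC iterD.
have brn i (c0 : cmd) (b0 : bool) c1 b1 c2 b2 (st0 st1 : store) n0 P p :
  (forall P p, code_at P p (compile p (branch c0 c1 c2 (pop st0 i).1)) ->
   iter n0 (sm_step P) (p, (pop st0 i).2) = (p + clen (branch c0 c1 c2 (pop st0 i).1), st1)) ->
  code_at P p (compile p (Loop i c0 b0 c1 b1 c2 b2)) ->
  iter (n0 + 2) (sm_step P) (p, st0) =
   (if branch b0 b1 b2 (pop st0 i).1 then p else p + clen (Loop i c0 b0 c1 b1 c2 b2), st1).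
 move=> H/= /code_at_cons [E0 /code_at_cat [K0 /code_at_cons [E1 /code_at_cat [K1 /code_at_cons [E2 /code_at_cat [K2 /code_at_cons [E3 _]]]]]]].
 rewrite !size_compile in E0 E1 E2 E3 K0 K1 K2.
 rewrite (_ : n0 + 2 = 1 + n0 + 1) ?it/=; last by lia.
 rewrite E0; move: H; rewrite /pop; case: sget=>[|[] s]/= H.
 - by rewrite H//= E1; case: b0 {E0 E1 E2 E3 K0 K1 K2} => //; congr (_, _); lia.
 - by rewrite H//= E3; case: b2 {E0 E1 E2 E3 K0 K1 K2} => //; congr (_, _); lia.
 - by rewrite H//= E2; case: b1 {E0 E1 E2 E3 K0 K1 K2} => //; congr (_, _); lia.
move=> E; elim: E=> {c st st' n} /=.
- by move=> st P p _; rewrite addn0.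
- by move=> i b st P p /code_at_cons [E _]; rewrite E addn1.
- move=> c1 c2 st st1 st2 n1 n2 _ I1 _ I2 P p /code_at_cat [K1 K2].
 by rewrite size_compile in K2; rewrite it (I1 _ _ K1) (I2 _ _ K2) addnA.
- by move=> i c0 b0 c1 b1 c2 b2 st st1 n B _ I1 P p K; rewrite (brn _ _ _ _ _ _ _ _ _ _ _ _ I1 K) B.
- move=> i c0 b0 c1 b1 c2 b2 st st1 st2 n m B _ I1 _ I2 P p K.
 by rewrite it (brn _ _ _ _ _ _ _ _ _ _ _ _ I1 K) B I2.
Qed.
Lemma exec_tm c x y n : cmd_ok c -> exec c (st1 x) (st1 y) n ->
 tm_outputs (tm_of (compile 0 c)) x (n * (2 * (size x + n) + 6)).+1 y.
move=> ok E; apply: sm_to_tm; first exact: compile_ok.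
by rewrite (exec_compile E (p := 0)) ?size_compile.
Qed.
Lemma exec_ssz c st st' n : cmd_ok c -> size st = 5 -> exec c st st' n -> size st' = 5 /\ ssz st' <= ssz st + n.
move=> ok S5 E; have/= H : forall m, size (iter m (sm_step (compile 0 c)) (0, st)).2 = 5 /\
  ssz (iter m (sm_step (compile 0 c)) (0, st)).2 <= ssz st + m.
 elim=> [|m [A B]]; first by rewrite addn0.
 by have [C D] := ssz_step (compile_ok 0 ok) A; split=>//; apply: leq_trans D _; rewrite addnS.
by have := H n; rewrite (exec_compile E).
Qed.
Definition X c st st' n := exists2 m, m <= n & exec c st st' m.
Lemma X_le c st st' n n' : n <= n' -> X c st st' n -> X c st st' n'.
by move=> nn [m mn E]; exists m=> //; apply: leq_trans nn. Qed.
Lemma X_seq c1 c2 st st1 st2 n1 n2 : X c1 st st1 n1 -> X c2 st1 st2 n2 -> X (Seq c1 c2) st st2 (n1 + n2).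
by case=> m1 l1 E1 [m2 l2 E2]; exists (m1 + m2); [apply: leq_add | apply: ESeq E1 E2]. Qed.
Lemma X_push i b st st' : st' = sset st i (b :: sget st i) -> X (Push i b) st st' 1.
by move=> ->; exists 1=> //; apply: EPush. Qed.
Lemma X_skip st : X Skip st st 0. by exists 0=> //; apply: ESkip. Qed.
Lemma X_exitN i c0 c1 b1 c2 b2 st st1 n : sget st i = [::] ->
 X c0 st st1 n -> X (Loop i c0 false c1 b1 c2 b2) st st1 (n + 2).
by move=> P [m mn E]; exists (m + 2); rewrite ?leq_add2r//; apply: EExit; rewrite /pop P. Qed.
Lemma X_exitF i c0 b0 c1 c2 b2 st s st1 n : sget st i = false :: s ->
 X c1 (sset st i s) st1 n -> X (Loop i c0 b0 c1 false c2 b2) st st1 (n + 2).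
by move=> P [m mn E]; exists (m + 2); rewrite ?leq_add2r//; apply: EExit; rewrite /pop P. Qed.
Lemma X_exitT i c0 b0 c1 b1 c2 st s st1 n : sget st i = true :: s ->
 X c2 (sset st i s) st1 n -> X (Loop i c0 b0 c1 b1 c2 false) st st1 (n + 2).
by move=> P [m mn E]; exists (m + 2); rewrite ?leq_add2r//; apply: EExit; rewrite /pop P. Qed.
Lemma X_againF i c0 b0 c1 c2 b2 st s st1 st2 n m : sget st i = false :: s ->
 X c1 (sset st i s) st1 n -> X (Loop i c0 b0 c1 true c2 b2) st1 st2 m ->
 X (Loop i c0 b0 c1 true c2 b2) st st2 (n + 2 + m).
move=> P [k kn E] [l lm F]; exists (k + 2 + l); rewrite ?leq_add//.
by apply: (@EAgain _ _ _ _ _ _ _ _ st1); rewrite /pop ?P.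
Qed.
Lemma X_againT i c0 b0 c1 b1 c2 st s st1 st2 n m : sget st i = true :: s ->
 X c2 (sset st i s) st1 n -> X (Loop i c0 b0 c1 b1 c2 true) st1 st2 m ->
 X (Loop i c0 b0 c1 b1 c2 true) st st2 (n + 2 + m).
move=> P [k kn E] [l lm F]; exists (k + 2 + l); rewrite ?leq_add//.
by apply: (@EAgain _ _ _ _ _ _ _ _ st1); rewrite /pop ?P.
Qed.
Inductive tree := Lf | Nd of tree & tree.
(** A preorder code is prefix-free, so it can lie on top of a stack without any delimiter. *)
Fixpoint tcode t : seq bool := if t is Nd a b then true :: tcode a ++ tcode b else [:: false].
Definition sz t := size (tcode t).
Lemma sz_gt0 t : 0 < sz t. by case: t. Qed.
Lemma sz_Nd a b : sz (Nd a b) = (sz a + sz b).+1. by rewrite /sz/= size_cat. Qed.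
(* Stacks 0, 1, 2 hold codes of trees; stacks 3 (reversed copy) and 4 (number of pending
  subtrees, in unary) are scratch space for the traversal of one tcode. *)
Definition mk i u v s x c : store :=
 match i with 0 => [:: s; u; v; x; c] | 1 => [:: u; s; v; x; c] | _ => [:: u; v; s; x; c] end.
Definition rdtree i :=
 let body := Loop i Skip false (Push 3 false) false (Seq (Push 3 true) (Seq (Push 4 false) (Push 4 false))) false in
 Loop 4 Skip false body true body true.
(** A leaf settles one pending subtree and a node replaces one by two, so the unary counter on stack
    4 runs out exactly at the end of the code. Stack 3 receives the code reversed, ready to be
    pushed anywhere. *)
Lemma X_parse i t : i < 3 -> forall u v s x c st n,
 X (rdtree i) (mk i u v s (rev (tcode t) ++ x) c) st n ->
 X (rdtree i) (mk i u v (tcode t ++ s) x (false :: c)) st (n + 7 * sz t).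
move=> i3; elim: t=>[|a IHa b IHb] u v s x c st n H.
 have -> : n + 7 * sz Lf = (1 + 2) + 2 + (n + 2) by rewrite /sz/=; lia.
 have {}H := X_le (leq_addr 2 n) H.
 by case: i i3 H=>[|[|[|//]]] _ H; apply: X_againF H=> //; apply: X_exitF=> //; apply: X_push.
have {}IHb := IHb u v s (rev (tcode a) ++ true :: x) c st n.
rewrite catA -rev_cat -cat_rcons -rev_cons in IHb; have {}IHa := IHa u v (tcode b ++ s) (true :: x) (false :: c) _ _ (IHb _).
rewrite sz_Nd (_ : n + _ = (1 + (1 + 1) + 2) + 2 + (n + 7 * sz b + 7 * sz a)); last by lia.
rewrite/= -catA in H *; have {}IHa := IHa H.
by case: i i3 H IHa {IHb} => [|[|[|//]]] _ H IHa; apply: X_againF IHa=> //; apply: X_exitT=> //;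
 apply: X_seq; [exact: X_push | apply: X_seq; exact: X_push | exact: X_push | apply: X_seq; exact: X_push |
 exact: X_push | apply: X_seq; exact: X_push].
Qed.
Lemma X_parse1 i t u v s : i < 3 ->
 X (Seq (Push 4 false) (rdtree i)) (mk i u v (tcode t ++ s) [::] [::]) (mk i u v s (rev (tcode t)) [::]) (7 * sz t + 3).
move=> i3; rewrite (_ : 7 * _ + 3 = 1 + (2 + 7 * sz t)); last by lia.
apply: X_seq; first by apply: X_push.
have -> : sset (mk i u v (tcode t ++ s) [::] [::]) 4 (false :: sget (mk i u v (tcode t ++ s) [::] [::]) 4)
  = mk i u v (tcode t ++ s) [::] [:: false].
 by case: i i3=>[|[|[|//]]].
apply: X_parse=> //; rewrite cats0; apply: (@X_exitN _ _ _ _ _ _ _ _ 0); last exact: X_skip.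
by case: i i3=>[|[|[|//]]].
Qed.
Definition discard i := Seq (Seq (Push 4 false) (rdtree i)) (Loop 3 Skip false Skip true Skip true).
Definition mv i j := Seq (Seq (Push 4 false) (rdtree i)) (Loop 3 Skip false (Push j false) true (Push j true) true).
Definition cp i j := Seq (Seq (Push 4 false) (rdtree i))
 (Loop 3 Skip false (Seq (Push i false) (Push j false)) true (Seq (Push i true) (Push j true)) true).
Lemma X_discard t s z w : X (discard 0) [:: tcode t ++ s; z; w; [::]; [::]] [:: s; z; w; [::]; [::]] (24 * sz t).
have H := X_parse1 t z w s (i := 0) isT.
apply: (@X_le _ _ _ (7 * sz t + 3 + (2 * sz t + 2))); first by have := sz_gt0 t; lia.
apply: (X_seq H); rewrite /sz -(size_rev (tcode t)).
elim: (rev)=>[|b x IH]/=; first by apply: X_exitN=> //; apply: X_skip.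
by apply: (@X_le _ _ _ (0 + 2 + (2 * size x + 2))); [lia | case: b; [apply: X_againT IH|apply: X_againF IH]=> //; apply: X_skip].
Qed.
Lemma X_mv i j t u v s : i < 3 -> j < 3 -> i != j ->
 X (mv i j) (mk i u v (tcode t ++ s) [::] [::])
  (sset (mk i u v s [::] [::]) j (tcode t ++ sget (mk i u v s [::] [::]) j)) (24 * sz t).
move=> i3 j3 ij; have H := X_parse1 t u v s i3.
apply: (@X_le _ _ _ (7 * sz t + 3 + (3 * sz t + 2))); first by have := sz_gt0 t; lia.
apply: (X_seq H); rewrite /sz -(size_rev (tcode t)) -{2}(revK (tcode t)); elim: (rev) u v s {H} => [|b x IH] u v s.
 rewrite (_ : sset _ _ _ = mk i u v s [::] [::]).
  by apply: X_exitN; [case: i i3 {ij} => [|[|[|//]]]|apply: X_skip].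
 by case: i j i3 j3 ij=>[|[|[|//]]] [|[|[|//]]].
apply: (@X_le _ _ _ (1 + 2 + (3 * size x + 2))); first by rewrite/=; lia.
rewrite rev_cons cat_rcons.
by case: i j i3 j3 ij IH=>[|[|[|//]]] [|[|[|//]]]// _ _ _ IH;
 (case: b; [apply: X_againT (IH _ _ _)|apply: X_againF (IH _ _ _)]=> //; apply: X_push).
Qed.
Lemma X_cp01 t s z w : X (cp 0 1) [:: tcode t ++ s; z; w; [::]; [::]]
 [:: tcode t ++ s; tcode t ++ z; w; [::]; [::]] (24 * sz t).
have H := X_parse1 t z w s (i := 0) isT.
apply: (@X_le _ _ _ (7 * sz t + 3 + (4 * sz t + 2))); first by have := sz_gt0 t; lia.
apply: (X_seq H); rewrite /sz -(size_rev (tcode t)) -{2 3}(revK (tcode t)); elim: (rev) s z {H} => [|b x IH] s z/=.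
 by apply: X_exitN=> //; apply: X_skip.
apply: (@X_le _ _ _ (1 + 1 + 2 + (4 * size x + 2))); first by lia.
rewrite rev_cons !cat_rcons.
by case: b; [apply: X_againT (IH _ _)|apply: X_againF (IH _ _)]=> //; apply: X_seq; apply: X_push.
Qed.
Definition mv01 t s z w := @X_mv 0 1 t z w s isT isT isT.
Definition mv10 t s z w := @X_mv 1 0 t s w z isT isT isT.
Definition mv02 t s z w := @X_mv 0 2 t z w s isT isT isT.
Definition mv20 t s z w := @X_mv 2 0 t s z w isT isT isT.
(** Quantifying over the contents [s], [z], [w] underneath makes the relation stable under
    sequencing and lets a program run above saved data; the scratch stacks are empty at both
    ends. *)
Definition computes c a b n : Prop := forall s z w,
 X c [:: tcode a ++ s; z; w; [::]; [::]] [:: tcode b ++ s; z; w; [::]; [::]] n.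
Lemma comp_le c a b n n' : n <= n' -> computes c a b n -> computes c a b n'.
by move=> nn H s z w; apply: X_le nn (H _ _ _). Qed.
(** A program pushes at most one bit per step, so its time bounds the growth of its output;
    composition of polynomial bounds rests on this. *)
Lemma comp_sz c a b n : cmd_ok c -> computes c a b n -> sz b <= sz a + n.
move=> ok /(_ [::] [::] [::]) [m mn E].
by have [] := exec_ssz ok _ E; rewrite /ssz /sz//= !cats0; lia.
Qed.
Lemma comp_seq c1 c2 a b d n m : computes c1 a b n -> computes c2 b d m -> computes (Seq c1 c2) a d (n + m).
by move=> A B s z w; apply: X_seq (A _ _ _) (B _ _ _). Qed.
Definition pairc p q := Seq (cp 0 1) (Seq q (Seq (mv 1 0) (Seq p (Push 0 true)))).
Lemma comp_pair p q t a b n m : computes p t a n -> computes q t b m ->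
 computes (pairc p q) t (Nd a b) (n + m + 48 * sz t + 1).
move=> P Q s z w; apply: (@X_le _ _ _ (24 * sz t + (m + (24 * sz t + (n + 1))))); first by lia.
apply: (X_seq (X_cp01 t s z w)); apply: (X_seq (Q s (tcode t ++ z) w)).
apply: (X_seq (mv10 t (tcode b ++ s) z w)); apply: (X_seq (P _ _ _)).
by apply: X_push; rewrite/= -!catA.
Qed.
Definition hdc := Loop 0 Skip false (Push 0 false) false (Seq (mv 0 1) (Seq (discard 0) (mv 1 0))) false.
Definition tlc := Loop 0 Skip false (Push 0 false) false (discard 0) false.
Definition thd t := if t is Nd a _ then a else Lf.
Definition ttl t := if t is Nd _ b then b else Lf.
Lemma comp_hd t : computes hdc t (thd t) (50 * sz t).
move=> s z w; case: t=>[|a b].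
 by apply: (@X_le _ _ _ (1 + 2))=> //; apply: X_exitF=> //; apply: X_push.
apply: (@X_le _ _ _ (24 * sz a + (24 * sz b + 24 * sz a) + 2)).
 by rewrite sz_Nd; lia.
apply: X_exitT; rewrite//= -?catA.
apply: (X_seq (mv01 a (tcode b ++ s) z w)); apply: X_seq (X_discard b s (tcode a ++ z) w) _.
exact: mv10.
Qed.
Lemma comp_tl t : computes tlc t (ttl t) (50 * sz t).
move=> s z w; case: t=>[|a b].
 by apply: (@X_le _ _ _ (1 + 2))=> //; apply: X_exitF=> //; apply: X_push.
apply: (@X_le _ _ _ (24 * sz a + 2)).
 by rewrite sz_Nd; lia.
apply: X_exitT; rewrite//= -?catA.
exact: X_discard.
Qed.
Fixpoint pushes l : cmd := if l is b :: l' then Seq (pushes l') (Push 0 b) else Skip.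
Definition constc t := Seq (discard 0) (pushes (tcode t)).
Lemma comp_const t t' : computes (constc t') t t' (24 * sz t + sz t').
move=> s z w; apply: (X_seq (X_discard t s z w)); rewrite /sz.
elim: tcode=>[|b l IH]/=; first exact: X_skip.
by rewrite -addn1; apply: (X_seq IH); apply: X_push.
Qed.
Lemma ok_pushes l : cmd_ok (pushes l). by elim: l=> //= b l ->. Qed.
Definition ifc c p q := Seq (cp 0 1) (Seq c (Loop 0 Skip false (Seq (mv 1 0) q) false
 (Seq (discard 0) (Seq (discard 0) (Seq (mv 1 0) p))) false)).
Definition isN t := if t is Nd _ _ then true else false.
Lemma comp_if c p q t tc b k n m : cmd_ok c -> computes c t tc k ->
 (isN tc -> computes p t b n) -> (~~ isN tc -> computes q t b m) ->
 computes (ifc c p q) t b (100 * (sz t + k) + n + m).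
move=> ok C P Q s z w; case: tc C P Q=>[|x y] C P Q.
 apply: (@X_le _ _ _ (24 * sz t + (k + (24 * sz t + m + 2)))); first by have := sz_gt0 t; lia.
 apply: (X_seq (X_cp01 t s z w)); apply: (X_seq (C s (tcode t ++ z) w)).
 apply: X_exitF; rewrite//=.
 by apply: (X_seq (mv10 t s z w)); apply: Q.
apply: (@X_le _ _ _ (24 * sz t + (k + (24 * sz x + (24 * sz y + (24 * sz t + n)) + 2)))).
 by have := comp_sz ok C; rewrite sz_Nd; lia.
apply: (X_seq (X_cp01 t s z w)); apply: (X_seq (C s (tcode t ++ z) w)).
apply: X_exitT; rewrite//= -?catA.
apply: (X_seq (X_discard x (tcode y ++ s) _ w)); apply: (X_seq (X_discard y s _ w)).
by apply: (X_seq (mv10 t s z w)); apply: P.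
Qed.
Fixpoint tlist l : tree := if l is x :: l' then Nd x (tlist l') else Lf.
(** The accumulator and the current item are handed to [p] as a pair; meanwhile the rest of the list
    waits on stack 2, which [p] leaves intact by the frame in [computes]. *)
Definition foldc p := Loop 0 Skip false (Push 0 false) false
 (Seq (mv 0 1) (Seq (Loop 0 Skip false Skip false
   (Seq (mv 0 1) (Seq (mv 0 2) (Seq (mv 1 0) (Seq (mv 1 0) (Seq (Push 0 true) (Seq p (Seq (mv 0 1) (mv 2 0)))))))) true)
  (mv 1 0))) false.
Lemma X_fold p s w M B l : forall g z, sz (tlist l) <= M ->
 (forall i, i <= size l -> sz (g i) <= M) ->
 (forall i, i < size l -> computes p (Nd (g i) (nth Lf l i)) (g i.+1) B) ->
 X (Loop 0 Skip false Skip false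
   (Seq (mv 0 1) (Seq (mv 0 2) (Seq (mv 1 0) (Seq (mv 1 0) (Seq (Push 0 true) (Seq p (Seq (mv 0 1) (mv 2 0)))))))) true)
  [:: tcode (tlist l) ++ s; tcode (g 0) ++ z; w; [::]; [::]] [:: s; tcode (g (size l)) ++ z; w; [::]; [::]]
  (size l * (B + 171 * M) + 2).
elim: l=>[|x l IH] g z szl szf P.
 by apply: X_exitF=> //; apply: X_skip.
have s0 := szf 0 isT; have s1 := szf 1 isT.
move: szl; rewrite [tlist _]/= sz_Nd=> szl.
have {}IH := IH (fun i=> g i.+1) z _ (fun i il=> szf i.+1 il) (fun i il=> P i.+1 il).
have P0 := P 0 isT.
apply: (@X_le _ _ _ ((24 * sz x + (24 * sz (tlist l) + (24 * sz x + (24 * sz (g 0) + (1 + (B + (24 * sz (g 1) + 24 * sz (tlist l)))))))) + 2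
 + (size l*(B + 171*M) + 2))).
 rewrite [(size l).+1 * _]mulSn; lia.
apply: X_againT; last by apply: IH; lia.
 by rewrite/= -!catA.
apply: (X_seq (mv01 x (tcode (tlist l) ++ s) (tcode (g 0) ++ z) w)).
apply: (X_seq (mv02 (tlist l) s (tcode x ++ tcode (g 0) ++ z) w)).
apply: (X_seq (mv10 x s (tcode (g 0) ++ z) (tcode (tlist l) ++ w))).
apply: (X_seq (mv10 (g 0) (tcode x ++ s) z (tcode (tlist l) ++ w))).
apply: X_seq; first exact: X_push.
have := P0 s z (tcode (tlist l) ++ w); rewrite/= -catA=> P1; apply: (X_seq P1).
apply: (X_seq (mv01 (g 1) s z (tcode (tlist l) ++ w))).
exact: mv20.
Qed.
Lemma comp_fold p g l B M : sz (tlist l) <= M ->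
 (forall i, i <= size l -> sz (g i) <= M) ->
 (forall i, i < size l -> computes p (Nd (g i) (nth Lf l i)) (g i.+1) B) ->
 computes (foldc p) (Nd (g 0) (tlist l)) (g (size l)) ((size l).+1 * (B + 200 * M)).
move=> szl szf P s z w; have s0 := szf 0 isT.
have s1 := szf (size l) (leqnn _).
have M0 := sz_gt0 (tlist l).
apply: (@X_le _ _ _ ((24 * sz (g 0) + (size l*(B + 171*M) + 2 + 24 * sz (g (size l)))) + 2)).
 lia.
apply: X_exitT; first by rewrite/= -!catA.
apply: (X_seq (mv01 (g 0) (tcode (tlist l) ++ s) z w)).
apply: (X_seq (X_fold _ _ _ szl szf P)).
exact: mv10.
Qed.
Definition pol f := exists k, forall n, f n <= (n + 2) ^ k.
Lemma pol_le f g : (forall n, f n <= g n) -> pol g -> pol f.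
by move=> fg [k H]; exists k=> n; apply: leq_trans (fg n) (H n). Qed.
Lemma pol_c c : pol (fun _ => c).
by exists c=> n; apply: leq_trans (ltnW (ltn_expl c (ltnSn 1))) _; case: c=> // c; rewrite leq_exp2r; lia. Qed.
Lemma pol_id : pol (fun n => n). by exists 1=> n; rewrite leq_addr. Qed.
Lemma polM f g : pol f -> pol g -> pol (fun n => f n * g n).
by move=> [k H] [l G]; exists (k + l)=> n; rewrite expnD leq_mul. Qed.
Lemma polD f g : pol f -> pol g -> pol (fun n => f n + g n).
move=> [k H] [l G]; exists (k + l).+1=> n; rewrite expnSr.
have A: (n + 2) ^ k <= (n + 2) ^ (k + l) by rewrite leq_pexp2l; lia.
have B: (n + 2) ^ l <= (n + 2) ^ (k + l) by rewrite leq_pexp2l; lia.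
by have := H n; have := G n; nia.
Qed.
Lemma polX f k : pol f -> pol (fun n => f n ^ k).
by move=> H; elim: k=>[|k IH]; [apply: (pol_le _ (pol_c 1)) | apply: pol_le (polM H IH)=> n; rewrite expnS]. Qed.
#[global] Hint Resolve pol_c pol_id polM polD polX : pol.

(** * Polynomial-time functions *)
(** Naturals are lists of leaves, hence unary, so that polynomial time means polynomial in the value
    of a [nat] argument; binary numbers appear only as [int] and as lists of bits. *)
Structure encT := EncT { esort :> Type; tr : esort -> tree }.
Canonical encT_tree := EncT (fun t : tree => t).
Canonical encT_unit := EncT (fun _ : unit => Lf).
Canonical encT_bool := EncT (fun b : bool => if b then Nd Lf Lf else Lf).
Canonical encT_nat := EncT (fun n : nat => tlist (nseq n Lf)).
Canonical encT_seq (A : encT) := EncT (fun l : seq A => tlist (map (@tr A) l)).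
Canonical encT_opt (A : encT) := EncT (fun o : option A => if o is Some a then Nd Lf (tr a) else Lf).
Canonical encT_prod (A B : encT) := EncT (fun p : A * B => Nd (tr p.1) (tr p.2)).
Definition esz (A : encT) (a : A) := sz (tr a).
Definition ptime (A B : encT) (f : A -> B) : Prop :=
 exists c k, cmd_ok c /\ forall a, computes c (tr a) (tr (f a)) ((esz a + 2) ^ k).
Lemma pt_intro (A B : encT) (f : A -> B) c T : cmd_ok c -> pol T ->
 (forall a, computes c (tr a) (tr (f a)) (T (esz a))) -> ptime f.
by move=> ok [k H] C; exists c, k; split=>// a; apply: comp_le (H _) (C a). Qed.
Lemma esz_pair (A B : encT) (a : A) (b : B) : esz (a, b) = (esz a + esz b).+1.
exact: sz_Nd. Qed.
Lemma esz_cons (A : encT) a (l : seq A) : esz (a :: l) = (esz a + esz l).+1.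
exact: sz_Nd. Qed.
Lemma esz_nil (A : encT) : esz (@nil A) = 1. by []. Qed.
Lemma esz_gt0 (A : encT) (a : A) : 0 < esz a. exact: sz_gt0. Qed.
Lemma esz_S n : esz n.+1 = (esz n).+2. by []. Qed.
Lemma esz_nat n : esz n = n.*2.+1. by elim: n=> // n IH; rewrite esz_S IH. Qed.
Lemma esz_bool (b : bool) : esz b <= 3. by case: b. Qed.
Lemma esz_sum (A : encT) (l : seq A) : esz l = (\sum_(x <- l) (esz x).+1).+1.
by elim: l=>[|a l IH]; rewrite ?big_nil ?big_cons// esz_cons; lia. Qed.
Lemma esz_cat (A : encT) (l l' : seq A) : (esz (l ++ l')).+1 = esz l + esz l'.
by rewrite !esz_sum big_cat/=; lia. Qed.
Lemma esz_rev (A : encT) (l : seq A) : esz (rev l) = esz l.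
by elim: l=> // a l IH; rewrite rev_cons -cats1; have := esz_cat (rev l) [:: a]; rewrite !esz_cons esz_nil; lia. Qed.
Lemma esz_take (A : encT) (l : seq A) i : esz (take i l) <= esz l.
by rewrite -{2}(cat_take_drop i l); have := esz_cat (take i l) (drop i l); have := esz_gt0 (drop i l); lia. Qed.
Lemma esz_drop (A : encT) (l : seq A) i : esz (drop i l) <= esz l.
by rewrite -{2}(cat_take_drop i l); have := esz_cat (take i l) (drop i l); have := esz_gt0 (take i l); lia. Qed.
Lemma size_esz (A : encT) (l : seq A) : size l < esz l.
by elim: l=> // a l IH; rewrite esz_cons/=; lia. Qed.
Lemma pt_szb (A B : encT) (f : A -> B) : ptime f -> exists k, forall a, esz (f a) <= (esz a + 2) ^ k.
move=> [c [k [ok C]]]; have [l H] : pol (fun n=> n + (n + 2) ^ k) by auto with pol.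
by exists l=> a; apply: leq_trans (H _); apply: comp_sz (C a).
Qed.
Lemma leqX a b k : a <= b -> a ^ k <= b ^ k.
by case: k=> // k; rewrite leq_exp2r. Qed.
Lemma pt_tr (A B B' : encT) (f : A -> B) (g : A -> B') :
 (forall a, tr (f a) = tr (g a)) -> ptime f -> ptime g.
by move=> E [c [k [ok C]]]; exists c, k; split=>// a; rewrite -E. Qed.
Lemma pt_ext (A B : encT) (f g : A -> B) : f =1 g -> ptime f -> ptime g.
by move=> E; apply: pt_tr=> a; rewrite E. Qed.
Lemma pt_id (A : encT) : ptime (fun x : A => x).
apply: (@pt_intro _ _ _ Skip (fun=> 0))=> //; first exact: pol_c.
by move=> a s z w; apply: X_skip.
Qed.
Lemma pt_comp (A B D : encT) (f : A -> B) (g : B -> D) :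
 ptime f -> ptime g -> ptime (fun a => g (f a)).
move=> Pf [c' [k' [ok' C']]]; have [l H] := pt_szb Pf; case: Pf=> c [k [ok C]].
apply: (@pt_intro _ _ _ (Seq c c') (fun n=> (n + 2) ^ k + ((n + 2) ^ l + 2) ^ k'))=> /=.
- by lia.
- by auto 9 with pol.
- move=> a; apply: comp_seq (C a) (comp_le _ (C' _)).
 by case: k' {C'} => // k'; rewrite leq_exp2r// leq_add2r.
Qed.
Lemma pt_const (A B : encT) (b : B) : ptime (fun _ : A => b).
apply: (@pt_intro _ _ _ (constc (tr b)) (fun n=> 24*n + sz (tr b))).
- by rewrite/= ok_pushes.
- by auto with pol.
- by move=> a; apply: comp_const.
Qed.
Lemma pt_pair (A B D : encT) (f : A -> B) (g : A -> D) :
 ptime f -> ptime g -> ptime (fun a => (f a, g a)).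
move=> [c [k [ok C]]] [c' [k' [ok' C']]].
apply: (@pt_intro _ _ _ (pairc c c') (fun n=> (n + 2) ^ k + (n + 2) ^ k' + 48*n + 1)).
- by rewrite/= ok ok'.
- by auto 9 with pol.
- by move=> a; apply: comp_pair.
Qed.
Lemma pt_hd (A : encT) (f : A -> tree) : ptime f -> ptime (fun a => thd (f a)).
move=> H; apply: (pt_comp H).
by apply: (@pt_intro _ _ _ hdc (fun n=> 50*n)); [| auto with pol | apply: comp_hd].
Qed.
Lemma pt_tl (A : encT) (f : A -> tree) : ptime f -> ptime (fun a => ttl (f a)).
move=> H; apply: (pt_comp H).
by apply: (@pt_intro _ _ _ tlc (fun n=> 50*n)); [| auto with pol | apply: comp_tl].
Qed.
Lemma pt_fst (E A B : encT) (f : E -> A * B) : ptime f -> ptime (fun e => (f e).1).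
by move=> H; apply: (@pt_tr _ _ _ (fun e=> thd (tr (f e))))=> //; apply: pt_hd. Qed.
Lemma pt_snd (E A B : encT) (f : E -> A * B) : ptime f -> ptime (fun e => (f e).2).
by move=> H; apply: (@pt_tr _ _ _ (fun e=> ttl (tr (f e))))=> //; apply: pt_tl. Qed.
Lemma pt_isN (E B : encT) (t : E -> tree) (p q f : E -> B) :
 ptime t -> ptime p -> ptime q -> (forall e, f e = if isN (t e) then p e else q e) -> ptime f.
move=> [c [k [ok C]]] [c1 [k1 [ok1 C1]]] [c2 [k2 [ok2 C2]]] H.
apply: (@pt_intro _ _ _ (ifc c c1 c2) (fun n=> 100*(n + (n + 2) ^ k) + (n + 2) ^ k1 + (n + 2) ^ k2)).
- by rewrite/= ok ok2.
- by auto 12 with pol.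
- by move=> a; apply: comp_if (C a) _ _=> //; rewrite H; [move=> ->| move=> /negbTE ->].
Qed.
Lemma pt_if (E B : encT) (b : E -> bool) (p q : E -> B) :
 ptime b -> ptime p -> ptime q -> ptime (fun e => if b e then p e else q e).
by move=> Pb Pp Pq; apply: (@pt_isN _ _ (fun e=> tr (b e)) p q _ _ Pp Pq)=>[|e]; [exact: pt_tr Pb | case: (b e)]. Qed.
Lemma pt_seqcase (E A B : encT) (l : E -> seq A) p (q : E -> A -> seq A -> B) :
 ptime l -> ptime p -> ptime (fun x : E * (A * seq A) => q x.1 x.2.1 x.2.2) ->
 ptime (fun e => if l e is x :: l' then q e x l' else p e).
move=> Pl Pp [c [k [ok C]]].
have Pt: ptime (fun e=> tr (l e)) by [].
case: (pt_pair (pt_id _) (pt_pair (pt_hd Pt) (pt_tl Pt)))=> c' [k' [ok' C']].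
case: (pt_szb (pt_pair (pt_id _) (pt_pair (pt_hd Pt) (pt_tl Pt))))=> m M.
case: Pp=> c2 [k2 [ok2 C2]]; case: Pt=> c1 [k1 [ok1 C1]].
apply: (@pt_intro _ _ _ (ifc c1 (Seq c' c) c2)
 (fun n=> 100*(n + (n + 2) ^ k1) + ((n + 2) ^ k' + ((n + 2) ^ m + 2) ^ k) + (n + 2) ^ k2)).
- by rewrite/= ok1 ok2 ok'.
- by auto 15 with pol.
- move=> e; apply: comp_if (C1 e) _ _=> //.
 + case E1: l=>[|x l']// _; apply: comp_seq (C' e) _.
  have := C (e, (x, l')); rewrite E1; apply: comp_le.
  have := M e; rewrite E1=> M'; case: (k)=> // j; rewrite leq_exp2r// leq_add2r//.
 + by case: (l e).
Qed.
(** A fold is polynomial when all intermediate states obey one polynomial bound in the size of the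
    environment, whence the explicit sequence [g e i] and the bound [T]. The environment is threaded
    through the accumulator, because a compiled body sees nothing else. *)
Lemma pt_fold_raw (E S A : encT) F (l : E -> seq A) g :
 ptime (fun x : E * S * A => F x.1 x.2) -> ptime (fun e => g e 0) -> ptime l ->
 (forall e i x, onth (l e) i = Some x -> g e i.+1 = F (e, g e i) x) ->
 (exists2 T, pol T & forall e i, i <= size (l e) -> esz (g e i) <= T (esz e)) ->
 ptime (fun e => g e (size (l e))).
move=> PF P0 Pl gS [T [t HT] G].
have PF': ptime (fun x : E*S*A=> (x.1.1, F x.1 x.2)).
 by apply: pt_pair=> //; apply/pt_fst/pt_fst/pt_id.
case: PF'=> c [k [ok C]]; case: (pt_szb Pl)=> m M.
suff R: ptime (fun e=> (e, g e (size (l e)))) by exact: (pt_snd R).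
have [c' [k' [ok' C']]] := pt_pair (pt_pair (pt_id _) P0) Pl.
pose MM n := n + ((n + 2) ^ t) + (n + 2) ^ m + 1.
apply: (@pt_intro _ _ _ (Seq c' (foldc c)) (fun n=> (n + 2) ^ k' + (((n + 2) ^ m).+1*(((MM n + MM n).+1 + 2) ^ k + 200*MM n)))).
- by rewrite/= ok ok'.
- apply: pol_le (_ : pol (fun n=> (n + 2) ^ k' + (((n + 2) ^ m + 1)*(((MM n + MM n + 1) + 2) ^ k + 200*MM n))))=>[n|].
  by lia.
 by rewrite /MM; auto 20 with pol.
- move=> e; apply: comp_seq (C' e) _.
 have szl: sz (tlist (map (@tr A) (l e))) <= MM (esz e).
  by have := M e; rewrite /MM -/(esz (l e)); lia.
 have szg i: i <= size (l e) -> esz (e, g e i) <= MM (esz e).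
  by move=> il; rewrite esz_pair; have := G e i il; have := HT (esz e); rewrite /MM; lia.
 have H := @comp_fold c (fun i=> tr (e, g e i)) (map (@tr A) (l e)) (((MM (esz e) + MM (esz e)).+1 + 2) ^ k) (MM (esz e)).
 rewrite size_map in H; apply: comp_le (H szl szg _).
  by rewrite leq_mul2r; apply/orP; right; apply: leq_trans (M e); apply: ltnW; apply: size_esz.
 move=> i il; have [x Hx] : exists x, onth (l e) i = Some x.
  by case: (l e) il=> // y l' il; exists (nth y (y :: l') i); rewrite onthE (nth_map y).
 have Hn: nth Lf (map (@tr A) (l e)) i = tr x.
  by move: Hx; rewrite onthE; case: (l e) il=> // y l' il; rewrite !(nth_map y)// => -[->].
 have := C (e, g e i, x); rewrite -(gS _ _ _ Hx) Hn; apply: comp_le.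
 case: (k)=> // j; rewrite leq_exp2r// leq_add2r esz_pair ltnS leq_add ?szg//; first exact: ltnW.
 apply: leq_trans szl; rewrite /esz -Hn; move: il; rewrite -(size_map (@tr A)).
 by elim: (map (@tr A) (l e)) (i)=> // a ll IH [|j']/= il; rewrite sz_Nd; [lia | have := IH j' il; lia].
Qed.
Lemma pt_foldl (E S A : encT) f s0 (l : E -> seq A) :
 ptime (fun x : E * S * A => f x.1.1 x.1.2 x.2) -> ptime s0 -> ptime l ->
 (exists2 T, pol T & forall e i, i <= size (l e) -> esz (foldl (f e) (s0 e) (take i (l e))) <= T (esz e)) ->
 ptime (fun e => foldl (f e) (s0 e) (l e)).
move=> Pf Ps Pl G.
apply: (@pt_ext _ _ (fun e=> foldl (f e) (s0 e) (take (size (l e)) (l e))))=>[e|]; first by rewrite take_size.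
apply: (@pt_fold_raw _ _ _ (fun es x=> f es.1 es.2 x) _ (fun e i=> foldl (f e) (s0 e) (take i (l e))))=> //.
 by apply: pt_ext Ps=> e; rewrite take0.
move=> e i x; rewrite onthE=> Hx/=.
have il: i < size (l e) by rewrite ltnNge; apply/negP=> H; rewrite nth_default ?size_map in Hx.
by rewrite (take_nth x)// foldl_rcons; move: Hx; rewrite (nth_map x)// => -[->].
Qed.
Lemma pt_iter (E S : encT) f s0 (n : E -> nat) :
 ptime (fun x : E * S => f x.1 x.2) -> ptime s0 -> ptime n ->
 (exists2 T, pol T & forall e i, i <= n e -> esz (iter i (f e) (s0 e)) <= T (esz e)) ->
 ptime (fun e => iter (n e) (f e) (s0 e)).
move=> Pf Ps Pn [T pT G].
apply: (@pt_ext _ _ (fun e=> iter (size (nseq (n e) tt)) (f e) (s0 e)))=>[e|]; first by rewrite size_nseq.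
apply: (@pt_fold_raw _ _ _ (fun es (x : unit)=> f es.1 es.2) (fun e=> nseq (n e) tt) (fun e i=> iter i (f e) (s0 e)))=> //.
- exact: (pt_comp (pt_fst (pt_id _)) Pf).
- by apply: pt_tr Pn=> e; rewrite/= map_nseq.
- by exists T=> // e i; rewrite size_nseq; apply: G.
Qed.
Lemma pt_app1 (E A B : encT) (g : A -> B) (f : E -> A) : ptime g -> ptime f -> ptime (fun e => g (f e)).
by move=> G F; apply: pt_comp F G. Qed.
Lemma pt_app2 (E A B D : encT) (g : A -> B -> D) f1 (f2 : E -> B) :
 ptime (fun x : A * B => g x.1 x.2) -> ptime f1 -> ptime f2 -> ptime (fun e => g (f1 e) (f2 e)).
by move=> G F1 F2; apply: (pt_comp (pt_pair F1 F2) G). Qed.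
Lemma pt_cons (E A : encT) f (g : E -> seq A) : ptime f -> ptime g -> ptime (fun e => f e :: g e).
by move=> F G; apply: pt_tr (pt_pair F G). Qed.
Lemma pt_S (E : encT) (f : E -> nat) : ptime f -> ptime (fun e => (f e).+1).
by move=> F; apply: pt_tr (pt_pair (pt_const _ tt) F). Qed.
Lemma pt_pred (E : encT) (f : E -> nat) : ptime f -> ptime (fun e => (f e).-1).
move=> F; have H: ptime (fun e=> tr (f e)) by [].
by apply: pt_tr (pt_tl H)=> e; case: (f e).
Qed.
Lemma pt_behead (E A : encT) (f : E -> seq A) : ptime f -> ptime (fun e => behead (f e)).
move=> F; have H: ptime (fun e=> tr (f e)) by [].
by apply: pt_tr (pt_tl H)=> e; case: (f e).
Qed.
Lemma pt_head (E A : encT) d (f : E -> seq A) : ptime d -> ptime f -> ptime (fun e => head (d e) (f e)).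
move=> D F.
by apply: (pt_seqcase F D); apply/pt_fst/pt_snd/pt_id.
Qed.
Lemma pt_eq0 (E : encT) (f : E -> nat) : ptime f -> ptime (fun e => f e == 0).
move=> F; apply: (@pt_isN _ _ (fun e=> tr (f e)) (fun _=> false) (fun _=> true));
 [exact: pt_tr F | exact: pt_const | exact: pt_const | by move=> e; case: (f e)].
Qed.
Lemma pt_nseqtt (E : encT) (f : E -> nat) : ptime f -> ptime (fun e => nseq (f e) tt).
by move=> F; apply: pt_tr F=> e; rewrite/= map_nseq. Qed.
(** The bound on intermediate states is automatic when an item adds at most a polynomial in the
    environment and the item, never a multiple of the state. *)
Lemma pt_foldl_add (E S A : encT) f s0 (l : E -> seq A) :
 ptime (fun x : E * S * A => f x.1.1 x.1.2 x.2) -> ptime s0 -> ptime l ->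
 (exists k, forall e s x, esz (f e s x) <= esz s + (esz e + esz x + 2) ^ k) ->
 ptime (fun e => foldl (f e) (s0 e) (l e)).
move=> F S0 L [k H]; apply: pt_foldl=> //.
have [i Hi] := pt_szb S0; have [j Hj] := pt_szb L.
exists (fun n=> (n + 2) ^ i + (n + 2) ^ j*(n + (n + 2) ^ j + 2) ^ k); first by auto 12 with pol.
move=> e m ml.
have: esz (foldl (f e) (s0 e) (take m (l e))) <= (esz e + 2) ^ i + m*(esz e + (esz e + 2) ^ j + 2) ^ k.
 elim: m ml=>[|m IH] ml; first by rewrite take0 addn0; apply: Hi.
 have [x Ex szx] : exists2 x, take m.+1 (l e) = rcons (take m (l e)) x & esz x <= esz (l e).
  case E1: l ml=>[|y ll] ml//; exists (nth y (y :: ll) m); first by rewrite (take_nth y).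
  by rewrite esz_sum (big_nth y) big_mkord (bigD1 (Ordinal ml))//=; lia.
 rewrite Ex foldl_rcons; apply: leq_trans (H _ _ _) _.
 have A2: (esz e + esz x + 2) ^ k <= (esz e + (esz e + 2) ^ j + 2) ^ k.
  by apply: leqX; have := Hj e; lia.
 lia.
move/leq_trans; apply; rewrite leq_add2l leq_mul2r; apply/orP; right.
by apply: leq_trans ml _; apply: leq_trans (Hj e); apply/ltnW/size_esz.
Qed.
Lemma pt_rev (E A : encT) (l : E -> seq A) : ptime l -> ptime (fun e => rev (l e)).
move=> L; apply: (@pt_ext _ _ (fun e=> foldl (fun s x=> x :: s) [::] (l e)))=>[e|].
 by rewrite /rev; elim: (l e) [::]=> //= x s IH r.
apply: pt_foldl_add=> //; last first.
 by exists 1=> e s x; rewrite esz_cons; lia.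
- exact: pt_const.
- by apply: pt_cons; [apply/pt_snd/pt_id | apply/pt_snd/pt_fst/pt_id].
Qed.
Lemma pt_map (E A B : encT) (f : E -> A -> B) (l : E -> seq A) :
 ptime (fun x : E * A => f x.1 x.2) -> ptime l -> ptime (fun e => map (f e) (l e)).
move=> F L; apply: (@pt_ext _ _ (fun e=> rev (foldl (fun s x=> f e x :: s) [::] (l e))))=>[e|].
 have H: forall s r, foldl (fun s x=> f e x :: s) r s = catrev (map (f e) s) r by elim=>//= x s IH r.
 by rewrite H revK.
apply: pt_rev; apply: pt_foldl_add=> //.
- by apply: pt_cons; [apply: (@pt_app2 _ _ _ _ f _ _ F); [apply/pt_fst/pt_fst/pt_id|apply/pt_snd/pt_id] | apply/pt_snd/pt_fst/pt_id].
- exact: pt_const.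
have [k H] := pt_szb F; exists (k.*2).+1=> e s x; rewrite esz_cons.
have := H (e, x); rewrite esz_pair/= => {}H.
have A1: (esz e + esz x).+1 + 2 <= (esz e + esz x + 2) ^ 2 by nia.
have A2 := leqX k A1; rewrite -expnM in A2.
by rewrite expnS; nia.
Qed.
Lemma pt_cat (E A : encT) (l l' : E -> seq A) : ptime l -> ptime l' -> ptime (fun e => l e ++ l' e).
move=> L L'; apply: (@pt_ext _ _ (fun e=> foldl (fun s x=> x :: s) (l' e) (rev (l e))))=>[e|].
 rewrite -{2}(revK (l e)); elim: (rev (l e)) (l' e)=> //= x s IH r.
 by rewrite rev_cons cat_rcons.
apply: pt_foldl_add=> //; last first.
 by exists 1=> e s x; rewrite esz_cons; lia.
- exact: pt_rev.
- by apply: pt_cons; [apply/pt_snd/pt_id | apply/pt_snd/pt_fst/pt_id].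
Qed.
Lemma pt_flatten (E A : encT) (l : E -> seq (seq A)) : ptime l -> ptime (fun e => flatten (l e)).
move=> L; apply: (@pt_ext _ _ (fun e=> foldl (fun s x=> x ++ s) [::] (rev (l e))))=>[e|].
 rewrite -{2}(revK (l e)); elim/last_ind: (rev (l e))=> //= s x IH.
 by rewrite foldl_rcons IH rev_rcons.
apply: pt_foldl_add=> //; last first.
 by exists 1=> e s x; have := esz_cat x s; lia.
- exact: pt_rev.
- exact: pt_const.
- by apply: pt_cat; [apply/pt_snd/pt_id | apply/pt_snd/pt_fst/pt_id].
Qed.
Lemma pt_size (E A : encT) (l : E -> seq A) : ptime l -> ptime (fun e => size (l e)).
move=> L; apply: (@pt_ext _ _ (fun e=> foldl (fun s _=> s.+1) 0 (l e)))=>[e|].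
 have H s n: foldl (fun k (_ : A)=> k.+1) n s = n + size s by elim: s n=>[|x s IH] n//=; rewrite ?addn0// addnS.
 by [].
apply: pt_foldl_add=> //; last first.
 by exists 1=> e s x; rewrite esz_S; lia.
- exact: pt_const.
- by apply: pt_S; apply/pt_snd/pt_fst/pt_id.
Qed.
Lemma pt_iter_le (E S : encT) f s0 (n : E -> nat) :
 ptime (fun x : E * S => f x.1 x.2) -> ptime s0 -> ptime n ->
 (exists k, forall e s, esz (f e s) <= esz s + (esz e + 2) ^ k) ->
 ptime (fun e => iter (n e) (f e) (s0 e)).
move=> F S0 N [k H]; apply: (@pt_ext _ _ (fun e=> foldl (fun s _=> f e s) (s0 e) (nseq (n e) tt)))=>[e|].
 by elim: (n e) (s0 e)=> // m IH s; rewrite/= IH -iterSr.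
apply: pt_foldl_add=> //.
- by apply: (@pt_app2 _ _ _ _ f _ _ F); [apply/pt_fst/pt_fst/pt_id | apply/pt_snd/pt_fst/pt_id].
- exact: pt_nseqtt.
- by exists k=> e s x; apply: leq_trans (H e s) _; rewrite leq_add2l; apply: leqX; lia.
Qed.
Lemma pt_addn (E : encT) (f g : E -> nat) : ptime f -> ptime g -> ptime (fun e => f e + g e).
move=> F G; apply: (@pt_ext _ _ (fun e=> iter (f e) S (g e)))=>[e|]; first by rewrite iter_succn addnC.
apply: pt_iter_le=> //; first by apply/pt_S/pt_snd/pt_id.
by exists 1=> e s; rewrite esz_S; lia.
Qed.
Lemma pt_subn (E : encT) (f g : E -> nat) : ptime f -> ptime g -> ptime (fun e => f e - g e).
move=> F G; apply: (@pt_ext _ _ (fun e=> iter (g e) predn (f e)))=>[e|]; first by rewrite iter_predn.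
apply: pt_iter_le=> //; first by apply/pt_pred/pt_snd/pt_id.
by exists 1=> e s; rewrite !esz_nat; lia.
Qed.
Lemma pt_muln (E : encT) (f g : E -> nat) : ptime f -> ptime g -> ptime (fun e => f e * g e).
move=> F G; apply: (@pt_ext _ _ (fun e=> iter (f e) (fun s=> g e + s) 0))=>[e|]; first by rewrite iter_addn addn0 mulnC.
have [k H] := pt_szb G; apply: pt_iter_le=> //; last first.
- by exists k=> e s; have := H e; rewrite !esz_nat; lia.
- exact: pt_const.
- by apply: pt_addn; [apply: (pt_app1 G); apply/pt_fst/pt_id | apply/pt_snd/pt_id].
Qed.
Lemma pt_leq (E : encT) (f g : E -> nat) : ptime f -> ptime g -> ptime (fun e => f e <= g e).
by move=> F G; apply: pt_eq0; apply: pt_subn. Qed.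
Lemma pt_andb (E : encT) (f g : E -> bool) : ptime f -> ptime g -> ptime (fun e => f e && g e).
by move=> F G; apply: (pt_if F G); apply: pt_const. Qed.
Lemma pt_orb (E : encT) (f g : E -> bool) : ptime f -> ptime g -> ptime (fun e => f e || g e).
by move=> F G; apply: (pt_if F _ G); apply: pt_const. Qed.
Lemma pt_negb (E : encT) (f : E -> bool) : ptime f -> ptime (fun e => ~~ f e).
by move=> F; apply: (pt_if F); apply: pt_const. Qed.
Lemma pt_eqn (E : encT) (f g : E -> nat) : ptime f -> ptime g -> ptime (fun e => f e == g e).
by move=> F G; apply: pt_ext=>[e|];
 [rewrite eqn_leq | apply: pt_andb; apply: pt_leq].
Qed.
Lemma pt_drop (E A : encT) (n : E -> nat) (l : E -> seq A) : ptime n -> ptime l -> ptime (fun e => drop (n e) (l e)).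
move=> N L; apply: (@pt_ext _ _ (fun e=> iter (n e) behead (l e)))=>[e|].
 by elim: (n e) (l e)=>[|m IH] s; rewrite ?drop0// iterSr; case: s=> //=.
apply: pt_iter_le=> //; first by apply/pt_behead/pt_snd/pt_id.
by exists 0=> e s; rewrite -drop1; apply: leq_trans (esz_drop _ _) (leq_addr _ _).
Qed.
Lemma pt_nth (E A : encT) d (l : E -> seq A) (n : E -> nat) :
 ptime d -> ptime l -> ptime n -> ptime (fun e => nth (d e) (l e) (n e)).
move=> D L N; apply: (@pt_ext _ _ (fun e=> head (d e) (drop (n e) (l e))))=>[e|]; last by apply/pt_head/pt_drop.
by rewrite -nth0 nth_drop addn0.
Qed.
Lemma pt_take (E A : encT) (n : E -> nat) (l : E -> seq A) : ptime n -> ptime l -> ptime (fun e => take (n e) (l e)).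
move=> N L; apply: (@pt_ext _ _ (fun e=> rev (drop (size (l e) - n e) (rev (l e)))))=>[e|].
 by rewrite drop_rev revK; case: (leqP (n e) (size (l e)))=> H; [rewrite subKn | rewrite (eqnP (ltnW H)) subn0 take_size take_oversize// ltnW].
by apply/pt_rev/pt_drop; [apply: pt_subn=> //; apply: pt_size | apply: pt_rev].
Qed.
Lemma pt_iota (E : encT) (m n : E -> nat) : ptime m -> ptime n -> ptime (fun e => iota (m e) (n e)).
move=> M N; apply: (@pt_ext _ _ (fun e=> rev (iter (n e) (fun s=> (m e + size s) :: s) [::])))=>[e|].
 elim: (n e)=> // k IH; rewrite rev_cons -addn1 iotaD -cats1.
 by rewrite -size_rev IH size_iota.
apply: pt_rev; apply: pt_iter=> //.
- apply: pt_cons; last by apply/pt_snd/pt_id.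
 by apply: pt_addn; [apply: (pt_app1 M); apply/pt_fst/pt_id | apply/pt_size/pt_snd/pt_id].
- exact: pt_const.
have [i Hi] := pt_szb M; have [j Hj] := pt_szb N.
exists (fun n=> (n + 2) ^ j*((n + 2) ^ i + 2*(n + 2) ^ j + 1) + 1); first by auto 12 with pol.
move=> e k kn; set s := iter _ _ _.
have : size s = k /\ esz s <= k*(esz (m e) + 2*k + 1) + 1.
 rewrite /s; elim: k {kn s} => // k [A B]; rewrite/= A esz_cons.
 move: (esz (iter _ _ _)) B=> Z B; have := esz_nat (m e); rewrite (esz_nat (m e + k)).
 lia.
case=> _ /leq_trans; apply; rewrite leq_add2r; have := Hi e; have := Hj e; rewrite (esz_nat (n e))=> A B.
by apply: leq_mul; lia.
Qed.
Lemma pt_mkseq (E A : encT) (f : E -> nat -> A) (n : E -> nat) :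
 ptime (fun x : E * nat => f x.1 x.2) -> ptime n -> ptime (fun e => mkseq (f e) (n e)).
by move=> F N; apply: pt_map F _; apply: pt_iota N; apply: pt_const. Qed.
Lemma pt_nseq (E A : encT) (n : E -> nat) (a : E -> A) : ptime n -> ptime a -> ptime (fun e => nseq (n e) (a e)).
move=> N H; apply: (@pt_ext _ _ (fun e=> map (fun _=> a e) (nseq (n e) tt)))=>[e|]; first by rewrite map_nseq.
by apply: pt_map; [apply: (pt_app1 H); apply/pt_fst/pt_id | apply: pt_nseqtt].
Qed.
Lemma pt_expn (E : encT) (f : E -> nat) k : ptime f -> ptime (fun e => f e ^ k).
by move=> F; elim: k=>[|k IH]; [apply: pt_const | apply: pt_ext (pt_muln F IH)=> e; rewrite expnS]. Qed.
Lemma pt_filter (E A : encT) (p : E -> A -> bool) (l : E -> seq A) :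
 ptime (fun x : E * A => p x.1 x.2) -> ptime l -> ptime (fun e => filter (p e) (l e)).
move=> P L; apply: (@pt_ext _ _ (fun e=> flatten (map (fun x=> if p e x then [:: x] else [::]) (l e))))=>[e|].
 by elim: (l e)=> //= x s ->; case: (p e x).
apply/pt_flatten/(@pt_map _ _ _ (fun e x=> if p e x then [:: x] else [::]))=> //.
by apply: pt_if=> //; [apply: pt_cons; [apply/pt_snd/pt_id | apply: pt_const] | apply: pt_const].
Qed.
Lemma pt_all (E A : encT) (p : E -> A -> bool) (l : E -> seq A) :
 ptime (fun x : E * A => p x.1 x.2) -> ptime l -> ptime (fun e => all (p e) (l e)).
move=> P L; apply: (@pt_ext _ _ (fun e=> size (filter (fun x=> ~~ p e x) (l e)) == 0))=>[e|].
 by elim: (l e)=> //= x s IH; case: (p e x).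
by apply/pt_eq0/pt_size/(@pt_filter _ _ (fun e x=> ~~ p e x))=> //; apply: pt_negb.
Qed.

(** * Binary integers *)
Ltac pt1 := first [ assumption | match goal with
 | |- ptime (fun x => x) => exact: pt_id
 | |- ptime (fun x => (@?f x, @?g x)) => apply: pt_pair
 | |- ptime fst => exact: (pt_fst (pt_id _))
 | |- ptime snd => exact: (pt_snd (pt_id _))
 | |- ptime (@size _) => exact: (pt_size (pt_id _))
 | |- ptime (@rev _) => exact: (pt_rev (pt_id _))
 | |- ptime (@flatten _) => exact: (pt_flatten (pt_id _))
 | |- ptime S => exact: (pt_S (pt_id _))
 | |- ptime predn => exact: (pt_pred (pt_id _))
 | |- ptime negb => exact: (pt_negb (pt_id _))
 | |- ptime (fun x => fst (@?f x)) => apply: pt_fst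
 | |- ptime (fun x => snd (@?f x)) => apply: pt_snd
 | |- ptime (fun x => cons (@?f x) (@?g x)) => apply: pt_cons
 | |- ptime (fun x => rev (@?f x)) => apply: pt_rev
 | |- ptime (fun x => cat (@?f x) (@?g x)) => apply: pt_cat
 | |- ptime (fun x => flatten (@?f x)) => apply: pt_flatten
 | |- ptime (fun x => size (@?f x)) => apply: pt_size
 | |- ptime (fun x => andb (@?f x) (@?g x)) => apply: pt_andb
 | |- ptime (fun x => orb (@?f x) (@?g x)) => apply: pt_orb
 | |- ptime (fun x => negb (@?f x)) => apply: pt_negb
 | |- ptime (fun x => (@?f x).+1) => apply: pt_S
 | |- ptime (fun x => (@?f x).-1) => apply: pt_pred
 | |- ptime (fun x => behead (@?f x)) => apply: pt_behead
 | |- ptime (fun x => addn (@?f x) (@?g x)) => apply: pt_addn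
 | |- ptime (fun x => subn (@?f x) (@?g x)) => apply: pt_subn
 | |- ptime (fun x => muln (@?f x) (@?g x)) => apply: pt_muln
 | |- ptime (fun x => expn (@?f x) ?k) => apply: pt_expn
 | |- ptime (fun x => leq (@?f x) (@?g x)) => apply: pt_leq
 | |- ptime (fun x => eq_op (@?f x) (@?g x)) => first [apply: pt_eq0 | apply: pt_eqn]
 | |- ptime (fun x => nth (@?d x) (@?f x) (@?g x)) => apply: pt_nth
 | |- ptime (fun x => head (@?f x) (@?g x)) => apply: pt_head
 | |- ptime (fun x => drop (@?f x) (@?g x)) => apply: pt_drop
 | |- ptime (fun x => take (@?f x) (@?g x)) => apply: pt_take
 | |- ptime (fun x => iota (@?f x) (@?g x)) => apply: pt_iota
 | |- ptime (fun x => nseq (@?f x) (@?g x)) => apply: pt_nseq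
 | |- ptime (fun x => if _ then _ else _) => apply: pt_if
 | H : ptime (fun y => ?f y.1 y.2) |- ptime (fun x => ?f (@?a x) (@?b x)) => apply: (@pt_app2 _ _ _ _ f _ _ H)
 | H : ptime ?g |- ptime (fun x => ?g (@?h x)) => apply: (pt_app1 H)
 | |- ptime (fun _ => ?c) => exact: pt_const
 end ].
Ltac pt := repeat pt1.
Lemma pt_foldr_add (E S A : encT) f s0 (l : E -> seq A) :
 ptime (fun x : E * S * A => f x.1.1 x.2 x.1.2) -> ptime s0 -> ptime l ->
 (exists k, forall e s x, esz (f e x s) <= esz s + (esz e + esz x + 2) ^ k) ->
 ptime (fun e => foldr (f e) (s0 e) (l e)).
move=> F S0 L H; apply: (@pt_ext _ _ (fun e=> foldl (fun s x=> f e x s) (s0 e) (rev (l e))))=>[e|].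
 by rewrite foldl_rev.
by apply: pt_foldl_add=> //; apply: pt_rev.
Qed.
(** The first argument is fuel. The result is little-endian without a final zero, so that equal
    numbers have equal codes. *)
Fixpoint n2b (k n : nat) : seq bool := if k is k'.+1 then if n == 0 then [::] else odd n :: n2b k' n./2 else [::].
Definition bits n := n2b n n.
Definition b2n s : nat := foldr (fun (b : bool) a => b + a.*2) 0 s.
Definition norm s : seq bool := foldr (fun b r => if ~~ b && (size r == 0) then [::] else b :: r) [::] s.
Lemma n2bK k n : n <= k -> b2n (n2b k n) = n.
elim: k n=>[|k IH] n nk/=; first by lia.
by case: eqP=>[->|n0]//=; rewrite IH; lia.
Qed.
Lemma bitsK n : b2n (bits n) = n. exact: n2bK. Qed.
Lemma n2b_eq k k' n : n <= k -> n <= k' -> n2b k n = n2b k' n.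
elim: k k' n=>[|k IH] [|k'] n//= nk nk'; try by have -> : n = 0 by lia.
by case: eqP=> // n0; congr (_ :: _); apply: IH; lia.
Qed.
Lemma bitsE n : bits n = if n == 0 then [::] else odd n :: bits n./2.
case: n=>[|n]//; congr (_ :: _).
by apply: n2b_eq=> //; lia.
Qed.
Lemma bits_b2n s : bits (b2n s) = norm s.
elim: s=> // b s IH/=; rewrite -IH bitsE; case: b=> /=.
 by rewrite odd_double uphalf_double.
rewrite double_eq0 odd_double doubleK.
by have -> : (size (bits (b2n s)) == 0) = (b2n s == 0) by rewrite bitsE; case: (b2n s == 0).
Qed.
Lemma b2n_lt s : b2n s < 2 ^ size s.
by elim: s=> //= b s IH; rewrite expnS; lia. Qed.
Lemma size_bits_le n k : n < 2 ^ k -> size (bits n) <= k.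
elim: k n=>[|k IH] n; first by rewrite ltnS leqn0=>/eqP ->.
rewrite expnS=> nk; rewrite bitsE; case: eqP=> //= n0; apply: IH.
lia.
Qed.
Lemma bits_lt n : n < 2 ^ size (bits n). by rewrite -{1}(bitsK n) b2n_lt. Qed.
Lemma bits_ge n : 0 < n -> 2 ^ (size (bits n)).-1 <= n.
move=> n0; rewrite leqNgt; apply/negP=>/size_bits_le.
by rewrite bitsE; case: eqP=>[E|_]/=; [lia | rewrite ltnn].
Qed.
Lemma size_bitsD m n : size (bits (m + n)) <= (maxn (size (bits m)) (size (bits n))).+1.
apply: size_bits_le; rewrite expnS mul2n -addnn.
apply: (@leq_trans (2 ^ size (bits m) + 2 ^ size (bits n))).
 by have := bits_lt m; have := bits_lt n; lia.
by rewrite leq_add// leq_pexp2l ?leq_maxl ?leq_maxr.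
Qed.
Lemma size_bits_mono m n : m <= n -> size (bits m) <= size (bits n).
by move=> mn; apply: size_bits_le; apply: leq_ltn_trans mn (bits_lt n). Qed.
Definition zipn s t : seq (bool * bool) :=
 mkseq (fun i => (nth false s i, nth false t i)) (size s + size t).
Definition addr s t : bool * seq bool :=
 foldl (fun st ab =>
   ((ab.1 && ab.2) || (st.1 && (ab.1 || ab.2)), (ab.1 (+) (ab.2 (+) st.1)) :: st.2)) (false, [::]) (zipn s t).
Definition addb s t := rev ((addr s t).1 :: (addr s t).2).
Definition subr s t : bool * seq bool :=
 foldl (fun st ab =>
   ((~~ ab.1 && ab.2) || (st.1 && (~~ ab.1 || ab.2)), (ab.1 (+) (ab.2 (+) st.1)) :: st.2)) (false, [::]) (zipn s t).
Definition subb s t := ((subr s t).1, rev (subr s t).2).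
Definition mulb s t : seq bool :=
 foldl (fun acc b => addb (false :: acc) (if b then t else [::])) [::] (rev s).
Arguments addb : simpl never.
Arguments subb : simpl never.
Arguments mulb : simpl never.
Lemma b2n_cat s t : b2n (s ++ t) = b2n s + 2 ^ size s * b2n t.
by elim: s=>[|b s IH]/=; rewrite ?mul1n// expnS; lia. Qed.
Lemma b2n_mkseq s n : size s <= n -> b2n (mkseq (nth false s) n) = b2n s.
move=> sn; rewrite -(subnK sn) addnC /mkseq iotaD map_cat -/(mkseq _ _) mkseq_nth b2n_cat.
rewrite (_ : b2n (map _ _) = 0) ?muln0 ?addn0//.
have H k m: size s <= m -> b2n (map (nth false s) (iota m k)) = 0; last exact: H.
by elim: k m=> //= k IH m sm; rewrite nth_default// IH// ltnW.
Qed.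
Lemma zipn1 s t : b2n (map fst (zipn s t)) = b2n s.
by rewrite -map_comp b2n_mkseq// leq_addr. Qed.
Lemma zipn2 s t : b2n (map snd (zipn s t)) = b2n t.
by rewrite -map_comp b2n_mkseq// leq_addl. Qed.
Lemma addbE s t : b2n (addb s t) = b2n s + b2n t.
rewrite -(zipn1 s t) -(zipn2 s t) /addb /addr.
set f := (fun (st : bool * seq bool) (ab : bool*bool)=> _).
have H z' c r: let q := foldl f (c, r) z' in
  b2n (rev (q.1 :: q.2)) = b2n (rev r) + 2 ^ size r*(c + b2n (map fst z') + b2n (map snd z')).
 elim: z' c r=>[|[a b] z' IH] c r/=; first by rewrite rev_cons -cats1 b2n_cat size_rev/=; lia.
 by rewrite IH/= rev_cons -cats1 b2n_cat size_rev expnS; case: a b c=>[] [] []/=; lia.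
by rewrite H mul1n.
Qed.
(** The digits produced, together with the pending borrow at the current weight, always account for
    the difference of the parts already read. Since the digits alone stay below the weight of the
    last borrow, that borrow decides the comparison. *)
Lemma subbE s t : let r := subb s t in r.1 = (b2n s < b2n t) /\ (b2n t <= b2n s -> b2n r.2 = b2n s - b2n t).
rewrite -(zipn1 s t) -(zipn2 s t) /subb /subr; move: (zipn s t)=> z.
set f := (fun (st : bool * seq bool) (ab : bool*bool)=> _).
have H z' c r: let q := foldl f (c, r) z' in size q.2 = size r + size z' /\
  b2n (rev q.2) + 2 ^ size r*(c + b2n (map snd z')) = b2n (rev r) + 2 ^ size r*b2n (map fst z') + 2 ^ size q.2 * q.1.
 elim: z' c r=>[|[a b] z' IH] c r/=; first by lia.
 have := IH ((~~ a && b) || (c && (~~ a || b))) ((a (+) (b (+) c)) :: r).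
 move: (foldl _ _ _)=> q [-> /= H]; split; first lia.
 by move: H; rewrite rev_cons -cats1 b2n_cat size_rev expnS; case: a b c=>[] [] []/=; lia.
have [] := H z false [::]; rewrite/=; move: (foldl _ _ _)=> q S E.
have := b2n_lt (rev q.2); rewrite size_rev=> L1.
lia.
Qed.
Lemma mulbE s t : b2n (mulb s t) = b2n s * b2n t.
rewrite /mulb foldl_rev; elim: s=> //= b s IH; rewrite addbE; case: b=> /=; lia.
Qed.
Lemma esz_bits (s : seq bool) : esz s <= 4 * size s + 1.
by elim: s=> // b s IH; rewrite esz_cons/=; have := esz_bool b; lia. Qed.
Lemma size_addb s t : size (addb s t) = (size s + size t).+1.
have H z' (f : bool * seq bool -> bool*bool -> bool) (g : bool * seq bool -> bool*bool -> bool) q :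
  size (foldl (fun st ab=> (f st ab, g st ab :: st.2)) q z').2 = size q.2 + size z'.
 by elim: z' q=>[|a z' IH] q/=; rewrite ?addn0// IH addSnnS.
by rewrite size_rev/= (H _ (fun st ab=> _) (fun st ab=> _)) size_mkseq.
Qed.
Lemma pt_norm (E : encT) (f : E -> seq bool) : ptime f -> ptime (fun e => norm (f e)).
move=> F; apply: pt_foldr_add=> //; pt.
exists 1=> e s x; case: ifP=> _; rewrite ?esz_cons ?esz_nil; lia.
Qed.
Lemma pt_zipn (E : encT) (f g : E -> seq bool) : ptime f -> ptime g -> ptime (fun e => zipn (f e) (g e)).
move=> F G; apply: pt_mkseq; pt.
Qed.
Lemma pt_xor (E : encT) (f g : E -> bool) : ptime f -> ptime g -> ptime (fun e => f e (+) g e).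
by move=> F G; apply: (@pt_ext _ _ (fun e=> if f e then ~~ g e else g e))=>[e|]; [case: (f e) | pt]. Qed.
Lemma pt_addb (E : encT) (f g : E -> seq bool) : ptime f -> ptime g -> ptime (fun e => addb (f e) (g e)).
move=> F G; suff H: ptime (fun e=> addr (f e) (g e)) by rewrite /addb; pt.
apply: pt_foldl_add; pt; try exact: pt_zipn.
 by apply: pt_xor; pt; apply: pt_xor; pt.
exists 2=> e [c r] x; rewrite !esz_pair esz_cons.
have := esz_bool (x.1 (+) (x.2 (+) c)); have := esz_bool (x.1 && x.2 || c && (x.1 || x.2)).
have : 16 <= (esz e + esz x + 2) ^ 2 by have := esz_gt0 e; have := esz_gt0 x; lia.
move: (esz (x.1 && x.2 || c && (x.1 || x.2))) (esz (x.1 (+) (x.2 (+) c))) (esz c) (esz r) ((esz e + esz x + 2) ^ 2)=> *; lia.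
Qed.
Lemma pt_subb (E : encT) (f g : E -> seq bool) : ptime f -> ptime g -> ptime (fun e => subb (f e) (g e)).
move=> F G; suff H: ptime (fun e=> subr (f e) (g e)) by rewrite /subb; pt.
apply: pt_foldl_add; pt; try exact: pt_zipn.
 by apply: pt_xor; pt; apply: pt_xor; pt.
exists 2=> e [c r] x; rewrite !esz_pair esz_cons.
have := esz_bool (x.1 (+) (x.2 (+) c)); have := esz_bool (~~ x.1 && x.2 || c && (~~ x.1 || x.2)).
have : 16 <= (esz e + esz x + 2) ^ 2 by have := esz_gt0 e; have := esz_gt0 x; lia.
move: (esz (~~ x.1 && x.2 || c && (~~ x.1 || x.2))) (esz (x.1 (+) (x.2 (+) c))) (esz c) (esz r) ((esz e + esz x + 2) ^ 2)=> *; lia.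
Qed.
Lemma pt_mulb (E : encT) (f g : E -> seq bool) : ptime f -> ptime g -> ptime (fun e => mulb (f e) (g e)).
move=> F G; have [k H] := pt_szb G; apply: pt_foldl.
- by apply: pt_addb; pt.
- by pt.
- by pt.
have [j J] := pt_szb F.
exists (fun n=> 4*((n + 2) ^ j*((n + 2) ^ k + 2)) + 1); first by auto 12 with pol.
move=> e i il; apply: leq_trans (esz_bits _) _; rewrite leq_add2r leq_mul2l/=.
apply: (@leq_trans (i*(size (g e) + 2))); last first.
 apply: leq_mul; last by rewrite leq_add2r; apply: leq_trans (H e); apply/ltnW/size_esz.
 by apply: leq_trans il _; rewrite size_rev; apply: leq_trans (J e); apply/ltnW/size_esz.
elim: i il=>[|i IH] il; first by rewrite take0.
rewrite (take_nth false)// foldl_rcons size_addb.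
by case: (nth)=> /=; lia.
Qed.
(** Sign and binary magnitude: integers with exponentially large values keep polynomial size. *)
Definition unz (z : int) : bool * seq bool := ((z < 0)%R, bits (absz z)).
Canonical encT_int := EncT (fun z : int => tr (unz z)).
Definition zof b n : int := if b then (- (n%:Z))%R else n%:Z.
Lemma unz_zof b s : unz (zof b (b2n s)) = (b && (0 < size (norm s)), norm s).
rewrite /unz -bits_b2n; case: b=> /=; rewrite ?abszN; congr (_, _).
by case: b2n.
Qed.
Lemma pt_zof (E : encT) (b : E -> bool) (s : E -> seq bool) : ptime b -> ptime s -> ptime (fun e => zof (b e) (b2n (s e))).
move=> B S; have H: ptime (fun e=> (b e && (0 < size (norm (s e))), norm (s e))).
 by have := pt_norm S=> N; pt.
by apply: pt_tr H=> e; rewrite -unz_zof.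
Qed.
Lemma pt_unz (E : encT) (z : E -> int) : ptime z -> ptime (fun e => unz (z e)).
by []. Qed.
Lemma unzK z : z = zof (unz z).1 (b2n (unz z).2).
by rewrite /zof bitsK/=; case: ltP=> H; lia. Qed.
Lemma pt_oppz (E : encT) (x : E -> int) : ptime x -> ptime (fun e => (- x e)%R).
move=> /pt_unz X; apply: (@pt_ext _ _ (fun e=> zof (~~ (unz (x e)).1) (b2n (unz (x e)).2)))=>[e|].
 by rewrite {3}(unzK (x e)); case: (unz _).1; rewrite//= opprK.
by apply: pt_zof; pt.
Qed.
Lemma pt_addz (E : encT) (x y : E -> int) : ptime x -> ptime y -> ptime (fun e => (x e + y e)%R).
move=> /pt_unz X /pt_unz Y.
apply: (@pt_ext _ _ (fun e=> let sx := (unz (x e)).1 in let sy := (unz (y e)).1 in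
  let mx := (unz (x e)).2 in let my := (unz (y e)).2 in
  zof (if sx (+) sy then if (subb mx my).1 then sy else sx else sx)
    (b2n (if sx (+) sy then if (subb mx my).1 then (subb my mx).2 else (subb mx my).2 else addb mx my))))=>[e|].
 rewrite [in RHS](unzK (x e)) [in RHS](unzK (y e)); move: (unz (x e)) (unz (y e))=>[a s] [b t].
 have [-> H1] := subbE s t; have [_ H2] := subbE t s.
 by case: a b=>[] []/=; rewrite ?addbE /zof; try (case: ltnP=> st; rewrite ?H1 ?H2); lia.
apply: pt_zof; pt; try (by apply: pt_xor; pt); try (by apply: pt_subb; pt); by apply: pt_addb; pt.
Qed.
Lemma pt_subz (E : encT) (x y : E -> int) : ptime x -> ptime y -> ptime (fun e => (x e - y e)%R).
by move=> X Y; apply: pt_addz=> //; apply: pt_oppz. Qed.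
Lemma pt_mulz (E : encT) (x y : E -> int) : ptime x -> ptime y -> ptime (fun e => (x e * y e)%R).
move=> /pt_unz X /pt_unz Y.
apply: (@pt_ext _ _ (fun e=> zof ((unz (x e)).1 (+) (unz (y e)).1) (b2n (mulb (unz (x e)).2 (unz (y e)).2))))=>[e|].
 rewrite mulbE [in RHS](unzK (x e)) [in RHS](unzK (y e)); move: (unz) (unz _)=>[a s] [b t]/=.
 by case: a b=>[] []/=; lia.
by apply: pt_zof; [apply: pt_xor; pt | apply: pt_mulb; pt].
Qed.
Lemma pt_lt0z (E : encT) (x : E -> int) : ptime x -> ptime (fun e => (x e < 0)%R).
by move=> /pt_unz X; apply: (pt_fst X). Qed.
Lemma pt_ltz (E : encT) (x y : E -> int) : ptime x -> ptime y -> ptime (fun e => (x e < y e)%R).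
by move=> X Y; apply: (@pt_ext _ _ (fun e=> (x e - y e < 0)%R))=>[e|]; [rewrite subr_lt0 | apply/pt_lt0z/pt_subz]. Qed.
Lemma pt_lez (E : encT) (x y : E -> int) : ptime x -> ptime y -> ptime (fun e => (x e <= y e)%R).
by move=> X Y; apply: (@pt_ext _ _ (fun e=> ~~ (y e < x e)%R))=>[e|]; [rewrite -leNgt | apply/pt_negb/pt_ltz]. Qed.
Definition zlen z : nat := size (bits (absz z)).
(* Division by a power of two, rounding towards zero. *)
Definition zshr (z : int) l : int := zof (z < 0)%R (b2n (drop l (bits (absz z)))).
Lemma pt_zlen (E : encT) (x : E -> int) : ptime x -> ptime (fun e => zlen (x e)).
by move=> /pt_unz X; apply/pt_size/(pt_snd X). Qed.
Lemma pt_zshr (E : encT) (x : E -> int) (l : E -> nat) : ptime x -> ptime l -> ptime (fun e => zshr (x e) (l e)).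
by move=> /pt_unz X L; apply: pt_zof; [apply: (pt_fst X) | apply: pt_drop=> //; apply: (pt_snd X)]. Qed.
Lemma esz_int_le (z : int) : esz z <= 4 * zlen z + 5.
rewrite /zlen -[esz z]/(esz (unz z)) esz_pair; have := esz_bits (bits (absz z)).
by have := esz_bool (z < 0)%R; lia.
Qed.
Lemma zlen_esz z : zlen z <= esz z.
apply: leq_trans (ltnW (size_esz (bits (absz z)))) _.
by rewrite -[esz z]/(esz (unz z)) esz_pair; apply: leqW (leq_addl _ _). Qed.
Lemma zlenD (x y : int) : zlen (x + y) <= (zlen x + zlen y).+1.
apply: leq_trans (size_bits_mono (_ : absz (x + y)%R <= absz x + absz y)) _; first by lia.
by apply: leq_trans (size_bitsD _ _) _; rewrite /zlen; lia.
Qed.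
Lemma pt_sumz (E : encT) (A : encT) (f : E -> A -> int) (l : E -> seq A) :
 ptime (fun x : E * A => f x.1 x.2) -> ptime l -> ptime (fun e => (\sum_(a <- l e) f e a)%R).
move=> F L; apply: (@pt_ext _ _ (fun e=> foldr +%R 0%R (map (f e) (l e))))=>[e|].
 by elim: (l e)=>[|a s IH]/=; rewrite ?big_nil ?big_cons// IH.
have M: ptime (fun e=> map (f e) (l e)) by apply: pt_map.
have [j J] := pt_szb M.
apply: (@pt_ext _ _ (fun e=> foldl (fun s x : int=> x + s)%R 0 (rev (map (f e) (l e)))))=>[e|]; first by rewrite foldl_rev.
apply: pt_foldl; pt; first by apply: pt_addz; pt.
exists (fun n=> 4*((n + 2) ^ j) + 5); first by auto with pol.
move=> e i _; set w := rev _; apply: leq_trans (esz_int_le _) _; rewrite leq_add2r leq_mul2l.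
apply: leq_trans (J e); rewrite -esz_rev; apply: leq_trans (esz_take w i).
elim/last_ind: (take i w)=> // s x IH; rewrite foldl_rcons -cats1.
have H := esz_cat s [:: x]; rewrite esz_cons in H; apply: leq_trans (zlenD _ _) _.
have -> : esz (s ++ [:: x]) = (esz s + esz x).+1 by apply: succn_inj; rewrite H addn1 !addnS.
by rewrite addnC; apply: leq_add IH (zlen_esz x).
Qed.
Lemma pt_pow2z (E : encT) (n : E -> nat) : ptime n -> ptime (fun e => (2 ^+ n e : int)).
move=> N; apply: (@pt_ext _ _ (fun e=> zof false (b2n (nseq (n e) false ++ [:: true]))))=>[e|]; last by apply: pt_zof; pt.
rewrite b2n_cat size_nseq muln1 (_ : b2n _ = 0); last by elim: (n e)=> //= m ->.
by rewrite -natrX natz.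
Qed.
Lemma pt_natz (E : encT) (n : E -> nat) : ptime n -> ptime (fun e => (n e)%:Z).
move=> N; apply: (@pt_ext _ _ (fun e=> (\sum_(a <- nseq (n e) (1 : int)) a)%R))=>[e|].
 by rewrite big_nseq iter_addr addr0 natz.
by apply: pt_sumz; pt.
Qed.
Ltac pt2 := match goal with
 | |- ptime (fun x => addb (@?f x) (@?g x)) => apply: pt_addb
 | |- ptime (fun x => @GRing.add _ (@?f x) (@GRing.opp _ (@?g x))) => apply: pt_subz
 | |- ptime (fun x => @GRing.add _ (@?f x) (@?g x)) => apply: pt_addz
 | |- ptime (fun x => @GRing.opp _ (@?g x)) => apply: pt_oppz
 | |- ptime (fun x => @GRing.mul _ (@?f x) (@?g x)) => apply: pt_mulz
 | |- ptime (fun x => @Order.lt _ _ (@?f x) (@?g x)) => apply: pt_ltz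
 | |- ptime (fun x => @Order.le _ _ (@?f x) (@?g x)) => apply: pt_lez
 | |- ptime (fun x => zlen (@?f x)) => apply: pt_zlen
 | |- ptime (fun x => zshr (@?f x) (@?g x)) => apply: pt_zshr
 | |- ptime (fun x => Posz (@?g x)) => apply: pt_natz
 | |- ptime (fun x => GRing.exp _ (@?g x)) => apply: pt_pow2z
 | |- ptime (fun x => addb (@?f x) (@?g x)) => apply: pt_addb
 | |- ptime (fun x => addb (@?f x) (@?g x)) => apply: pt_addb
 end.
Ltac ptz := repeat first [ pt1 | pt2 ].

(** * Raw words and tree codes, padding, simulation of a given machine *)

Definition skip1 := Loop 0 Skip false Skip false Skip false.
(** The input is first reversed onto stack 3, since its tree code has to be pushed from the end; a
    bit costs two or four symbols because true is itself a node. *)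
Definition readc := Seq (Loop 0 Skip false (Push 3 false) true (Push 3 true) true) (Seq (Push 0 false)
 (Loop 3 Skip false (Seq (Push 0 false) (Push 0 true)) true
   (Seq (Push 0 false) (Seq (Push 0 false) (Seq (Push 0 true) (Push 0 true)))) true)).
Definition writec := Seq (Loop 0 Skip false Skip false
  (Loop 0 Skip false (Push 3 false) false (Seq skip1 (Seq skip1 (Push 3 true))) false) true)
 (Loop 3 Skip false (Push 0 false) true (Push 0 true) true).
Lemma X_readc x : X readc (st1 x) (st1 (tcode (tr x))) (20 * size x + 20).
have A s r: X (Loop 0 Skip false (Push 3 false) true (Push 3 true) true) [:: s; [::]; [::]; r; [::]]
  [:: [::]; [::]; [::]; catrev s r; [::]] (3 * size s + 2).
 elim: s r=>[|b s IH] r; first by apply: X_exitN=> //; apply: X_skip.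
 apply: (@X_le _ _ _ (1 + 2 + (3 * size s + 2))); first by rewrite/=; lia.
 by case: b; [apply: X_againT (IH _)|apply: X_againF (IH _)]=> //; apply: X_push.
have B s r: X (Loop 3 Skip false (Seq (Push 0 false) (Push 0 true)) true
   (Seq (Push 0 false) (Seq (Push 0 false) (Seq (Push 0 true) (Push 0 true)))) true) [:: tcode (tr (r : seq bool)); [::]; [::]; s; [::]]
  [:: tcode (tr (catrev s r)); [::]; [::]; [::]; [::]] (6 * size s + 2).
 elim: s r=>[|b s IH] r; first by apply: X_exitN=> //; apply: X_skip.
 apply: (@X_le _ _ _ (4 + 2 + (6 * size s + 2))); first by rewrite/=; lia.
 case: b; [apply: X_againT (IH (true :: r))|apply: X_againF (IH (false :: r))]=> //.
  by apply: (@X_le _ _ _ (1 + (1 + (1 + 1))))=> //; do 3! (apply: X_seq; first exact: X_push); apply: X_push.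
 by apply: (@X_le _ _ _ (1 + 1))=> //; (apply: X_seq); apply: X_push.
apply: (@X_le _ _ _ ((3 * size x + 2) + (1 + (6 * size (rev x) + 2)))); first by rewrite size_rev; lia.
apply: (X_seq (A x [::])); apply: (X_seq (X_push erefl)).
by have := B (rev x) [::]; rewrite -/(rev (rev x)) revK.
Qed.
Lemma X_writec (y : seq bool) : X writec (st1 (tcode (tr y))) (st1 y) (20 * size y + 20).
have S b s r: X skip1 [:: b :: s; [::]; [::]; r; [::]] [:: s; [::]; [::]; r; [::]] 2.
 apply: (@X_le _ _ _ (0 + 2))=> //.
 by case: b; [apply: X_exitT|apply: X_exitF]=> //; apply: X_skip.
have A (s : seq bool) r : X (Loop 0 Skip false Skip false
  (Loop 0 Skip false (Push 3 false) false (Seq skip1 (Seq skip1 (Push 3 true))) false) true) [:: tcode (tr s); [::]; [::]; r; [::]]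
  [:: [::]; [::]; [::]; catrev s r; [::]] (9 * size s + 2).
 elim: s r=>[|b s IH] r; first by apply: X_exitF=> //; apply: X_skip.
 apply: (@X_le _ _ _ (7 + 2 + (9 * size s + 2))); first by rewrite/=; lia.
 apply: X_againT; [by [] | | exact: IH].
 case: b.
  apply: (@X_le _ _ _ (2 + (2 + 1) + 2))=> //; apply: X_exitT=> //.
  by apply: (X_seq (S _ _ _)); apply: (X_seq (S _ _ _)); apply: X_push.
 apply: (@X_le _ _ _ (1 + 2))=> //; apply: X_exitF=> //.
 exact: X_push.
have B s r: X (Loop 3 Skip false (Push 0 false) true (Push 0 true) true) [:: r; [::]; [::]; s; [::]]
  [:: catrev s r; [::]; [::]; [::]; [::]] (3 * size s + 2).
 elim: s r=>[|b s IH] r; first by apply: X_exitN=> //; apply: X_skip.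
 apply: (@X_le _ _ _ (1 + 2 + (3 * size s + 2))); first by rewrite/=; lia.
 by case: b; [apply: X_againT (IH _)|apply: X_againF (IH _)]=> //; apply: X_push.
apply: (@X_le _ _ _ ((9 * size y + 2) + (3 * size (rev y) + 2))); first by rewrite size_rev; lia.
by apply: (X_seq (A y [::])); have := B (rev y) [::]; rewrite -/(rev (rev y)) revK.
Qed.
Definition iotm c := tm_of (compile 0 (Seq readc (Seq c writec))).
Lemma iotm_outputs c (x y : seq bool) n : cmd_ok c -> computes c (tr x) (tr y) n ->
 tm_outputs (iotm c) x (10 * (200 * (size x + n + 1)) ^ 2) y.
move=> ok C.
have sy: size y <= 4 * size x + 1 + n.
 apply: leq_trans (ltnW (size_esz y)) _; apply: leq_trans (comp_sz ok C) _.
 by rewrite leq_add2r; apply: esz_bits.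
have : X (Seq readc (Seq c writec)) (st1 x) (st1 y) ((20 * size x + 20) + (n + (20 * size y + 20))).
 apply: (X_seq (X_readc x)); apply: X_seq (X_writec y).
 by have := C [::] [::] [::]; rewrite !cats0.
case=> m mn E; apply: tm_outputs_le (exec_tm _ E); last by rewrite/= ok.
have m1: m <= 200*(size x + n + 1) by lia.
have x1: size x + 1 <= 200*(size x + n + 1) by lia.
move: (200 * _) m1 x1=> K m1 x1; have : m*(2*(size x + m) + 6) <= K*(2*(K + K) + 5).
 by apply: leq_mul=> //; lia.
nia.
Qed.
Lemma pol_nk f : pol f -> exists k, forall n, f n <= n ^ k + k.
case=> k H; exists (3 ^ k + 2*k)=> n; apply: leq_trans (H n) _.
case: n=>[|[|n]].
- by apply: leq_trans (_ : 3 ^ k <= _); [apply: leqX | lia].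
- by rewrite -[1 + 2]/3; lia.
apply: leq_trans (leq_addr _ _); apply: (@leq_trans (n.+2 ^ (2*k))).
 by rewrite expnM; apply: leqX; nia.
by rewrite leq_pexp2l; lia.
Qed.
Lemma ptime_polytime (f : seq bool -> seq bool) : ptime f -> polytime_fun f.
case=> c [k [ok C]].
have [j J] : exists j, forall n, 10*(200*(n + (4*n + 1 + 2) ^ k + 1)) ^ 2 <= n ^ j + j.
 by apply: pol_nk; auto 15 with pol.
exists (iotm c), j=> x; apply: tm_outputs_le (J (size x)) _.
apply: iotm_outputs=> //; apply: comp_le (C x).
by apply: leqX; rewrite leq_add2r; apply: esz_bits.
Qed.
Lemma ptime_in_poly (p : nat -> nat) : ptime p -> in_poly p.
move=> P; have : ptime (fun x : seq bool=> nseq (p (size x)) true).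
 by [pt | pt].
by case/ptime_polytime=> M [k H]; exists M, k=> n; have := H (nseq n true); rewrite !size_nseq.
Qed.
(** Doubling a unary number [m] times produces the padding; the time is polynomial in the result and
    hence of the form [2 ^ O(size x + m)]. *)
Lemma computes_pow2 : exists c C, cmd_ok c /\ forall (x : seq bool) (m : nat),
 computes c (tr (x, m)) (tr (x, 2 ^ m)) (2 ^ (C * (size x + m + 1))).
have PF: ptime (fun s : seq bool*nat*unit=> (s.1.1, s.1.2 + s.1.2)) by pt.
case: PF=> c [k [ok H]].
have Q: ptime (fun xm : seq bool*nat=> ((xm.1, 1), nseq xm.2 tt)).
 by [pt | pt].
case: Q=> c' [k' [ok' H']].
exists (Seq c' (foldc c)), (20*(k + k' + 20)); split; first by rewrite/= ok ok'.
move=> x m; set B := 2 ^ (size x + m + 1).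
have B1: size x + m + 1 < B by apply: ltn_expl.
have mB: m.+1 <= B by lia.
have B2: 2 <= B by lia.
have C1 := H' (x, m).
have E: tr ((x, m).1, 1, nseq (x, m).2 tt) = Nd (tr (x, 2 ^ 0)) (tlist (nseq m Lf)) by rewrite/= map_nseq.
rewrite E in C1.
have C2 := @comp_fold c (fun i=> tr (x, 2 ^ i)) (nseq m Lf) ((20*B + 2) ^ k) (20*B).
have szx: esz x <= 4 * size x + 1 by apply: esz_bits.
have sz2 i: i <= m -> esz (x, 2 ^ i) <= 20*B - 10.
 move=> im; rewrite esz_pair esz_nat; have : 2 ^ i <= B by rewrite leq_exp2l; lia.
 lia.
apply: (@comp_le _ _ _ ((esz (x, m) + 2) ^ k' + (m.+1*((20*B + 2) ^ k + 200*(20*B))))).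
 have BB: B ^ 6 = B*B ^ 5 by [].
 have H1: 20*B + 2 <= B ^ 6 by nia.
 have H2: 200*(20*B) <= B ^ 13.
  apply: (@leq_trans (B*2 ^ 12)); [rewrite -[2 ^ 12]/(4000 + 96) | rewrite leq_mul2l]; lia.
 have H3: esz (x, m) + 2 <= B ^ 6 by rewrite esz_pair esz_nat; lia.
 have mon a b: a <= b -> B ^ a <= B ^ b by apply: leq_pexp2l; lia.
 have H4 := leqX k H1; have H5 := leqX k' H3; rewrite -expnM in H4; rewrite -expnM in H5.
 have H6: (20*B + 2) ^ k <= B ^ (6*k' + 6*k + 13) by apply: leq_trans H4 (mon _ _ _); lia.
 have H7: 200*(20*B) <= B ^ (6*k' + 6*k + 13) by apply: leq_trans H2 (mon _ _ _); lia.
 have H8: (esz (x, m) + 2) ^ k' <= B ^ (6*k' + 6*k + 13) by apply: leq_trans H5 (mon _ _ _); lia.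
 apply: (@leq_trans (B*(B*(B*B ^ (6*k' + 6*k + 13))))); last first.
  by rewrite -!expnS -expnM leq_exp2l; lia.
 move: (B ^ (6 * _ + _ + _)) H6 H7 H8=> Y H6 H7 H8; move: ((_ + 2) ^ k) ((_ + 2) ^ k') (200 * _) H6 H7 H8=> y1 y2 y3.
 clear -mB B2=> H6 H7 H8; apply: (@leq_trans (Y + B*(Y + Y))).
  by apply: leq_add=> //; apply: leq_mul=> //; apply: leq_add.
 have : 2*(B*Y) <= B*(B*Y) by rewrite leq_mul2r B2 orbT.
 have : 2*(B*(B*Y)) <= B*(B*(B*Y)) by rewrite leq_mul2r B2 orbT.
 have : Y <= B*Y by rewrite -{1}(mul1n Y) leq_mul2r; lia.
 lia.
rewrite size_nseq in C2; apply: comp_seq C1 (C2 _ _ _).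
- by rewrite -[sz _]/(esz m) esz_nat; lia.
- by move=> i /sz2; rewrite /esz; lia.
- move=> i im; rewrite nth_nseq im; have := H (x, 2 ^ i, tt); rewrite addnn -mul2n -expnS.
 apply: comp_le; apply: leqX; rewrite esz_pair.
 have E0: esz tt = 1 by [].
 by have := sz2 i (ltnW im); lia.
Qed.
(** The padding argument: [F] is polynomial in a second argument of value [2 ^ (size x ^ k + k)]
    given in unary, so it may spend exponential time on [x]. *)
Lemma ptime_EXP (F : seq bool * nat -> bool) k A : ptime F ->
 (forall x, (yes_inst A x -> F (x, 2 ^ (size x ^ k + k))) /\ (no_inst A x -> ~~ F (x, 2 ^ (size x ^ k + k)))) ->
 in_EXP A.
move=> PF H.
have P1: ptime (fun x : seq bool=> (x, size x ^ k + k)) by pt.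
have P2: ptime (fun xm : seq bool*nat=>[:: F xm]) by pt.
case: P1=> c1 [k1 [ok1 C1]]; case: P2=> c2 [k2 [ok2 C2]].
have [c [C [ok H2]]] := computes_pow2.
pose c3 := Seq c1 (Seq c c2).
have R x: computes c3 (tr x) (tr [:: F (x, 2 ^ (size x ^ k + k))])
  ((esz x + 2) ^ k1 + (2 ^ (C*(size x + (size x ^ k + k) + 1)) + (esz (x, 2 ^ (size x ^ k + k)) + 2) ^ k2)).
 by apply: comp_seq (C1 x) (comp_seq (H2 x _) (C2 (x, _))).
have yn x: (yes_inst A x -> [:: F (x, 2 ^ (size x ^ k + k))] = [:: true]) /\ (no_inst A x -> [:: F (x, 2 ^ (size x ^ k + k))] = [:: false]).
 by have [Y N] := H x; split=> [/Y ->|/N /negbTE ->].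
pose D := 8*k1 + C + 8*k2 + 20.
have [j J] : exists j, forall n, 2*(D + 20)*(n + n ^ k + k + 1) <= n ^ j + j.
 by apply: pol_nk; auto 15 with pol.
exists (iotm c3), j=> x; exists [:: F (x, 2 ^ (size x ^ k + k))]; split; last exact: yn.
apply: tm_outputs_le (iotm_outputs _ (R x)); last by rewrite/= ok1 ok.
apply: leq_trans (_ : 2 ^ (2*(D + 20)*(size x + size x ^ k + k + 1)) <= _); last by rewrite leq_exp2l.
have szx: esz x <= 4 * size x + 1 by apply: esz_bits.
have -> : C*(size x + (size x ^ k + k) + 1) = (size x + size x ^ k + k + 1)*C by lia.
rewrite expnM [2*(D + 20) * _]mulnC (expnM 2 _ (2 * _)); set P := 2 ^ (_ + k + 1).
have P1: size x + size x ^ k + k + 1 < P by apply: ltn_expl.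
have mon a b: a <= b -> P ^ a <= P ^ b by apply: leq_pexp2l; lia.
have PP a: 2 ^ a <= P ^ a by apply: leqX; lia.
have H1: 32*P <= P ^ 6 by rewrite mulnC leq_mul2l (PP 5) orbT.
have K2: esz (x, 2 ^ (size x ^ k + k)) + 2 <= P ^ 6.
 rewrite esz_pair esz_nat.
 have : 2 ^ (size x ^ k + k) <= P by rewrite leq_exp2l; lia.
 by lia.
have K1: esz x + 2 <= P ^ 6 by lia.
have {}K1 := leqX k1 K1; have {}K2 := leqX k2 K2; rewrite -expnM in K1; rewrite -expnM in K2.
have P4: 4 <= P ^ 2 by rewrite -[4]/(2 ^ 2).
set n := (esz x + 2) ^ k1 + _; have nD: n <= P ^ D.
 apply: (@leq_trans (P ^ (D - 2) + (P ^ (D - 2) + P ^ (D - 2)))).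
  apply: leq_add; first by apply: leq_trans K1 (mon _ _ _); lia.
  by apply: leq_add; [apply: mon; lia | apply: leq_trans K2 (mon _ _ _); lia].
 apply: (@leq_trans (P ^ ((D - 2) + 2))); last by apply: mon; lia.
 by rewrite expnD; move: (P ^ (D - 2))=> Y; nia.
apply: (@leq_trans (P ^ 4*(P ^ (8 + (D + 2))) ^ 2)).
 apply: leq_mul; first by apply: leq_trans (PP 4).
 apply: leqX; rewrite expnD; apply: leq_mul; first by apply: leq_trans (PP 8).
 rewrite expnD; have : P <= P ^ D by rewrite -{1}(expn1 P); apply: mon; lia.
 clear -P4 nD P1; nia.
by rewrite -expnM -expnD; apply: mon; lia.
Qed.
(** The machine is fixed, so its transition function is a constant table, and the configuration
    grows by a bounded amount per step. *)
Lemma pt_tmrun M : ptime (fun xt : seq bool * nat => tape_out (tm_run M xt.2 (tm_init xt.1)).2).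
pose tbl := mkseq (fun q=> mkseq (fun s=> let r := tm_delta M (inord q, inord s) in
  ((r.1.1 : nat), (r.1.2 : nat), (r.2 : nat))) (tm_S M).+3) (tm_Q M).+2.
pose lk (q s : nat) : nat*nat*nat := nth (nth (0, 0, 0) (nth (nth [::] tbl 0) tbl q) 0) (nth (nth [::] tbl 0) tbl q) s.
(* [inord] sends an index out of range to 0, so the default values of the table lookup must be the
   entries of index 0. *)
have in0 n m: n < m -> inord m = inord 0 :> 'I_n.+1 by move=> mn; apply: val_inj; rewrite /inord /insubd insubN ?insubT// -leqNgt.
have lkE q s: lk q s = let r := tm_delta M (inord q, inord s) in ((r.1.1 : nat), (r.1.2 : nat), (r.2 : nat)).
 rewrite /lk; have -> : nth (nth [::] tbl 0) tbl q = mkseq (fun s=> let r := tm_delta M (inord q, inord s) in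
  ((r.1.1 : nat), (r.1.2 : nat), (r.2 : nat))) (tm_S M).+3.
  case: (ltnP q (tm_Q M).+2)=> qQ; first by rewrite nth_mkseq.
  by rewrite nth_default ?size_mkseq// nth_mkseq// -(in0 _ _ qQ).
 case: (ltnP s (tm_S M).+3)=> sS; first by rewrite nth_mkseq.
 by rewrite nth_default ?size_mkseq// nth_mkseq// -(in0 _ _ sS).
have Plk: ptime (fun qs : nat*nat=> lk qs.1 qs.2) by rewrite /lk; pt.
pose stp (c : nat * seq nat * seq nat) := if c.1.1 == 1 then c else
  let r1 := (lk c.1.1 (head 0 c.2)).1.2 :: behead c.2 in
  let q' := (lk c.1.1 (head 0 c.2)).1.1 in
  if (lk c.1.1 (head 0 c.2)).2 == 0 then (q', behead c.1.2, head 0 c.1.2 :: r1)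
  else if (lk c.1.1 (head 0 c.2)).2 == 1 then (q', c.1.2, r1)
  else (q', (lk c.1.1 (head 0 c.2)).1.2 :: c.1.2, behead c.2).
have stpE c: tm_step M c = stp c.
 case: c=>[[q l] r]; rewrite /tm_step /stp lkE.
 by case: (tm_delta _ _)=>[[q' b] mv]/=; case: l=>[|y l].
have Pstp: ptime stp by rewrite /stp; pt.
have lkb q s: (lk q s).1.1 + (lk q s).1.2 <= tm_Q M + tm_S M + 5.
 by rewrite lkE; case: (tm_delta _ _)=>[[q' b] mv]/=; have := ltn_ord q'; have := ltn_ord b; lia.
have Pinit: ptime tm_init.
 apply: (@pt_ext _ _ (fun x=> (0, @nil nat, map enc_bit x)))=> //.
 pt; apply: pt_map; pt.
 by apply: (@pt_ext _ _ (fun x : seq bool*bool=> if x.2 then 2 else 1)); [case=> [? []] | pt].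
have Prun: ptime (fun xt : seq bool*nat=> tm_run M xt.2 (tm_init xt.1)).
 apply: (@pt_ext _ _ (fun xt : seq bool*nat=> iter xt.2 stp (tm_init xt.1)))=>[xt|].
  by apply/esym/eq_iter.
 apply: pt_iter_le; pt.
 exists (4*(tm_Q M + tm_S M + 5) + 10)=> e c; apply: (@leq_trans (esz c + 4*(tm_Q M + tm_S M + 5) + 10)); last first.
  by rewrite -addnA leq_add2l; apply: leq_trans (ltnW (ltn_expl _ (ltnSn 1))) _; apply: leqX; lia.
 case: c=>[[q l] r]; rewrite /stp; case: ifP=> _; first lia.
 have := lkb q (head 0 r); move: (lk)=>[[q' b] mv]/= H.
 by case: ifP=> _; [|case: ifP=> _]; case: l=>[|y l]; case: r {H} (H)=>[|z r] H/=; rewrite !esz_pair ?esz_cons !esz_nat; lia.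
suff Pto: ptime tape_out by pt.
pose f (s : bool * seq bool) (a : nat) : bool * seq bool := if s.1 then s else if a == 1 then (false, false :: s.2) else if a == 2 then (false, true :: s.2) else (true, s.2).
apply: (@pt_ext _ _ (fun s=> rev (foldl f (false, [::]) s).2))=>[s|].
 have H b r: rev (foldl f (b, r) s).2 = rev r ++ (if b then [::] else tape_out s).
  elim: s b r=>[|a s IH] b r; first by rewrite if_same cats0.
  case: b=> /=; first by rewrite IH.
  by case: a=>[|[|[|a]]]/=; rewrite IH ?rev_cons ?cat_rcons.
 by [].
pt; apply: pt_foldl_add; pt; first by rewrite /f; pt.
exists 2=> e [b s] a; apply: (@leq_trans (esz (b, s) + 6)); last first.
 have := esz_gt0 a; lia.
rewrite /f; case: b=> /=; first lia.
have [E1 E3] : esz false = 1 /\ esz true = 3 by [].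
by case: eqP=> _; [|case: eqP=> _]; rewrite !esz_pair ?esz_cons; lia.
Qed.

(** * Linear matrix inequalities *)
Local Open Scope ring_scope.
(** Truncation makes every intermediate result short unconditionally, so that the running time needs
    no numerical analysis; correctness is proved under size hypotheses that exclude truncation. *)
Definition clampz w z : int := if (zlen z <= w)%N then z else 0.
Definition en (S : seq (seq int)) i j : int := nth 0 (nth [::] S i) j.
Definition mx d e f : seq (seq int) := mkseq (fun i => mkseq (f i) e) d.
Lemma en_mx d e f i j : (i < d)%N -> (j < e)%N -> en (mx d e f) i j = f i j.
by move=> id je; rewrite /en !nth_mkseq. Qed.
Lemma size_mx d e f : size (mx d e f) = d. exact: size_mkseq. Qed.
(* One step of symmetric elimination with pivot a = S00 + 1; dividing by the power of two just
  above a keeps the entries bounded, and the diagonal correction absorbs the rounding. *)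
Definition elim1 w S : seq (seq int) :=
 let d := (size S).-1 in let a := en S 0 0 + 1 in
 mx d d (fun i j => clampz w (zshr (a * en S i.+1 j.+1 - en S 0 i.+1 * en S 0 j.+1) (zlen a)
   + (if i == j then d.+2%:Z else 0))).
(** A negative diagonal entry gives a unit vector as witness. Otherwise a witness [v] for the
    eliminated matrix is extended by the coordinate that annihilates the square in [qf_schur],
    everything being scaled by the pivot to stay integral. The empty list means that no witness was
    found. *)
Definition ext1 w S (v : seq int) : seq int :=
 let negs := [seq i <- iota 0 (size S) | en S i i < 0] in
 if size negs == 0%N then
  if size v == 0%N then [::] else
   clampz w (- \sum_(j <- iota 0 (size S).-1) en S 0 j.+1 * nth 0 v j)
   :: mkseq (fun j => clampz w ((en S 0 0 + 1) * nth 0 v j)) (size S).-1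
 else mkseq (fun j => if j == head 0%N negs then 1 else 0) (size S).
Definition psd w S : seq int :=
 foldr (ext1 w) [::] (mkseq (fun i => iter i (elim1 w) S) (size S)).
Lemma esz_clampz w z : (esz (clampz w z) <= 4 * w + 5)%N.
rewrite /clampz; case: ifP=> H; first by apply: leq_trans (esz_int_le z) _; lia.
by apply: leq_trans (esz_int_le 0) _; rewrite /zlen/=; lia.
Qed.
Lemma pt_clampz (E : encT) (w : E -> nat) (z : E -> int) : ptime w -> ptime z -> ptime (fun e => clampz (w e) (z e)).
by move=> W Z; rewrite /clampz; ptz. Qed.
Lemma pt_en (E : encT) (S : E -> seq (seq int)) (i j : E -> nat) : ptime S -> ptime i -> ptime j ->
 ptime (fun e => en (S e) (i e) (j e)).
by move=> HS I J; rewrite /en; ptz. Qed.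
Lemma pt_mx (E : encT) (d e : E -> nat) (f : E -> nat -> nat -> int) : ptime d -> ptime e ->
 ptime (fun x : E * nat * nat => f x.1.1 x.1.2 x.2) -> ptime (fun x => mx (d x) (e x) (f x)).
move=> PD PE F; apply: pt_mkseq=> //.
by apply: pt_mkseq=> //; pt.
Qed.
Lemma pt_elim1 (E : encT) (w : E -> nat) (S : E -> seq (seq int)) : ptime w -> ptime S -> ptime (fun e => elim1 (w e) (S e)).
move=> W HS; apply: pt_mx; pt.
apply: pt_clampz; first by pt.
ptz; apply: pt_en; ptz.
Qed.
Lemma pt_ext1 (E : encT) (w : E -> nat) (S : E -> seq (seq int)) (v : E -> seq int) :
 ptime w -> ptime S -> ptime v -> ptime (fun e => ext1 (w e) (S e) (v e)).
move=> W HS V; have N: ptime (fun e=>[seq i <- iota 0 (size (S e)) | en (S e) i i < 0]).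
 by apply: pt_filter; ptz; apply: pt_en; ptz.
rewrite /ext1; pt.
- apply: pt_clampz; ptz; apply: pt_sumz; ptz.
 by apply: pt_en; ptz.
- apply: pt_mkseq; pt.
 by apply: pt_clampz; ptz; apply: pt_en; ptz.
- have N': ptime (fun x : E*nat=>[seq i <- iota 0 (size (S x.1)) | en (S x.1) i i < 0]) by apply: (pt_app1 N); pt.
 by apply: pt_mkseq; ptz.
Qed.
Lemma esz_mx d e f B : (forall i j, esz (f i j) <= B)%N -> (esz (mx d e f) <= (d * (e * B.+1).+2).+1)%N.
move=> H; rewrite esz_sum big_map -[X in (_ <= (X * _).+1)%N]subn0 -sum_nat_const_nat.
rewrite /index_iota subn0; apply: leq_sum=> i _; rewrite ltnS esz_sum big_map -[X in (_ <= (X * _).+1)%N]subn0 -sum_nat_const_nat /index_iota subn0.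
by apply: leq_sum=> j _; rewrite ltnS.
Qed.
Lemma size_elim1 w S : size (elim1 w S) = (size S).-1. exact: size_mx. Qed.
Lemma esz_elim1 w S : (esz (elim1 w S) <= (size S * (size S * (4 * w + 7))).+1)%N.
apply: leq_trans (esz_mx _ _ (B := (4*w + 5)) _) _; first by move=> i j; apply: esz_clampz.
case: size=>[|d]//.
lia.
Qed.
Lemma esz_nth (A : encT) d (l : seq A) i : (i < size l)%N -> (esz (nth d l i) <= esz l)%N.
by elim: l i=> // a l IH [|i]/= il; rewrite esz_cons; [lia | have := IH i il; lia]. Qed.
Lemma esz_ext1 w S v : (esz (ext1 w S v) <= ((size S).+1 * (4 * w + 9)).+2)%N.
rewrite /ext1.
have H (f : nat -> int) n : (n <= size S)%N -> (forall i, esz (f i) <= 4*w + 7)%N -> (esz (mkseq f n) <= (size S*(4*w + 8)).+1)%N.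
 move=> nS Hf; rewrite esz_sum big_map ltnS; apply: (@leq_trans (n*(4*w + 8))); last by rewrite leq_mul2r nS orbT.
 rewrite -[X in (_ <= X * _)%N]subn0 -sum_nat_const_nat /index_iota subn0; apply: leq_sum=> i _.
 by have := Hf i; lia.
case: ifP=> n0; first case: ifP=> v0.
- by [].
- rewrite esz_cons; apply: (@leq_trans ((4*w + 5) + (size S*(4*w + 8)).+1).+1); last by lia.
 by rewrite ltnS leq_add ?esz_clampz// H ?leq_pred// => i; apply: leq_trans (esz_clampz _ _) _; lia.
- apply: leq_trans (H _ _ (leqnn _) _) _; last by lia.
 by move=> i; case: ifP=> _; apply: (@leq_trans 7)=> //; lia.
Qed.
Lemma pt_psd (E : encT) (w : E -> nat) (S : E -> seq (seq int)) : ptime w -> ptime S -> ptime (fun e => psd (w e) (S e)).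
move=> W HS; have [k Hk] := pt_szb HS; have [l Hl] := pt_szb W.
have wl e: (w e <= (esz e + 2) ^ l)%N by apply: leq_trans (Hl e); rewrite esz_nat; lia.
have szk e: (size (S e) <= (esz e + 2) ^ k)%N by apply: leq_trans (Hk e); apply/ltnW/size_esz.
have PH: ptime (fun e=> mkseq (fun i=> iter i (elim1 (w e)) (S e)) (size (S e))).
 apply: pt_mkseq; last by pt.
 apply: pt_iter; pt; first by apply: pt_elim1; pt.
 exists (fun n=> (n + 2) ^ k + ((n + 2) ^ k*((n + 2) ^ k*(4*(n + 2) ^ l + 7)) + 1))%N; first by auto 15 with pol.
 move=> [e n] i _; rewrite -[(e, n).1]/e; have En: (esz e <= esz (e, n))%N by rewrite esz_pair; lia.
 have X1 := leqX k (_ : esz e + 2 <= esz (e, n) + 2)%N; have X2 := leqX l (_ : esz e + 2 <= esz (e, n) + 2)%N.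
 have {}X1 : ((esz e + 2) ^ k <= (esz (e, n) + 2) ^ k)%N by lia.
 case: i=>[|i]; first by apply: leq_trans (Hk e) _; apply: leq_trans X1 (leq_addr _ _).
 apply: leq_trans (esz_elim1 _ _) _; rewrite -addn1; apply: leq_trans (leq_addl _ _); rewrite leq_add2r.
 have sle: (size (iter i (elim1 (w e)) (S e)) <= (esz (e, n) + 2) ^ k)%N.
  apply: leq_trans (leq_trans (szk e) X1); elim: i=> //= i IH; rewrite size_elim1; lia.
 apply: leq_mul=> //; apply: leq_mul=> //; have := wl e; lia.
have [j Hj] := pt_szb PH.
apply: (@pt_ext _ _ (fun e=> foldl (fun v s=> ext1 (w e) s v) [::] (rev (mkseq (fun i=> iter i (elim1 (w e)) (S e)) (size (S e))))))=>[e|]; first by rewrite foldl_rev.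
apply: pt_foldl; pt; first by apply: pt_ext1; pt.
exists (fun n=> ((n + 2) ^ j + 1)*(4*(n + 2) ^ l + 9) + 2)%N; first by auto 15 with pol.
move=> e i; set L := rev _; move=> iL; case: i iL=>[|i] iL; first by rewrite take0 esz_nil; lia.
case EL : L iL=>[|s0 L']// iL; rewrite (take_nth s0)// foldl_rcons; apply: leq_trans (esz_ext1 _ _ _) _.
rewrite -addn2 leq_add2r; apply: leq_mul; last by have := wl e; lia.
rewrite addn1; apply: leq_trans (Hj e); rewrite -esz_rev -/L EL.
by apply: leq_trans (ltnW (size_esz _)) (esz_nth _ _).
Qed.
Section Correct.
Variable K : realFieldType.
Implicit Types (x : nat -> K).
Definition qf d (S : nat -> nat -> K) x := \sum_(i < d) \sum_(j < d) x i * S i j * x j.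
Definition nr d x := \sum_(i < d) x i ^+ 2.
Lemma nr_ge0 d x : 0 <= nr d x. by apply: sumr_ge0=> i _; apply: sqr_ge0. Qed.
Lemma qf_pert d S x (c : K) : (forall i j, (i < d)%N -> (j < d)%N -> `|S i j| <= c) -> `|qf d S x| <= c * d%:R * nr d x.
case: d=>[|d] H; first by rewrite /qf /nr !big_ord0 normr0 mulr0.
apply: le_trans (ler_norm_sum _ _ _) _.
apply: (@le_trans _ _ (\sum_(i < d.+1) \sum_(j < d.+1) c*((x i ^+ 2 + x j ^+ 2) / 2))).
 apply: ler_sum=> i _; apply: le_trans (ler_norm_sum _ _ _) _; apply: ler_sum=> j _.
 rewrite !normrM mulrAC mulrC; apply: ler_pM=> //; first by rewrite mulr_ge0.
  exact: H.
 have := sqr_ge0 (`|x i| - `|x j|); rewrite sqrrB !real_normK ?num_real// => h.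
 by lra.
rewrite (_ : \sum_(i < d.+1) _ = c*((\sum_(i < d.+1) \sum_(j < d.+1) x i ^+ 2 + \sum_(i < d.+1) \sum_(j < d.+1) x j ^+ 2) / 2)).
 rewrite sumr_const card_ord (_ : \sum_(i < d.+1) \sum_(j < d.+1) _ = nr d.+1 x *+ d.+1).
  rewrite -mulr2n.
  by lra.
 by rewrite -sumrMnl; apply: eq_bigr=> i _; rewrite sumr_const card_ord.
rewrite -big_split mulr_suml mulr_sumr; apply: eq_bigr=> i _/=.
by rewrite -big_split mulr_suml mulr_sumr.
Qed.
(** Completing the square with pivot [S 0 0 + 1]: the added 1, paid by the term [x 0 ^+ 2], keeps
    the pivot at least 1 when the diagonal is only known to be nonnegative. *)
Lemma qf_schur d (S : nat -> nat -> K) x : (forall i j, (i <= d)%N -> (j <= d)%N -> S i j = S j i) -> let a := S 0%N 0%N + 1 in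
 a * (qf d.+1 S x + x 0%N ^+ 2) = (a * x 0%N + \sum_(j < d) S 0%N j.+1 * x j.+1) ^+ 2
  + qf d (fun i j => a * S i.+1 j.+1 - S 0%N i.+1 * S 0%N j.+1) (fun i => x i.+1).
move=> sy a; set s := \sum_(j < d) _.
have -> : qf d.+1 S x = x 0*S 0 0*x 0 + x 0 * s *+ 2 + qf d (fun i j=> S i.+1 j.+1) (fun i=> x i.+1).
 rewrite /qf big_ord_recl big_ord_recl/= (_ : \sum_(i < d) x 0 * _ * _ = x 0 * s); last first.
  by rewrite mulr_sumr; apply: eq_bigr=> i _; rewrite mulrA.
 rewrite (eq_bigr (fun i : 'I_d => x i.+1*S 0 i.+1*x 0 + \sum_(j < d) x i.+1*S i.+1 j.+1*x j.+1)); last first.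
  by move=> i _; rewrite big_ord_recl sy.
 rewrite big_split !addrA; congr (_ + _ + _ + _).
 by rewrite mulr_sumr; apply: eq_bigr=> i _; ring.
have -> : qf d (fun i j=> a*S i.+1 j.+1 - S 0 i.+1*S 0 j.+1) (fun i=> x i.+1)
  = a * qf d (fun i j=> S i.+1 j.+1) (fun i=> x i.+1) - s ^+ 2.
 rewrite mulr_sumr expr2 mulr_suml -sumrB; apply: eq_bigr=> i _.
 by rewrite mulr_sumr mulr_sumr -sumrB; apply: eq_bigr=> j _; ring.
by rewrite /a; ring.
Qed.
Lemma zshr_err z l : `|z%:~R - (zshr z l)%:~R * 2 ^+ l : K| <= 2 ^+ l.
have [q [r [rl Ez Es]]] : exists q r : nat, [/\ (r < 2 ^ l)%N, absz z = (r + 2 ^ l * q)%N & zshr z l = zof (z < 0) q].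
 exists (b2n (drop l (bits (absz z)))); rewrite /zshr; case: (ltnP l (size (bits (absz z))))=> H.
  exists (b2n (take l (bits (absz z)))); split=>//; first by rewrite -{2}(size_takel (ltnW H)) b2n_lt.
  by rewrite -{1}(bitsK (absz z)) -{1}(cat_take_drop l (bits _)) b2n_cat size_takel// ltnW.
 rewrite drop_oversize//; exists (absz z); split=>//; last by rewrite muln0 addn0.
 by apply: leq_trans (bits_lt _) _; rewrite leq_exp2l.
have -> : z%:~R - (zshr z l)%:~R*2 ^+ l = (zof (z < 0) r)%:~R :> K.
 have Ezz: z%:~R = (zof (z < 0) (absz z))%:~R :> K by congr (_%:~R); rewrite /zof; case: ltP=> H; lia.
 rewrite Ezz Es Ez; case: (z < 0); rewrite ?rmorphN/= -!pmulrn natrD natrM natrX; ring.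
case: (z < 0); rewrite ?rmorphN ?normrN normr_nat -natrX ler_nat; exact: ltnW.
Qed.
Lemma zlen_bounds (a : int) : 1 <= a -> 2 ^+ (zlen a) <= 2 * a%:~R :> K /\ a%:~R <= 2 ^+ (zlen a) :> K.
move=> a1; have -> : a%:~R = (absz a)%:R :> K by rewrite pmulrn; congr (_%:~R); lia.
have := bits_lt (absz a); have := @bits_ge (absz a); rewrite -/(zlen a); set l := zlen a=> B1 B2.
have l0: (0 < l)%N by case: (l) B2=> //; lia.
split; last by rewrite -natrX ler_nat ltnW.
rewrite -natrX -natrM ler_nat -(prednK l0) expnS; lia.
Qed.
Lemma clampz_id w z : `|z%:~R| < 2 ^+ w :> K -> clampz w z = z.
by rewrite -intr_norm -natrX ltr_nat=> H; rewrite /clampz size_bits_le.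
Qed.
Variables (w d0 : nat) (W : K).
Hypotheses (w1 : W ^+ 2 + W + d0%:R + 4 < 2 ^+ w) (w2 : ((W + 1) * (d0%:R + 1)) ^+ d0 < 2 ^+ w).
(** A nonnegative new diagonal bounds the squares of the pivot row by [2 ^+ l * (m + d%:R + 3)], and
    a product of two such entries is at most the mean of their squares. Hence the entries grow
    additively, from [M] to [M + m + 2 * d%:R + 6], and keep few digits over all eliminations. *)
Lemma elim1_spec d S (M m : K) : size S = d.+1 -> (d < d0)%N -> M <= W -> m <= W ->
 (forall i j, (i <= d)%N -> (j <= d)%N -> en S i j = en S j i) ->
 (forall i, (i <= d)%N -> 0 <= en S i i) ->
 (forall i j, (i <= d)%N -> (j <= d)%N -> `|(en S i j)%:~R| <= M :> K) -> (forall i, (i <= d)%N -> (en S i i)%:~R <= m :> K) ->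
 let a := (en S 0 0 + 1)%:~R : K in let l := zlen (en S 0 0 + 1) in
 [/\ 1 <= a, a <= 2 ^+ l, 2 ^+ l <= 2 * a,
  forall i j, (i < d)%N -> (j < d)%N -> exists2 e : K, `|e| <= 1 &
   (en (elim1 w S) i j)%:~R = (a * (en S i.+1 j.+1)%:~R - (en S 0 i.+1)%:~R * (en S 0 j.+1)%:~R) / 2 ^+ l + e + (i == j)%:R * (d%:R + 2)
 & (forall i, (i < d)%N -> 0 <= en (elim1 w S) i i) ->
  (forall i j, (i < d)%N -> (j < d)%N -> `|(en (elim1 w S) i j)%:~R| <= M + m + 2 * d%:R + 6 :> K) /\
  (forall i, (i < d)%N -> (en (elim1 w S) i i)%:~R <= m + d%:R + 3 :> K)].
move=> Sd dd0 MW mW sy dg Mb mb a l.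
have a1: 1 <= en S 0 0 + 1 by have := dg 0%N isT; lia.
have [l1 l2] := zlen_bounds a1; rewrite -/a -/l in l1 l2.
have a1K: 1 <= a by rewrite /a -[1]/(1%:~R) ler_int.
have l0: 0 < 2 ^+ l :> K by rewrite exprn_gt0.
have M0: 0 <= M by apply: le_trans (Mb 0%N 0%N isT isT).
have aW: a <= M + 1 by rewrite /a intrD lerD2r; apply: le_trans (Mb 0 0 isT isT); apply: ler_norm.
pose T i j : K := a*(en S i.+1 j.+1)%:~R - (en S 0 i.+1)%:~R*(en S 0 j.+1)%:~R.
have E i j: (i < d)%N -> (j < d)%N -> exists2 e : K, `|e| <= 1 &
   (en (elim1 w S) i j)%:~R = T i j / 2 ^+ l + e + (i == j)%:R*(d%:R + 2).
 move=> id jd; rewrite /elim1 Sd/= en_mx//.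
 set t := _ - _; have Tt: T i j = t%:~R by rewrite /T /t intrB !intrM.
 have := zshr_err t l; rewrite -Tt=> zr; set z := zshr _ _ in zr *.
 have ez: `|z%:~R - T i j / 2 ^+ l| <= 1.
  rewrite -(ler_pM2r l0) mul1r -[X in _ * X <= _](gtr0_norm l0) -normrM mulrBl divfK ?gt_eqF// distrC//.
 have zT: `|T i j / 2 ^+ l| <= M + M ^+ 2.
  rewrite normrM normfV (gtr0_norm l0) ler_pdivrMr// /T.
  apply: le_trans (ler_normB _ _) _; rewrite !normrM (ger0_norm (le_trans ler01 a1K)) mulrDl.
  apply: lerD; first by rewrite mulrC; apply: ler_pM=> //; [apply: le_trans ler01 a1K | apply: Mb].
  apply: (@le_trans _ _ (M ^+ 2)); first by rewrite expr2; apply: ler_pM=> //; apply: Mb.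
  by rewrite ler_peMr ?sqr_ge0//; apply: le_trans a1K l2.
 exists (z%:~R - T i j / 2 ^+ l)=> //; rewrite clampz_id.
  rewrite intrD [T i j / _ + _]addrC subrK; congr (_ + _).
  by case: (i == j); rewrite ?mul1r ?mul0r//= -pmulrn -[d.+2]addn2 natrD.
 apply: le_lt_trans w1; rewrite intrD -[z%:~R](subrK (T i j / 2 ^+ l)).
 apply: le_trans (ler_normD _ _) _; apply: (@le_trans _ _ ((1 + (M + M ^+ 2)) + (d0%:R + 1))).
  apply: lerD; first by apply: le_trans (ler_normD _ _) _; apply: lerD.
  have : d%:R + 1 <= d0%:R :> K by rewrite -natr1E ler_nat || (rewrite natr1 ler_nat).
  by case: (i == j)=> /=; rewrite ?normr0 -?pmulrn ?normr_nat -?natr1; have := ler0n K d; lra.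
 have : M ^+ 2 <= W ^+ 2 by rewrite ler_sqr ?nnegrE//; apply: le_trans MW.
 by lra.
split=>// dg'.
have X i: (i < d)%N -> ((en S 0 i.+1)%:~R) ^+ 2 <= 2 ^+ l*(m + d%:R + 3).
 move=> id; have := dg' i id; rewrite -(ler0z K); have [e e1 ->] := E i i id id.
 rewrite eqxx mul1r=> H; have : - (d%:R + 3) <= T i i / 2 ^+ l by have := ler_norm e; lra.
 rewrite ler_pdivlMr// /T -expr2=> H2.
 have : a*(en S i.+1 i.+1)%:~R <= 2 ^+ l * m.
  apply: ler_pM=> //; [exact: le_trans ler01 a1K | by rewrite ler0z dg | exact: mb].
 by move: H2; rewrite mulNr=> H2; lra.
have d0K: 0 <= d%:R :> K by [].
split=> [i j id jd|i id].
 have [e e1 ->] := E i j id jd.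
 have HT: `|T i j / 2 ^+ l| <= M + (m + d%:R + 3).
  rewrite normrM normfV (gtr0_norm l0) ler_pdivrMr// /T.
  apply: le_trans (ler_normB _ _) _; rewrite mulrDl [_ * 2 ^+ l]mulrC [(m + _ + _) * _]mulrC; apply: lerD.
   rewrite normrM (ger0_norm (le_trans ler01 a1K)).
   apply: ler_pM=> //; [exact: le_trans ler01 a1K | exact: Mb].
  have h1 := X i id; have h2 := X j jd; rewrite normrM.
  have := sqr_ge0 (`|(en S 0 i.+1)%:~R : K| - `|(en S 0 j.+1)%:~R : K|); rewrite sqrrB !real_normK ?num_real// => h.
  by lra.
 apply: le_trans (ler_normD _ _) _; apply: (@le_trans _ _ (M + (m + d%:R + 3) + 1 + (d%:R + 2))); last by lra.
 apply: lerD; first by apply: le_trans (ler_normD _ _) _; apply: lerD.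
 by rewrite normrM ger0_norm ?ler0n// ger0_norm ?addr_ge0 ?ler0n//; case: (i == j)=> /=; lra.
have [e e1 ->] := E i i id id; rewrite eqxx mul1r.
have : T i i / 2 ^+ l <= m.
 rewrite ler_pdivrMr// /T -expr2; have := sqr_ge0 ((en S 0 i.+1)%:~R : K).
 have : a*(en S i.+1 i.+1)%:~R <= m*2 ^+ l.
  by rewrite mulrC; apply: ler_pM=> //; [rewrite ler0z dg | exact: le_trans ler01 a1K | exact: mb].
 by lra.
by have := ler_norm e; lra.
Qed.
Lemma psd_elim S : S != [::] -> psd w S = ext1 w S (psd w (elim1 w S)).
case ES : S=>[|r S0]// _; rewrite -ES /psd size_elim1.
have -> : size S = (size S).-1.+1 by rewrite ES.
rewrite /mkseq -[iota 0 _.+1]/(0 :: iota (1 + 0) _) iotaDl map_cons -map_comp; congr (ext1 w S (foldr _ _ _)).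
by apply: eq_map=> i; rewrite -iterSr.
Qed.
Lemma elim1_sym d S : size S = d.+1 -> (forall i j, (i <= d)%N -> (j <= d)%N -> en S i j = en S j i) ->
 forall i j, (i < d)%N -> (j < d)%N -> en (elim1 w S) i j = en (elim1 w S) j i.
move=> Sd sy i j id jd; rewrite /elim1 Sd !en_mx// sy// [en S 0 i.+1 * _]mulrC eq_sym.
by [].
Qed.
(** A returned vector is an exact certificate, because the diagonal correction [d + 2] exceeds the
    rounding error, of norm at most [d]. An empty answer loses a factor 4 per elimination: 2 because
    the power of two dividing the entries may be twice the pivot, and 2 to absorb the correction.
    The bounds on entries are assumed only for a nonnegative diagonal, the only case in which
    elimination continues. *)
Lemma psd_spec d S (M m : K) : size S = d -> (d <= d0)%N -> 0 <= W ->
 (forall i j, (i < d)%N -> (j < d)%N -> en S i j = en S j i) ->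
 ((forall i, (i < d)%N -> 0 <= en S i i) ->
  (forall i j, (i < d)%N -> (j < d)%N -> `|(en S i j)%:~R| <= M :> K) /\ (forall i, (i < d)%N -> (en S i i)%:~R <= m :> K)) ->
 M + d%:R * (m + 2 * d0%:R + 8) + d%:R ^+ 2 * (d0%:R + 3) <= W ->
 let v := psd w S in
 (v != [::] -> [/\ size v = d, forall j, `|(nth 0 v j)%:~R| <= ((W + 1) * (d0%:R + 1)) ^+ d
   & qf d (fun i j => (en S i j)%:~R) (fun j => (nth 0 v j)%:~R) < 0]) /\
 (v = [::] -> forall x, - (8 * 4 ^+ d) * nr d x <= qf d (fun i j => (en S i j)%:~R) x).
move=> Sd dd0 W0; elim: d S M m Sd dd0=>[|d IH] S M m Sd dd0 sy bnd MW v.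
 have -> : v = [::] by rewrite /v /psd Sd.
 by split=>// _ x; rewrite /qf /nr !big_ord0 mulr0.
have Ev: v = ext1 w S (psd w (elim1 w S)) by apply: psd_elim; case: (S) Sd.
have d0K: 0 <= d%:R :> K by apply: ler0n.
have dK: d%:R + 1 <= d0%:R :> K by rewrite natr1 ler_nat.
have B1: 1 <= (W + 1)*(d0%:R + 1).
 have := mulr_ge0 W0 (ler0n K d0); rewrite mulrDl mulrDr; lra.
have Bw n: (n <= d0)%N -> ((W + 1)*(d0%:R + 1)) ^+ n < 2 ^+ w.
 by move=> nd; apply: le_lt_trans w2; rewrite ler_weXn2l.
rewrite {}Ev /ext1 Sd; case: ifP=> negs.
 have dg i: (i <= d)%N -> 0 <= en S i i.
  move=> id; case: (ltP (en S i i) 0)=> // h.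
  have : i \in [seq i <- iota 0 d.+1 | en S i i < 0] by rewrite mem_filter h mem_iota.
  by move/eqP/size0nil: negs=> ->.
 have [Mb mb] := bnd dg.
 have M0: 0 <= M by apply: le_trans (Mb 0%N 0%N isT isT).
 have m0: 0 <= m by apply: le_trans (mb 0%N isT); rewrite ler0z dg.
 have P1: 0 <= d%:R * m by apply: mulr_ge0.
 have P2: 0 <= d%:R*d0%:R :> K by apply: mulr_ge0.
 have P3: 0 <= d%:R ^+ 2*d0%:R :> K by rewrite mulr_ge0 ?sqr_ge0.
 have P4: d%:R ^+ 2 <= d%:R*d0%:R :> K by rewrite expr2 ler_wpM2l//; lra.
 have P5: 0 <= d%:R ^+ 2 :> K by rewrite sqr_ge0.
 rewrite -natr1 in MW.
 have MW1: M <= W by move: MW; rewrite sqrrD !mulrDl !mulrDr; lra.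
 have mW1: m <= W by move: MW; rewrite sqrrD !mulrDl !mulrDr; lra.
 have [a1 al la E] := elim1_spec Sd dd0 MW1 mW1 sy dg Mb mb.
 set a := (_ + _)%:~R in a1 al la E; set l := zlen _ in al la E.
 move=> bnd'.
 have/= := IH (elim1 w S) (M + m + 2*d%:R + 6) (m + d%:R + 3) _ (ltnW dd0) (elim1_sym Sd sy) bnd' _.
 rewrite size_elim1 Sd; case=>//.
  by move: MW; rewrite !sqrrD !mulrDl !mulrDr; lra.
 set v' := psd w _; move=> H1 H2.
 have a0: 0 < a by lra.
 have l0: 0 < 2 ^+ l :> K by rewrite exprn_gt0.
 pose Tf i j : K := a*(en S i.+1 j.+1)%:~R - (en S 0 i.+1)%:~R*(en S 0 j.+1)%:~R.
 have sch x: a*(qf d.+1 (fun i j=> (en S i j)%:~R) x + x 0%N ^+ 2) =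
   (a*x 0%N + \sum_(j < d) (en S 0 j.+1)%:~R*x j.+1) ^+ 2 + qf d Tf (fun i=> x i.+1).
  have := @qf_schur d (fun i j=> (en S i j)%:~R) x _.
  have -> : a = (en S 0 0)%:~R + 1 by rewrite /a intrD.
  by move=> ->; [rewrite /Tf /a intrD | move=> i j ? ?; rewrite sy].
 have err x: `|qf d Tf x - 2 ^+ l*(qf d (fun i j=> (en (elim1 w S) i j)%:~R) x - (d%:R + 2)*nr d x)| <= 2 ^+ l*d%:R*nr d x.
  rewrite (_ : _ - _ = qf d (fun i j=> Tf i j - 2 ^+ l*((en (elim1 w S) i j)%:~R - (i == j)%:R*(d%:R + 2))) x).
   apply: qf_pert=> i j id jd; have [e e1 ->] := E i j id jd.
   rewrite [X in `|X|](_ : _ = - (2 ^+ l*e)); first by rewrite normrN normrM (gtr0_norm l0) ger_pMr.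
   by rewrite /Tf; field; rewrite gt_eqF.
  have -> : (d%:R + 2)*nr d x = \sum_(i < d) \sum_(j < d) x i*((i == j :> nat)%:R*(d%:R + 2))*x j.
   rewrite /nr mulr_sumr; apply: eq_bigr=> i _; rewrite (bigD1 i)//= eqxx big1 ?addr0/=; first by ring.
   by move=> j ji; rewrite -(inj_eq val_inj) eq_sym in ji; rewrite (negbTE ji) !(mul0r, mulr0).
  rewrite /qf -sumrB mulr_sumr -sumrB; apply: eq_bigr=> i _.
  rewrite -sumrB mulr_sumr -sumrB; apply: eq_bigr=> j _; ring.
 case: ifP=> v0.
  have v'0: v' = [::] by apply: size0nil; apply/eqP.
  split=>// _ x; have N0 := nr_ge0 d (fun i=> x i.+1).
  have Q := H2 v'0 (fun i=> x i.+1); have := err (fun i=> x i.+1).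
  rewrite ler_norml=>/andP[h _].
  set q' := qf d _ _ in Q h; set n' := nr d _ in N0 Q h.
  have nrS: nr d.+1 x = x 0%N ^+ 2 + n' by rewrite /nr big_ord_recl.
  set q := qf d.+1 _ _.
  have h2: qf d Tf (fun i=> x i.+1) >= - (2*a*((8*4 ^+ d + 2*d%:R + 2)*n')).
   have h3: 2 ^+ l*(- (8*4 ^+ d)*n') <= 2 ^+ l * q' by rewrite ler_pM2l.
   have h4: 2 ^+ l*((8*4 ^+ d + 2*d%:R + 2)*n') <= 2*a*((8*4 ^+ d + 2*d%:R + 2)*n').
    rewrite ler_wpM2r// mulr_ge0// !addr_ge0 ?mulr_ge0 ?exprn_ge0//.
   by move: h h4; rewrite !mulrBr !mulrDl !mulrDr !mulNr ?mulrN in h3 *; clear -h3; lra.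
  have := sch x; have := sqr_ge0 (a*x 0%N + \sum_(j < d) (en S 0 j.+1)%:~R*x j.+1).
  move: (_ ^+ 2)=> s s0 Es.
  have h5: a*(- (2*((8*4 ^+ d + 2*d%:R + 2)*n'))) <= a*(q + x 0%N ^+ 2) by rewrite Es; clear -s0 h2; lra.
  rewrite ler_pM2l// in h5; rewrite nrS exprS.
  have dp: d%:R + 1 <= 4 ^+ d :> K.
   by rewrite natr1 -natrX ler_nat; apply: ltn_expl.
  have h6: (d%:R + 1)*n' <= 4 ^+ d*n' by rewrite ler_wpM2r.
  have h7: 0 <= 4 ^+ d*x 0%N ^+ 2 by rewrite mulr_ge0 ?sqr_ge0 ?exprn_ge0.
  have h8: x 0%N ^+ 2 <= 4 ^+ d*x 0%N ^+ 2 by rewrite ler_peMl ?sqr_ge0//; lra.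
  have h9: 0 <= 4 ^+ d*n' by rewrite mulr_ge0 ?exprn_ge0.
  by move: h5 h6; rewrite !mulNr !mulrDr !mulrDl; clear -h7 h8 h9 N0; lra.
 have v'0: v' != [::] by case: (v') v0.
 have {H1 H2} [sv bv qv] := H1 v'0.
 set B := _ ^+ d in bv; have B0: 1 <= B by rewrite exprn_ege1.
 have aW: a <= W + 1.
  by rewrite /a intrD lerD2r; apply: le_trans MW1; apply: le_trans (Mb 0%N 0%N isT isT); apply: ler_norm.
 set s := \sum_(j <- _) _; rewrite/= in s *.
 have Es: s%:~R = \sum_(j < d) (en S 0 j.+1)%:~R*(nth 0 v' j)%:~R :> K.
  rewrite /s rmorph_sum -(big_mkord xpredT (fun j=> (en S 0 j.+1)%:~R*(nth 0 v' j)%:~R)) /index_iota subn0.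
  by apply: eq_bigr=> j _; exact: intrM.
 have bs: `|s%:~R| <= (W + 1)*(d0%:R + 1)*B :> K.
  rewrite Es; apply: le_trans (ler_norm_sum _ _ _) _; apply: (@le_trans _ _ (\sum_(j < d) W*B)).
   apply: ler_sum=> j _; rewrite normrM; apply: ler_pM=> //; (exact: le_trans (Mb 0%N j.+1 isT (ltn_ord j)) MW1) || exact: bv.
  rewrite sumr_const card_ord -mulr_natl; have := mulr_ge0 W0 (le_trans ler01 B0)=> h.
  have h1: d%:R*(W*B) <= d0%:R*(W*B) by rewrite ler_wpM2r//; lra.
  have h2: 0 <= d0%:R*B by rewrite mulr_ge0 ?ler0n//; lra.
  by rewrite !mulrDl !mulrDr !mulrDl; lra.
 have ba j: `|(a*(nth 0 v' j)%:~R)| <= (W + 1)*(d0%:R + 1)*B :> K.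
  rewrite normrM gtr0_norm//; apply: ler_pM=> //; first exact: ltW.
  by apply: le_trans aW _; rewrite ler_peMr//; lra.
 have lt1 z: `|z%:~R| <= (W + 1)*(d0%:R + 1)*B :> K -> clampz w z = z.
  move=> h; apply: clampz_id; apply: le_lt_trans h _; rewrite /B -exprS; exact: Bw.
 rewrite lt1; last by rewrite rmorphN normrN.
 set vv := _ :: mkseq _ _.
 have vS j: (j < d)%N -> (nth 0 vv j.+1)%:~R = a*(nth 0 v' j)%:~R :> K.
  move=> jd; rewrite/= nth_mkseq// lt1; first by rewrite intrM.
  by rewrite intrM -/a.
 split=>// _; split; first by rewrite/= size_mkseq.
  case=> [|j]; first by rewrite/= rmorphN normrN exprS.
  case: (ltnP j d)=> jd; first by rewrite vS// exprS.
  rewrite nth_default ?normr0 ?exprn_ge0//; last by rewrite/= size_mkseq ltnS.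
  by rewrite (le_trans ler01).
 have := sch (fun j=> (nth 0 vv j)%:~R); have -> : qf d Tf (fun i=> (nth 0 vv i.+1)%:~R) = a ^+ 2 * qf d Tf (fun i=> (nth 0 v' i)%:~R).
  rewrite /qf mulr_sumr; apply: eq_bigr=> i _; rewrite mulr_sumr; apply: eq_bigr=> j _; rewrite !vS//; ring.
 have -> : a*(nth 0 vv 0%N)%:~R + \sum_(j < d) (en S 0 j.+1)%:~R*(nth 0 vv j.+1)%:~R = 0.
  rewrite [nth 0 vv 0%N]/(- s) rmorphN/= Es mulrN mulr_sumr addrC; apply/eqP; rewrite subr_eq0; apply/eqP; apply: eq_bigr=> j _.
  by have := vS j (ltn_ord j); rewrite/= => ->; ring.
 rewrite expr0n add0r; set q := qf d.+1 _ _; set q' := qf d Tf _=> Eq.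
 have q'0: q' < 0.
  have := err (fun j=> (nth 0 v' j)%:~R); rewrite -/q' ler_norml=>/andP[_ h].
  set n' := nr d _ in h; have n0: 0 <= n' by apply: nr_ge0.
  have h1: 2 ^+ l * qf d (fun i j=> (en (elim1 w S) i j)%:~R) (fun j=> (nth 0 v' j)%:~R) < 0 by rewrite pmulr_rlt0.
  have h2: 0 <= 2 ^+ l*n' by rewrite mulr_ge0// ltW.
  by move: h; rewrite !mulrBr !mulrDl !mulrDr; lra.
 have h: a*(q + (nth 0 vv 0%N)%:~R ^+ 2) < 0 by rewrite Eq pmulr_rlt0// exprn_gt0.
 rewrite pmulr_rlt0// in h; have := sqr_ge0 ((nth 0 vv 0%N)%:~R : K); lra.
set negl := filter _ _ in negs *; pose k := head 0%N negl.
have kin: k \in negl by rewrite /k; case: (negl) negs=> //= ? ? _; rewrite inE eqxx.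
have [kd kneg] : (k < d.+1)%N /\ en S k k < 0 by move: kin; rewrite mem_filter mem_iota=>/andP[].
rewrite -/k; set vv := mkseq _ _.
have Ev j: (j < d.+1)%N -> (nth 0 vv j)%:~R = (j == k)%:R :> K by move=> jd; rewrite nth_mkseq//; case: eqP.
split; last by move/(congr1 size); rewrite size_mkseq.
move=> _; split; first by rewrite size_mkseq.
 move=> j; case: (ltnP j d.+1)=> jd; first by rewrite Ev// normr_nat; apply: (@le_trans _ _ 1); [case: eqP | rewrite exprn_ege1].
 by rewrite nth_default ?normr0 ?exprn_ge0 ?size_mkseq// (le_trans ler01).
rewrite /qf (bigD1 (Ordinal kd))//= [X in _ + X]big1 ?addr0=>[|i ik]; last first.
 apply: big1=> j _; rewrite Ev//; move: ik; rewrite -(inj_eq val_inj)=>/negbTE/= ->; by rewrite !mul0r.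
rewrite (bigD1 (Ordinal kd))//= [X in _ + X]big1 ?addr0=>[|i ik]; last first.
 rewrite (Ev i)//; move: ik; rewrite -(inj_eq val_inj)=>/negbTE/= ->; by rewrite mulr0.
by rewrite !Ev// eqxx mul1r mulr1 ltrz0.
Qed.
End Correct.

(** * The shrinking simplex method *)

Definition zsum n (f : nat -> int) : int := \sum_(i <- iota 0 n) f i.
Definition quad d A (v : seq int) := zsum d (fun i => zsum d (fun j => nth 0 v i * en A i j * nth 0 v j)).
Definition absi (z : int) : int := if z < 0 then - z else z.
(** Floor division by counting multiples: the quotient lies between [- D0] and [D0], and [D0] is
    polynomial in the number of vertices. *)
Definition flr D0 (b a : int) : int :=
 Posz (size [seq c <- iota 1 (2 * D0) | Posz c * a <= b + Posz D0 * a]) - Posz D0.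
(** The sum of all vertices stands for the centroid in homogeneous coordinates. The factor [2 ^+ b]
    is meant to outweigh the inaccuracy [8 * 4 ^+ d] of [psd]. *)
Definition combo d N F b V := mx d d (fun i j =>
 2 ^+ b * zsum N (fun l => zsum N (fun k => en V k l) * en (nth [::] F l) i j)).
(** Entry [j] is minus the value of the violated constraint at vertex [j]: a feasible point is a
    combination of the vertices with nonpositive total, whereas the plain sum, belonging to the
    centroid, is positive. *)
Definition cuts d N F V v := mkseq (fun j => - zsum N (fun l => en V j l * quad d (nth [::] F l) v)) N.
Definition argmin (h : seq int) := head 0%N [seq k <- iota 0 (size h) | all (fun j => nth 0 h k <= nth 0 h j) (iota 0 (size h))].
(** A cut contributes at least [1 / (N ^ 2 * TT)] to the sum of the relative shifts, and must beat
    the errors [2 / TT ^ 2 + 1 / DD] made at each vertex; the values of [DD] and [TT] leave the gain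
    [1 / (16 * N ^ 5)]. *)
Definition DD N := (32 * N ^ 6)%N.
Definition TT N := (8 * N ^ 3)%N.
(** The quotient of shift [j] by [DD] approximates [h_j / (TT * H + h_j)]: a violating vertex is
    pulled towards the most feasible one and a satisfied vertex is pushed away from it, only
    slightly since [TT] dominates. *)
Definition shifts N (h : seq int) := let H := zsum N (fun j => absi (nth 0 h j)) in
 mkseq (fun j => if j == argmin h then 0 else flr (DD N) (Posz (DD N) * nth 0 h j) (Posz (TT N) * H + nth 0 h j)) N.
(* The shrinking simplex method of Yamnitsky and Levin; the rows of V are the vertices in
  homogeneous coordinates. *)
Definition shrink N ww V h := let c := shifts N h in
 mx N N (fun j i => clampz ww ((Posz (DD N) - nth 0 c j) * en V j i + nth 0 c j * en V (argmin h) i)).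
Definition sstep d N F b w ww V := let v := psd w (combo d N F b V) in
 if size v == 0%N then V else shrink N ww V (cuts d N F V v).
(** The homogenising coordinate is the last one. The simplex contains the cube of half-side 2 around
    0, hence a solution with coordinates at most 1 together with a small simplex at it. *)
Definition simplex0 N := mx N N (fun j i => if i == N.-1 then 1 else if i == j then Posz (4 * N) - 2 else - 2).
Lemma zsumE (K : pzRingType) n f : (zsum n f)%:~R = \sum_(i < n) (f i)%:~R :> K.
by rewrite rmorph_sum -(big_mkord xpredT (fun i=> (f i)%:~R)) /index_iota subn0. Qed.
Lemma zsum_int n f : zsum n f = \sum_(i < n) f i.
by rewrite -(big_mkord xpredT f) /index_iota subn0. Qed.
Lemma absiE z : absi z = `|z|. by rewrite /absi; case: ltP=> h; [rewrite ltr0_norm | rewrite ger0_norm]. Qed.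
Lemma flrP D0 (a b : int) : 0 < a -> - (Posz D0 * a) <= b -> b < Posz D0 * a ->
 [/\ flr D0 b a * a <= b, b < (flr D0 b a + 1) * a & `|flr D0 b a| <= Posz D0].
move=> a0 b1 b2; rewrite /flr; set e := b + _; have e0: 0 <= e by lia.
have G n: let F := size [seq c <- iota 1 n | Posz c*a <= e] in
  Posz F*a <= e /\ (F <= n)%N /\ (e < (Posz F + 1)*a \/ F = n).
 elim: n=>[|n [i1 [i2 i3]]]; first by rewrite/= mul0r; split=>//; split=>//; right.
 have -> : iota 1 n.+1 = iota 1 n ++ [:: n.+1] by rewrite -[n.+1]addn1 iotaD addn1.
 rewrite filter_cat size_cat/=.
 case: ifP=> /= H; rewrite ?addn1 ?addn0; last by split=>//; split; [lia | case: i3=>[->|i3]; [left | lia]].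
 have En: size [seq c <- iota 1 n | Posz c*a <= e] = n by nia.
 by rewrite En; split=>//; split; [ | right].
have/= [g1 [g2 g3]] := G (2*D0); set F := size _ in g1 g2 g3 *.
have g3': e < (Posz F + 1)*a by nia.
by split; [rewrite mulrBl lerBlDr | rewrite addrAC mulrBl ltrBrDr | lia].
Qed.
Lemma argminP h : (0 < size h)%N -> (argmin h < size h)%N /\ forall j, (j < size h)%N -> nth 0 h (argmin h) <= nth 0 h j.
move=> h0; rewrite /argmin; set s := filter _ _.
have [k ks] : exists k, k \in s.
 have [k _ kP] := arg_minP (fun i : 'I_(size h)=> nth 0 h i) (P := xpredT) (i0 := Ordinal h0) isT.
 exists (val k); rewrite mem_filter mem_iota/= ltn_ord andbT; apply/allP=> j; rewrite mem_iota=> jh.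
 exact: (kP (Ordinal jh)).
have : head 0 s \in s by case: (s) ks=> //= x l _; rewrite inE eqxx.
rewrite mem_filter mem_iota=>/andP[/allP m1 m2]; split=>// j jh; apply: m1; rewrite mem_iota//.
Qed.
Lemma bern (K : realFieldType) (x : K) m : 0 <= x -> 1 + m%:R * x <= (1 + x) ^+ m.
move=> x0; elim: m=>[|m IH]; first by rewrite mul0r addr0.
rewrite exprS; have : 0 <= m%:R*x*x by rewrite mulr_ge0// mulr_ge0.
have : (1 + x)*(1 + m%:R*x) <= (1 + x)*(1 + x) ^+ m by rewrite ler_wpM2l; lra.
lra.
Qed.
Section Shrink.
Variable K : realFieldType.
Variables (n : nat) (h : seq int).
Hypothesis n0 : (0 < n)%N.
Let N := n.+1.
Hypotheses (sh : size h = N) (hpos : 0 < zsum N (fun j => nth 0 h j)).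
Let k := argmin h.
Let H := zsum N (fun j => absi (nth 0 h j)).
Let c j := nth 0 (shifts N h) j.
Let T := Posz (TT N).
Let D0 := Posz (DD N).
Lemma k_ltN : (k < N)%N. by have [] := @argminP h; rewrite sh. Qed.
Lemma k_min j : (j < N)%N -> nth 0 h k <= nth 0 h j.
by have [] := @argminP h; rewrite sh// => _ m jN; apply: m. Qed.
Lemma shift_k : c k = 0. by rewrite /c nth_mkseq ?k_ltN// eqxx. Qed.
Lemma H_gt0 : 0 < H.
apply: lt_le_trans hpos _; apply: ler_sum=> j _; rewrite absiE; exact: ler_norm.
Qed.
Lemma h_le j : (j < N)%N -> `|nth 0 h j| <= H.
move=> jN; rewrite /H zsum_int (bigD1 (Ordinal jN))//= absiE lerDl; apply: sumr_ge0=> i _; by rewrite absiE.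
Qed.
Lemma TN : 8 <= T /\ 32 <= D0.
split; rewrite lez_nat leq_pmulr//. Qed.
Lemma shiftP j : (j < N)%N -> j != k ->
 [/\ 0 < T * H + nth 0 h j, c j * (T * H + nth 0 h j) <= D0 * nth 0 h j, D0 * nth 0 h j < (c j + 1) * (T * H + nth 0 h j) & `|c j| <= D0].
move=> jN jk; have := h_le jN; have := H_gt0; have [T8 D8] := TN=> H0; rewrite ler_norml=>/andP[h1 h2].
have a0: 0 < T*H + nth 0 h j by nia.
have [||e1 e2 e3] := @flrP (DD N) (T*H + nth 0 h j) (D0*nth 0 h j) a0; first 2 last.
- by rewrite /c nth_mkseq// (negbTE jk).
- by rewrite -mulrN ler_pM2l; nia.
- nia.
Qed.
(** The entries have a positive sum and [k] is a minimum, so each entry is at most [N] times the sum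
    over the indices other than [k], in absolute value. *)
Lemma sum_h : H <= (N ^ 2)%:Z * \sum_(j < N | j != k :> nat) nth 0 h j.
set X := \sum_(_ < _ | _) _; have kN := k_ltN.
have hp: - nth 0 h k < X.
 move: hpos; rewrite zsum_int (bigD1 (Ordinal kN))//= -ltrBlDl sub0r; congr (_ < _).
have hX j: (j < N)%N -> `|nth 0 h j| <= Posz N*X.
 have main i: (i < N)%N -> i != k -> `|nth 0 h i| <= Posz n*X /\ nth 0 h k <= Posz n*X.
  move=> iN ik; have mi := k_min iN.
  have hi: nth 0 h i + (Posz n - 1)*nth 0 h k <= X.
   rewrite /X (bigD1 (Ordinal iN))//= lerD2l.
   apply: (@le_trans _ _ (\sum_(j < N | (j != k :> nat) && (j != Ordinal iN)) nth 0 h k)).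
    rewrite sumr_const -mulr_natl (_ : #|_| = n.-1); first by rewrite (_ : n.-1%:R = Posz n - 1)//; lia.
    have -> : #|[pred j : 'I_N | (j != k :> nat) && (j != Ordinal iN)]| = #|~: [set Ordinal kN; Ordinal iN]|.
     by apply: eq_card=> q; rewrite !inE negb_or.
    by rewrite cardsCs setCK card_ord cards2 eq_sym ik subSS subn1.
   by apply: ler_sum=> q _; apply: k_min.
  nia.
 move=> jN; have X0: 0 <= X.
  case: (leP 0 (nth 0 h k))=> hk; last by lia.
  by apply: sumr_ge0=> i _; apply: le_trans hk (k_min _).
 case: (eqVneq j k)=>[->|jk]; last by have [] := main j jN jk; lia.
 have [i [iN ik]] : exists i, (i < N)%N /\ i != k.
  by case: (eqVneq k 0)=> k0; [exists 1 | exists 0]; rewrite ?k0 eq_sym.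
 have [_ m2] := main i iN ik; have : 0 <= (Posz n - 1)*X by rewrite mulr_ge0; lia.
 nia.
rewrite /H zsum_int; apply: (@le_trans _ _ (\sum_(j < N) Posz N*X)).
 by apply: ler_sum=> j _; rewrite absiE hX.
by rewrite sumr_const card_ord -mulr_natl natz mulrA.
Qed.
(** The function [u / (1 + u)] is expanded to second order at [u = h / (T * H)], of absolute value
    at most [1 / T]; the linear terms add up to at least [1 / (N ^ 2 * T)], up to the missing
    nonpositive corrections, by [sum_h]. *)
Lemma sum_shift : (16 * N ^ 5)%N%:R^-1 <= \sum_(j < N | j != k :> nat) (c j)%:~R / D0%:~R :> K.
have H0: 0 < H%:~R :> K by rewrite ltr0z H_gt0.
have NK: 1 <= N%:R :> K by rewrite ler1n.
have T0: T%:~R = 8*N%:R ^+ 3 :> K by rewrite /T -pmulrn natrM natrX.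
have D00: D0%:~R = 32*N%:R ^+ 6 :> K by rewrite /D0 -pmulrn natrM natrX.
have T1: 8 <= T%:~R :> K by rewrite T0 ler_peMr// exprn_ege1.
have D1: 0 < D0%:~R :> K by rewrite D00 mulr_gt0// exprn_gt0// lt_le_trans.
pose u j : K := (nth 0 h j)%:~R / (T%:~R*H%:~R).
have TH0: 0 < T%:~R*H%:~R :> K by rewrite mulr_gt0//; lra.
have ub j: (j < N)%N -> `|u j| <= T%:~R^-1.
 move=> jN; rewrite /u normrM normfV (gtr0_norm TH0) ler_pdivrMr// mulrA mulVf ?mul1r; last by lra.
 by rewrite -intr_norm ler_int h_le.
have zb j: (j < N)%N -> j != k -> u j - 2*T%:~R^-1 ^+ 2 - D0%:~R^-1 <= (c j)%:~R / D0%:~R.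
 move=> jN jk; have [a0 _ + _] := shiftP jN jk; rewrite -(ltr0z K) intrD intrM in a0.
 rewrite -(ltr_int K) !intrM !intrD !intrM=> lt2.
 rewrite lerBlDr -[X in _ <= _ + X]mul1r -mulrDl ler_pdivlMr//.
 have eh: (nth 0 h j)%:~R = u j*(T%:~R*H%:~R) by rewrite /u divfK// gt_eqF.
 rewrite eh in a0 lt2.
 have a1: 0 < 1 + u j by move: a0; rewrite -[X in X + _]mul1r -mulrDl pmulr_lgt0.
 have lt3: D0%:~R*u j < ((c j)%:~R + 1)*(1 + u j).
  rewrite -(ltr_pM2r TH0); apply: le_lt_trans (lt_le_trans lt2 _); rewrite le_eqVlt; apply/orP; left; apply/eqP; ring.
 apply: ltW; rewrite -(ltr_pM2r a1); apply: le_lt_trans lt3; rewrite mulrAC [X in _ <= X]mulrC ler_pM2r//.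
 have := ub j jN; set t := T%:~R^-1=> ut.
 have t8: t <= 1 / 8 by rewrite /t div1r lef_pV2// posrE; lra.
 have u2: u j ^+ 2 <= t ^+ 2 by rewrite -(real_normK (num_real (u j))) ler_sqr ?nnegrE// (le_trans _ ut).
 move: ut; rewrite ler_norml=>/andP[t1 t2].
 have h1: (t ^+ 2 - u j ^+ 2)*(1 + 2*u j) >= 0 by rewrite mulr_ge0; lra.
 by move: h1; rewrite !expr2=> h1; nra.
apply: (@le_trans _ _ (\sum_(j < N | j != k :> nat) (u j - 2*T%:~R^-1 ^+ 2 - D0%:~R^-1))); last by apply: ler_sum=> j jk; apply: zb.
have -> : \sum_(j < N | j != k :> nat) (u j - 2*T%:~R^-1 ^+ 2 - D0%:~R^-1) = (\sum_(j < N | j != k :> nat) nth 0 h j)%:~R / (T%:~R*H%:~R) - (2*T%:~R^-1 ^+ 2 + D0%:~R^-1) *+ n.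
 rewrite (eq_bigr (fun j : 'I_N => u j - (2*T%:~R^-1 ^+ 2 + D0%:~R^-1))); last by move=> j _; rewrite opprD addrA.
 rewrite sumrB -mulr_suml [in RHS]rmorph_sum; congr (_ - _).
 rewrite sumr_const; congr (_ *+ _).
 transitivity #|predC1 (Ordinal k_ltN)|; last by rewrite cardC1 card_ord.
 by [].
have sX: 1 <= N%:R ^+ 2*((\sum_(j < N | j != k :> nat) nth 0 h j)%:~R / H%:~R) :> K.
 rewrite mulrA ler_pdivlMr// mul1r -natrX pmulrn -intrM ler_int; exact: sum_h.
set x := _ / _ in sX.
have -> : (\sum_(j < N | j != k :> nat) nth 0 h j)%:~R / (T%:~R*H%:~R) = x / T%:~R.
 by rewrite /x; lra.
rewrite T0 D00 natrM natrX; set y := N%:R in NK sX *.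
have y0: y != 0 by lra.
have nN: n%:R <= y by rewrite ler_nat.
set i := y^-1; have iy: i*y = 1 by rewrite mulVf.
have i0: 0 < i by rewrite invr_gt0.
have xi: i ^+ 2 <= x.
 by rewrite -(ler_pM2l (_ : 0 < y ^+ 2)) ?exprn_gt0// -exprMn mulrC iy expr1n.
have ni: n%:R * i <= 1 by rewrite -[X in _ <= X]iy mulrC ler_pM2l.
rewrite (_ : (16*y ^+ 5)^-1 = i ^+ 5 / 16); last by rewrite /i; field.
rewrite (_ : (8*y ^+ 3)^-1 = i ^+ 3 / 8); last by rewrite /i; field.
rewrite (_ : (32*y ^+ 6)^-1 = i ^+ 6 / 32); last by rewrite /i; field.
have h1: i ^+ 5 <= x * i ^+ 3 by rewrite -[5%N]/(2 + 3)%N exprD ler_pM2r// exprn_gt0.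
have h2: n%:R * i ^+ 6 <= i ^+ 5 by rewrite exprS mulrA ler_piMl// exprn_ge0// ltW.
lra.
Qed.
Lemma shift_lt j : (j < N)%N -> j != k -> c j < D0.
move=> jN jk; have [a0 c1 _ _] := shiftP jN jk; have H0 := H_gt0; have [T8 D8] := TN.
rewrite ltNge; apply/negP=> h1; have h2: D0*(T*H + nth 0 h j) <= c j*(T*H + nth 0 h j) by rewrite ler_pM2r.
lia.
Qed.
Let V' (V : nat -> nat -> int) j i := (D0 - c j) * V j i + c j * V k i.
(** An old vertex is a combination of its replacement and of vertex [k], so rewriting a point
    changes the weights by moving mass off [k]. The weight left on [k] is nonnegative because the
    point satisfies the cut. *)
Lemma shrink_hull (V : nat -> nat -> int) (y l : nat -> K) (Q : K) :
 (forall j, (j < N)%N -> 0 <= l j) -> (forall i, (i < N)%N -> y i * Q = \sum_(j < N) l j * (V j i)%:~R) ->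
 \sum_(j < N) l j * (nth 0 h j)%:~R <= 0 ->
 exists2 l' : nat -> K, (forall j, (j < N)%N -> 0 <= l' j) &
  (forall i, (i < N)%N -> y i * (D0%:~R * Q) = \sum_(j < N) l' j * (V' V j i)%:~R).
move=> l0 El lh; have kN := k_ltN; have H0 := H_gt0; have [T8 D8] := TN.
have TH0: 0 < (T*H)%:~R :> K by rewrite ltr0z; lia.
have cD j: (j < N)%N -> j != k -> 0 < D0%:~R - (c j)%:~R :> K.
 by move=> jN jk; rewrite subr_gt0 ltr_int shift_lt.
pose sk := \sum_(j < N | j != k :> nat) l j*((c j)%:~R / (D0%:~R - (c j)%:~R)).
have bigk (f : nat -> K) : \sum_(j < N) f j = f k + \sum_(j < N | j != k :> nat) f j.
 by rewrite (bigD1 (Ordinal kN)).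
have sk1: sk <= l k.
 apply: (@le_trans _ _ (\sum_(j < N | j != k :> nat) l j*((nth 0 h j)%:~R / (T*H)%:~R))).
  apply: ler_sum=> j jk; apply: ler_wpM2l; first exact: l0.
  have [a0 c1 _ _] := shiftP (ltn_ord j) jk.
  rewrite ler_pdivrMr ?cD// mulrAC ler_pdivlMr// -intrB -!intrM ler_int; lia.
 under eq_bigr do rewrite mulrA.
 rewrite -mulr_suml ler_pdivrMr//; rewrite (bigk (fun j=> l j*(nth 0 h j)%:~R)) in lh.
 have := h_le kN; rewrite ler_norml=>/andP[hk _]; rewrite -(ler_int K) in hk.
 have h1 := ler_wpM2l (l0 _ kN) hk.
 have h2: l k*H%:~R <= l k*(T*H)%:~R by apply: ler_wpM2l; [exact: l0 | rewrite ler_int ler_peMl; lia].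
 lra.
exists (fun j=> if j == k then l k - sk else l j*(D0%:~R / (D0%:~R - (c j)%:~R))).
 move=> j jN; case: eqP=>[_|/eqP jk]; first by rewrite subr_ge0.
 by rewrite mulr_ge0 ?l0// divr_ge0 ?ltW// cD.
move=> i iN; rewrite mulrCA El// mulr_sumr (bigk (fun j=> D0%:~R*(l j*(V j i)%:~R))).
rewrite [RHS](bigD1 (Ordinal kN))//= [X in _ = _ + X](eq_bigl (fun j : 'I_N => j != k :> nat))// eqxx /V' [X in _ = _ + X](eq_bigr (fun j : 'I_N => D0%:~R*(l j*(V j i)%:~R) + D0%:~R*(V k i)%:~R*(l j*((c j)%:~R / (D0%:~R - (c j)%:~R))))); last first.
 move=> j jk; rewrite (negbTE jk) ; have := cD j (ltn_ord j) jk=> cj.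
 by field; rewrite gt_eqF.
by rewrite big_split -[X in _ = _ + (_ + X)]mulr_sumr -/sk; ring.
Qed.
Definition vmx (V : nat -> nat -> int) : 'M[K]_N := \matrix_(j, i) (V j i)%:~R.
Lemma shrink_vol V : `|\det (vmx (V' V))| * (1 + (16 * N ^ 5)%:R^-1) <= D0%:~R ^+ N * `|\det (vmx V)|.
have kN := k_ltN; have H0 := H_gt0; have [T8 D8] := TN; pose k' : 'I_N := Ordinal kN.
have D0K: 0 < D0%:~R :> K by rewrite ltr0z; lia.
pose E : 'M[K]_N := \matrix_(i, j) ((i == j)%:R*(D0%:~R - (c i)%:~R) + (j == k')%:R*(c i)%:~R).
have EV: vmx (V' V) = E *m vmx V.
 apply/matrixP=> i j; rewrite !mxE (eq_bigr (fun q : 'I_N => (i == q)%:R*((D0%:~R - (c i)%:~R)*(V q j)%:~R) + (q == k')%:R*((c i)%:~R*(V q j)%:~R))); last first.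
  by move=> q _; rewrite !mxE; ring.
 rewrite big_split/= (bigD1 i)//= big1 ?addr0; last by move=> q; rewrite eq_sym=>/negbTE ->; rewrite mul0r.
 rewrite (bigD1 k')//= big1 ?addr0; last by move=> q /negbTE ->; rewrite mul0r.
 by rewrite !eqxx !mul1r /V' intrD !intrM intrB.
have detE: \det E = D0%:~R * \prod_(j < n) (D0%:~R - (c (lift k' j))%:~R).
 rewrite (expand_det_row _ k') (bigD1 k')//= big1 ?addr0; last first.
  move=> j jk; rewrite mxE [k' == j]eq_sym (negbTE jk) shift_k !mul0r ?mulr0 ?addr0 ?mul0r//.
 rewrite mxE !eqxx shift_k mulr0 addr0 subr0 mul1r; congr (_ * _).
 rewrite /cofactor addnn -signr_odd odd_double expr0 mul1r (_ : row' k' (col' k' E) = diag_mx (\row_j (D0%:~R - (c (lift k' j))%:~R))); first by rewrite det_diag; apply: eq_bigr=> j _; rewrite mxE.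
 apply/matrixP=> i j; rewrite !mxE (inj_eq lift_inj) [lift k' j == k']eq_sym (negbTE (neq_lift _ _)) mul0r addr0.
 by case: eqP=>[->|_]; rewrite ?mulr1n ?mulr0n ?mul1r ?mul0r.
rewrite EV det_mulmx normrM mulrAC ler_wpM2r//.
have sc: (16*N ^ 5)%N%:R^-1 <= \sum_(j < n) ((c (lift k' j))%:~R / D0%:~R) :> K.
 apply: le_trans sum_shift _; rewrite le_eqVlt; apply/orP; left; apply/eqP.
 rewrite [RHS](_ : _ = \sum_(j < N) (c j)%:~R / D0%:~R); last by rewrite (bigD1_ord k')//= shift_k mul0r add0r.
 by rewrite [RHS](bigD1 k')//= shift_k mul0r add0r; apply: eq_bigl=> j; rewrite -(inj_eq val_inj).
set s := _^-1 in sc *; set z := \sum_(j < n) _ in sc.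
have zj (j : 'I_n) : 0 < D0%:~R - (c (lift k' j))%:~R :> K.
 by rewrite subr_gt0 ltr_int shift_lt// -[k]/(val k') (inj_eq val_inj) eq_sym neq_lift.
rewrite detE normrM (gtr0_norm D0K) ger0_norm; last by apply: prodr_ge0=> j _; rewrite ltW.
rewrite [in X in _ <= X]/N exprS -mulrA ler_pM2l//.
have nK: 0 < n%:R :> K by rewrite ltr0n.
pose x := z / n%:R.
have agm: \prod_(j < n) (D0%:~R - (c (lift k' j))%:~R) <= (D0%:~R*(1 - x)) ^+ n.
 have := @leif_AGM K 'I_n [pred j | true] (fun j=> D0%:~R - (c (lift k' j))%:~R) _.
 case=> [j _|]; first by rewrite ltW.
 rewrite card_ord=> h1 _; apply: le_trans h1 _; rewrite sumrB sumr_const card_ord le_eqVlt; apply/orP; left; apply/eqP; congr (_ ^+ _).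
 by rewrite [X in _ - X](_ : _ = \sum_(j < n) (c (lift k' j))%:~R)// /x /z -mulr_suml -[X in X - _]mulr_natr; field; rewrite !gt_eqF.
have s0: 0 <= s by rewrite invr_ge0.
have x1: x <= 1.
 rewrite /x ler_pdivrMr// mul1r /z -[n in n%:R]card_ord -sumr_const -[X in _ <= X]/(\sum_(j < n) 1).
 by apply: ler_sum=> j _; rewrite ler_pdivrMr// mul1r -subr_ge0 ltW.
have x0: 0 <= x by rewrite /x divr_ge0// (le_trans s0 sc).
apply: (@le_trans _ _ ((D0%:~R*(1 - x)) ^+ n*(1 + x) ^+ n)).
 apply: ler_pM=> //; [by apply: prodr_ge0=> j _; rewrite ltW | lra | ].
 apply: (@le_trans _ _ (1 + z)); first by lra.
 by apply: le_trans (bern n x0); rewrite /x mulrCA divff ?mulr1// gt_eqF.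
rewrite -exprMn -mulrA; apply: lerXn2r; rewrite ?nnegrE.
- by rewrite mulr_ge0 ?(ltW D0K)// mulr_ge0//; lra.
- exact: ltW.
- rewrite ger_pMr//; have := sqr_ge0 x; rewrite expr2 mulrDr !mulrBl; lra.
Qed.
End Shrink.
Definition srun d N F b w ww t := iter t (sstep d N F b w ww) (simplex0 N).
Definition solve d N F b w ww t := let V := srun d N F b w ww t in
 (size (psd w (combo d N F b V)) == 0%N) && (0 < zsum N (fun k => en V k N.-1)).
Section Det.
Variable K : realFieldType.
Lemma norm_det_le m (A : 'M[K]_m) : `|\det A| <= \prod_i \sum_j `|A i j|.
rewrite bigA_distr_bigA; apply: le_trans (ler_norm_sum _ _ _) _.
rewrite (bigID (fun f : {ffun 'I_m -> 'I_m} => injectiveb f)) -[X in X <= _]addr0; apply: lerD; last by apply: sumr_ge0=> f _; apply: prodr_ge0=> i _.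
rewrite (reindex_onto (fun s : 'S_m => val s) (insubd (1%g : 'S_m))); last by move=> f fi; rewrite insubdK.
rewrite le_eqVlt; apply/orP; left; apply/eqP; apply: eq_big=>[s|s _]; first by rewrite valKd eqxx (valP s).
rewrite normrM normr_sign mul1r normr_prod; by rewrite pvalE.
Qed.
(** The rows are the homogeneous coordinates of the corner simplex of side [r] at [x], whose volume
    does not depend on [x]. *)
Lemma det_affine n (x : nat -> K) (r : K) : let N := n.+1 in
 \det (\matrix_(j < N, i < N) (if (i == n :> nat) then 1 else x i + (if i == j then r else 0))) = r ^+ n.
move=> N; pose U : 'M[K]_N := \matrix_(j, i) ((j == i)%:R + ((j != i) && (i == n :> nat))%:R).
pose Z : 'M[K]_N := \matrix_(j, i) (if j == n :> nat then if i == n :> nat then 1 else x i else if i == j then r else 0).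
have E: \matrix_(j < N, i < N) (if (i == n :> nat) then 1 else x i + (if i == j then r else 0)) = U *m Z.
 apply/matrixP=> j i; rewrite !mxE.
 rewrite (eq_bigr (fun q : 'I_N => (j == q)%:R*Z q i + (q == ord_max)%:R*((j != q)%:R*Z q i))); last first.
  move=> q _; rewrite mxE mulrDl -(inj_eq val_inj q ord_max).
  by case: (j == q); case: (q == n :> nat); rewrite ?mul0r ?mul1r.
 rewrite big_split (bigD1 j)//= big1; last by move=> q; rewrite eq_sym=>/negbTE ->; rewrite mul0r.
 rewrite (bigD1 ord_max)//= big1; last by move=> q /negbTE ->; rewrite mul0r.
 rewrite !eqxx !mxE -(inj_eq val_inj j ord_max) eqxx.
 case: (eqVneq (j : nat) n)=> jn; case: (eqVneq (i : nat) n)=> i_n; rewrite ?mul0r ?mul1r ?addr0//.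
 - by rewrite -(inj_eq val_inj)/= jn (negbTE i_n) addr0.
 - by rewrite (_ : (i == j) = false) ?add0r// -(inj_eq val_inj)/= i_n eq_sym; apply/negbTE.
 - by rewrite addrC.
rewrite E det_mulmx -det_tr ?det_trig.
- rewrite big1 ?mul1r=>[|i _]; last by rewrite !mxE eqxx addr0.
 rewrite big_ord_recr/= !mxE !eqxx mulr1 (eq_bigr (fun=> r)); first by rewrite prodr_const card_ord.
 by move=> i _; rewrite !mxE (ltn_eqF (ltn_ord i)) eqxx.
- apply/is_trig_mxP=> i j ij; rewrite !mxE (ltn_eqF); last by apply: leq_trans ij _; rewrite -ltnS.
 by rewrite -(inj_eq val_inj) gtn_eqF.
- apply/is_trig_mxP=> i j ij; rewrite !mxE -(inj_eq val_inj) (gtn_eqF ij) add0r (_ : (i == n :> nat) = false)//.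
 by apply: ltn_eqF; apply: leq_trans ij _; rewrite -ltnS.
Qed.
End Det.
Lemma simplex0_le N i j : (0 < N)%N -> `|if j == N.-1 then 1 else if j == i then Posz (4 * N) - 2 else - 2| <= Posz (4 * N).
case: (j == N.-1); [|case: (j == i)]; lia. Qed.
Lemma clampz_lt (K : realFieldType) w z : `|(clampz w z)%:~R| < 2 ^+ w :> K.
rewrite /clampz; case: ifP=> H; last by rewrite normr0 exprn_gt0.
rewrite -intr_norm -natrX ltr_nat; apply: leq_trans (bits_lt _) _; by rewrite leq_exp2l.
Qed.
Lemma quadE (K : realFieldType) d A v : (quad d A v)%:~R = qf d (fun i j => (en A i j)%:~R) (fun j => (nth 0 v j)%:~R) :> K.
rewrite zsumE; apply: eq_bigr=> i _; rewrite zsumE; apply: eq_bigr=> j _; by rewrite !intrM.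
Qed.
Section Solve.
Variable K : realFieldType.
Variables (d n b w ww wf t : nat) (F : seq (seq (seq int))).
Let N := n.+1.
Let M : K := N%:R ^+ 2 * 2 ^+ (b + ww + wf).
Let W : K := M + d%:R * (M + 2 * d%:R + 8) + d%:R ^+ 2 * (d%:R + 3).
Hypotheses (n0 : (0 < n)%N) (w1 : W ^+ 2 + W + d%:R + 4 < 2 ^+ w) (w2 : ((W + 1) * (d%:R + 1)) ^+ d < 2 ^+ w) (b4 : 8 * 4 ^+ d <= 2 ^+ b :> K) (Nww : (4 * N < 2 ^ ww)%N).
Let f l i j : int := en (nth [::] F l) i j.
Hypotheses (fsym : forall l i j, (l < N)%N -> (i < d)%N -> (j < d)%N -> f l i j = f l j i) (fb : forall l i j, (l < N)%N -> (i < d)%N -> (j < d)%N -> `|(f l i j)%:~R| <= 2 ^+ wf :> K).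
Let fK l i j : K := (f l i j)%:~R.
Let small V := forall i j, (i < N)%N -> (j < N)%N -> `|(en V i j)%:~R| <= 2 ^+ ww :> K.
Let cent V l : K := \sum_(k < N) (en V k l)%:~R.
Lemma comboE V i j : (i < d)%N -> (j < d)%N -> (en (combo d N F b V) i j)%:~R = 2 ^+ b * \sum_(l < N) cent V l * fK l i j :> K.
move=> id jd; rewrite en_mx// intrM rmorphXn zsumE; congr (_ * _); apply: eq_bigr=> l _.
by rewrite intrM zsumE.
Qed.
Lemma qf_combo V x : qf d (fun i j => (en (combo d N F b V) i j)%:~R) x = 2 ^+ b * \sum_(l < N) cent V l * qf d (fK l) x.
transitivity (\sum_(i < d) \sum_(j < d) \sum_(l < N) 2 ^+ b*(cent V l*(x i * fK l i j*x j))).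
 apply: eq_bigr=> i _; apply: eq_bigr=> j _; rewrite comboE// !mulr_sumr mulr_suml; apply: eq_bigr=> l _; ring.
rewrite mulr_sumr; under eq_bigr=> i _ do rewrite exchange_big/=.
rewrite exchange_big; apply: eq_bigr=> l _; rewrite !mulr_sumr; apply: eq_bigr=> i _.
by rewrite !mulr_sumr.
Qed.
Lemma psd_combo V : small V -> let S := combo d N F b V in let v := psd w S in
 (v != [::] -> [/\ size v = d & \sum_(l < N) cent V l * qf d (fK l) (fun j => (nth 0 v j)%:~R) < 0]) /\
 (v = [::] -> forall x, - nr d x <= \sum_(l < N) cent V l * qf d (fK l) x).
move=> sV S v; have M0: 0 <= M by rewrite mulr_ge0 ?exprn_ge0.
have W0: 0 <= W.
 have d1 := ler0n K d; have d2: 0 <= d%:R*M by apply: mulr_ge0.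
 have d3: 0 <= d%:R ^+ 2 :> K by apply: sqr_ge0.
 have d4: 0 <= d%:R ^+ 2*d%:R :> K by apply: mulr_ge0.
 by rewrite /W; lra.
have bS i j: (i < d)%N -> (j < d)%N -> `|(en S i j)%:~R| <= M.
 move=> id jd; rewrite comboE// normrM ger0_norm ?exprn_ge0//.
 apply: (@le_trans _ _ (2 ^+ b * \sum_(l < N) N%:R*2 ^+ (ww + wf))); last first.
  rewrite sumr_const card_ord /M -addnA [2 ^+ (b + _)]exprD le_eqVlt; apply/orP; left; apply/eqP; ring.
 rewrite ler_wpM2l ?exprn_ge0//; apply: le_trans (ler_norm_sum _ _ _) _; apply: ler_sum=> l _.
 rewrite normrM exprD mulrA; apply: ler_pM=> //; last by apply: fb.
 apply: le_trans (ler_norm_sum _ _ _) _; rewrite mulr_natl -[X in _ *+ X]card_ord -sumr_const; apply: ler_sum=> k _.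
 exact: sV.
have sS i j: (i < d)%N -> (j < d)%N -> en S i j = en S j i.
 move=> id jd; rewrite !en_mx//; congr (_ * _); rewrite !zsum_int; apply: eq_bigr=> l _.
 by congr (_ * _); apply: fsym.
have [||h1 h2] := @psd_spec K w d W w1 w2 d S M M (size_mx _ _ _) (leqnn _) W0 sS.
- split=>// i id; apply: le_trans (bS i i id id); apply: ler_norm.
- by [].
have b0: 0 < 2 ^+ b :> K by rewrite exprn_gt0.
split=> [v0|v0 x].
 by have [s1 _ s3] := h1 v0; move: s3; rewrite qf_combo pmulr_rlt0.
have := h2 v0 x; rewrite qf_combo=> h3; rewrite -(ler_pM2l b0) mulrN; apply: le_trans h3.
by rewrite mulNr lerN2 ler_wpM2r// nr_ge0.
Qed.
Lemma small_step V : small V -> small (sstep d N F b w ww V).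
move=> sV; rewrite /sstep; case: ifP=> // _ i j iN jN; rewrite en_mx//; exact/ltW/clampz_lt.
Qed.
Lemma small_run s : small (srun d N F b w ww s).
elim: s=>[|s IH]; last by apply: small_step.
move=> i j iN jN; rewrite en_mx// -intr_norm -natrX [X in _ <= X]pmulrn ler_int.
apply: le_trans (simplex0_le _ _ _) _=> //; exact: ltnW.
Qed.
Lemma solve_sound : solve d N F b w ww t -> exists x : nat -> K, forall v, - nr d v <= \sum_(l < n) x l * qf d (fK l) v + qf d (fK n) v.
case/andP=> /eqP/size0nil v0 q0; set V := srun _ _ _ _ _ _ _ in v0 q0.
have c0: 1 <= cent V n by rewrite /cent -(zsumE K N (fun k=> en V k n)) -[1]/(1%:~R) ler_int.
have [_ /(_ v0) h] := psd_combo (small_run t).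
exists (fun l=> cent V l / cent V n)=> v; have {}h := h v.
have cp: 0 < cent V n by lra.
rewrite -(ler_pM2l cp); apply: (@le_trans _ _ (- nr d v)).
 by rewrite mulrN lerN2 ler_peMl// nr_ge0.
apply: le_trans h _; rewrite big_ord_recr mulrDr le_eqVlt; apply/orP; left; apply/eqP.
by congr (_ + _); rewrite mulr_sumr; apply: eq_bigr=> l _; rewrite mulrA [cent V n * _]mulrC divfK// gt_eqF.
Qed.
Section Complete.
Variables (x : nat -> K) (lr L : nat).
Hypotheses (x1 : forall l, (l < n)%N -> `|x l| <= 1) (xf : forall v, nr d v <= \sum_(l < n) x l * qf d (fK l) v + qf d (fK n) v) (lrP : d%:R * 2 ^+ wf <= 2 ^+ lr :> K) (tP : t = (16 * N ^ 5 * L)%N) (LP : (4 * N%:R * N%:R) ^+ N * 2 ^+ (lr * n) < 2 ^+ L :> K) (wwt : 4 * N%:R * (3 * (DD N)%:R) ^+ t < 2 ^+ ww :> K).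
Let r : K := 2 ^- lr.
(** Corners of a small simplex at [x]. All are feasible, because [x] satisfies the constraint with
    slack [nr d v] and each matrix has norm at most [d * 2 ^+ wf]. *)
Let y j i : K := if (i == n)%N then 1 else x i + (if i == j then r else 0).
Lemma y_feas j v : (j < N)%N -> 0 <= \sum_(l < N) y j l * qf d (fK l) v.
move=> jN; rewrite big_ord_recr/= {2}/y eqxx.
have -> : \sum_(l < n) y j l * qf d (fK l) v = \sum_(l < n) x l * qf d (fK l) v + \sum_(l < n) (if (l : nat) == j then r else 0) * qf d (fK l) v.
 rewrite -big_split; apply: eq_bigr=> l _/=; by rewrite /y (ltn_eqF (ltn_ord l)) mulrDl.
have e: `|\sum_(l < n) (if (l : nat) == j then r else 0) * qf d (fK l) v| <= nr d v.
 case: (ltnP j n)=> jn; last first.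
  rewrite big1 ?normr0 ?nr_ge0// => l _; by rewrite (ltn_eqF (leq_trans (ltn_ord l) jn)) mul0r.
 rewrite (bigD1 (Ordinal jn))//= eqxx big1 ?addr0; last first.
  by move=> l; rewrite -(inj_eq val_inj)=>/negbTE ->; rewrite mul0r.
 have r0: 0 < r by rewrite invr_gt0 exprn_gt0.
 rewrite normrM (gtr0_norm r0); have q := @qf_pert K d (fK j) v (2 ^+ wf) _.
 have {}q := q (fun i k id kd=> fb jN id kd).
 apply: (@le_trans _ _ (r*(2 ^+ wf*d%:R*nr d v))); first by rewrite ler_pM2l.
 rewrite mulrA ler_piMl ?nr_ge0// mulrC [X in X * _]mulrC ler_pdivrMr ?mul1r// exprn_gt0//.
have := xf v; move: e; rewrite ler_norml=>/andP[e _]; lra.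
Qed.
(** A step multiplies by [DD] instead of dividing, so after [s] steps the homogenising coordinate of
    every vertex is [DD ^ s]; the same power appears in the hull and volume clauses, and sizes grow
    by a factor [3 * DD] per step. *)
Let inv s V := [/\ forall i, (i < N)%N -> (en V i n)%:~R = (DD N)%:R ^+ s :> K,
 forall i j, (i < N)%N -> (j < N)%N -> `|(en V i j)%:~R| <= 4 * N%:R * (3 * (DD N)%:R) ^+ s :> K,
 forall j, (j < N)%N -> exists2 l : nat -> K, (forall k, (k < N)%N -> 0 <= l k) &
   (forall i, (i < N)%N -> y j i * (DD N)%:R ^+ s = \sum_(k < N) l k * (en V k i)%:~R)
 & `|\det (vmx K n (en V))| * (1 + (16 * N ^ 5)%N%:R^-1) ^+ s <= ((DD N)%:R ^+ s) ^+ N * (4 * N%:R * N%:R) ^+ N].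
Let good V := psd w (combo d N F b V) = [::] /\ 0 < zsum N (fun k => en V k N.-1).
Lemma inv_good s V : inv s V -> psd w (combo d N F b V) = [::] -> good V.
case=> q _ _ _ v0; split=>//; rewrite zsum_int -(ltr0z K) rmorph_sum (eq_bigr (fun=> (DD N)%:R ^+ s))=>[|i _]; last exact: q.
by rewrite sumr_const card_ord pmulrn_lgt0// exprn_gt0.
Qed.
Lemma inv_step s V : (s < t)%N -> small V -> inv s V -> psd w (combo d N F b V) <> [::] -> inv s.+1 (sstep d N F b w ww V).
move=> st sV [q bV hull vol] /eqP v0; rewrite /sstep; set v := psd _ _ in v0 *.
have/= := psd_combo sV; rewrite -/v=> -[/(_ v0) [sv neg] _].
have -> : (size v == 0%N) = false by apply/negP=>/eqP/size0nil; move/eqP: v0.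
set h := cuts _ _ _ _ _.
have sh: size h = N by rewrite size_mkseq.
have hE j: (j < N)%N -> (nth 0 h j)%:~R = - \sum_(l < N) (en V j l)%:~R * qf d (fK l) (fun j=> (nth 0 v j)%:~R).
 move=> jN; rewrite nth_mkseq// rmorphN/= zsumE; congr (- _); apply: eq_bigr=> l _; by rewrite intrM quadE.
have hpos: 0 < zsum N (fun j=> nth 0 h j).
 rewrite -(ltr0z K) zsumE; under eq_bigr=> j _ do rewrite hE//.
 rewrite sumrN oppr_gt0 exchange_big/=.
 by under eq_bigr do rewrite -mulr_suml.
have D1: 1 <= (DD N)%:R :> K by rewrite ler1n muln_gt0 expn_gt0.
have cb j: (j < N)%N -> `|(nth 0 (shifts N h) j)%:~R| <= (DD N)%:R :> K.
 move=> jN; case: (eqVneq j (argmin h))=>[->|jk]; first by rewrite shift_k// normr0; lra.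
 have [_ _ _] := shiftP n0 sh hpos jN jk; by rewrite pmulrn -intr_norm ler_int.
have kN := k_ltN sh.
have B i j: (i < N)%N -> (j < N)%N -> `|((Posz (DD N) - nth 0 (shifts N h) i)*en V i j + nth 0 (shifts N h) i*en V (argmin h) j)%:~R| <= 4*N%:R*(3*(DD N)%:R) ^+ s.+1 :> K.
 move=> iN jN; rewrite intrD !intrM intrB -pmulrn; have b1 := bV i j iN jN; have b2 := bV _ j kN jN; have c1 := cb i iN.
 set Bs := 4 * _ * _ in b1 b2; rewrite exprS mulrCA -/Bs.
 apply: (@le_trans _ _ (((DD N)%:R + (DD N)%:R)*Bs + (DD N)%:R*Bs)); last by lra.
 apply: le_trans (ler_normD _ _) _; rewrite !normrM; apply: lerD; apply: ler_pM=> //.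
 by apply: le_trans (ler_normB _ _) _; rewrite normr_nat lerD2l.
have NC i j: (i < N)%N -> (j < N)%N -> en (shrink N ww V h) i j = (Posz (DD N) - nth 0 (shifts N h) i)*en V i j + nth 0 (shifts N h) i*en V (argmin h) j.
 move=> iN jN; rewrite /shrink en_mx// (@clampz_id K)//; apply: le_lt_trans (B i j iN jN) _; apply: le_lt_trans wwt.
 rewrite ler_wpM2l ?mulr_ge0 ?ler0n//; apply: ler_weXn2l=> //; lra.
split.
- move=> i iN; rewrite NC// intrD !intrM !q// -mulrDl intrB subrK exprS; by [].
- by move=> i j iN jN; rewrite NC//; apply: B.
- move=> j jN; have [l l0 El] := hull j jN.
 have lh: \sum_(k < N) l k*(nth 0 h k)%:~R <= 0.
  under eq_bigr=> k _ do rewrite hE// mulrN mulr_sumr.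
  rewrite sumrN exchange_big/= oppr_le0.
  under eq_bigr=> i _ do under eq_bigr=> k _ do rewrite mulrA.
  under eq_bigr=> i _ do rewrite -mulr_suml -El// mulrAC.
  by rewrite -mulr_suml mulr_ge0 ?y_feas// exprn_ge0// ler0n.
 have [l' l'0 El'] := shrink_hull n0 sh hpos l0 El lh.
 exists l'=> // i iN; rewrite exprS pmulrn El'//; apply: eq_bigr=> k _; by rewrite NC.
- have := shrink_vol K n0 sh hpos (en V).
 rewrite (_ : vmx _ _ _ = vmx K n (en (shrink N ww V h))); last first.
  by apply/matrixP=> i j; rewrite !mxE NC.
 set dt' := \det _ in vol * => h1.
 have s1: 0 <= (1 + (16*N ^ 5)%:R^-1) ^+ s :> K by rewrite exprn_ge0// addr_ge0 ?invr_ge0.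
 have h2 := ler_wpM2r s1 h1; rewrite exprS mulrA; apply: le_trans h2 _.
 have -> : ((DD N)%:R ^+ s.+1) ^+ N = (DD N)%:R ^+ N*((DD N)%:R ^+ s) ^+ N :> K by rewrite exprS exprMn.
 by rewrite -!mulrA ler_wpM2l ?exprn_ge0// mulrA.
Qed.
Lemma inv0 : inv 0 (simplex0 N).
have NK: 1 <= N%:R :> K by rewrite ler1n.
have NE: 4*N%:R = (Posz (4*N))%:~R :> K by rewrite -pmulrn natrM.
split.
- by move=> i iN; rewrite en_mx// eqxx.
- move=> i j iN jN; rewrite mulr1 en_mx// NE -intr_norm ler_int.
 exact: simplex0_le.
- move=> j jN; have r01: 0 <= r <= 1 by rewrite invr_ge0 exprn_ge0//= invf_le1 ?exprn_gt0// exprn_ege1// ler1n.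
 have yb i: (i < n)%N -> -2 <= y j i <= 2.
  move=> i_n; rewrite /y (ltn_eqF i_n); have := x1 i_n; rewrite ler_norml=>/andP[? ?]; case: ifP=> _; lra.
 pose l i : K := (y j i + 2) / (4*N%:R).
 have l0 i: (i < n)%N -> 0 <= l i <= N%:R^-1.
  move=> i_n; have /andP[y1 y2] := yb i i_n; rewrite divr_ge0 ?mulr_ge0//=; last by lra.
  by rewrite ler_pdivrMr ?mulr_gt0// mulrCA mulVf; lra.
 exists (fun i=> if i == n then 1 - \sum_(k < n) l k else l i).
  move=> k kN; case: eqP=>[_|/eqP kn]; last first.
   have kn': (k < n)%N by rewrite ltn_neqAle kn.
   by have /andP[] := l0 k kn'.
  rewrite subr_ge0; apply: (@le_trans _ _ (\sum_(k < n) N%:R^-1)); first by apply: ler_sum=> i _; have /andP[] := l0 i (ltn_ord i).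
  by rewrite sumr_const card_ord -[X in X <= _]mulr_natr mulrC ler_pdivrMr// mul1r ler_nat.
 move=> i iN; rewrite mulr1 big_ord_recr/= eqxx.
 under eq_bigr=> k _ do rewrite (ltn_eqF (ltn_ord k)).
 under eq_bigr=> k _ do rewrite en_mx ?(ltnS, leq_trans (ltn_ord k))//.
 rewrite en_mx//; case: eqVneq=>[->|i_n].
  by under eq_bigr do rewrite mulr1; rewrite mulr1 addrC subrK /y eqxx.
 have i_n': (i < n)%N by rewrite ltn_neqAle i_n.
 rewrite mulrBl mulr_suml addrCA -sumrB (bigD1 (Ordinal i_n'))//= eqxx big1; last first.
  by move=> k; rewrite -(inj_eq val_inj) eq_sym=>/negbTE ->; rewrite subrr.
 by rewrite /l; field; rewrite gt_eqF.
- rewrite mulr1 expr1n mul1r; apply: le_trans (norm_det_le _) _.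
 rewrite -[X in _ <= _ ^+ X]card_ord -prodr_const; apply: ler_prod=> i _; rewrite sumr_ge0//= mulr_natr -[X in _ *+ X]card_ord -sumr_const; apply: ler_sum=> j _; rewrite mxE en_mx// NE -intr_norm ler_int.
 exact: simplex0_le.
Qed.
(** All corners [y j] lie in the final simplex. Their weights form a stochastic matrix, of
    determinant at most 1, so the volume is at least [r ^+ n] times the scale, contrary to the
    shrinking. *)
Lemma inv_false V : inv t V -> False.
case=> q _ hull vol; have D1: 0 < (DD N)%:R ^+ t :> K by rewrite exprn_gt0.
have [l lP] : exists l : nat -> nat -> K, forall j, (j < N)%N -> (forall k, (k < N)%N -> 0 <= l j k) /\
   (forall i, (i < N)%N -> y j i*(DD N)%:R ^+ t = \sum_(k < N) l j k*(en V k i)%:~R).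
 suff: forall m, (m <= N)%N -> exists l : nat -> nat -> K, forall j, (j < m)%N -> (forall k, (k < N)%N -> 0 <= l j k) /\
   (forall i, (i < N)%N -> y j i*(DD N)%:R ^+ t = \sum_(k < N) l j k*(en V k i)%:~R) by move=> /(_ N (leqnn _)).
 elim=> [|m IH] mN; first by exists (fun _ _=> 0).
 have [l0 l0P] := IH (ltnW mN); have [l1 l1P l1P'] := hull m mN.
 exists (fun j=> if j == m then l1 else l0 j)=> j; rewrite ltnS leq_eqVlt; case: eqP=>[-> _|_]//= jm; exact: l0P.
pose Lm : 'M[K]_N := \matrix_(j, k) l j k.
pose Y : 'M[K]_N := \matrix_(j, i) (if (i == n :> nat) then 1 else x i + (if i == j then r else 0)).
have E: (DD N)%:R ^+ t *: Y = Lm *m vmx K n (en V).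
 apply/matrixP=> j i; rewrite !mxE mulrC; have [_ /(_ i (ltn_ord i))] := lP j (ltn_ord j); rewrite /y=> ->.
 by apply: eq_bigr=> k _; rewrite !mxE.
have dL: `|\det Lm| <= 1.
 apply: le_trans (norm_det_le _) _; rewrite big1// => j _; have [l0 /(_ n (leqnn _))] := lP j (ltn_ord j).
 rewrite /y eqxx mul1r (eq_bigr (fun k : 'I_N => l j k*(DD N)%:R ^+ t)); last by move=> k _; rewrite q.
 rewrite -mulr_suml=> Es; have <- : \sum_(k < N) l j k = 1.
  by apply: (mulIf (_ : (DD N)%:R ^+ t != 0)); rewrite ?mul1r// gt_eqF.
 by apply: eq_bigr=> k _; rewrite mxE ger0_norm// l0.
have := congr1 (fun A=> `|\det A|) E; rewrite detZ det_mulmx det_affine !normrM=> E2.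
have r0: 0 < r by rewrite invr_gt0 exprn_gt0.
have h1: ((DD N)%:R ^+ t) ^+ N * r ^+ n <= `|\det (vmx K n (en V))|.
 have -> : ((DD N)%:R ^+ t) ^+ N * r ^+ n = `|((DD N)%:R ^+ t) ^+ N| * `|r ^+ n|.
  by rewrite !ger0_norm// exprn_ge0 ?ltW.
 by rewrite E2 ler_piMl.
(* By Bernoulli's inequality, [16 * N ^ 5] steps double the factor. *)
have h2: 2 ^+ L <= (1 + (16*N ^ 5)%:R^-1) ^+ t :> K.
 rewrite tP exprM; apply: lerXn2r; rewrite ?nnegrE ?exprn_ge0 ?addr_ge0 ?invr_ge0//.
 have := @bern K (16*N ^ 5)%:R^-1 (16*N ^ 5); rewrite divff ?gt_eqF// => h; apply: le_trans (h _); last by rewrite invr_ge0.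
 by lra.
have D2: 0 < ((DD N)%:R ^+ t) ^+ N :> K by rewrite exprn_gt0.
have h3: ((DD N)%:R ^+ t) ^+ N*(r ^+ n*2 ^+ L) <= ((DD N)%:R ^+ t) ^+ N*(4*N%:R*N%:R) ^+ N.
 apply: le_trans vol; rewrite mulrA; apply: ler_pM=> //; first by rewrite mulr_ge0 ?exprn_ge0// ltW.
 by rewrite exprn_ge0.
rewrite ler_pM2l// in h3; have e: r ^+ n = (2 ^+ (lr*n))^-1 by rewrite exprVn exprM.
rewrite e mulrC ler_pdivrMr ?exprn_gt0// in h3; by rewrite lt_geF in h3.
Qed.
Lemma solve_complete : solve d N F b w ww t.
suff G: good (srun d N F b w ww t) by case: G=> g1 g2; rewrite /solve g1.
have : forall s, (s <= t)%N -> good (srun d N F b w ww s) \/ inv s (srun d N F b w ww s).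
 elim=> [|s IH] st; first by right; apply: inv0.
 have fx V: psd w (combo d N F b V) = [::] -> sstep d N F b w ww V = V by move=> e; rewrite /sstep e.
 case: (IH (ltnW st))=>[g|i]; first by left; rewrite /srun iterS fx; case: g.
 rewrite /srun iterS.
 case: (psd w (combo d N F b (srun d N F b w ww s)) =P [::])=>[e|ne].
  by left; rewrite fx//; apply: inv_good i e.
 by right; apply: inv_step=> //; apply: small_run.
by move=> /(_ t (leqnn _)) [|/inv_false].
Qed.
End Complete.
End Solve.
Section Pt.
Variable E : encT.
Lemma pt_zsum (n : E -> nat) (f : E -> nat -> int) : ptime n -> ptime (fun x : E * nat => f x.1 x.2) -> ptime (fun e => zsum (n e) (f e)).
by move=> Hn Hf; apply: pt_sumz=> //; pt. Qed.
Lemma pt_absi (z : E -> int) : ptime z -> ptime (fun e => absi (z e)).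
by move=> Z; rewrite /absi; ptz. Qed.
End Pt.
Lemma pt_quad (E : encT) (d : E -> nat) (A : E -> seq (seq int)) (v : E -> seq int) : ptime d -> ptime A -> ptime v ->
 ptime (fun e => quad (d e) (A e) (v e)).
move=> D HA V; apply: pt_zsum=> //.
apply: pt_zsum; ptz.
by apply: pt_en; ptz.
Qed.
Lemma pt_flr (E : encT) (D0 : E -> nat) (b a : E -> int) : ptime D0 -> ptime b -> ptime a -> ptime (fun e => flr (D0 e) (b e) (a e)).
move=> D B A; apply: pt_subz; ptz.
apply: pt_filter; ptz.
Qed.
Lemma pt_combo (E : encT) (d N : E -> nat) (F : E -> seq (seq (seq int))) (b : E -> nat) (V : E -> seq (seq int)) :
 ptime d -> ptime N -> ptime F -> ptime b -> ptime V -> ptime (fun e => combo (d e) (N e) (F e) (b e) (V e)).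
move=> D HN HF B HV; apply: pt_mx=> //.
ptz.
apply: pt_zsum; ptz.
 apply: pt_zsum; ptz.
 by apply: pt_en; pt.
by apply: pt_en; pt.
Qed.
Lemma pt_cuts (E : encT) (d N : E -> nat) (F : E -> seq (seq (seq int))) (V : E -> seq (seq int)) (v : E -> seq int) :
 ptime d -> ptime N -> ptime F -> ptime V -> ptime v -> ptime (fun e => cuts (d e) (N e) (F e) (V e) (v e)).
move=> D HN HF HV Hv; apply: pt_mkseq=> //.
apply: pt_oppz; apply: pt_zsum; ptz; first by apply: pt_en; pt.
by apply: pt_quad; pt.
Qed.
Lemma pt_argmin (E : encT) (h : E -> seq int) : ptime h -> ptime (fun e => argmin (h e)).
move=> H; apply: pt_head; pt.
apply: pt_filter; ptz.
apply: pt_all; ptz.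
Qed.
Lemma pt_DD (E : encT) (N : E -> nat) : ptime N -> ptime (fun e => DD (N e)).
by move=> H; rewrite /DD; ptz. Qed.
Lemma pt_TT (E : encT) (N : E -> nat) : ptime N -> ptime (fun e => TT (N e)).
by move=> H; rewrite /TT; ptz. Qed.
Lemma pt_shifts (E : encT) (N : E -> nat) (h : E -> seq int) : ptime N -> ptime h -> ptime (fun e => shifts (N e) (h e)).
move=> HN H.
apply: pt_mkseq=> //.
have N1: ptime (fun x : E*nat=> N x.1) by pt.
have h1: ptime (fun x : E*nat=> h x.1) by pt.
have D1 := pt_DD N1; have T1 := pt_TT N1.
pt; first by apply: pt_argmin.
apply: pt_flr=> //; ptz.
apply: pt_zsum=> //.
by apply: pt_absi; pt.
Qed.
Lemma pt_shrink (E : encT) (N ww : E -> nat) (V : E -> seq (seq int)) (h : E -> seq int) :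
 ptime N -> ptime ww -> ptime V -> ptime h -> ptime (fun e => shrink (N e) (ww e) (V e) (h e)).
move=> HN HW HV H; have C := pt_shifts HN H; have A := pt_argmin H; have D := pt_DD HN.
apply: pt_mx=> //.
have C1: ptime (fun x : E*nat*nat=> shifts (N x.1.1) (h x.1.1)) by apply: (pt_app1 C); pt.
have A1: ptime (fun x : E*nat*nat=> argmin (h x.1.1)) by apply: (pt_app1 A); pt.
have D1: ptime (fun x : E*nat*nat=> DD (N x.1.1)) by apply: (pt_app1 D); pt.
apply: pt_clampz; pt.
ptz; apply: pt_en; pt.
Qed.
Lemma pt_sstep (E : encT) (d N : E -> nat) (F : E -> seq (seq (seq int))) (b w ww : E -> nat) (V : E -> seq (seq int)) :
 ptime d -> ptime N -> ptime F -> ptime b -> ptime w -> ptime ww -> ptime V ->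
 ptime (fun e => sstep (d e) (N e) (F e) (b e) (w e) (ww e) (V e)).
move=> D HN HF B W WW HV; have C := pt_combo D HN HF B HV; have P := pt_psd W C; rewrite /sstep.
by pt; apply: pt_shrink=> //; apply: pt_cuts.
Qed.
Lemma pt_simplex0 (E : encT) (N : E -> nat) : ptime N -> ptime (fun e => simplex0 (N e)).
move=> HN; apply: pt_mx=> //.
ptz.
Qed.
Lemma pt_srun (E : encT) (d N : E -> nat) (F : E -> seq (seq (seq int))) (b w ww t : E -> nat) :
 ptime d -> ptime N -> ptime F -> ptime b -> ptime w -> ptime ww -> ptime t ->
 ptime (fun e => srun (d e) (N e) (F e) (b e) (w e) (ww e) (t e)).
move=> D HN HF B W WW T; have S0 := pt_simplex0 HN.
have [k1 H1] := pt_szb HN; have [k2 H2] := pt_szb WW; have [k3 H3] := pt_szb S0.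
apply: pt_iter=> //.
 by apply: pt_sstep; pt.
exists (fun n=> ((n + 2) ^ k1*((n + 2) ^ k1*(4*(n + 2) ^ k2 + 6) + 2) + 1 + (n + 2) ^ k3))%N; first by auto 20 with pol.
move=> e i _.
have h1: (N e <= (esz e + 2) ^ k1)%N by apply: leq_trans (H1 e); rewrite esz_nat; lia.
have h2: (ww e <= (esz e + 2) ^ k2)%N by apply: leq_trans (H2 e); rewrite esz_nat; lia.
have st V: (esz V <= (N e*(N e*(4*ww e + 6)).+2).+1 + esz (simplex0 (N e)))%N ->
 (esz (sstep (d e) (N e) (F e) (b e) (w e) (ww e) V) <= (N e*(N e*(4*ww e + 6)).+2).+1 + esz (simplex0 (N e)))%N.
 rewrite /sstep; case: ifP=> // _ _.
 apply: leq_trans (esz_mx _ _ (B := (4*ww e + 5)) _) _; first by move=> ? ?; apply: esz_clampz.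
 by lia.
apply: (@leq_trans ((N e*(N e*(4*ww e + 6)).+2).+1 + esz (simplex0 (N e)))).
 elim: i=>[|i IH]; [by rewrite leq_addl | exact: st].
rewrite leq_add// addn1; apply: leq_mul=> //; rewrite addn2; apply: leq_mul=> //; lia.
Qed.
Lemma pt_solve (E : encT) (d N : E -> nat) (F : E -> seq (seq (seq int))) (b w ww t : E -> nat) :
 ptime d -> ptime N -> ptime F -> ptime b -> ptime w -> ptime ww -> ptime t ->
 ptime (fun e => solve (d e) (N e) (F e) (b e) (w e) (ww e) (t e)).
move=> D HN HF B W WW T; have S := pt_srun D HN HF B W WW T.
apply: pt_andb; first by pt; apply: pt_psd=> //; apply: pt_combo.
ptz; apply: pt_zsum=> //.
by apply: pt_en; pt; apply: (pt_app1 S); pt.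
Qed.

(** * Explicit lengths for the feasibility test *)

Section Lmi.
Variables (d n wf : nat).
Let N := n.+1.
(** [2 ^ l_L] exceeds the ratio of the volume bounds for the first simplex and for the corner
    simplex of side [2 ^- (wf + d)], and [l_t] steps exhaust it. The other lengths leave room for
    the vertices ([l_ww]), the inaccuracy of [psd] ([l_b]), the entries met during elimination
    ([l_P]) and the certificates ([l_w]). *)
Definition l_L := ((2 + 2 * N) * N + (wf + d) * n + 1)%N.
Definition l_t := (16 * N ^ 5 * l_L)%N.
Definition l_ww := (3 + N + (7 + 6 * N) * l_t)%N.
Definition l_b := (3 + 2 * d)%N.
Definition l_P := (l_b + l_ww + wf + 2 * N + 3 * (d + 2))%N.
Definition l_w := ((l_P + d + 2) * (d + 2))%N.
Definition lmi F := solve d N F l_b l_w l_ww l_t.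
End Lmi.
Lemma pt_lmi (E : encT) (d n wf : E -> nat) (F : E -> seq (seq (seq int))) : ptime d -> ptime n -> ptime wf -> ptime F ->
 ptime (fun e => lmi (d e) (n e) (wf e) (F e)).
move=> D HN WF HF; have L: ptime (fun e=> l_L (d e) (n e) (wf e)) by rewrite /l_L; pt.
have T: ptime (fun e=> l_t (d e) (n e) (wf e)) by rewrite /l_t; pt.
have WW: ptime (fun e=> l_ww (d e) (n e) (wf e)) by rewrite /l_ww; pt.
have B: ptime (fun e=> l_b (d e)) by rewrite /l_b; pt.
have P: ptime (fun e=> l_P (d e) (n e) (wf e)) by rewrite /l_P; pt.
have W: ptime (fun e=> l_w (d e) (n e) (wf e)) by rewrite /l_w; pt.
apply: pt_solve; pt.
Qed.
Section LmiSpec.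
Variables (K : realFieldType) (d n wf : nat) (F : seq (seq (seq int))).
Let N := n.+1.
Hypothesis n0 : (0 < n)%N.
Let f l i j : int := en (nth [::] F l) i j.
Hypotheses (fsym : forall l i j, (l < N)%N -> (i < d)%N -> (j < d)%N -> f l i j = f l j i) (fb : forall l i j, (l < N)%N -> (i < d)%N -> (j < d)%N -> `|(f l i j)%:~R| <= 2 ^+ wf :> K).
Lemma le_pow2 m : m%:R + 1 <= 2 ^+ m :> K.
by rewrite natr1 -natrX ler_nat ltn_expl. Qed.
Let M : K := N%:R ^+ 2 * 2 ^+ (l_b d + l_ww d n wf + wf).
Let W : K := M + d%:R * (M + 2 * d%:R + 8) + d%:R ^+ 2 * (d%:R + 3).
Lemma N_pow2 : N%:R <= 2 ^+ N :> K. by have := le_pow2 N; lra. Qed.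
Lemma W_bound : 0 <= W /\ W + 1 <= 2 ^+ l_P d n wf.
have M1: 1 <= M.
 by rewrite mulr_ege1// exprn_ege1// ler1n.
have MA: M <= 2 ^+ (l_b d + l_ww d n wf + wf + 2*N).
 rewrite addnC exprD mulnC exprM ler_wpM2r ?exprn_ge0//; apply: lerXn2r; rewrite ?nnegrE ?exprn_ge0//; exact: N_pow2.
have d1 := ler0n K d; have d2: 0 <= d%:R*M by apply: mulr_ge0; lra.
have d3: 0 <= d%:R ^+ 2 :> K by apply: sqr_ge0.
have d4: 0 <= d%:R ^+ 2*d%:R :> K by apply: mulr_ge0.
split; first by rewrite /W; lra.
have WM: W + 1 <= M*(d%:R + 2) ^+ 3.
 have h k: 0 <= k -> k <= k*M by move=> k0; rewrite ler_peMr.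
 have g1 := h _ d1; have g2 := h _ d3; have g3 := h _ d4.
 rewrite /W (_ : M*(d%:R + 2) ^+ 3 = d%:R ^+ 2*d%:R*M + 6*(d%:R ^+ 2*M) + 12*(d%:R*M) + 8*M); last by ring.
 lra.
apply: le_trans WM _; rewrite exprD; apply: ler_pM=> //; [lra | by rewrite exprn_ge0// addr_ge0 | ].
rewrite mulnC exprM; apply: lerXn2r; rewrite ?nnegrE ?exprn_ge0 ?addr_ge0//.
have := le_pow2 (d + 2); lra.
Qed.
Lemma lmi_w1 : W ^+ 2 + W + d%:R + 4 < 2 ^+ l_w d n wf.
have [W0 WP] := W_bound; have dp: d%:R + 3 <= 2 ^+ l_P d n wf :> K.
 apply: (@le_trans _ _ (2 ^+ (d + 2))); last by rewrite ler_weXn2l ?ler1n /l_P; lia.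
 have := le_pow2 (d + 2); lra.
have : 2 ^+ (2 * l_P d n wf + 2) <= 2 ^+ l_w d n wf :> K.
 by rewrite ler_weXn2l ?ler1n /l_w; lia.
rewrite exprD mulnC exprM; set Q := 2 ^+ l_P d n wf in WP dp *.
have : (W + 1) ^+ 2 <= Q ^+ 2 by apply: lerXn2r; rewrite ?nnegrE; lra.
have : Q <= Q ^+ 2 by rewrite ler_peMr; lra.
lra.
Qed.
Lemma lmi_w2 : ((W + 1) * (d%:R + 1)) ^+ d < 2 ^+ l_w d n wf.
have [W0 WP] := W_bound; apply: (@le_lt_trans _ _ (2 ^+ ((l_P d n wf + d)*d))).
 have W1: 0 <= W + 1 by lra.
 have D1: 0 <= d%:R + 1 :> K by rewrite addr_ge0.
 rewrite exprM; apply: lerXn2r; rewrite ?nnegrE ?exprn_ge0 ?mulr_ge0// exprD; apply: ler_pM=> //; exact: le_pow2.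
rewrite ltr_eXn2l ?ltr1n// /l_w; apply: (@leq_ltn_trans ((l_P d n wf + d + 2)*d)); first by lia.
lia.
Qed.
Lemma lmi_b4 : 8 * 4 ^+ d <= 2 ^+ l_b d :> K.
have e8: 8 = 2 ^+ 3 :> K by ring.
have e4: 4 = 2 ^+ 2 :> K by ring.
by rewrite exprD exprM -e8 -e4.
Qed.
Lemma lmi_Nww : (4 * N < 2 ^ l_ww d n wf)%N.
apply: (@leq_trans (2 ^ (2 + N).+1)); last by rewrite leq_exp2l /l_ww; lia.
rewrite expnS expnD; have : (N < 2 ^ N)%N by apply: ltn_expl. lia.
Qed.
Let fK l i j : K := (f l i j)%:~R.
Lemma lmi_sound : lmi d n wf F -> exists x : nat -> K, forall v, - nr d v <= \sum_(l < n) x l * qf d (fK l) v + qf d (fK n) v.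
exact: (solve_sound lmi_w1 lmi_w2 lmi_b4 lmi_Nww fsym fb). Qed.
(** With [lmi_sound] this is a test with a gap, from [nr] to [- nr], for points of the unit cube;
    constraints are to be scaled so that the gap is negligible. *)
Lemma lmi_complete (x : nat -> K) : (forall l, (l < n)%N -> `|x l| <= 1) ->
 (forall v, nr d v <= \sum_(l < n) x l * qf d (fK l) v + qf d (fK n) v) -> lmi d n wf F.
move=> x1 xf; apply: (solve_complete n0 lmi_w1 lmi_w2 lmi_b4 lmi_Nww fsym fb x1 xf (lr := (wf + d)) (L := l_L d n wf))=> //.
- by rewrite exprD mulrC ler_wpM2l ?exprn_ge0; have := le_pow2 d; lra.
- have NN: 4*N%:R*N%:R <= 2 ^+ (2 + 2*N) :> K.
  rewrite exprD mulnC exprM -mulrA -natrX ler_wpM2l//; apply: ler_pM; rewrite//; exact: N_pow2.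
 apply: (@le_lt_trans _ _ (2 ^+ ((2 + 2*N)*N + (wf + d)*n))).
  rewrite exprD; apply: ler_pM; rewrite ?exprn_ge0 ?mulr_ge0// exprM.
  by apply: lerXn2r; rewrite ?nnegrE ?exprn_ge0 ?mulr_ge0.
 by rewrite ltr_eXn2l ?ltr1n// /l_L addn1.
- apply: (@le_lt_trans _ _ (2 ^+ (2 + N + (7 + 6*N) * l_t d n wf))); last first.
  by rewrite ltr_eXn2l ?ltr1n.
 rewrite exprD; apply: ler_pM; rewrite ?exprn_ge0 ?mulr_ge0//.
  by rewrite exprD -natrX ler_wpM2l// N_pow2.
 rewrite exprM; apply: lerXn2r; rewrite ?nnegrE ?exprn_ge0 ?mulr_ge0// natrM mulrA exprD; apply: ler_pM; rewrite ?mulr_ge0//.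
  by rewrite -natrM -natrX ler_nat.
 rewrite mulnC exprM natrX; apply: lerXn2r; rewrite ?nnegrE ?exprn_ge0//; exact: N_pow2.
Qed.
End LmiSpec.

(** * Provers as isometries *)
Section Gram.
Variables (F : numClosedFieldType) (I : finType).
Implicit Types (x y z : I -> F) (U : I -> I -> F).
Definition ip x y := \sum_i x i * (y i)^*.
Definition unit_op U := forall j k, \sum_i (U i j)^* * U i k = (j == k)%:R.
Definition app U x : I -> F := fun i => \sum_j U i j * x j.
Lemma sum_delta (f : I -> F) k : \sum_i (i == k)%:R * f i = f k.
by rewrite (bigD1 k)//= eqxx mul1r big1 ?addr0// => i /negbTE ->; rewrite mul0r. Qed.
Lemma sum_delta' (f : I -> F) k : \sum_i (k == i)%:R * f i = f k.
by under eq_bigr do rewrite eq_sym; exact: sum_delta. Qed.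
Lemma ip_app U x y : unit_op U -> ip (app U x) (app U y) = ip x y.
move=> HU; transitivity (\sum_j \sum_k (\sum_i (U i k)^* * U i j)*(x j*(y k)^*)).
 rewrite /ip; under eq_bigr=> i _.
  rewrite rmorph_sum big_distrlr/=; under eq_bigr=> j _ do under eq_bigr=> k _ do rewrite rmorphM mulrACA [U i j * _]mulrC.
  over.
 rewrite exchange_big; apply: eq_bigr=> j _; rewrite exchange_big; apply: eq_bigr=> k _.
 by rewrite mulr_suml.
apply: eq_bigr=> j _; under eq_bigr=> k _ do rewrite HU.
exact: sum_delta.
Qed.
Lemma app_comp U V x : app U (app V x) = app (fun i j => \sum_k U i k * V k j) x.
funext i; rewrite /app; under eq_bigr do rewrite mulr_sumr.
rewrite exchange_big; apply: eq_bigr=> j _; rewrite mulr_suml; apply: eq_bigr=> k _; by rewrite mulrA.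
Qed.
Lemma unit_comp U V : unit_op U -> unit_op V -> unit_op (fun i j => \sum_k U i k * V k j).
move=> HU HV j k; transitivity (ip (app U (V^~ k)) (app U (V^~ j))); first by apply: eq_bigr=> i _; rewrite mulrC.
by rewrite ip_app// -HV; apply: eq_bigr=> i _; rewrite mulrC.
Qed.
Lemma unit_id : unit_op (fun i j => (i == j)%:R).
by move=> j j'; under eq_bigr do rewrite conjC_nat; rewrite (sum_delta (fun i=> (i == j')%:R)). Qed.
Lemma app_id x : app (fun i j => (i == j)%:R) x = x.
by funext i; rewrite /app sum_delta'. Qed.
Lemma ip_conj x y : (ip x y)^* = ip y x.
by rewrite rmorph_sum; apply: eq_bigr=> i _/=; rewrite rmorphM/= conjCK mulrC. Qed.
(* The reflection z - d <z, d> / <x, d> with d = x - y is unitary because |x| = |y| forces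
  2 Re <x, d> = |d|^2. *)
Lemma reflect_op x y : ip x x = ip y y -> exists2 U, unit_op U & app U x = y /\ forall z, ip z x = ip z y -> app U z = z.
move=> xy; pose d i := x i - y i; pose t := ip x d.
have ipB z: ip z d = ip z x - ip z y.
 by rewrite -sumrB; apply: eq_bigr=> i _; rewrite rmorphB mulrBr.
have ipD z: ip d z = ip x z - ip y z.
 by rewrite -sumrB; apply: eq_bigr=> i _; rewrite mulrBl.
have dd: ip d d = t + t^*.
 by rewrite /t ipD !ipB rmorphB/= !ip_conj opprB -xy.
have [t0|t0] := eqVneq t 0.
 have d0 i: d i = 0.
  have : ip d d = 0 by rewrite dd t0 rmorph0 addr0.
  move/eqP; rewrite psumr_eq0=> [/allP /(_ i (mem_index_enum _))|j _]; last exact: mul_conjC_ge0.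
  by rewrite mul_conjC_eq0=>/eqP.
 have e: x = y by funext i; apply/eqP; rewrite -subr_eq0; apply/eqP/d0.
 by exists (fun i j=> (i == j)%:R); [exact: unit_id | rewrite app_id; split=>// z _; rewrite app_id].
have tc0: t^* != 0 by rewrite conjC_eq0.
pose U i j := (i == j)%:R - d i*(d j)^* / t.
have appU z i: app U z i = z i - d i*(ip z d / t).
 rewrite /app; under eq_bigr do rewrite mulrBl.
 rewrite sumrB sum_delta' mulr_suml mulr_sumr; congr (_ - _); apply: eq_bigr=> j _; ring.
exists U; last first.
 split; first by funext i; rewrite appU divff// mulr1 opprB addrC subrK.
 by move=> z e; funext i; rewrite appU ipB e subrr mul0r mulr0 subr0.
move=> j k; rewrite /U; under eq_bigr=> i _.
 rewrite rmorphB rmorphM fmorphV rmorphM/= conjCK (_ : (_ - _) * _ = (i == j)%:R*((i == k)%:R - d i*(d k)^* / t) - (i == k)%:R*((d i)^* * d j / t^*) + (d i*(d i)^*)*(d j*(d k)^* / t / t^*)); last by ring.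
 over.
rewrite big_split sumrB/= !sum_delta -mulr_suml -/(ip d d) dd (_ : (t + t^*) * _ = d j*(d k)^* / t + d j*(d k)^* / t^*); last by field; apply/andP.
ring.
Qed.
(** The vectors are matched one at a time. The reflection that corrects the new vector fixes those
    already matched, because the inner products agree. *)
Lemma gram_unitary (K : eqType) (L : seq K) (x y : K -> I -> F) :
 {in L &, forall k l, ip (x k) (x l) = ip (y k) (y l)} -> exists2 U, unit_op U & {in L, forall k, app U (x k) = y k}.
elim: L=>[|k L IH] H; first by exists (fun i j=> (i == j)%:R); [exact: unit_id |].
have [|U HU Ux] := IH; first by move=> a b aL bL; apply: H; rewrite inE ?aL ?bL orbT.
have [|V HV [Vx Vz]] := @reflect_op (app U (x k)) (y k).
 by rewrite ip_app// H// mem_head.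
exists (fun i j=> \sum_l V i l*U l j); first exact: unit_comp.
move=> l; rewrite -app_comp inE=>/orP[/eqP ->|lL]; first exact: Vx.
rewrite Ux// Vz// -{1}(Ux l lL) ip_app// H ?mem_head// inE lL orbT//.
Qed.
End Gram.
Section Real.
Implicit Types z : C.
Lemma normsqE z : (normsq z)%:C%C = z * z^*.
by case: z=> a b; rewrite /normsq; apply/eqP; rewrite eq_complex/=; apply/andP; split; apply/eqP; ring. Qed.
Lemma normsq_ge0 z : 0 <= normsq z. by rewrite addr_ge0 ?sqr_ge0. Qed.
Lemma normsqM z z' : normsq (z * z') = normsq z * normsq z'.
by case: z=> a b; case: z'=> c d; rewrite /normsq/=; ring. Qed.
Lemma normsq_par z z' : normsq (z + z') + normsq (z - z') = 2 * (normsq z + normsq z').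
rewrite /normsq; ring. Qed.
(** The weight [t] trades the main term against the error and avoids the square roots of a triangle
    inequality. *)
Lemma normsq_add (t : R) z z' : 0 < t -> normsq (z + z') <= (1 + t) * normsq z + (1 + t^-1) * normsq z'.
move=> t0; have H (a b : R) : (a + b) ^+ 2 <= (1 + t)*a ^+ 2 + (1 + t^-1)*b ^+ 2.
 rewrite -subr_ge0 (_ : _ - _ = t*(a - b / t) ^+ 2); first by rewrite mulr_ge0 ?sqr_ge0// ltW.
 by field; rewrite gt_eqF.
case: z=> a b; case: z'=> c d; rewrite /normsq/=; have := H a c; have := H b d; lra.
Qed.
End Real.
Section Ops.
Variables (nv nm D : nat).
Let N := (nv.+1 + nm)%N.
Implicit Types (psi : qstate N D) (b : basis N).
Definition nrm2 N' (psi : qstate N' D) : R := \sum_b \sum_e normsq (psi b e).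
Definition lin N' (a : C) (psi phi : qstate N' D) : qstate N' D := fun (b : basis N') e => a * psi b e + phi b e.
Lemma getq_setq N' i j v (b : basis N') : (i < N')%N -> getq i (setq j v b) = if i == j then v else getq i b.
by move=> iN; rewrite /getq insubT ffunE. Qed.
Lemma basis_eq N' (b b' : basis N') : (forall i, (i < N')%N -> getq i b = getq i b') -> b = b'.
by move=> H; apply/ffunP=> -[i iN]; have := H i iN; rewrite /getq insubT. Qed.
Lemma setq_id N' i (b : basis N') : setq i (getq i b) b = b.
by apply: basis_eq=> k kN; rewrite getq_setq//; case: eqP=> // ->. Qed.
Lemma setq_setq N' i v v' (b : basis N') : setq i v (setq i v' b) = setq i v b.
by apply: basis_eq=> k kN; rewrite !getq_setq//; case: eqP. Qed.
Lemma apply_gate_lin N' g a (psi phi : qstate N' D) : apply_gate g (lin a psi phi) = lin a (apply_gate g psi) (apply_gate g phi).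
by case: g=>[i j k|i|i]/=; case: ifP=> // _; funext b; funext e; rewrite /lin; ring.
Qed.
Lemma apply_circuit_lin N' c a (psi phi : qstate N' D) : apply_circuit c (lin a psi phi) = lin a (apply_circuit c psi) (apply_circuit c phi).
by elim: c psi phi=> //= g c IH psi phi; rewrite apply_gate_lin. Qed.
Definition tofb N' i j k (b : basis N') := if getq i b && getq j b then setq k (~~ getq k b) b else b.
Lemma tofbK N' i j k : (i < N')%N -> (j < N')%N -> (k < N')%N -> i != k -> j != k -> involutive (@tofb N' i j k).
move=> iN jN kN ik jk b; rewrite /tofb; case H : (getq i b && getq j b); last by rewrite H.
by rewrite !getq_setq// (negbTE ik) (negbTE jk) H eqxx negbK setq_setq setq_id.
Qed.
(** Basis states differing in qubit [i] are paired, so that a Hadamard gate becomes the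
    parallelogram law on each pair; every pair is met twice, whence the half. *)
Lemma sum_flip N' i (f : basis N' -> R) : (i < N')%N -> \sum_b f b = 2^-1 * \sum_b (f (setq i false b) + f (setq i true b)).
move=> iN; have fl: involutive (fun b : basis N'=> setq i (~~ getq i b) b).
 by move=> b; rewrite getq_setq// eqxx negbK setq_setq setq_id.
have -> : \sum_b (f (setq i false b) + f (setq i true b)) = \sum_b f b + \sum_b f (setq i (~~ getq i b) b).
 rewrite -big_split; apply: eq_bigr=> b _/=; rewrite -{3}(setq_id i b); case: getq=> //=; exact: addrC.
have -> : \sum_b f (setq i (~~ getq i b) b) = \sum_b f b by rewrite [RHS](reindex_inj (inv_inj fl)).
lra.
Qed.
Lemma nrm2_gate N' g (psi : qstate N' D) : nrm2 (apply_gate g psi) = nrm2 psi.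
case: g=>[i j k|i|i]/=; case: ifP=> //.
- by case/and5P=> iN jN kN ij /andP[jk ik]; rewrite /nrm2 (reindex_inj (inv_inj (tofbK iN jN kN ik jk))); apply: eq_bigr=> b _; rewrite -/(tofb i j k _) tofbK.
- move=> iN; rewrite /nrm2 (sum_flip _ iN) [RHS](sum_flip _ iN); congr (_ * _); apply: eq_bigr=> b _.
 rewrite -!big_split; apply: eq_bigr=> e _/=; rewrite !getq_setq// eqxx !setq_setq mul1r mulN1r !normsqM -mulrDr normsq_par mulrA (_ : normsq _ * 2 = 1) ?mul1r// /normsq expr0n addr0 exprVn sqr_sqrtr ?mulVf ?pnatr_eq0//.
- move=> iN; apply: eq_bigr=> b _; apply: eq_bigr=> e _; rewrite normsqM (_ : normsq _ = 1) ?mul1r//.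
 by case: getq; rewrite /normsq ?expr0n ?expr1n ?addr0 ?add0r.
Qed.
Lemma nrm2_circuit N' c (psi : qstate N' D) : nrm2 (apply_circuit c psi) = nrm2 psi.
by elim: c psi=> //= g c IH psi; rewrite IH nrm2_gate. Qed.
Lemma getq_setm b c i : (i < N)%N -> getq i (setm b c) = if (nv.+1 <= i)%N then getq (i - nv.+1) c else getq i b.
move=> iN; rewrite /getq insubT ffunE/=; case: ifP=> // vi.
have H: (i - nv.+1 < nm)%N by lia.
by rewrite insubT.
Qed.
Lemma mpart_setm b c : mpart (setm b c) = c.
apply: basis_eq=> k kN; rewrite {1}/getq insubT ffunE getq_setm ?ltn_add2l// leq_addr addKn//.
Qed.
Lemma setm_setm b c c' : setm (setm b c) c' = setm b c'.
by apply: basis_eq=> k kN; rewrite !getq_setm; case: (nv.+1 <= k)%N. Qed.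
Lemma setm_mpart b : setm b (mpart b) = b.
apply: basis_eq=> k kN; rewrite getq_setm//; case: ifP=> // vk.
have H: (k - nv.+1 < nm)%N by lia.
by rewrite {1}/getq insubT ffunE subnKC.
Qed.
(* The overlap of the parts of the state that the prover sees when the verifier's register reads b and b'. *)
Definition gram psi b b' : C := \sum_(x : basis nm * 'I_D.+1) psi (setm b x.1) x.2 * (psi (setm b' x.1) x.2)^*.
Let slice psi b : basis nm * 'I_D.+1 -> C := fun x => psi (setm b x.1) x.2.
Lemma slice_prover U psi b : slice (@apply_prover nv nm D U psi) b = app U (slice psi b).
apply: functional_extensionality=> -[c e]; rewrite /slice /apply_prover mpart_setm; apply: eq_bigr=> x _.
by rewrite setm_setm.
Qed.
Lemma gram_prover U psi b b' : unitary U -> gram (@apply_prover nv nm D U psi) b b' = gram psi b b'.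
by move=> HU; rewrite -[LHS]/(ip (slice _ b) (slice _ b')) !slice_prover ip_app. Qed.
Lemma sum_setm (f : basis N -> R) : \sum_b \sum_(c : basis nm) f (setm b c) = (2 ^ nm)%:R * \sum_b f b.
have C2: #|{: basis nm}| = (2 ^ nm)%N by rewrite card_ffun card_bool card_ord.
pose g (x : basis N*basis nm) := (setm x.1 x.2, mpart x.1).
have gK: involutive g by case=> b c; rewrite /g setm_setm setm_mpart mpart_setm.
rewrite (pair_big xpredT xpredT (fun b c=> f (setm b c))) (reindex_inj (inv_inj gK)).
under eq_bigr do rewrite setm_setm setm_mpart.
rewrite -(pair_big xpredT xpredT (fun b _=> f b)) mulr_sumr; apply: eq_bigr=> b _.
by rewrite sumr_const C2 mulr_natl.
Qed.
Lemma nrm2_gram psi : (2 ^ nm)%:R * (nrm2 psi)%:C%C = \sum_b gram psi b b.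
rewrite -(rmorph_nat (real_complex R)) -rmorphM -sum_setm rmorph_sum; apply: eq_bigr=> b _.
rewrite pair_big rmorph_sum; apply: eq_bigr=> -[c e] _/=; exact: normsqE.
Qed.
Lemma nrm2_prover U psi : unitary U -> nrm2 (@apply_prover nv nm D U psi) = nrm2 psi.
move=> HU; have h: (2 ^ nm)%:R*(nrm2 (@apply_prover nv nm D U psi))%:C%C = (2 ^ nm)%:R*(nrm2 psi)%:C%C.
 by rewrite !nrm2_gram; apply: eq_bigr=> b _; apply: gram_prover.
have n0: (2 ^ nm)%:R != 0 :> C by rewrite pnatr_eq0 -lt0n expn_gt0.
by have /complexI := mulfI n0 h.
Qed.
Lemma prover_lin U a psi phi : @apply_prover nv nm D U (lin a psi phi) = lin a (@apply_prover nv nm D U psi) (@apply_prover nv nm D U phi).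
funext b; funext e; rewrite /lin mulr_sumr -big_split.
by apply: eq_bigr=> x _/=; rewrite mulrDr mulrCA.
Qed.
(** For fixed contents of the private register a state is a vector of the space on which the prover
    acts; one unitary matches all these vectors as soon as their inner products agree. *)
Lemma uhlmann psi phi : (forall b b', gram psi b b' = gram phi b b') -> exists2 U : prover_op nm D, unitary U & @apply_prover nv nm D U psi = phi.
move=> H; have [|U HU E] := @gram_unitary _ (basis nm * 'I_D.+1)%type _ (enum {: basis N}) (slice psi) (slice phi).
 by move=> b b' _ _; apply: H.
exists U=> //; funext b; funext e.
have := congr1 (fun f=> f (mpart b, e)) (E b (mem_enum _ b)); rewrite /slice setm_mpart=> <-.
by [].
Qed.
End Ops.

(** * Semidefinite programs for interactive proofs *)
Section Factor.
Variable K : rcfType.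
Lemma psd_row0 d (A : nat -> nat -> K) j : (forall i j, (i < d.+1)%N -> (j < d.+1)%N -> A i j = A j i) -> (forall x, 0 <= qf d.+1 A x) ->
 A 0%N 0%N = 0 -> (j < d.+1)%N -> A 0%N j = 0.
move=> sy psd a0 jd; case: (eqVneq j 0)=>[-> //|j0].
have E (s t : K) : qf d.+1 A (fun i=> if i == 0 then s else if i == j then t else 0) = 2 * s * t*A 0 j + t ^+ 2*A j j.
 have row (i : nat) : (i < d.+1)%N -> \sum_(k < d.+1) A i k*(if k == 0 :> nat then s else if k == j :> nat then t else 0) = A i 0 * s + A i j * t.
  rewrite (bigD1 ord0)//= (bigD1 (Ordinal jd))//= (negbTE j0) eqxx big1 ?addr0//.
  by move=> k; rewrite -!(inj_eq val_inj)=>/andP[/negbTE -> /negbTE ->]; rewrite mulr0.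
 transitivity (\sum_(i < d.+1) (if i == 0 :> nat then s else if i == j :> nat then t else 0)*(A i 0 * s + A i j * t)).
  by apply: eq_bigr=> i _; rewrite -row// mulr_sumr; apply: eq_bigr=> k _; rewrite mulrA.
 rewrite (bigD1 ord0)//= (bigD1 (Ordinal jd))//= (negbTE j0) eqxx big1; last first.
  by move=> k; rewrite -!(inj_eq val_inj)=>/andP[/negbTE -> /negbTE ->]; rewrite mul0r.
 by rewrite a0 sy//; ring.
apply/eqP/negP=>/negP n0.
(* Chosen so that the cross term outweighs the diagonal entry by 1. *)
have := psd (fun i=> if i == 0 then - (A j j + 1) / (2*A 0 j) else if i == j then 1 else 0); rewrite E.
rewrite (_ : 2 * _ * 1 * _ + _ = - 1); last by field.
lra.
Qed.
(** Cholesky elimination. At a zero pivot the whole row vanishes, and since the inverse of 0 is 0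
    the same formulas remain correct. *)
Lemma psd_factor d (A : nat -> nat -> K) : (forall i j, (i < d)%N -> (j < d)%N -> A i j = A j i) -> (forall x, 0 <= qf d A x) ->
 exists u : nat -> nat -> K, forall i j, (i < d)%N -> (j < d)%N -> A i j = \sum_(e < d) u e i * u e j.
elim: d A=>[|d IH] A sy psd; first by exists (fun _ _=> 0).
have qfS (B : nat -> nat -> K) x : (forall i j, (i < d.+1)%N -> (j < d.+1)%N -> B i j = B j i) ->
  qf d.+1 B x = x 0*B 0 0*x 0 + x 0*(\sum_(j < d) B 0 j.+1*x j.+1) *+ 2 + qf d (fun i j=> B i.+1 j.+1) (fun i=> x i.+1).
 move=> sB; set s := \sum_(j < d) _; rewrite /qf big_ord_recl big_ord_recl.
 rewrite (_ : \sum_(i < d) x 0 * _ * _ = x 0 * s); last first.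
  by rewrite mulr_sumr; apply: eq_bigr=> i _; rewrite mulrA.
 rewrite (eq_bigr (fun i : 'I_d => x i.+1*B 0 i.+1*x 0 + \sum_(j < d) x i.+1*B i.+1 j.+1*x j.+1)); last first.
  by move=> i _; rewrite big_ord_recl (sB i.+1)// ltnS.
 rewrite big_split !addrA; congr (_ + _ + _ + _).
 by rewrite mulr_sumr; apply: eq_bigr=> i _; ring.
have a_ge0: 0 <= A 0 0.
 have := psd (fun i=> (i == 0)%:R); rewrite qfS//= mul1r mulr1 big1=>[|j _]; last by rewrite mulr0.
 by rewrite mulr0 mul0rn /qf big1 ?addr0// => i _; apply: big1=> j _; rewrite mul0r mul0r.
pose B i j := A i.+1 j.+1 - A 0 i.+1*A 0 j.+1 / A 0 0.
have row0: A 0 0 = 0 -> forall j, (j < d.+1)%N -> A 0%N j = 0 by move=> a0 j; apply: psd_row0.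
have [|x|u Hu] := IH B.
- by move=> i j id jd; rewrite /B sy// [A 0 i.+1 * _]mulrC.
- have := psd (fun i=> if i is k.+1 then x k else - (\sum_(j < d) A 0 j.+1*x j) / A 0 0).
 rewrite qfS//=; set s := \sum_(j < d) _.
 have -> : qf d B x = qf d (fun i j=> A i.+1 j.+1) x - s ^+ 2 / A 0 0.
  rewrite expr2 2!mulr_suml -sumrB; apply: eq_bigr=> i _.
  rewrite mulr_sumr mulr_suml -sumrB; apply: eq_bigr=> j _; rewrite /B; ring.
 have [a0|a0] := eqVneq (A 0 0) 0; last by rewrite (_ : _ * _ * _ + _ = - (s ^+ 2 / A 0 0)) ?[- _ + _]addrC//; field.
 have -> : s = 0 by apply: big1=> j _; rewrite row0 ?mul0r// ltnS.
 by lra.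
exists (fun e i=> if e is e'.+1 then (if i is i'.+1 then u e' i' else 0) else A 0 i / Num.sqrt (A 0 0)).
move=> i j id jd; rewrite big_ord_recl mulrACA -invfM -expr2 sqr_sqrtr//.
have [a0|a0] := eqVneq (A 0 0) 0.
 rewrite (row0 a0 i id) mul0r mul0r add0r; case: i j id jd=>[|i] [|j] id jd.
 - by rewrite big1// => e _; rewrite mul0r.
 - by rewrite row0// big1// => e _; rewrite mul0r.
 - by rewrite sy// row0// big1// => e _; rewrite mulr0.
 - by rewrite -Hu// /B a0 invr0 mulr0 subr0.
case: i j id jd=>[|i] [|j] id jd.
- by rewrite mulfK// big1 ?addr0// => e _; rewrite mul0r.
- by rewrite mulrAC divff// mul1r big1 ?addr0// => e _; rewrite mul0r.
- by rewrite mulfK// big1 ?addr0; [exact: sy | move=> e _; rewrite mulr0].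
- by rewrite -Hu// addrC subrK.
Qed.
End Factor.
Section Forms.
Variables (K : rcfType) (I : finType).
Implicit Types (A B : I -> I -> K) (z : I -> K).
Definition qform A z := \sum_p \sum_q z p * A p q * z q.
Definition nsq z := \sum_p z p ^+ 2.
Definition cj (V : I -> I -> K) A p p' := \sum_q \sum_q' V p q * A q q' * V p' q'.
Lemma nsq_ge0 z : 0 <= nsq z. by apply: sumr_ge0=> p _; apply: sqr_ge0. Qed.
Lemma qform_add A B z : qform (fun p q => A p q + B p q) z = qform A z + qform B z.
rewrite -big_split; apply: eq_bigr=> p _; rewrite -big_split; apply: eq_bigr=> q _/=; ring. Qed.
Lemma qform_id c z : qform (fun p q => (p == q)%:R * c) z = c * nsq z.
rewrite mulr_sumr; apply: eq_bigr=> p _; rewrite (bigD1 p)//= eqxx big1/=; first by ring.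
by move=> q; rewrite eq_sym=>/negbTE ->; rewrite mul0r mulr0 mul0r.
Qed.
Lemma sum_dl (f : I -> K) k : \sum_i f i * (i == k)%:R = f k.
by rewrite (bigD1 k)//= eqxx mulr1 big1 ?addr0// => i /negbTE ->; rewrite mulr0. Qed.
Lemma qform_delta A p : qform A (fun q => (q == p)%:R) = A p p.
rewrite /qform; under eq_bigr=> i _ do rewrite (sum_dl (fun q=> (i == p)%:R*A i q)) mulrC.
exact: sum_dl.
Qed.
Lemma qform_cj V A z : qform (cj V A) z = qform A (fun q => \sum_p z p * V p q).
transitivity (\sum_p \sum_p' \sum_q \sum_q' z p*V p q*A q q'*(z p'*V p' q')).
 apply: eq_bigr=> p _; apply: eq_bigr=> p' _; rewrite mulr_sumr mulr_suml; apply: eq_bigr=> q _.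
 by rewrite mulr_sumr mulr_suml; apply: eq_bigr=> q' _; ring.
under eq_bigr=> p _ do rewrite exchange_big/=.
rewrite exchange_big; apply: eq_bigr=> q _.
under eq_bigr=> p _ do rewrite exchange_big/=.
rewrite exchange_big; apply: eq_bigr=> q' _.
rewrite mulr_suml mulr_suml; apply: eq_bigr=> p _; rewrite mulr_sumr//.
Qed.
Lemma psd_factor_fin A : (forall p q, A p q = A q p) -> (forall z, 0 <= qform A z) ->
 exists u : nat -> I -> K, forall p q, A p q = \sum_(e < #|I|) u e p * u e q.
move=> sy psd; case: (pickP (fun _ : I=> true))=>[p0 _|noI]; last by exists (fun _ _=> 0)=> p; have := noI p.
pose s i := nth p0 (enum I) i.
have sI (f : I -> K) : \sum_p f p = \sum_(i < #|I|) f (s i).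
 rewrite (reindex (@enum_val I xpredT)); last by apply: (onW_bij _ (enum_val_bij _)).
 by apply: eq_bigr=> i _; rewrite (enum_val_nth p0).
have [|x|u Hu] := @psd_factor K #|I| (fun i j=> A (s i) (s j)).
- by [].
- have := psd (fun p=> x (index p (enum I))); rewrite /qform sI; set f := (X in 0 <= X -> _).
 suff -> : f = qf #|I| (fun i j=> A (s i) (s j)) x by [].
 have ix (i : 'I_#|I|) : index (s i) (enum I) = i by rewrite index_uniq ?enum_uniq// -cardE.
 by apply: eq_bigr=> i _; rewrite sI; apply: eq_bigr=> j _; rewrite !ix.
exists (fun e p=> u e (index p (enum I)))=> p q.
have H p': (index p' (enum I) < #|I|)%N by rewrite cardE index_mem mem_enum.
by rewrite -Hu// /s !nth_index ?mem_enum.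
Qed.
Lemma orth_tr (V : I -> I -> K) : (forall q q', \sum_p V p q * V p q' = (q == q')%:R) -> forall p p', \sum_q V p q * V p' q = (p == p')%:R.
move=> H p p'; pose M : 'M[K]_#|I| := \matrix_(i, j) V (enum_val i) (enum_val j).
have sI (f : I -> K) : \sum_p f p = \sum_(i < #|I|) f (enum_val i).
 by rewrite (reindex (@enum_val I xpredT))//; apply: (onW_bij _ (enum_val_bij _)).
have M1: M^T *m M = 1%:M.
 apply/matrixP=> i j; rewrite !mxE (eq_bigr (fun k=> V (enum_val k) (enum_val i)*V (enum_val k) (enum_val j))); last by move=> k _; rewrite !mxE.
 by rewrite -(sI (fun k=> V k (enum_val i)*V k (enum_val j))) H (inj_eq enum_val_inj).
have /matrixP /(_ (enum_rank p) (enum_rank p')) := mulmx1C M1; rewrite !mxE (inj_eq enum_rank_inj)=> <-.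
by rewrite sI; apply: eq_bigr=> k _; rewrite !mxE !enum_rankK.
Qed.
Lemma orth_polar (V : I -> I -> K) : (forall z, nsq (fun p => \sum_q V p q * z q) = nsq z) -> forall q q', \sum_p V p q * V p q' = (q == q')%:R.
move=> H; pose B q q' := \sum_p V p q*V p q'.
have h1 q: B q q = 1.
 have := H (fun k=> (k == q)%:R); rewrite /nsq; under eq_bigr do rewrite sum_dl expr2.
 by rewrite sum_dl eqxx.
move=> q q'; case: eqVneq=>[->|qq]; first exact: h1.
have := H (fun k=> (k == q)%:R + (k == q')%:R); rewrite /nsq.
under eq_bigr=> p _.
 under eq_bigr do rewrite mulrDr. rewrite big_split !sum_dl sqrrD. over.
rewrite !big_split/= => E.
have e1: \sum_i V i q ^+ 2 = 1 by rewrite -(h1 q).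
have e2: \sum_i V i q' ^+ 2 = 1 by rewrite -(h1 q').
have e3: \sum_k ((k == q)%:R + (k == q')%:R) ^+ 2 = 2 :> K.
 under eq_bigr=> k _. rewrite sqrrD (_ : (k == q)%:R*(k == q')%:R = 0) ?mul0rn ?addr0; last first.
  by case: eqVneq=>[->|]; rewrite ?mul0r ?(negbTE qq) ?mulr0. over.
 by rewrite big_split !sum_dl !eqxx.
lra.
Qed.
End Forms.
Lemma rid (A : comPzRingType) (s s' x y x' y' g g' : A) :
 s * (x + g * y) * (s' * (x' + g' * y')) = s * s' * (x * x' + g' * (x * y') + g * (y * x') + g * g' * (y * y')).
ring. Qed.
Lemma normsq_bool (v : bool) : normsq v%:R = v%:R.
by case: v; rewrite /normsq ?expr0n ?expr1n ?addr0. Qed.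
Section RealPicture.
Variable N : nat.
Let T := (basis N * bool)%type.
Implicit Types (u : T -> R) (p q : T).
(* Complex vectors indexed by b are real vectors indexed by pairs (b, beta): beta = false
  selects the real part and beta = true the imaginary part. *)
Definition rgate g u : T -> R := match g with
 | Tof i j k => if [&& (i < N)%N, (j < N)%N, (k < N)%N, i != j, j != k & i != k] then fun p => u (tofb i j k p.1, p.2) else u
 | Had i => if (i < N)%N then fun p => (Num.sqrt 2)^-1 * (u (setq i false p.1, p.2) + (if getq i p.1 then -1 else 1) * u (setq i true p.1, p.2)) else u
 | Ph i => if (i < N)%N then fun p => if getq i p.1 then (if p.2 then u (p.1, false) else - u (p.1, true)) else u p else u
 end.
Definition rcirc c u := foldl (fun s g => rgate g s) u c.
Definition vmat c p q : R := rcirc c (fun k => (k == q)%:R) p.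
Definition cxv u b : C := Complex (u (b, false)) (u (b, true)).
Lemma cx_gate D g (U : 'I_D.+1 -> T -> R) : apply_gate g (fun b e => cxv (U e) b) = (fun b e => cxv (rgate g (U e)) b).
case: g=>[i j k|i|i]/=; case: ifP=> // _; funext b; funext e; rewrite /cxv.
- by case: getq; apply/eqP; rewrite eq_complex/=; apply/andP; split; apply/eqP; ring.
- by case: getq; apply/eqP; rewrite eq_complex/=; apply/andP; split; apply/eqP; ring.
Qed.
Lemma cx_circuit D c (U : 'I_D.+1 -> T -> R) : apply_circuit c (fun b e => cxv (U e) b) = (fun b e => cxv (rcirc c (U e)) b).
by elim: c U=> //= g c IH U; rewrite cx_gate. Qed.
Lemma rgate_sum (J : finType) g (a : J -> R) (f : J -> T -> R) : rgate g (fun p => \sum_q a q * f q p) = (fun p => \sum_q a q * rgate g (f q) p).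
case: g=>[i j k|i|i]/=; case: ifP=> // _; funext p.
- rewrite mulr_sumr -big_split mulr_sumr; apply: eq_bigr=> q _/=; ring.
- case: (getq i p.1)=> //; case: p.2=> //; rewrite -sumrN; apply: eq_bigr=> q _; by rewrite mulrN.
Qed.
Lemma rcirc_sum (J : finType) c (a : J -> R) (f : J -> T -> R) : rcirc c (fun p => \sum_q a q * f q p) = (fun p => \sum_q a q * rcirc c (f q) p).
by elim: c f=> //= g c IH f; rewrite rgate_sum. Qed.
Lemma rcircE c u p : rcirc c u p = \sum_q vmat c p q * u q.
have {1}-> : u = (fun p=> \sum_q u q*(p == q)%:R).
 by funext p'; under eq_bigr do rewrite eq_sym; rewrite sum_dl.
by rewrite (rcirc_sum c u (fun q p=> (p == q)%:R)); apply: eq_bigr=> q _; rewrite mulrC.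
Qed.
Lemma sum_T (f : T -> R) : \sum_p f p = \sum_b (f (b, false) + f (b, true)).
rewrite (eq_bigr (fun p=> f (p.1, p.2))); last by case.
rewrite -(pair_bigA _ (fun b v=> f (b, v))); apply: eq_bigr=> b _; by rewrite big_bool addrC.
Qed.
Lemma nsq_rcirc c u : nsq (rcirc c u) = nsq u.
have H v: nrm2 (fun b (e : 'I_1) => cxv v b) = nsq v.
 by rewrite /nsq sum_T; apply: eq_bigr=> b _; rewrite big_ord1.
by rewrite -!H -(nrm2_circuit c (fun b (e : 'I_1) => cxv u b)) cx_circuit.
Qed.
Lemma vmat_orth c p p' : \sum_q vmat c p q * vmat c p' q = (p == p')%:R.
apply: orth_tr; apply: orth_polar=> z; rewrite -[RHS](nsq_rcirc c); congr nsq.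
by funext q; rewrite rcircE.
Qed.
Lemma cj_id c a p p' : cj (vmat c) (fun q q' => (q == q')%:R * a) p p' = (p == p')%:R * a.
rewrite -(vmat_orth c) mulr_suml; apply: eq_bigr=> q _.
rewrite (eq_bigr (fun q'=> (a*vmat c p q*vmat c p' q')*(q' == q)%:R)) ?sum_dl; first by ring.
by move=> q' _; rewrite eq_sym; ring.
Qed.
(** The complex Gram matrix of vectors whose real and imaginary parts have the real Gram matrix [A];
    the matrix [A] may be any positive one, with no symmetry between the two parts. *)
Definition cxm (A : T -> T -> R) b b' : C := Complex (A (b, false) (b', false) + A (b, true) (b', true)) (A (b, true) (b', false) - A (b, false) (b', true)).
Definition dens D (psi : qstate N D) b b' : C := \sum_e psi b e * (psi b' e)^*.
Lemma sumC (J : finType) (f g : J -> R) : \sum_j (Complex (f j) (g j) : C) = Complex (\sum_j f j) (\sum_j g j).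
apply: (big_ind3 (fun (a : C) b c=> a = Complex b c))=> //.
by move=> a b c a' b' c' -> ->.
Qed.
Lemma dens_cx D (U : 'I_D.+1 -> T -> R) b b' : dens (fun b e => cxv (U e) b) b b' = cxm (fun p q => \sum_e U e p * U e q) b b'.
rewrite /cxm -!big_split -sumrB -sumC; apply: eq_bigr=> e _.
apply/eqP; rewrite eq_complex/=; apply/andP; split; apply/eqP; ring.
Qed.
Lemma dens_gate D g (psi phi : qstate N D) : (forall b b', dens psi b b' = dens phi b b') ->
 forall b b', dens (apply_gate g psi) b b' = dens (apply_gate g phi) b b'.
move=> H b b'; case: g=>[i j k|i|i]/=; case: ifP=> // _; rewrite /dens.
- exact: H.
- set s := (_^-1)%:C%C; have E (f : qstate N D) : \sum_e s*(f (setq i false b) e + (if getq i b then -1 else 1) * f (setq i true b) e) *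
   (s*(f (setq i false b') e + (if getq i b' then -1 else 1) * f (setq i true b') e))^* =
  s * s^* * (dens f (setq i false b) (setq i false b') + ((if getq i b' then -1 else 1))^* * dens f (setq i false b) (setq i true b')
   + (if getq i b then -1 else 1)*dens f (setq i true b) (setq i false b') + (if getq i b then -1 else 1)*((if getq i b' then -1 else 1))^* * dens f (setq i true b) (setq i true b')).
  rewrite !mulr_sumr -!big_split mulr_sumr; apply: eq_bigr=> e _/=; rewrite !(rmorphM, rmorphD); exact: rid.
 by rewrite !E !H.
- set s := (if _ then _ else _); set s' := (if _ then _ else _).
 have E (f : qstate N D) : \sum_e s * f b e*(s' * f b' e)^* = s * s'^* * dens f b b'.
  by rewrite mulr_sumr; apply: eq_bigr=> e _; ring.
 by rewrite !E H.
Qed.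
Lemma dens_circuit D c (psi phi : qstate N D) : (forall b b', dens psi b b' = dens phi b b') ->
 forall b b', dens (apply_circuit c psi) b b' = dens (apply_circuit c phi) b b'.
by elim: c psi phi=> //= g c IH psi phi H; apply: IH; apply: dens_gate. Qed.
End RealPicture.

(** * From a relaxed solution to a prover *)

Section Sound.
Variables nv nm : nat.
Let N := (nv.+1 + nm)%N.
Let T := (basis N * bool)%type.
Definition zmsg : basis nm := [ffun => false].
Definition zreg M : basis M := [ffun => false].
Definition pset (p : T) c : T := (setm p.1 c, p.2).
(** Representatives of the indices modulo the message register; they index the reduced states, which
    [trm] forms as partial traces over the messages. *)
Definition rep (p : T) := mpart p.1 == zmsg.
Definition trm (A : T -> T -> R) p p' : R := \sum_c A (pset p c) (pset p' c).
(** The factor 1/2 spreads the initial state evenly over its real and imaginary copies, with total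
    trace 1. *)
Definition xinit : T -> T -> R := fun p q => ((p == q) && (p.1 == zreg N))%:R / 2.
Lemma gram_dens D (psi : qstate N D) b b' : gram psi b b' = \sum_c dens psi (setm b c) (setm b' c).
by rewrite pair_big. Qed.
Lemma qform_trm V A z : qform (trm (cj V A)) z = \sum_c qform A (fun q => \sum_p z p * V (pset p c) q).
under eq_bigr=> c _ do rewrite -(qform_cj (fun p q=> V (pset p c) q)).
rewrite exchange_big; apply: eq_bigr=> p _; rewrite exchange_big; apply: eq_bigr=> p' _/=.
by rewrite mulr_sumr mulr_suml.
Qed.
Lemma trm_pset A p p' c c' : trm A (pset p c) (pset p' c') = trm A p p'.
by apply: eq_bigr=> d _; rewrite /pset !setm_setm. Qed.
Lemma trm_add A B p p' : trm (fun p q => A p q + B p q) p p' = trm A p p' + trm B p p'.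
by rewrite -big_split. Qed.
Lemma cj_add (V A B : T -> T -> R) p p' : cj V (fun p q => A p q + B p q) p p' = cj V A p p' + cj V B p p'.
rewrite -big_split; apply: eq_bigr=> q _; rewrite -big_split; apply: eq_bigr=> q' _/=; ring.
Qed.
Lemma trm_sym A : (forall p q, A p q = A q p) -> forall p q, trm A p q = trm A q p.
by move=> H p q; apply: eq_bigr=> c _. Qed.
Lemma cj_sym (V A : T -> T -> R) : (forall p q, A p q = A q p) -> forall p q, cj V A p q = cj V A q p.
by move=> H p q; rewrite /cj exchange_big; apply: eq_bigr=> k _; apply: eq_bigr=> l _; rewrite H; ring.
Qed.
Lemma qform_trm_id z : (forall p, ~~ rep p -> z p = 0) -> nsq z <= qform (trm (fun p q => (p == q)%:R * 1)) z.
move=> z0; have -> : qform (trm (fun p q=> (p == q)%:R*1)) z = \sum_c nsq (fun q=> \sum_p z p*(pset p c == q)%:R).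
 have e: trm (fun p q=> (p == q)%:R*1) = trm (cj (fun p q=> (p == q)%:R) (fun p q=> (p == q)%:R*1)).
  funext p; funext q; apply: eq_bigr=> c _; rewrite /cj.
  rewrite (eq_bigr (fun k=> (pset q c == k)%:R*(k == pset p c)%:R)); first by rewrite sum_dl mulr1 eq_sym.
  move=> k _; rewrite (eq_bigr (fun l=> ((pset p c == k)%:R*(pset q c == l)%:R)*(l == k)%:R)) ?sum_dl; first by rewrite mulrC [k == _]eq_sym.
  by move=> l _; rewrite [l == k]eq_sym; ring.
 by rewrite e qform_trm; apply: eq_bigr=> c _; rewrite qform_id mul1r.
rewrite (bigD1 zmsg)//= -[X in X <= _]addr0; apply: lerD; last by apply: sumr_ge0=> c _; apply: nsq_ge0.
rewrite le_eqVlt; apply/orP; left; apply/eqP; congr nsq; funext q.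
rewrite (eq_bigr (fun p=> z p*(p == q)%:R)) ?sum_dl// => p _.
case: (boolP (rep p))=> [/eqP r|/z0 ->]; last by rewrite !mul0r.
by rewrite /pset -r setm_mpart.
Qed.
Section Chain.
Variables (r : nat) (cs : nat -> seq gate) (x : nat -> T -> T -> R) (eta : R).
Hypotheses (eta0 : 0 < eta) (xsym : forall j p q, x j p q = x j q p) (x0 : x 0 = xinit) (x1 : forall j z, (j <= r.+1)%N -> - (2 * eta) * nsq z <= qform (x j) z).
Hypothesis x2 : forall j z, (j <= r)%N -> (forall p, ~~ rep p -> z p = 0) ->
 - (2 * eta) * nsq z <= qform (trm (cj (vmat (cs j)) (x j))) z - qform (trm (x j.+1)) z.
(** The multiple of the identity added at time [j] drops by [2 * eta] at each move. The drop pays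
    for the defect allowed in [x2], and what remains at the end still covers the negative part
    allowed in [x1]. *)
Let c j : R := 2 * eta * (r.+2 - j)%N%:R.
Let xs j p q := x j p q + (p == q)%:R * c j.
(** The surplus that restores equality of the reduced states. A positive matrix on reduced states is
    realised by placing it at message 0, where the partial trace reads it back. *)
Fixpoint blk j : T -> T -> R := match j with
 | 0 => fun _ _ => 0
 | j.+1 => fun p p' => if rep p && rep p' then trm (cj (vmat (cs j)) (fun p q => xs j p q + blk j p q)) p p' - trm (xs j.+1) p p' else 0
 end.
Let y j p q := xs j p q + blk j p q.
Lemma xs_sym j p q : xs j p q = xs j q p. by rewrite /xs xsym eq_sym. Qed.
Lemma blk_sym j p q : blk j p q = blk j q p.
elim: j p q=> //= j IH p q; rewrite andbC.
by rewrite (trm_sym (cj_sym _ _)) 1?(trm_sym (xs_sym _))// => p' q'; rewrite xs_sym IH.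
Qed.
Lemma y_sym j p q : y j p q = y j q p. by rewrite /y xs_sym blk_sym. Qed.
Lemma y_tr j p q : trm (y j.+1) p q = trm (cj (vmat (cs j)) (y j)) p q.
rewrite trm_add (_ : trm (blk j.+1) p q = trm (cj (vmat (cs j)) (y j)) p q - trm (xs j.+1) p q); first by rewrite addrC subrK.
rewrite {1}/trm (bigD1 zmsg)//= big1 ?addr0; last first.
 by move=> d dz; rewrite /rep mpart_setm (negbTE dz).
by rewrite /rep !mpart_setm eqxx !trm_pset.
Qed.
Lemma blk_psd j z : (j <= r.+1)%N -> 0 <= qform (blk j) z.
elim: j z=>[|j IH] z jr; first by rewrite /qform big1// => p _; rewrite big1// => q _; rewrite mulr0 mul0r.
pose z' p := if rep p then z p else 0.
have z'0 p: ~~ rep p -> z' p = 0 by rewrite /z'=>/negbTE ->.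
have -> : qform (blk j.+1) z = qform (trm (cj (vmat (cs j)) (y j))) z' - qform (trm (xs j.+1)) z'.
 rewrite -sumrB; apply: eq_bigr=> p _; rewrite -sumrB; apply: eq_bigr=> q _; rewrite /z'/=.
 by case: rep; case: rep; rewrite ?mulr0 ?mul0r ?subrr// mulrBr mulrBl.
have lin A a z1: qform (trm (fun p q=> A p q + (p == q)%:R*a)) z1 = qform (trm A) z1 + a * qform (trm (fun p q=> (p == q)%:R*1)) z1.
 have -> : trm (fun p q=> A p q + (p == q)%:R*a) = (fun p q=> trm A p q + trm (fun p q=> (p == q)%:R*a) p q).
  by funext p; funext q; rewrite trm_add.
 rewrite qform_add; congr (_ + _); rewrite mulr_sumr; apply: eq_bigr=> p _; rewrite mulr_sumr; apply: eq_bigr=> q _.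
 by rewrite mulr_sumr mulr_suml mulr_sumr mulr_suml mulr_sumr; apply: eq_bigr=> d _; ring.
have -> : qform (trm (cj (vmat (cs j)) (y j))) z' = qform (trm (fun p q=> cj (vmat (cs j)) (x j) p q + (p == q)%:R*c j)) z' + qform (trm (cj (vmat (cs j)) (blk j))) z'.
 rewrite -qform_add; congr qform; funext p; funext q.
 by rewrite -trm_add; apply: eq_bigr=> d _; rewrite -(cj_id (cs j)) -cj_add -cj_add.
rewrite !lin; have b0: 0 <= qform (trm (cj (vmat (cs j)) (blk j))) z'.
 by rewrite qform_trm; apply: sumr_ge0=> d _; apply: IH; apply: ltnW.
have h2 := x2 (_ : (j <= r)%N) z'0; have {}h2 := h2 jr; have h3 := qform_trm_id z'0.
set q1 := qform (trm (fun _ _=> _ * 1)) _ in h3 *.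
have cc: c j = c j.+1 + 2*eta by rewrite /c (subSn (ltnW jr)); ring.
have : 2*eta*nsq z' <= 2*eta * q1 by rewrite ler_pM2l// mulr_gt0.
by rewrite cc; lra.
Qed.
Lemma y_psd j z : (j <= r.+1)%N -> 0 <= qform (y j) z.
move=> jr; rewrite qform_add qform_add qform_id; have := x1 z jr; have := blk_psd z jr.
have : 2*eta*nsq z <= c j*nsq z.
 by rewrite ler_wpM2r ?nsq_ge0// ler_peMr ?ler1n ?subn_gt0// mulr_ge0// ltW.
lra.
Qed.
Lemma y_diag j p : (j <= r.+1)%N -> x j p p <= y j p p.
move=> jr; have := blk_psd (fun q=> (q == p)%:R) jr; rewrite qform_delta /y /xs eqxx mul1r.
have : 0 <= c j by rewrite mulr_ge0// mulr_ge0// ltW.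
lra.
Qed.
Fixpoint chain D Ps k s0 : qstate N D :=
 if k is k'.+1 then @apply_prover nv nm D (Ps k') (apply_circuit (cs k') (chain Ps k' s0)) else s0.
Lemma chain_lin D (Ps : nat -> prover_op nm D) k a s s' : chain Ps k (lin a s s') = lin a (chain Ps k s) (chain Ps k s').
by elim: k=> //= k ->; rewrite apply_circuit_lin prover_lin. Qed.
Lemma chain_nrm D (Ps : nat -> prover_op nm D) k s : (forall j, unitary (Ps j)) -> nrm2 (chain Ps k s) = nrm2 s.
by move=> H; elim: k=> //= k IH; rewrite nrm2_prover// nrm2_circuit. Qed.
Definition acc0 D (psi : qstate N D) : R := \sum_(b | getq 0 b) \sum_e normsq (psi b e).
Lemma acc0_prover D U (psi : qstate N D) : unitary U -> acc0 (@apply_prover nv nm D U psi) = acc0 psi.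
move=> HU; have E (phi : qstate N D) : (2 ^ nm)%:R*(acc0 phi)%:C%C = \sum_(b | getq 0 b) gram phi b b.
 rewrite -(rmorph_nat (real_complex R)) -rmorphM /acc0 big_mkcond -sum_setm rmorph_sum [RHS]big_mkcond; apply: eq_bigr=> b _.
 have q0 d: getq 0 (setm b d) = getq 0 b by rewrite getq_setm.
 under eq_bigr do rewrite q0.
 case: ifP=> _; last by rewrite big1.
 by rewrite pair_big rmorph_sum; apply: eq_bigr=> -[d e] _/=; exact: normsqE.
have h: (2 ^ nm)%:R*(acc0 (@apply_prover nv nm D U psi))%:C%C = (2 ^ nm)%:R*(acc0 psi)%:C%C.
 by rewrite !E; apply: eq_bigr=> b _; apply: gram_prover.
have n0: (2 ^ nm)%:R != 0 :> C by rewrite pnatr_eq0 -lt0n expn_gt0.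
by have /complexI := mulfI n0 h.
Qed.
Lemma acc0_le D (psi : qstate N D) : acc0 psi <= nrm2 psi.
rewrite /nrm2 (bigID (fun b : basis N=> getq 0 b)) lerDl; apply: sumr_ge0=> b _; apply: sumr_ge0=> e _; apply: normsq_ge0.
Qed.
Lemma nrm2_init D : nrm2 (@init_state nv nm D) = 1.
rewrite /nrm2 (bigD1 (zreg N))//= [X in _ + X]big1=>[|b b0]; last first.
 apply: big1=> e _; rewrite /init_state; case: ifP=> [/andP[/forallP H _]|_]; last by rewrite /normsq expr0n addr0.
 by case/eqP: b0; apply/ffunP=> j; rewrite ffunE; apply/eqP.
rewrite (bigD1 ord0)//= big1 ?addr0=>[|e e0]; last by rewrite /init_state (negbTE e0) andbF /normsq expr0n addr0.
rewrite /init_state andbT; case: ifP=>[_|/negP[]]; first by rewrite /normsq expr1n expr0n addr0.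
by apply/forallP=> j; rewrite ffunE.
Qed.
Lemma sum_nar (K : nmodType) n m (f : nat -> K) : (n <= m)%N -> \sum_(e < m) (if (e < n)%N then f e else 0) = \sum_(e < n) f e.
by move=> nm'; rewrite (big_ord_widen m f nm') [RHS]big_mkcond. Qed.
(** The repaired matrices are factored into states, consecutive states are joined by [uhlmann], and
    the resulting prover is run on the true initial state. The repaired initial state differs from
    it by a vector of squared norm [4 * eta * r.+2%:R * (2 ^ N)%:R]; [t] is the free weight of
    [normsq_add]. *)
Theorem sdp_sound a t : 0 < t -> a - 2 * eta <= \sum_(p : T | getq 0 p.1) x r.+1 p p ->
 exists D Ps, (forall j, unitary (Ps j)) /\
  a - 2 * eta - t - (1 + t^-1) * (4 * eta * r.+2%:R * (2 ^ N)%:R) <= acc0 (apply_circuit (cs r) (chain Ps r (@init_state nv nm D))).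
move=> t0 obj; pose D := #|{: T}|; exists D.
have [u Hu] : exists u : nat -> nat -> T -> R, forall j, (j <= r.+1)%N -> forall p q, y j p q = \sum_(e < #|{: T}|) u j e p*u j e q.
 suff: forall k, (k <= r.+2)%N -> exists u : nat -> nat -> T -> R, forall j, (j < k)%N -> forall p q, y j p q = \sum_(e < #|{: T}|) u j e p*u j e q.
  by move=> /(_ r.+2 (leqnn _)) [u Hu]; exists u=> j jr; apply: Hu.
 elim=> [|k IH] kr; first by exists (fun _ _ _=> 0).
 have [u1 H1] := IH (ltnW kr); have [u2 H2] := psd_factor_fin (y_sym k) (fun z=> y_psd z (kr : (k <= r.+1)%N)).
 exists (fun j=> if j == k then u2 else u1 j)=> j; rewrite ltnS leq_eqVlt; case: eqP=>[-> _|_/= jk]; [exact: H2 | exact: H1].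
pose Psi j : qstate N D := fun b e=> cxv (fun p=> if (e < #|{: T}|)%N then u j e p else 0) b.
(* Prover dimension 0 holds the exact initial state and the others purify the added multiple of the
   identity, so that [Phi] is near the initial state; [Psi 0] has the same reduced matrix but need
   not be near it. *)
pose Phi : qstate N D := fun b e=> if e == ord0 then (b == zreg N)%:R else
 if (e.-1 < #|{: basis N}|)%N then ((Num.sqrt (2*c 0))%:C%C*(b == nth (zreg N) (enum {: basis N}) e.-1)%:R) else 0.
have fam j: (j <= r.+1)%N -> forall p q, \sum_(e < D.+1) (if (e < #|{: T}|)%N then u j e p else 0)*(if (e < #|{: T}|)%N then u j e q else 0) = y j p q.
 move=> jr p q; rewrite Hu// -(@sum_nar _ #|{: T}| D.+1 (fun e=> u j e p*u j e q)) ?leqnSn//.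
 by apply: eq_bigr=> e _; case: ifP; rewrite ?mulr0.
have gramV j: (j <= r)%N -> forall b b', gram (apply_circuit (cs j) (Psi j)) b b' = gram (Psi j.+1) b b'.
 move=> jr b b'; rewrite !gram_dens cx_circuit.
 have gE A: \sum_d cxm A (setm b d) (setm b' d) = cxm (trm A) b b'.
  by rewrite /cxm -!big_split -sumrB -sumC.
 under eq_bigr=> d _ do rewrite dens_cx; under [RHS]eq_bigr=> d _ do rewrite dens_cx.
 rewrite !gE; congr cxm; funext p; funext q.
 rewrite [RHS](_ : _ = trm (y j.+1) p q); last by apply: eq_bigr=> d _; rewrite fam.
 rewrite y_tr; apply: eq_bigr=> d _; under eq_bigr=> e _ do rewrite !rcircE big_distrlr/=.
 rewrite exchange_big; apply: eq_bigr=> k _; rewrite exchange_big; apply: eq_bigr=> l _/=.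
 rewrite -(fam j (leqW jr)) mulr_sumr mulr_suml; apply: eq_bigr=> e _; ring.
have cT: (#|{: basis N}| <= D)%N by rewrite /D card_prod card_bool leq_pmulr.
have nthE (b : basis N) (k : 'I_#|{: basis N}|) : (b == nth (zreg N) (enum {: basis N}) k) = (enum_rank b == k).
 by rewrite -(enum_val_nth (A := {: basis N}) (zreg N) k) -{1}(enum_rankK b) (inj_eq enum_val_inj).
have c0: 0 <= c 0 by rewrite mulr_ge0// mulr_ge0// ltW.
have densPhi b b': dens Phi b b' = dens (Psi 0) b b'.
 rewrite dens_cx (_ : (fun p q=> \sum_e _) = y 0); last first.
  by funext p; funext q; rewrite -fam.
 rewrite /dens big_ord_recl (eq_bigr (fun e : 'I_D => if (e < #|{: basis N}|)%N then ((2*c 0)%:C%C*((b == nth (zreg N) (enum {: basis N}) e)%:R*(b' == nth (zreg N) (enum {: basis N}) e)%:R)) else 0)); last first.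
  move=> e _; rewrite /Phi; case: ifP=> _; last by rewrite mul0r.
  by rewrite rmorphM/= conjC_nat mulrACA -normsqE /normsq expr0n addr0 sqr_sqrtr// mulr_ge0.
 rewrite (sum_nar (fun e=> _ * ((b == nth _ _ e)%:R*(b' == nth _ _ e)%:R)) cT) -mulr_sumr.
 under eq_bigr=> k _ do rewrite !nthE.
 rewrite (eq_bigr (fun k=> (k == enum_rank b)%:R*(enum_rank b' == k)%:R)); last by move=> k _; rewrite eq_sym.
 rewrite sum_delta (inj_eq enum_rank_inj) /Phi conjC_nat /cxm /y /xs x0 /xinit !xpair_eqE eq_sym; apply/eqP; rewrite eq_complex; case: (eqVneq b b')=>[<-|bb]/=.
  by rewrite [zreg N == b]eq_sym; case: (b == zreg N); apply/andP; split; apply/eqP; rewrite/=; field.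
 rewrite [zreg N == b]eq_sym; have -> : (b == zreg N)%:R*(b' == zreg N)%:R = 0 :> C.
  by case: (eqVneq b (zreg N)) bb=>[->|_] bb; rewrite ?mul0r// eq_sym (negbTE bb) mulr0.
 by apply/andP; split; apply/eqP; rewrite/=; ring.
have [Ps HPs] : exists Ps : nat -> prover_op nm D, (forall j, unitary (Ps j)) /\ forall j, (j <= r)%N ->
  @apply_prover nv nm D (Ps j) (apply_circuit (cs j) (if j == 0 then Phi else Psi j)) = Psi j.+1.
 suff: forall k, (k <= r.+1)%N -> exists Ps : nat -> prover_op nm D, (forall j, unitary (Ps j)) /\ forall j, (j < k)%N ->
   @apply_prover nv nm D (Ps j) (apply_circuit (cs j) (if j == 0 then Phi else Psi j)) = Psi j.+1.
  by move=> /(_ r.+1 (leqnn _)).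
 elim=> [|k IH] kr; first by exists (fun _ i j=> (i == j)%:R); split=>// _; apply: unit_id.
 have [P1 [H1 H1']] := IH (ltnW kr).
 have [|U HU EU] := @uhlmann nv nm D (apply_circuit (cs k) (if k == 0 then Phi else Psi k)) (Psi k.+1).
  move=> b b'; rewrite -gramV//; case: eqP=>[->|//]; rewrite !gram_dens; apply: eq_bigr=> d _; exact: dens_circuit.
 exists (fun j=> if j == k then U else P1 j); split=> [j|j]; first by case: eqP.
 by rewrite ltnS leq_eqVlt; case: eqVneq=>[-> _|_/= jk]; [exact: EU | exact: H1'].
case: HPs=> HPs EPs; exists Ps; split=>//.
have chainPhi: chain Ps r.+1 Phi = Psi r.+1.
 suff: forall k, (k <= r)%N -> chain Ps k.+1 Phi = Psi k.+1 by apply.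
 by elim=> [|k IH] kr; [exact: EPs | rewrite [LHS]/= -/(chain Ps k.+1 Phi) IH ?(ltnW kr)//; exact: EPs].
have accPsi: a - 2*eta <= acc0 (Psi r.+1).
 apply: le_trans obj _; apply: le_trans; first by apply: ler_sum=> p _; apply: y_diag.
 rewrite le_eqVlt; apply/orP; left; apply/eqP; rewrite big_mkcond sum_T [RHS]big_mkcond; apply: eq_bigr=> b _/=.
 case: ifP=> _; last by rewrite addr0.
 by rewrite -!fam// -big_split.
rewrite -(acc0_prover _ (HPs r)); pose init := @init_state nv nm D.
pose dl : qstate N D := fun b e=> Phi b e - init b e.
have EPhi: Phi = lin 1 init dl by funext b; funext e; rewrite /lin mul1r addrC subrK.
have ndl: nrm2 dl = 4*eta * r.+2%:R*(2 ^ N)%:R.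
 rewrite /nrm2 (eq_bigr (fun=> 2*c 0)); last first.
  move=> b _; rewrite big_ord_recl (_ : normsq _ = 0); last first.
   rewrite /dl /Phi /init /init_state/= (_ : [forall j, b j == false] = (b == zreg N)); first by case: eqP=> _; rewrite subrr /normsq expr0n addr0.
   by apply/forallP/eqP=>[H|-> j]; [apply/ffunP=> j; rewrite ffunE; apply/eqP | rewrite ffunE].
  rewrite add0r (eq_bigr (fun e : 'I_D => if (e < #|{: basis N}|)%N then 2*c 0*(b == nth (zreg N) (enum {: basis N}) e)%:R else 0)); last first.
   move=> e _; rewrite /dl /Phi /init /init_state andbF subr0; case: ifP=> _; last by rewrite /normsq expr0n addr0.
   by rewrite normsqM normsq_bool /normsq expr0n addr0 sqr_sqrtr// mulr_ge0.
  rewrite (sum_nar (fun e=> 2*c 0*(b == nth (zreg N) (enum {: basis N}) e)%:R) cT).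
  under eq_bigr=> k _ do rewrite nthE eq_sym.
  by rewrite sum_dl.
 rewrite sumr_const card_ffun card_bool card_ord /c subn0; ring.
have : acc0 (Psi r.+1) <= (1 + t)*acc0 (chain Ps r.+1 init) + (1 + t^-1)*nrm2 dl.
 rewrite -chainPhi EPhi chain_lin -(chain_nrm r.+1 dl HPs).
 apply: (@le_trans _ _ ((1 + t)*acc0 (chain Ps r.+1 init) + (1 + t^-1)*acc0 (chain Ps r.+1 dl))).
  rewrite !mulr_sumr -big_split; apply: ler_sum=> b _; rewrite !mulr_sumr -big_split; apply: ler_sum=> e _/=.
  by rewrite /lin mul1r; apply: normsq_add.
 by rewrite lerD2l ler_wpM2l ?acc0_le// addr_ge0// invr_ge0 ltW.
have : t*acc0 (chain Ps r.+1 init) <= t.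
 rewrite ler_piMr ?(ltW t0)//; apply: le_trans (acc0_le _) _; by rewrite chain_nrm// nrm2_init.
rewrite ndl; lra.
Qed.
End Chain.
End Sound.

(** * From a prover to an exact solution *)

Section Complete.
Variables nv nm D : nat.
Let N := (nv.+1 + nm)%N.
Let T := (basis N * bool)%type.
Implicit Types (psi : qstate N D) (p q : T).
(* The real vectors of psi (g = false) and of i * psi (g = true); averaging over both makes the
  real Gram matrix a function of the complex one. *)
Definition rv psi e g p : R :=
 if g then (if p.2 then complex.Re (psi p.1 e) else - complex.Im (psi p.1 e))
 else if p.2 then complex.Im (psi p.1 e) else complex.Re (psi p.1 e).
Definition xst psi p q : R := 2^-1 * \sum_e \sum_g rv psi e g p * rv psi e g q.
Definition mxc (z : C) (v v' : bool) : R := if v == v' then complex.Re z else if v then complex.Im z else - complex.Im z.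
Lemma rv_gate g psi e s : rgate g (rv psi e s) = rv (apply_gate g psi) e s.
case: g=>[i j k|i|i]/=; case: ifP=> // _; apply: functional_extensionality=> -[b v]; rewrite /rv.
- case: (psi (setq i false b) e)=> x1 y1; case: (psi (setq i true b) e)=> x2 y2.
 by case: getq; case: s; case: v=> /=; ring.
- case: psi=> x1 y1; by case: getq; case: s; case: v=> /=; ring.
Qed.
Lemma rv_circuit c psi e s : rcirc c (rv psi e s) = rv (apply_circuit c psi) e s.
by elim: c psi=> //= g c IH psi; rewrite rv_gate. Qed.
Lemma xst_circuit c psi p q : cj (vmat c) (xst psi) p q = xst (apply_circuit c psi) p q.
rewrite /xst mulr_sumr; under [RHS]eq_bigr=> e _ do rewrite mulr_sumr; under [RHS]eq_bigr=> e _ do under eq_bigr=> g _ do rewrite -!rv_circuit !rcircE big_distrlr/= mulr_sumr.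
under [RHS]eq_bigr=> e _ do rewrite exchange_big/=.
rewrite exchange_big; apply: eq_bigr=> k _.
under [RHS]eq_bigr=> e _ do under eq_bigr=> g _ do rewrite mulr_sumr.
under [RHS]eq_bigr=> e _ do rewrite exchange_big/=.
rewrite exchange_big; apply: eq_bigr=> l _; rewrite mulr_sumr mulr_sumr mulr_suml; apply: eq_bigr=> e _.
by rewrite !mulr_sumr mulr_suml; apply: eq_bigr=> g _; ring.
Qed.
Lemma ReIm_sum (J : finType) (f : J -> C) : \sum_j f j = Complex (\sum_j complex.Re (f j)) (\sum_j complex.Im (f j)).
by rewrite -sumC; apply: eq_bigr=> j _; case: f. Qed.
Lemma mxc_sum (J : finType) (f : J -> C) v v' : mxc (\sum_j f j) v v' = \sum_j mxc (f j) v v'.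
by rewrite ReIm_sum; case: v; case: v'=> //=; rewrite sumrN. Qed.
Lemma xst_dens psi p q : xst psi p q = 2^-1 * mxc (dens psi p.1 q.1) p.2 q.2.
congr (_ * _); rewrite mxc_sum; apply: eq_bigr=> e _; rewrite big_bool /mxc.
case: p=> b v; case: q=> b' v'/=; case: (psi b e)=> x y; case: psi=> x' y'.
by case: v; case: v'=> /=; ring.
Qed.
Lemma trm_xst psi p q : trm (xst psi) p q = 2^-1 * mxc (gram psi p.1 q.1) p.2 q.2.
by rewrite gram_dens mxc_sum mulr_sumr; apply: eq_bigr=> c _; rewrite xst_dens. Qed.
Lemma trm_prover U psi p q : unitary U -> trm (xst (@apply_prover nv nm D U psi)) p q = trm (xst psi) p q.
by move=> HU; rewrite !trm_xst gram_prover. Qed.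
Lemma xst_sym psi p q : xst psi p q = xst psi q p.
by congr (_ * _); apply: eq_bigr=> e _; apply: eq_bigr=> g _; rewrite mulrC. Qed.
Lemma xst_psd psi z : 0 <= qform (xst psi) z.
have -> : qform (xst psi) z = 2^-1 * \sum_e \sum_g (\sum_p z p * rv psi e g p) ^+ 2.
 rewrite /xst mulr_sumr; under [RHS]eq_bigr=> e _ do rewrite mulr_sumr; under [RHS]eq_bigr=> e _ do under eq_bigr=> g _ do rewrite expr2 big_distrlr/= mulr_sumr.
 under [RHS]eq_bigr=> e _ do rewrite exchange_big/=.
 rewrite exchange_big; apply: eq_bigr=> k _.
 under [RHS]eq_bigr=> e _ do under eq_bigr=> g _ do rewrite mulr_sumr.
 under [RHS]eq_bigr=> e _ do rewrite exchange_big/=.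
 rewrite exchange_big; apply: eq_bigr=> l _; rewrite mulr_sumr mulr_sumr mulr_suml; apply: eq_bigr=> e _.
 by rewrite !mulr_sumr mulr_suml; apply: eq_bigr=> g _; ring.
by rewrite mulr_ge0 ?invr_ge0// sumr_ge0// => e _; apply: sumr_ge0=> g _; apply: sqr_ge0.
Qed.
Lemma rv_sq psi e p : \sum_g rv psi e g p ^+ 2 = normsq (psi p.1 e).
by rewrite big_bool /rv; case: p.2; rewrite ?sqrrN//; exact: addrC. Qed.
(** Keeps the unknowns inside the cube searched by the simplex method. *)
Lemma xst_bound psi p q : nrm2 psi <= 1 -> `|xst psi p q| <= 2^-1.
move=> n1; have S p': \sum_e \sum_g rv psi e g p' ^+ 2 <= 1.
 under eq_bigr=> e _ do rewrite rv_sq.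
 apply: le_trans n1; rewrite /nrm2 (bigD1 p'.1)//= lerDl; apply: sumr_ge0=> b _; apply: sumr_ge0=> e _; exact: normsq_ge0.
rewrite normrM ger0_norm ?invr_ge0// ler_piMr ?invr_ge0//.
apply: le_trans (ler_norm_sum _ _ _) _.
apply: (@le_trans _ _ (2^-1*(\sum_e \sum_g rv psi e g p ^+ 2 + \sum_e \sum_g rv psi e g q ^+ 2))); last first.
 by have := S p; have := S q; lra.
rewrite -big_split mulr_sumr; apply: ler_sum=> e _/=; rewrite -big_split mulr_sumr.
apply: le_trans (ler_norm_sum _ _ _) _; apply: ler_sum=> g _/=; rewrite normrM.
have := sqr_ge0 (`|rv psi e g p| - `|rv psi e g q|); rewrite sqrrB !real_normK ?num_real// => h; lra.
Qed.
Lemma xst_init : xst (@init_state nv nm D) = @xinit nv nm.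
funext p; funext q; rewrite xst_dens /xinit.
have E b e: @init_state nv nm D b e = ((b == zreg N) && (e == ord0))%:R.
 rewrite /init_state (_ : [forall j, b j == false] = (b == zreg N)); first by case: ifP.
 by apply/forallP/eqP=>[H|-> j]; [apply/ffunP=> j; rewrite ffunE; apply/eqP | rewrite ffunE].
have -> : dens (@init_state nv nm D) p.1 q.1 = ((p.1 == zreg N) && (q.1 == zreg N))%:R.
 rewrite /dens big_ord_recl big1 ?addr0=>[|e _]; last by rewrite E andbF mul0r.
 by rewrite !E !andbT conjC_nat -natrM mulnb.
case: p=> b v; case: q=> b' v'/=; rewrite xpair_eqE mulrC.
case: (eqVneq b (zreg N))=>[->|b0]; last by rewrite andbF /mxc; case: v; case: v'=> //=; rewrite oppr0.
rewrite [zreg N == b']eq_sym; by case: (b' == _); rewrite /mxc; case: v; case: v'=> //=; rewrite oppr0.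
Qed.
Lemma xst_acc psi : \sum_(p : T | getq 0 p.1) xst psi p p = acc0 psi.
rewrite big_mkcond sum_T [RHS]big_mkcond; apply: eq_bigr=> b _/=; case: ifP=> _; last by rewrite addr0.
rewrite -mulrDr -big_split mulr_sumr; apply: eq_bigr=> e _/=.
by rewrite !rv_sq; field.
Qed.
Theorem sdp_complete r cs Ps a : (forall j, unitary (Ps j)) ->
 a <= acc0 (apply_circuit (cs r) (chain cs Ps r (@init_state nv nm D))) ->
 exists x : nat -> T -> T -> R, [/\ (forall j p q, x j p q = x j q p) /\ x 0%N = @xinit nv nm,
  forall j p q, `|x j p q| <= 2^-1, forall j z, 0 <= qform (x j) z,
  forall j p q, trm (cj (vmat (cs j)) (x j)) p q = trm (x j.+1) p q & a <= \sum_(p : T | getq 0 p.1) x r.+1 p p].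
exists (fun j=> xst (chain cs Ps j (@init_state nv nm D))); split.
- by split=> [j p q|]; [exact: xst_sym | exact: xst_init].
- by move=> j p q; apply: xst_bound; rewrite chain_nrm// nrm2_init.
- by move=> j z; apply: xst_psd.
- move=> j p q; rewrite trm_prover//; apply: eq_bigr=> c _; exact: xst_circuit.
- by rewrite xst_acc acc0_prover.
Qed.
End Complete.
Section Final.
Variables nv nm D : nat.
(** When the prover speaks first, an empty verifier circuit is put in front, so that both parities
    become the same alternation starting with the verifier. *)
Definition cseq m (Vs : seq (seq gate)) j := nth [::] (if odd m then [::] :: Vs else Vs) j.
Lemma final_chain m Vs Ps :
 @final_state nv nm D m Vs Ps = apply_circuit (cseq m Vs (uphalf m)) (chain (cseq m Vs) Ps (uphalf m) (@init_state nv nm D)).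
rewrite /final_state /cseq; case: odd.
 elim: uphalf=>[|k IH]//; rewrite -[k.+1]addn1 iotaD foldl_cat IH addn1//.
congr (apply_circuit); elim: uphalf=>[|k IH]//; by rewrite -[k.+1]addn1 iotaD foldl_cat IH addn1.
Qed.
Lemma accept_acc0 m Vs Ps :
 @accept_prob nv nm D m Vs Ps = acc0 (apply_circuit (cseq m Vs (uphalf m)) (chain (cseq m Vs) Ps (uphalf m) (@init_state nv nm D))).
by rewrite -final_chain. Qed.
End Final.

(** * Deciding a gap in exponential time *)
Local Close Scope ring_scope.
Lemma pt_iter_bd (E S : encT) f s0 (n : E -> nat) :
 ptime (fun x : E * S => f x.1 x.2) -> ptime s0 -> ptime n ->
 (exists2 T, pol T & forall e s, esz (f e s) <= T (esz e)) ->
 ptime (fun e => iter (n e) (f e) (s0 e)).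
move=> F S0 HN [T pT HT]; apply: pt_iter=> //; have [k Hk] := pt_szb S0.
exists (fun n=> T n + (n + 2) ^ k); first by auto 15 with pol.
move=> e [|i] il; first by apply: leq_trans (Hk e) _; rewrite leq_addl.
by apply: leq_trans (HT _ _) _; rewrite leq_addr.
Qed.
(** Powers of two are unary numbers here; cutting them at the padding [cap] keeps them polynomial,
    and [cap] is later large enough for the cut never to occur. *)
Definition pw cap e := iter e (fun a => if a + a <= cap then a + a else cap) 1.
Definition hf o := (iter o (fun p : nat * bool => if p.2 then (p.1.+1, false) else (p.1, true)) (0, false)).1.
Definition od o := iter o negb false.
(** In an index of a real coordinate, bit 0 tells the real from the imaginary part and bit [i + 1]
    is qubit [i], whence the shift by one. *)
Definition bt i o := od (iter i.+1 hf o).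
Definition sb cap i (v : bool) o := o + v * pw cap i.+1 - bt i o * pw cap i.+1.
Lemma hfE o : hf o = o./2.
rewrite /hf; have : iter o (fun p : nat*bool=> if p.2 then (p.1.+1, false) else (p.1, true)) (0, false) = (o./2, odd o).
 by elim: o=> //= o ->; case H : odd; rewrite uphalf_half H.
by move=> ->.
Qed.
Lemma odE o : od o = odd o. by []. Qed.
Lemma pwE cap e : 2 ^ e <= cap -> pw cap e = 2 ^ e.
elim: e=> // e IH H; have h: 2 ^ e <= cap by apply: leq_trans H; rewrite leq_exp2l.
by rewrite /pw iterS -/(pw cap e) IH// addnn -mul2n -expnS H.
Qed.
Lemma pt_pw (E : encT) (c e : E -> nat) : ptime c -> ptime e -> ptime (fun x => pw (c x) (e x)).
move=> HC He; apply: pt_iter; pt.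
have [k Hk] := pt_szb HC; exists (fun n=> (n + 2) ^ k + 3); first by auto 15 with pol.
move=> x i _; apply: (@leq_trans (esz (c x) + 3)); last by rewrite leq_add2r.
have : iter i (fun a=> if a + a <= c x then a + a else c x) 1 <= c x + 1.
 elim: i=>[|i IH]; first by rewrite/=; lia.
 by rewrite iterS; move: (iter i _ _) IH=> z IH; case: (leqP (z + z) (c x))=> h; lia.
by move: (iter _ _ _)=> a ha; rewrite !esz_nat; lia.
Qed.
Lemma pt_hf (E : encT) (o : E -> nat) : ptime o -> ptime (fun x => hf (o x)).
move=> O; apply: pt_fst; apply: pt_iter_le; pt.
exists 3=> e [a b].
have h1 := esz_bool true; have h2 := esz_bool false.
by case: b; rewrite [_.1]/= !esz_pair ?esz_S; lia.
Qed.
Lemma pt_od (E : encT) (o : E -> nat) : ptime o -> ptime (fun x => od (o x)).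
move=> O; apply: pt_iter_bd; pt.
by exists (fun _=> 3); [auto with pol | move=> e s; apply: esz_bool].
Qed.
Lemma pt_bt (E : encT) (i o : E -> nat) : ptime i -> ptime o -> ptime (fun x => bt (i x) (o x)).
move=> I O; apply: pt_od; apply: pt_iter; pt; first by apply: pt_hf; pt.
have [k Hk] := pt_szb O; exists (fun n=> (n + 2) ^ k); first by auto 15 with pol.
move=> x j _; apply: leq_trans (Hk x); elim: j=> // j IH; rewrite iterS hfE; apply: leq_trans IH; rewrite !esz_nat; lia.
Qed.
Lemma pt_b2 (E : encT) (b : E -> bool) : ptime b -> ptime (fun x => nat_of_bool (b x)).
by move=> B; apply: (@pt_ext _ _ (fun x=> if b x then 1 else 0))=>[e|]; [case: (b e) | pt]. Qed.
Lemma pt_sb (E : encT) (c i o : E -> nat) (v : E -> bool) : ptime c -> ptime i -> ptime o -> ptime v -> ptime (fun x => sb (c x) (i x) (v x) (o x)).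
move=> HC I O V; rewrite /sb; have P: ptime (fun x=> pw (c x) (i x).+1) by apply: pt_pw; pt.
have B := pt_b2 (pt_bt I O); have V' := pt_b2 V; pt.
Qed.

(** * Indices of basis states *)

Section Index.
Variable N : nat.
Let T := (basis N * bool)%type.
Definition tw (p : T) : seq bool := p.2 :: mkseq (fun i => getq i p.1) N.
Definition tO p := b2n (tw p).
Lemma size_tw p : size (tw p) = N.+1. by rewrite/= size_mkseq. Qed.
Lemma bit_b2n w i : odd (iter i half (b2n w)) = nth false w i.
elim: w i=>[|b w IH] i; first by rewrite (_ : iter i half _ = 0); elim: i=> //= i ->.
by case: i=>[|i]/=; [rewrite oddD odd_double addbF oddb | rewrite -iterS iterSr half_bit_double].
Qed.
Lemma b2n_set w i v : i < size w -> b2n (set_nth false w i v) + nth false w i * 2 ^ i = b2n w + v * 2 ^ i.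
elim: w i=> // b w IH [|i] iw/=; first by lia.
by have := IH i iw; rewrite expnS; lia.
Qed.
Lemma btE i p : i < N -> bt i (tO p) = getq i p.1.
by move=> iN; rewrite /bt odE (eq_iter hfE) bit_b2n/= nth_mkseq. Qed.
Lemma sbE cap i v p : i < N -> 2 ^ N.+1 <= cap -> sb cap i v (tO p) = tO (setq i v p.1, p.2).
move=> iN H; rewrite /sb btE// pwE; last by apply: leq_trans H; rewrite leq_exp2l//; exact: ltnW.
have -> : tO (setq i v p.1, p.2) = b2n (set_nth false (tw p) i.+1 v).
 congr b2n; apply: (@eq_from_nth _ false); first by rewrite size_set_nth !size_tw; lia.
 move=> k; rewrite size_tw nth_set_nth=> kN/=; case: k kN=>[|k] kN//=.
 by rewrite !nth_mkseq// getq_setq.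
have := @b2n_set (tw p) i.+1 v; rewrite size_tw=>/(_ iN).
have -> : nth false (tw p) i.+1 = getq i p.1 by rewrite/= nth_mkseq.
by rewrite -/tO=> <-; rewrite addnK.
Qed.
Lemma tO_odd p : odd (tO p) = p.2.
by rewrite oddD odd_double addbF oddb. Qed.
Lemma tO_bool b v : tO (b, v) = v + tO (b, false). by []. Qed.
Lemma tO_lt p : tO p < 2 ^ N.+1. by rewrite -(size_tw p) b2n_lt. Qed.
Lemma tO_inj : injective tO.
move=> p q E; have H i: nth false (tw p) i = nth false (tw q) i by rewrite -!bit_b2n -/(tO p) E.
case: p q E H=> b v [b' v'] E H; have -> : v = v' by apply: (H 0).
congr (_, _); apply: basis_eq=> i iN; have := H i.+1; by rewrite/= !nth_mkseq.
Qed.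
Local Open Scope ring_scope.
Lemma sum_tO (K : nmodType) (f : nat -> K) : \sum_(o < 2 ^ N.+1) f o = \sum_(p : T) f (tO p).
pose h p := Ordinal (tO_lt p); rewrite (reindex h)//=; apply: onW_bij; apply: inj_card_bij.
 by move=> p q /(congr1 val)/= /tO_inj.
by rewrite card_ord card_prod card_ffun card_bool card_ord expnS mulnC.
Qed.
End Index.

(** * Integer simulation of circuits *)

Section Simulate.
Variables (cap N wd : nat).
Definition gate_of g : gate := if nth 0 g 0 == 1 then Tof (nth 0 g 1) (nth 0 g 2) (nth 0 g 3)
 else if nth 0 g 0 == 2 then Had (nth 0 g 1) else Ph (nth 0 g 1).
Definition had g := (nth 0 g 0 == 2) && (nth 0 g 1 < N).
(** A Hadamard gate is applied without its factor [1 / sqrt 2], so that all numbers remain integers.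
    The missing factors are counted by [hads] and come in pairs whenever two entries of the same
    matrix are multiplied. *)
Definition newv (U : seq int) g o : int := let i := nth 0 g 1 in let j := nth 0 g 2 in let k := nth 0 g 3 in
 if nth 0 g 0 == 1 then
  (if [&& (i < N), (j < N), (k < N), i != j, j != k & i != k] then nth 0%R U (if bt i o && bt j o then sb cap k (~~ bt k o) o else o) else nth 0%R U o)
 else if (i < N) then
  (if nth 0 g 0 == 2 then (nth 0 U (sb cap i false o) + (if bt i o then - nth 0 U (sb cap i true o) else nth 0 U (sb cap i true o)))%R
   else (if bt i o then (if od o then nth 0%R U o.-1 else (- nth 0 U o.+1)%R) else nth 0%R U o))
 else nth 0%R U o.
Definition rgz U g : seq int := mkseq (fun o => clampz wd (newv U g o)) (size U).
Definition colz s c o0 := foldl rgz (mkseq (fun o => Posz (o == o0)) s) c.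
End Simulate.
Section SimSpec.
Local Open Scope ring_scope.
Variables (cap N wd : nat).
Hypothesis capN : (2 ^ N.+1 <= cap)%N.
Let T := (basis N * bool)%type.
Definition s2 : R := Num.sqrt 2.
Lemma rgz_spec U g (u : T -> R) al k : size U = (2 ^ N.+1)%N -> (k.+1 < wd)%N -> (forall o, `|nth 0 U o| <= (2 ^ k)%:Z) ->
 (forall p, (nth 0 U (tO p))%:~R = al * u p) ->
 [/\ size (rgz cap N wd U g) = (2 ^ N.+1)%N, forall o, `|nth 0 (rgz cap N wd U g) o| <= (2 ^ k.+1)%:Z &
  forall p, (nth 0 (rgz cap N wd U g) (tO p))%:~R = al * s2 ^+ had N g * rgate (gate_of g) u p].
move=> sU kw bU vU.
have b1 o: `|nth 0 U o| <= (2 ^ k.+1)%:Z by apply: le_trans (bU o) _; rewrite lez_nat leq_exp2l.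
have b2 o o': `|nth 0 U o| + `|nth 0 U o'| <= (2 ^ k.+1)%:Z.
 by apply: le_trans (lerD (bU _) (bU _)) _; rewrite -PoszD addnn -mul2n -expnS.
have bn o: `|newv cap N U g o| <= (2 ^ k.+1)%:Z.
 rewrite /newv; repeat case: ifP=> ? //; rewrite ?normrN//.
  by apply: le_trans (ler_normB _ _) _.
 by apply: le_trans (ler_normD _ _) _.
have cl o: clampz wd (newv cap N U g o) = newv cap N U g o.
 rewrite /clampz (_ : (zlen (newv cap N U g o) <= wd)%N = true)//; apply: size_bits_le.
 have : (absz (newv cap N U g o) <= 2 ^ k.+1)%N by have := bn o.
 by move=> h; apply: leq_ltn_trans h _; rewrite ltn_exp2l.
have nE o: (o < 2 ^ N.+1)%N -> nth 0 (rgz cap N wd U g) o = newv cap N U g o.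
 by move=> oN; rewrite nth_mkseq ?sU.
split; first by rewrite size_mkseq.
 move=> o; case: (ltnP o (2 ^ N.+1))=> oN; first by rewrite nE.
 by rewrite nth_default ?size_mkseq ?sU.
have gU i (p : T) : (i < N)%N -> bt i (tO p) = getq i p.1 by apply: btE.
move=> p; rewrite nE ?tO_lt// /newv /gate_of /had; set i := nth 0 g 1.
case: eqP=>[->|_]; rewrite/=.
 rewrite mulr1; case: ifP=> // /and3P[iN jN /andP[mN _]].
 by rewrite !gU// /tofb; case: ifP=> _; rewrite ?sbE// -surjective_pairing.
case: eqP=> _; rewrite/=; case: ifP=> iN; rewrite ?mulr1//.
 rewrite gU// !sbE// intrD vU; have s0: s2 != 0 by rewrite gt_eqF// sqrtr_gt0.
 by case: (getq i p.1); rewrite ?rmorphN/= vU -/s2; field.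
rewrite gU// odE tO_odd; case: (getq i p.1)=> //; case: p=> b v/=.
by case: v; rewrite tO_bool ?rmorphN/= -1?[(tO (b, false)).+1]add1n -?(tO_bool b true) vU// mulrN.
Qed.
Definition hads c := count (had N) c.
Lemma colz_spec c q : (size c < wd)%N -> let U := colz cap N wd (2 ^ N.+1) c (tO q) in
 (forall o, `|nth 0 U o| <= (2 ^ size c)%:Z) /\ forall p : T, (nth 0 U (tO p))%:~R = s2 ^+ hads c * vmat (map gate_of c) p q.
rewrite /colz; elim/last_ind: c=>[|c g IH] cw.
 split=> [o|p]; last by rewrite nth_mkseq ?tO_lt// mul1r (inj_eq (@tO_inj N)).
 case: (ltnP o (2 ^ N.+1))=> oN; first by rewrite nth_mkseq//; case: eqP.
 by rewrite nth_default ?size_mkseq.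
rewrite size_rcons in cw; have [|b1 b2] := IH; first exact: ltnW.
have sz c': size (foldl (rgz cap N wd) (mkseq (fun o=> Posz (o == tO q)) (2 ^ N.+1)) c') = (2 ^ N.+1)%N.
 by elim/last_ind: c'=>[|c' g' IH']; rewrite ?size_mkseq// -cats1 foldl_cat size_mkseq.
have [e1 e2 e3] := rgz_spec g (sz c) cw b1 b2.
by rewrite -cats1 foldl_cat size_cat addn1 /hads count_cat/= addn0 exprD /vmat map_cat /rcirc foldl_cat.
Qed.
End SimSpec.
(** One step of [parse_circuits] on an explicit state, so that parsing becomes an iteration, a form
    covered by [ptime]. *)
Definition pstep x := let s := x.1.1 in
 if s is [::] then x else
 if head 0 s == 0 then (behead s, [::], rev x.1.2 :: x.2) else
 if (head 0 s == 1) && (3 < size s) then (drop 4 s, take 4 s :: x.1.2, x.2) else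
 if ((head 0 s == 2) || (head 0 s == 3)) && (1 < size s) then (drop 2 s, take 2 s :: x.1.2, x.2) else
 (behead s, x.1.2, x.2).
Definition pfin (r : seq nat * seq (seq nat) * seq (seq (seq nat))) := rev (rev r.1.2 :: r.2).
Definition parse s := pfin (iter (size s) pstep (s, [::], [::])).
Lemma parseE s : map (map gate_of) (parse s) = parse_circuits s [::].
have step0 n c d: iter n pstep ([::], c, d) = ([::], c, d) by elim: n=> //= n ->.
suff H n t c d: size t <= n -> map (map gate_of) (pfin (iter n pstep (t, c, d))) = map (map gate_of) (rev d) ++ parse_circuits t (map gate_of c).
 by rewrite H.
have base c' d': map (map gate_of) (pfin ([::], c', d')) = map (map gate_of) (rev d') ++ [:: rev (map gate_of c')].
 by rewrite /pfin rev_cons map_rcons -cats1 !map_rev.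
elim: n t c d=>[|n IH] t c d.
 by rewrite leqn0=>/eqP/size0nil ->; rewrite base.
case: t=>[|a t] st; first by rewrite step0.
rewrite iterSr; have st': size t <= n by [].
have dr k: size (drop k t) <= n by rewrite size_drop; lia.
case: a st=>[|[|[|[|a]]]] st.
- by rewrite IH//= rev_cons map_rcons cat_rcons !map_rev.
- case: t st st' dr=>[|i [|j [|k t]]] st st' dr; rewrite IH/= ?drop0//; by move: st'; rewrite/=; lia.
- case: t st st' dr=>[|i t] st st' dr; rewrite IH/= ?drop0//; by move: st'; rewrite/=; lia.
- case: t st st' dr=>[|i t] st st' dr; rewrite IH/= ?drop0//; by move: st'; rewrite/=; lia.
- by rewrite IH.
Qed.
Local Open Scope ring_scope.

(** * The matrix inequality attached to a verifier *)

Definition prs K s : seq (nat * nat) := [seq (b, o) | b <- iota 0 K, o <- iota 0 s].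
(** Unknown [(j, i, k)] contributes to the entries [(i, k)] and [(k, i)] of state [j + 1]; symmetry
    comes from adding two unknowns rather than from a constraint. *)
Definition trip r s : seq (nat * nat * nat) := [seq (ji, k) | ji <- prs r.+1 s, k <- iota 0 s].
Definition zb b : int := if b then 1 else 0.
Section Lists.
Variables (r s q M ell : nat) (num den : int) (mats : seq (seq (seq int))) (hs : seq nat).
Definition sel (i k o o' : nat) : int := zb ((o == i) && (o' == k)) + zb ((o == k) && (o' == i)).
Definition wen b o i := en (nth [::] mats b) i o.
(** Blocks [0..r] express positivity of the states, the next [r + 1] the inequalities between
    reduced states, the last one the acceptance probability. Each is multiplied by at least
    [2 ^+ ell] and shifted by the identity in [cst]: an exact solution is then at least the
    identity, and a value that is at least minus the identity violates the original constraint by at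
    most [2 / 2 ^+ ell]. *)
Definition cfX (j i k b o o' : nat) : int := if j == b then 2 ^+ ell * sel i k o o' else 0.
(** The exponent contains [hs] because a product of two matrix entries carries the factor [2 ^+ hs],
    and one more bit because the initial state has the factor 1/2. Message bits are the high bits of
    an index, so the sum over [o + q * c] is the partial trace. *)
Definition cfT (j i k b o o' : nat) : int := if (o < q)%N && (o' < q)%N then
  (if b == j.+1 then 2 ^+ ell.+1 * zsum M (fun c => wen b (o + q * c) i * wen b (o' + q * c) k + wen b (o + q * c) k * wen b (o' + q * c) i) else 0)
  - (if b == j then 2 ^+ (ell.+1 + nth 0%N hs b) * zsum M (fun c => sel i k (o + q * c) (o' + q * c)) else 0)
 else 0.
Definition cfO (j i k o o' : nat) : int := if [&& o == 0%N, o' == 0%N, j == r, i == k & bt 0 i] then 2 ^+ ell.+1 * den else 0.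
Definition coef t b o o' : int := let j := t.1.1 in let i := t.1.2 in let k := t.2 in
 if (b <= r)%N then cfX j i k b o o' else if (b <= r + r.+1)%N then cfT j i k (b - r.+1) o o' else cfO j i k o o'.
Definition cst (b o o' : nat) : int := zb (o == o') +
 (if b == r.+1 then if (o < q)%N && (o' < q)%N then 2 ^+ ell * zsum M (fun c => wen 0 (o + q * c) 0 * wen 0 (o' + q * c) 0 + wen 0 (o + q * c) 1 * wen 0 (o' + q * c) 1) else 0
  else if b == (r + r.+2)%N then if (o == 0%N) && (o' == 0%N) then - (2 ^+ ell * num) else 0 else 0).
Definition bmx (f : nat -> nat -> nat -> int) := let P := prs (r + r + 3) s in
 mx (size P) (size P) (fun a a' => let u := nth (0, 0)%N P a in let v := nth (0, 0)%N P a' in if u.1 == v.1 then f u.1 u.2 v.2 else 0).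
Definition lmiF : seq (seq (seq int)) := [seq bmx (coef t) | t <- trip r s] ++ [:: bmx cst].
Lemma coefX t b o o' : (b <= r)%N -> coef t b o o' = cfX t.1.1 t.1.2 t.2 b o o'.
by rewrite /coef=> ->. Qed.
Lemma coefT t j o o' : (j <= r)%N -> coef t (r.+1 + j) o o' = cfT t.1.1 t.1.2 t.2 j o o'.
move=> jr; rewrite /coef; have -> : (r.+1 + j <= r)%N = false by lia.
have -> : (r.+1 + j <= r + r.+1)%N by lia.
by rewrite addKn.
Qed.
Lemma coefO t o o' : coef t (r + r.+2) o o' = cfO t.1.1 t.1.2 t.2 o o'.
rewrite /coef; have -> : (r + r.+2 <= r)%N = false by lia.
by have -> : (r + r.+2 <= r + r.+1)%N = false by lia.
Qed.
Lemma cstX b o o' : (b <= r)%N -> cst b o o' = zb (o == o').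
move=> br; rewrite /cst; have -> : (b == r.+1) = false by lia.
have -> : (b == r + r.+2) = false by lia.
by lia.
Qed.
Lemma cstT j o o' : (j <= r)%N -> cst (r.+1 + j) o o' = zb (o == o') + (if j == 0%N then
 if (o < q)%N && (o' < q)%N then 2 ^+ ell * zsum M (fun c => wen 0 (o + q * c) 0 * wen 0 (o' + q * c) 0 + wen 0 (o + q * c) 1 * wen 0 (o' + q * c) 1) else 0 else 0).
move=> jr; rewrite /cst; have -> : (r.+1 + j == r.+1) = (j == 0) by lia.
by have -> : (r.+1 + j == r + r.+2) = false by lia.
Qed.
Lemma cstO o o' : cst (r + r.+2) o o' = zb (o == o') + (if (o == 0%N) && (o' == 0%N) then - (2 ^+ ell * num) else 0).
by rewrite /cst eqxx; have -> : (r + r.+2 == r.+1) = false by lia. Qed.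
End Lists.
Section Generic.
Variable K : rcfType.
Lemma sum_iota n (f : nat -> K) : \sum_(i <- iota 0 n) f i = \sum_(i < n) f i.
by rewrite -(big_mkord xpredT f) /index_iota subn0. Qed.
Lemma sum_seq_nth (A : eqType) a0 l (f : A -> K) : \sum_(i < size l) f (nth a0 l i) = \sum_(a <- l) f a.
by rewrite (big_nth a0) big_mkord. Qed.
Lemma sum_prs k s (f : nat * nat -> K) : \sum_(u <- prs k s) f u = \sum_(b < k) \sum_(o < s) f (b : nat, o : nat).
by rewrite big_allpairs_dep sum_iota; apply: eq_bigr=> b _; rewrite sum_iota. Qed.
Lemma sum_trip r s (f : nat * nat * nat -> K) : \sum_(t <- trip r s) f t = \sum_(j < r.+1) \sum_(i < s) \sum_(k < s) f (j : nat, i : nat, k : nat).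
rewrite big_allpairs_dep sum_prs; apply: eq_bigr=> j _; apply: eq_bigr=> i _; by rewrite sum_iota.
Qed.
Lemma uniq_prs k s : uniq (prs k s).
by apply: allpairs_uniq=>[||[a b] [c d] _ _ []]; rewrite ?iota_uniq// => -> ->. Qed.
Lemma uniq_trip r s : uniq (trip r s).
by apply: allpairs_uniq=>[||[a b] [c d] _ _ []]; rewrite ?iota_uniq ?uniq_prs// => -> ->. Qed.
Lemma mem_trip r s j i k : (j < r.+1)%N -> (i < s)%N -> (k < s)%N -> (j, i, k) \in trip r s.
move=> jr is' ks; apply/allpairsPdep; exists (j, i), k; split=>//; last by rewrite mem_iota.
by apply/allpairsPdep; exists j, i; rewrite ?mem_iota.
Qed.
Lemma sum_one n (f : nat -> K) k : (k < n)%N -> \sum_(i < n) f i * (i == k :> nat)%:R = f k.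
move=> kn; rewrite (bigD1 (Ordinal kn))//= eqxx mulr1 big1 ?addr0// => i; rewrite -(inj_eq val_inj)=>/negbTE ->; exact: mulr0.
Qed.
Lemma zbE b : (zb b)%:~R = b%:R :> K. by case: b. Qed.
Variables (r s q M ell : nat) (num den : int) (mats : seq (seq (seq int))) (hs : seq nat).
Let F := lmiF r s q M ell num den mats hs.
Let P := prs (r + r + 3) s.
Let Tr := trip r s.
Let cf := coef r q M ell den mats hs.
Let ct := cst r q M ell num mats.
Definition hval (y : nat * nat * nat -> K) b o o' : K := \sum_(t <- Tr) y t * (cf t b o o')%:~R + (ct b o o')%:~R.
Lemma qf_bmx f v : qf (size P) (fun i j => (en (bmx r s f) i j)%:~R : K) v =
 \sum_(b < r + r + 3) \sum_(o < s) \sum_(o' < s) v (index (b : nat, o : nat) P) * (f b o o')%:~R * v (index (b : nat, o' : nat) P).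
pose g (u w : nat*nat) : K := v (index u P)*(if u.1 == w.1 then (f u.1 u.2 w.2)%:~R else 0)*v (index w P).
transitivity (\sum_(u <- P) \sum_(w <- P) g u w).
 rewrite -(sum_seq_nth (0, 0)); apply: eq_bigr=> a _; rewrite -(sum_seq_nth (0, 0)); apply: eq_bigr=> a' _.
 rewrite en_mx// /g !index_uniq ?uniq_prs//; by case: ifP.
rewrite sum_prs; apply: eq_bigr=> b _; apply: eq_bigr=> o _; rewrite sum_prs (bigD1 b)//= [X in _ + X]big1 ?addr0.
 by rewrite /g/= eqxx.
move=> b' bb; rewrite big1// => o' _; rewrite /g (_ : (b == b' :> nat) = false) ?mulr0 ?mul0r//.
by rewrite eq_sym; apply/negbTE.
Qed.
Lemma lmiF_val (x : nat -> K) v :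
 \sum_(l < size Tr) x l * qf (size P) (fun i j => (en (nth [::] F l) i j)%:~R) v + qf (size P) (fun i j => (en (nth [::] F (size Tr)) i j)%:~R) v =
 \sum_(b < r + r + 3) \sum_(o < s) \sum_(o' < s) v (index (b : nat, o : nat) P) * hval (fun t => x (index t Tr)) b o o' * v (index (b : nat, o' : nat) P).
have nl l: (l < size Tr)%N -> nth [::] F l = bmx r s (cf (nth (0, 0, 0) Tr l)).
 by move=> lT; rewrite nth_cat size_map lT (nth_map (0, 0, 0)).
have nn: nth [::] F (size Tr) = bmx r s ct by rewrite nth_cat size_map ltnn subnn.
rewrite nn qf_bmx; under eq_bigr=> l _ do rewrite nl// qf_bmx.
have -> : \sum_(l < size Tr) x l*(\sum_(b < r + r + 3) \sum_(o < s) \sum_(o' < s) v (index (b : nat, o : nat) P)*(cf (nth (0, 0, 0) Tr l) b o o')%:~R*v (index (b : nat, o' : nat) P)) =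
  \sum_(t <- Tr) x (index t Tr)*(\sum_(b < r + r + 3) \sum_(o < s) \sum_(o' < s) v (index (b : nat, o : nat) P)*(cf t b o o')%:~R*v (index (b : nat, o' : nat) P)).
 by rewrite -(sum_seq_nth (0, 0, 0)); apply: eq_bigr=> l _; rewrite index_uniq ?uniq_trip.
under eq_bigr=> t _ do rewrite mulr_sumr.
rewrite exchange_big -big_split; apply: eq_bigr=> b _/=.
under eq_bigr=> t _ do rewrite mulr_sumr.
rewrite exchange_big -big_split; apply: eq_bigr=> o _/=.
under eq_bigr=> t _ do rewrite mulr_sumr.
rewrite exchange_big -big_split; apply: eq_bigr=> o' _/=.
rewrite mulrDr mulrDl; congr (_ + _); rewrite mulr_sumr mulr_suml; apply: eq_bigr=> t _; ring.
Qed.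
Lemma nr_P v : nr (size P) v = \sum_(b < r + r + 3) \sum_(o < s) v (index (b : nat, o : nat) P) ^+ 2 :> K.
rewrite -(sum_prs (r + r + 3) s (fun u=> v (index u P) ^+ 2)) -(sum_seq_nth (0, 0)); apply: eq_bigr=> a _.
by rewrite index_uniq ?uniq_prs.
Qed.
End Generic.
Section Values.
Variables (nv nm r ell g : nat) (num den : int) (mats : seq (seq (seq int))) (hs : seq nat) (cs : nat -> seq gate).
Let N := (nv.+1 + nm)%N.
Let s := (2 ^ N.+1)%N.
Let q := (2 ^ nv.+2)%N.
Let M := (2 ^ nm)%N.
Let T := (basis N * bool)%type.
Let F := lmiF r s q M ell num den mats hs.
Let P := prs (r + r + 3) s.
Let Tr := trip r s.
Hypotheses (WE : forall j (p p' : T), (j <= r)%N -> (wen mats j (tO p) (tO p'))%:~R = s2 ^+ nth 0%N hs j * vmat (cs j) p p') (Wb : forall j o i, (j <= r)%N -> `|wen mats j o i| <= (2 ^ g)%N%:Z).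
Lemma s2_sq n : s2 ^+ n * s2 ^+ n = 2 ^+ n.
by rewrite -exprMn -expr2 sqr_sqrtr. Qed.
Definition cidx (c : basis nm) := b2n (mkseq (fun i => getq i c) nm).
Lemma tO_rep (p : T) : rep p -> forall c, tO (pset p c) = (tO p + q * cidx c)%N.
move=> /eqP rp c; have E d: tO (pset p d) = (b2n (p.2 :: mkseq (fun i=> getq i p.1) nv.+1) + q*cidx d).
 rewrite /tO /tw (_ : mkseq _ N = mkseq (fun i=> getq i p.1) nv.+1 ++ mkseq (fun i=> getq i d) nm).
  by rewrite -cat_cons b2n_cat/= !size_map !size_iota.
 rewrite /mkseq iotaD map_cat; congr (_ ++ _).
  apply/eq_in_map=> i; rewrite mem_iota/= => ir; rewrite getq_setm ?(leq_trans ir) ?leq_addr//.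
  by rewrite leqNgt ir.
 rewrite -[X in iota X nm]addn0 iotaDl -map_comp; apply/eq_in_map=> i; rewrite mem_iota/= => ir.
 by rewrite getq_setm ?ltn_add2l// leq_addr addKn.
have E0: tO p = b2n (p.2 :: mkseq (fun i=> getq i p.1) nv.+1).
 have := E (zmsg nm); rewrite /pset -rp setm_mpart -surjective_pairing rp=> ->.
 suff -> : cidx (zmsg nm) = 0 by lia.
 rewrite /cidx /mkseq; elim: iota=> //= i l ->; rewrite /getq; by case: insubP=> // k _ _; rewrite ffunE.
by rewrite E -E0.
Qed.
Lemma rep_lt (p : T) : rep p = (tO p < q)%N.
have E: tO p = (b2n (p.2 :: mkseq (fun i=> getq i p.1) nv.+1) + q*cidx (mpart p.1)).
 have := @tO_rep (pset p (zmsg nm)) _ (mpart p.1); rewrite /rep /pset mpart_setm setm_setm setm_mpart -surjective_pairing=> -> //.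
 congr (_ + _); have := @tO_rep (pset p (zmsg nm)) _ (zmsg nm); rewrite /rep=> _.
 rewrite /tO /tw /mkseq iotaD map_cat -cat_cons b2n_cat (_ : b2n (map _ (iota (0 + _) _)) = 0) ?muln0 ?addn0.
  suff H: map (fun i=> getq i (setm p.1 (zmsg nm))) (iota 0 nv.+1) = map (fun i=> getq i p.1) (iota 0 nv.+1) by exact: (f_equal (fun l=> b2n (p.2 :: l)) H).
  apply/eq_in_map=> i; rewrite mem_iota/= => ir; rewrite getq_setm ?(leq_trans ir) ?leq_addr//.
  by rewrite leqNgt ir.
 rewrite -[X in iota X nm]addn0 iotaDl.
 have : forall i, i \in iota 0 nm -> getq (nv.+1 + i) (setm p.1 (zmsg nm)) = false.
  move=> i; rewrite mem_iota=> ir; rewrite getq_setm ?ltn_add2l// leq_addr /getq; by case: insubP=> // k _ _; rewrite ffunE.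
 by elim: iota=> //= i l IH H; rewrite H ?mem_head// IH// => j jl; apply: H; rewrite inE jl orbT.
have lt: (b2n (p.2 :: mkseq (fun i=> getq i p.1) nv.+1) < q)%N.
 by have := b2n_lt (p.2 :: mkseq (fun i=> getq i p.1) nv.+1); rewrite/= size_map size_iota.
rewrite E; have c0: (mpart p.1 == (zmsg nm)) = (cidx (mpart p.1) == 0).
 apply/eqP/eqP=>[->|c0].
  rewrite /cidx /mkseq; elim: iota=> //= i l ->; rewrite /getq; by case: insubP=> // k _ _; rewrite ffunE.
 apply: basis_eq=> i im; have := bit_b2n (mkseq (fun i=> getq i (mpart p.1)) nm) i; rewrite -/(cidx _) c0 nth_mkseq//.
 rewrite (_ : iter i half 0 = 0); last by elim: (i)=> //= k ->.
 by move=> <-; rewrite /getq; case: insubP=> // k _ _; rewrite ffunE.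
rewrite /rep c0; case: (cidx)=>[|k]; first by lia.
by lia.
Qed.
Lemma tO_zreg n v : tO (zreg n, v) = v.
rewrite /tO/=; suff -> : b2n [seq getq i (zreg n) | i <- iota 0 n] = 0 by rewrite addn0.
elim: iota=> //= i l ->; rewrite /getq; case: insubP=> // k _ _; by rewrite ffunE.
Qed.
Lemma sum_cidx (f : nat -> R) : \sum_(c < M) f c = \sum_(c : basis nm) f (cidx c).
have lt (c : basis nm) : (cidx c < M)%N by have := b2n_lt (mkseq (fun i=> getq i c) nm); rewrite size_mkseq.
pose h c := Ordinal (lt c); rewrite (reindex h)//=; apply: onW_bij; apply: inj_card_bij.
 move=> c c' /(congr1 val)/= e; apply: basis_eq=> i im.
 have := bit_b2n (mkseq (fun i=> getq i c) nm) i; have := bit_b2n (mkseq (fun i=> getq i c') nm) i.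
 by rewrite -!/(cidx _) e !nth_mkseq// => -> ->.
by rewrite card_ord card_ffun card_bool card_ord.
Qed.
Variable y : nat * nat * nat -> R.
Definition sg j i k := y (j, i, k) + y (j, k, i).
Definition xy j (p p' : T) : R := if j is j'.+1 then sg j' (tO p) (tO p') else @xinit nv nm p p'.
Let hv := hval r s q M ell num den mats hs y.
Let G j (p p' : T) := trm (cj (vmat (cs j)) (xy j)) p p' - trm (xy j.+1) p p'.
Lemma sum_sel j o o' : (o < s)%N -> (o' < s)%N -> \sum_(i < s) \sum_(k < s) y (j, i : nat, k : nat) * (sel i k o o')%:~R = sg j o o'.
move=> os os'; rewrite /sg.
have E1: \sum_(i < s) \sum_(k < s) y (j, i : nat, k : nat)*((i == o :> nat)%:R*(k == o' :> nat)%:R) = y (j, o, o').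
 under eq_bigr=> i _ do under eq_bigr=> k _ do rewrite mulrA.
 under eq_bigr=> i _ do rewrite (sum_one (fun k=> y (j, i : nat, k)*(i == o :> nat)%:R) os').
 exact: (sum_one (fun i=> y (j, i, o')) os).
have E2: \sum_(i < s) \sum_(k < s) y (j, i : nat, k : nat)*((i == o' :> nat)%:R*(k == o :> nat)%:R) = y (j, o', o).
 under eq_bigr=> i _ do under eq_bigr=> k _ do rewrite mulrA.
 under eq_bigr=> i _ do rewrite (sum_one (fun k=> y (j, i : nat, k)*(i == o' :> nat)%:R) os).
 exact: (sum_one (fun i=> y (j, i, o)) os').
rewrite -E1 -E2 -big_split; apply: eq_bigr=> i _; rewrite -big_split; apply: eq_bigr=> k _/=.
rewrite intrD !zbE -!natrM mulrDr; congr (_ * _%:R + _ * _%:R); first by lia.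
by lia.
Qed.
Lemma hvX b o o' : (b <= r)%N -> (o < s)%N -> (o' < s)%N -> hv b o o' = 2 ^+ ell * sg b o o' + (o == o')%:R.
move=> br os os'; rewrite /hv /hval sum_trip cstX// zbE; congr (_ + _); rewrite (bigD1 (Ordinal (br : (b < r.+1)%N)))//= [X in _ + X]big1 ?addr0=>[|j jb].
 rewrite -(sum_sel b os os') mulr_sumr; apply: eq_bigr=> i _; rewrite mulr_sumr; apply: eq_bigr=> k _.
 by rewrite coefX// /cfX eqxx intrM rmorphXn mulrCA.
apply: big1=> i _; apply: big1=> k _; rewrite coefX// /cfX (_ : (j == b :> nat) = false) ?mulr0//.
by apply/negbTE.
Qed.
Lemma hvO o o' : hv (r + r.+2) o o' = (o == o')%:R + (if (o == 0%N) && (o' == 0%N) then 2 ^+ ell * (den%:~R * \sum_(p : T | getq 0 p.1) xy r.+1 p p - num%:~R) else 0).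
rewrite /hv /hval sum_trip cstO.
under eq_bigr=> j _ do under eq_bigr=> i _ do under eq_bigr=> k _ do rewrite coefO/=.
rewrite intrD zbE addrC -addrA; congr (_ + _); case: ifP=> o0; last first.
 by rewrite add0r big1// => j _; apply: big1=> i _; apply: big1=> k _; rewrite /cfO andbA o0 mulr0.
rewrite rmorphN/= intrM rmorphXn mulrBr addrC; congr (_ - _).
rewrite big_ord_recr/= big1 ?add0r=>[|j _]; last first.
 apply: big1=> i _; apply: big1=> k _; by rewrite /cfO (ltn_eqF (ltn_ord j)) !andbF mulr0.
have -> : \sum_(p : T | getq 0 p.1) xy r.+1 p p = \sum_(i < s) (if bt 0 i then sg r i i else 0).
 by rewrite (@sum_tO N _ (fun i=> if bt 0 i then sg r i i else 0)) big_mkcond; apply: eq_bigr=> p _; rewrite btE.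
rewrite !mulr_sumr; apply: eq_bigr=> i _; case/andP: o0=> o1 o2.
rewrite (eq_bigr (fun k : 'I_s => (if bt 0 i then y (r, i : nat, k : nat)*(2 ^+ ell*den%:~R *+ 2) else 0)*(k == i :> nat)%:R)).
 rewrite (sum_one (fun k=> if bt 0 i then y (r, i : nat, k)*(2 ^+ ell*den%:~R *+ 2) else 0) (ltn_ord i)).
 by case: ifP=> _; rewrite /sg; ring.
move=> k _; rewrite /cfO o1 o2 eqxx eq_sym; case: (k == i :> nat); case: bt; rewrite/= ?mulr0 ?mul0r//.
by rewrite intrM rmorphXn exprS; ring.
Qed.
(** Both orders of the unknowns occur in [cfT], so the products of matrix entries assemble into the
    conjugate of the symmetric state; in block [j = 0] the constant term supplies the known initial
    state instead. *)
Lemma hvT j p p' : (j <= r)%N -> hv (r.+1 + j) (tO p) (tO p') =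
 (if rep p && rep p' then 2 ^+ (ell.+1 + nth 0%N hs j) * G j p p' else 0) + (p == p')%:R.
move=> jr; rewrite /hv /hval sum_trip cstT//.
under eq_bigr=> j' _ do under eq_bigr=> i _ do under eq_bigr=> k _ do rewrite coefT//=.
rewrite intrD zbE (inj_eq (@tO_inj N)) addrCA addrC; congr (_ + _).
rewrite -!rep_lt; case: (boolP (rep p && rep p'))=> [/andP[rp rp']|rr]; last first.
 rewrite if_same addr0 big1// => j' _; rewrite big1// => i _; rewrite big1// => k _.
 by rewrite /cfT -!rep_lt (negbTE rr) mulr0.
have S1 j': \sum_(i < s) \sum_(k < s) y (j', i : nat, k : nat)*(zsum M (fun c=> sel i k (tO p + q*c) (tO p' + q*c)))%:~R = trm (fun p p'=> sg j' (tO p) (tO p')) p p'.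
 under eq_bigr=> i _ do under eq_bigr=> k _ do rewrite zsumE mulr_sumr.
 under eq_bigr=> i _ do rewrite exchange_big/=.
 rewrite exchange_big (sum_cidx (fun c=> \sum_(i < s) \sum_(k < s) y (j', i : nat, k : nat)*(sel i k (tO p + q*c) (tO p' + q*c))%:~R)); apply: eq_bigr=> c _.
 by rewrite -!tO_rep// sum_sel// tO_lt.
have S2 j': \sum_(i < s) \sum_(k < s) y (j', i : nat, k : nat)*(zsum M (fun c=> wen mats j (tO p + q*c) i*wen mats j (tO p' + q*c) k + wen mats j (tO p + q*c) k*wen mats j (tO p' + q*c) i))%:~R =
  2 ^+ nth 0 hs j * trm (cj (vmat (cs j)) (fun p p'=> sg j' (tO p) (tO p'))) p p'.
 under eq_bigr=> i _ do under eq_bigr=> k _ do rewrite zsumE mulr_sumr.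
 under eq_bigr=> i _ do rewrite exchange_big/=.
 rewrite exchange_big (sum_cidx (fun c=> \sum_(i < s) \sum_(k < s) y (j', i : nat, k : nat)*(wen mats j (tO p + q*c) i*wen mats j (tO p' + q*c) k + wen mats j (tO p + q*c) k*wen mats j (tO p' + q*c) i)%:~R)) mulr_sumr; apply: eq_bigr=> c _; rewrite -!tO_rep//.
 set a := pset p c; set a' := pset p' c.
 under eq_bigr=> i _ do under eq_bigr=> k _ do rewrite intrD mulrDr.
 under eq_bigr=> i _ do rewrite big_split/=.
 rewrite big_split/= [X in _ + X]exchange_big -big_split.
 under eq_bigr=> i _ do rewrite -big_split/=.
 rewrite (@sum_tO N _ (fun i=> \sum_(k < s) (y (j', i, k : nat)*(wen mats j (tO a) i*wen mats j (tO a') k)%:~R + y (j', k : nat, i)*(wen mats j (tO a) i*wen mats j (tO a') k)%:~R))) mulr_sumr; apply: eq_bigr=> b _.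
 rewrite (@sum_tO N _ (fun k=> (y (j', tO b, k : nat)*(wen mats j (tO a) (tO b)*wen mats j (tO a') k)%:~R + y (j', k : nat, tO b)*(wen mats j (tO a) (tO b)*wen mats j (tO a') k)%:~R))) mulr_sumr; apply: eq_bigr=> b' _.
 rewrite /sg !intrM !WE// -s2_sq; ring.
have S0: \sum_(j' < r.+1) \sum_(i < s) \sum_(k < s) y (j' : nat, i : nat, k : nat)*(cfT q M ell mats hs j' i k j (tO p) (tO p'))%:~R =
  (if j is j'.+1 then 2 ^+ (ell.+1 + nth 0 hs j) * trm (cj (vmat (cs j)) (xy j)) p p' else 0) - 2 ^+ (ell.+1 + nth 0 hs j) * trm (xy j.+1) p p'.
 pose A (j' : nat) := 2 ^+ (ell.+1 + nth 0 hs j) * trm (cj (vmat (cs j)) (fun p p'=> sg j' (tO p) (tO p'))) p p'.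
 pose B (j' : nat) := 2 ^+ (ell.+1 + nth 0 hs j) * trm (fun p p'=> sg j' (tO p) (tO p')) p p'.
 transitivity (\sum_(j' < r.+1) ((if j == j'.+1 then A j' else 0) - B j'*(j' == j :> nat)%:R)).
  apply: eq_bigr=> j' _; rewrite /cfT -!rep_lt rp rp'.
  have -> : (if j == j'.+1 then A j' else 0) = \sum_(i < s) \sum_(k < s) y (j' : nat, i : nat, k : nat)*(if j == j'.+1 then 2 ^+ ell.+1*(zsum M (fun c=> wen mats j (tO p + q*c) i*wen mats j (tO p' + q*c) k + wen mats j (tO p + q*c) k*wen mats j (tO p' + q*c) i))%:~R else 0).
   case: ifP=> _; last by rewrite big1// => i _; rewrite big1// => k _; rewrite mulr0.
   rewrite /A exprD -mulrA -S2 mulr_sumr; apply: eq_bigr=> i _; rewrite mulr_sumr; apply: eq_bigr=> k _; ring.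
  have -> : B j'*(j' == j :> nat)%:R = \sum_(i < s) \sum_(k < s) y (j' : nat, i : nat, k : nat)*(if j == j' then 2 ^+ (ell.+1 + nth 0 hs j)*(zsum M (fun c=> sel i k (tO p + q*c) (tO p' + q*c)))%:~R else 0).
   have -> : (j == j' :> nat) = (j' == j :> nat) by [].
   case: (j' == j :> nat); last by rewrite mulr0 big1// => i _; rewrite big1// => k _; rewrite mulr0.
   rewrite mulr1 /B -S1 mulr_sumr; apply: eq_bigr=> i _; rewrite mulr_sumr; apply: eq_bigr=> k _; ring.
  rewrite -sumrB; apply: eq_bigr=> i _; rewrite -sumrB; apply: eq_bigr=> k _; rewrite -mulrBr; congr (_ * _).
  by rewrite intrB; congr (_ - _); case: ifP=> _//; rewrite intrM rmorphXn.
 rewrite sumrB sum_one//; congr (_ - _); rewrite /A.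
 case: (j) jr=>[|j1] jr; first by rewrite big1.
 by rewrite (bigD1 (Ordinal (ltnW jr : (j1 < r.+1)%N)))//= eqxx big1 ?addr0// => j' jj; rewrite eqSS eq_sym (_ : (j' == j1 :> nat) = false)//; apply/negbTE.
rewrite S0 mulrBr; case: (j) jr=>[|j1] jr; last first.
 by rewrite addr0.
rewrite add0r addrC; congr (_ - _).
have z0 (v : bool) : tO (zreg N, v) = v := tO_zreg N v.
rewrite intrM rmorphXn zsumE (sum_cidx (fun c=> (wen mats 0 (tO p + q*c) 0*wen mats 0 (tO p' + q*c) 0 +
    wen mats 0 (tO p + q*c) 1*wen mats 0 (tO p' + q*c) 1)%:~R)) exprD exprS.
have -> : trm (cj (vmat (cs 0)) (@xinit nv nm)) p p' = 2^-1 * \sum_c \sum_(v : bool) vmat (cs 0) (pset p c) (zreg N, v)*vmat (cs 0) (pset p' c) (zreg N, v).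
 rewrite mulr_sumr; apply: eq_bigr=> c _; rewrite /cj.
 have e k: \sum_k' vmat (cs 0) (pset p c) k*xinit k k'*vmat (cs 0) (pset p' c) k' = (if k.1 == zreg N then 2^-1*(vmat (cs 0) (pset p c) k*vmat (cs 0) (pset p' c) k) else 0).
  rewrite (eq_bigr (fun k'=> (vmat (cs 0) (pset p c) k*((k.1 == zreg N)%:R / 2)*vmat (cs 0) (pset p' c) k')*(k' == k)%:R)).
   by rewrite sum_dl; case: (k.1 == _)=> /=; ring.
  by move=> k' _; rewrite /xinit eq_sym -mulnb; ring.
 under eq_bigr=> k _ do rewrite e.
 rewrite sum_T (bigD1 (zreg N))//= eqxx big1 ?addr0; first by rewrite big_bool mulrDr addrC.
 by move=> b /negbTE ->; rewrite addr0.
have alg (a b c : R) : 2*a*b*(2^-1*c) = a*(b*c) by field.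
rewrite alg; congr (_ * _); rewrite mulr_sumr; apply: eq_bigr=> c _; rewrite -!tO_rep// big_bool intrD !intrM.
have W0 a v: (wen mats 0 (tO a) (nat_of_bool v))%:~R = s2 ^+ nth 0 hs 0*vmat (cs 0) a (zreg N, v) by rewrite -z0 WE.
move: (W0 (pset p c) false) (W0 (pset p' c) false) (W0 (pset p c) true) (W0 (pset p' c) true)=> /= -> -> -> ->; rewrite -s2_sq; ring.
Qed.
End Values.
Lemma lra1 (a b : R) : - a <= b + a -> - 2 * a <= b. lra. Qed.
Lemma lra2 (b : R) : - 1 <= 1 + b -> - 2 <= b. lra. Qed.
Section Relax.
Variables (nv nm r ell g dg : nat) (num den : int) (mats : seq (seq (seq int))) (hs : seq nat) (cs : nat -> seq gate).
Let N := (nv.+1 + nm)%N.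
Let s := (2 ^ N.+1)%N.
Let q := (2 ^ nv.+2)%N.
Let M := (2 ^ nm)%N.
Let T := (basis N * bool)%type.
Let F := lmiF r s q M ell num den mats hs.
Let P := prs (r + r + 3) s.
Let Tr := trip r s.
Hypotheses (WE : forall j (p p' : T), (j <= r)%N -> (wen mats j (tO p) (tO p'))%:~R = s2 ^+ nth 0%N hs j * vmat (cs j) p p') (Wb : forall j o i, (j <= r)%N -> `|wen mats j o i| <= (2 ^ g)%N%:Z) (hg : forall j, (nth 0 hs j <= g)%N) (den0 : 0 < den) (denb : `|den| <= 2 ^+ dg) (numb : `|num| <= 2 ^+ dg).
Let wf := (ell + 2 * g + nm + dg + 4)%N.
Lemma sel_sym i k o o' : sel i k o o' = sel i k o' o.
by rewrite /sel addrC; congr (_ + zb _); rewrite andbC. Qed.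
Lemma coef_sym t b o o' : coef r q M ell den mats hs t b o o' = coef r q M ell den mats hs t b o' o.
rewrite /coef; case: ifP=> _; first by rewrite /cfX sel_sym.
case: ifP=> _; last by congr (if _ then _ else _); case: (o == 0); case: (o' == 0).
rewrite /cfT andbC; case: ifP=> // _; congr (_ - _); (case: ifP=> // _; congr (_ * zsum M _)); funext c; last exact: sel_sym.
lra.
Qed.
Lemma cst_sym b o o' : cst r q M ell num mats b o o' = cst r q M ell num mats b o' o.
rewrite /cst eq_sym; congr (_ + _); rewrite ![(o < q)%N && _]andbC ![(o == 0) && _]andbC; case: ifP=> // _; case: ifP=> // _.
congr (_ * zsum M _); funext c; by congr (_ + _); rewrite mulrC.
Qed.
Lemma bmx_sym f i j : (forall b o o', f b o o' = f b o' o) -> (i < size P)%N -> (j < size P)%N -> en (bmx r s f) i j = en (bmx r s f) j i.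
by move=> H iP jP; rewrite /bmx !en_mx// eq_sym; case: eqP=> // ->. Qed.
Lemma lmiF_sym l i j : (l < (size Tr).+1)%N -> (i < size P)%N -> (j < size P)%N -> en (nth [::] F l) i j = en (nth [::] F l) j i.
move=> lT iP jP; rewrite nth_cat size_map; case: ltnP=> lT'.
 by rewrite (nth_map (0, 0, 0))//; apply: bmx_sym=> // *; apply: coef_sym.
have -> : (l - size (trip r s) = 0)%N by move: lT lT'; rewrite /Tr; lia.
by apply: bmx_sym=> // *; apply: cst_sym.
Qed.
Lemma zb_le b : `|zb b| <= 1. by case: b. Qed.
Lemma sel_le i k o o' : `|sel i k o o'| <= 2.
apply: le_trans (ler_normD _ _) _; have := zb_le ((o == i) && (o' == k)); have := zb_le ((o == k) && (o' == i)); lia. Qed.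
Lemma zsum_le f (c : int) : (forall i, `|f i| <= c) -> `|zsum M f| <= 2 ^+ nm * c.
move=> H; rewrite zsum_int; apply: le_trans (ler_norm_sum _ _ _) _.
apply: le_trans (ler_sum _ (fun i _=> H _)) _.
by rewrite sumr_const card_ord -[c *+ _]mulr_natl -natrX.
Qed.
Lemma p2 n : (2 ^ n)%:Z = 2 ^+ n. by rewrite -natz natrX. Qed.
Lemma wprod_le a b o i o' i' o1 i1 o2 i2 : (a <= r)%N -> (b <= r)%N ->
 `|wen mats a o i * wen mats b o' i' + wen mats a o1 i1 * wen mats b o2 i2| <= 2 ^+ (2 * g).+1.
move=> ar br; apply: le_trans (ler_normD _ _) _; rewrite !normrM exprS mulr_natl mul2n -addnn exprD -p2.
by apply: lerD; apply: ler_pM; rewrite// Wb.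
Qed.
Lemma pow_le m n : (m <= n)%N -> 2 ^+ m <= 2 ^+ n :> int.
by rewrite -!p2 lez_nat leq_exp2l. Qed.
Lemma dbl (x : int) : x + x = 2 * x. ring. Qed.
Lemma coef_le t b o o' : `|coef r q M ell den mats hs t b o o'| <= 2 ^+ wf.
rewrite /coef; case: ifP=> br.
 rewrite /cfX; case: ifP=> _; last by lia.
 by rewrite normrM ger0_norm ?exprn_ge0//; apply: le_trans (ler_wpM2l _ (sel_le _ _ _ _)) _; rewrite ?exprn_ge0// -exprSr; apply: pow_le; lia.
case: ifP=> br2; last first.
 rewrite /cfO; case: ifP=> _; last by lia.
 by rewrite normrM ger0_norm ?exprn_ge0//; apply: le_trans (ler_wpM2l _ denb) _; rewrite ?exprn_ge0// -exprD; apply: pow_le; lia.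
rewrite /cfT; case: ifP=> _; last by lia.
set j := (b - r.+1)%N; have jr: (j <= r)%N by lia.
apply: le_trans (ler_normB _ _) _; apply: (@le_trans _ _ (2 ^+ (ell + 2 * g + nm + 3) + 2 ^+ (ell + 2 * g + nm + 3))); last first.
 by rewrite dbl -exprS; apply: pow_le; lia.
apply: lerD; case: ifP=> _; rewrite ?exprn_ge0// normrM ger0_norm ?exprn_ge0//.
 apply: le_trans (ler_wpM2l _ (zsum_le (fun c=> wprod_le _ _ _ _ _ _ _ _ jr jr))) _; rewrite ?exprn_ge0//.
 by rewrite -!exprD; apply: pow_le; lia.
apply: le_trans (ler_wpM2l _ (zsum_le (fun c=> sel_le _ _ _ _))) _; rewrite ?exprn_ge0//.
by rewrite -exprSr -exprD; apply: pow_le; have := hg j; lia.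
Qed.
Lemma cst_le b o o' : `|cst r q M ell num mats b o o'| <= 2 ^+ wf.
have H (z : int) : `|z| <= 2 ^+ (ell + 2 * g + nm + dg + 3) -> `|zb (o == o') + z| <= 2 ^+ wf.
 have h := zb_le (o == o').
 have -> : 2 ^+ wf = 2 ^+ (ell + 2 * g + nm + dg + 3) + 2 ^+ (ell + 2 * g + nm + dg + 3) :> int by rewrite dbl -exprS; congr (_ ^+ _); lia.
 by lia.
apply: H; case: ifP=> _.
 case: ifP=> _; rewrite ?exprn_ge0// normrM ger0_norm ?exprn_ge0//.
 apply: le_trans (ler_wpM2l _ (zsum_le (fun c=> wprod_le _ _ _ _ _ _ _ _ (leq0n r) (leq0n r)))) _; rewrite ?exprn_ge0//.
 by rewrite -!exprD; apply: pow_le; lia.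
case: ifP=> _; rewrite ?exprn_ge0//; case: ifP=> _; rewrite ?exprn_ge0//.
by rewrite normrN normrM ger0_norm ?exprn_ge0//; apply: le_trans (ler_wpM2l _ numb) _; rewrite ?exprn_ge0// -exprD; apply: pow_le; lia.
Qed.
Lemma bmx_le f i j : (forall b o o', `|f b o o'| <= 2 ^+ wf) -> (i < size P)%N -> (j < size P)%N -> `|en (bmx r s f) i j| <= 2 ^+ wf.
by move=> H iP jP; rewrite /bmx !en_mx//; case: ifP=> _; rewrite ?exprn_ge0. Qed.
Lemma lmiF_le l i j : (l < (size Tr).+1)%N -> (i < size P)%N -> (j < size P)%N -> `|(en (nth [::] F l) i j)%:~R| <= 2 ^+ wf :> R.
move=> lT iP jP; suff : `|en (nth [::] F l) i j| <= 2 ^+ wf by rewrite -intr_norm -(ler_int R) rmorphXn.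
rewrite nth_cat size_map; case: ltnP=> lT'.
 by rewrite (nth_map (0, 0, 0))//; apply: bmx_le=> // *; apply: coef_le.
have -> : (l - size (trip r s) = 0)%N by move: lT lT'; rewrite /Tr; lia.
by apply: bmx_le=> // *; apply: cst_le.
Qed.
Lemma Tr0 : (0 < size Tr)%N.
have : (0, 0, 0) \in Tr by rewrite mem_trip ?expn_gt0.
by case: Tr.
Qed.
Lemma idx_lt b o : (b < r + r + 3)%N -> (o < s)%N -> (b, o) \in P.
by move=> br os; apply/allpairsPdep; exists b, o; rewrite !mem_iota. Qed.
Lemma block_sound (hv : nat -> nat -> nat -> R) b : (b < r + r + 3)%N ->
 (forall v, - nr (size P) v <= \sum_(b < r + r + 3) \sum_(o < s) \sum_(o' < s) v (index (b : nat, o : nat) P) * hv b o o' * v (index (b : nat, o' : nat) P)) ->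
 forall z : T -> R, - nsq z <= \sum_p \sum_p' z p * hv b (tO p) (tO p') * z p'.
move=> br H z; pose w (o : nat) := \sum_p z p*(tO p == o)%:R.
have wz p: w (tO p) = z p.
 by rewrite /w (eq_bigr (fun p'=> z p'*(p' == p)%:R)) ?sum_dl// => p' _; rewrite (inj_eq (@tO_inj N)).
pose v a := let u := nth (0, 0) P a in if u.1 == b then w u.2 else 0.
have vE (b' : 'I_(r + r + 3)) (o : 'I_s) : v (index (b' : nat, o : nat) P) = if b' == b :> nat then w o else 0.
 by rewrite /v nth_index//= idx_lt.
have := H v; rewrite nr_P (bigD1 (Ordinal br))//= [X in _ + X]big1 ?addr0=>[|b' bb]; last first.
 apply: big1=> o _; rewrite vE (_ : (b' == b :> nat) = false) ?expr0n//; by apply/negbTE.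
rewrite (bigD1 (Ordinal br))//= [X in _ + X]big1 ?addr0=>[|b' bb]; last first.
 apply: big1=> o _; apply: big1=> o' _; rewrite vE (_ : (b' == b :> nat) = false) ?mul0r//; by apply/negbTE.
under eq_bigr=> o _ do rewrite (vE (Ordinal br))/= eqxx.
have -> : \sum_(o < s) w o ^+ 2 = nsq z by rewrite (@sum_tO N _ (fun o=> w o ^+ 2)); apply: eq_bigr=> p _; rewrite wz.
under eq_bigr=> o _ do under eq_bigr=> o' _ do rewrite !(vE (Ordinal br))/= !eqxx.
rewrite (@sum_tO N _ (fun o=> \sum_(o' < s) w o * hv b o o'*w o'))=> h; apply: le_trans h _; apply: ler_sum=> p _.
by rewrite (@sum_tO N _ (fun o'=> w (tO p) * hv b (tO p) o'*w o')) wz; apply: ler_sum=> p' _; rewrite wz.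
Qed.
Lemma block_complete (hv : nat -> nat -> nat -> R) :
 (forall b (z : T -> R), (b < r + r + 3)%N -> nsq z <= \sum_p \sum_p' z p * hv b (tO p) (tO p') * z p') ->
 forall v, nr (size P) v <= \sum_(b < r + r + 3) \sum_(o < s) \sum_(o' < s) v (index (b : nat, o : nat) P) * hv b o o' * v (index (b : nat, o' : nat) P).
move=> H v; rewrite nr_P; apply: ler_sum=> b _.
have := H b (fun p=> v (index (b : nat, tO p) P)) (ltn_ord b).
rewrite /nsq -(@sum_tO N _ (fun o=> v (index (b : nat, o) P) ^+ 2))=> h; apply: le_trans h _.
rewrite (@sum_tO N _ (fun o=> \sum_(o' < s) v (index (b : nat, o) P) * hv b o o'*v (index (b : nat, o' : nat) P))); apply: ler_sum=> p _.
by rewrite (@sum_tO N _ (fun o'=> v (index (b : nat, tO p) P) * hv b (tO p) o'*v (index (b : nat, o') P))).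
Qed.
Lemma sum_id (z : T -> R) : \sum_p \sum_p' z p * (p == p')%:R * z p' = nsq z.
apply: eq_bigr=> p _; rewrite (eq_bigr (fun p'=> (z p*z p')*(p' == p)%:R)) ?sum_dl// => p' _.
by rewrite eq_sym; ring.
Qed.
Lemma sum_zero (h : T -> T -> R) : \sum_p \sum_p' h p p' * ((tO p == 0%N) && (tO p' == 0%N))%:R = h (zreg N, false) (zreg N, false).
have z0: tO (zreg N, false) = 0%N := tO_zreg N false.
have e (p) : (tO p == 0%N) = (p == (zreg N, false)) by rewrite -z0 (inj_eq (@tO_inj N)).
under eq_bigr=> p _ do under eq_bigr=> p' _ do rewrite !e -mulnb natrM mulrCA mulrC.
under eq_bigr=> p _ do rewrite -mulr_suml sum_dl.
by rewrite sum_dl.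
Qed.
Lemma qform_sum (A : T -> T -> R) k (z : T -> R) : \sum_p \sum_p' z p * (k * A p p' + (p == p')%:R) * z p' = k * qform A z + nsq z.
rewrite -sum_id mulr_sumr -big_split; apply: eq_bigr=> p _; rewrite mulr_sumr -big_split; apply: eq_bigr=> p' _/=; ring.
Qed.
Definition lmiD := lmi (size P) (size Tr) wf F.
(** Dividing each block by its scale turns the lower bound [- nsq] into the defect allowed by
    [sdp_sound], with the inverse of [2 ^+ ell] as [eta]. *)
Lemma gap_sound t : lmiD -> 0 < t ->
 exists D Ps, (forall j, unitary (Ps j)) /\
  num%:~R / den%:~R - 2 * (2 ^+ ell)^-1 - t - (1 + t^-1) * (4 * (2 ^+ ell)^-1 * r.+2%:R * (2 ^ N)%:R) <= acc0 (apply_circuit (cs r) (chain cs Ps r (@init_state nv nm D))).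
move=> L t0; have [x0 H] := lmi_sound Tr0 lmiF_sym lmiF_le L.
pose y (u : nat*nat*nat) : R := x0 (index u Tr).
have {}H v : - nr (size P) v <= \sum_(b < r + r + 3) \sum_(o < s) \sum_(o' < s) v (index (b : nat, o : nat) P) * hval r s q M ell num den mats hs y b o o'*v (index (b : nat, o' : nat) P).
 by rewrite -lmiF_val.
have BS b br := @block_sound (hval r s q M ell num den mats hs y) b br H.
have e0: 0 < (2 ^+ ell)^-1 :> R by rewrite invr_gt0 exprn_gt0.
have inv2 k: (2 ^+ k)^-1*2 ^+ k = 1 :> R by rewrite mulVf// gt_eqF// exprn_gt0.
have nn (z : T -> R) : 0 <= nsq z by apply: sumr_ge0=> p _; apply: sqr_ge0.
apply: (@sdp_sound nv nm r cs (xy y) (2 ^+ ell)^-1)=> //.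
- case=> [|j] p p'; last by rewrite /xy /sg addrC.
 by rewrite/= /xinit eq_sym; case: eqP=>[->|].
- case=> [|j] z jr.
  apply: (@le_trans _ _ 0); first by rewrite mulNr oppr_le0 mulr_ge0// mulr_ge0// ltW.
  apply: sumr_ge0=> p _; rewrite/= (eq_bigr (fun p'=> (z p*((p.1 == zreg N)%:R / 2)*z p')*(p' == p)%:R)).
   by rewrite sum_dl mulrAC mulr_ge0 ?divr_ge0// sqr_ge0.
  by move=> p' _; rewrite /xinit eq_sym -mulnb; ring.
 have := BS j _ z; rewrite (eq_bigr (fun p=> \sum_p' z p*(2 ^+ ell*xy y j.+1 p p' + (p == p')%:R)*z p')); last first.
  move=> p _; apply: eq_bigr=> p' _; rewrite hvX ?tO_lt// (inj_eq (@tO_inj N))//.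
 rewrite qform_sum=>/(_ _) h; have {h} : - nsq z <= 2 ^+ ell * qform (xy y j.+1) z + nsq z by apply: h; lia.
 move=> h; have : (2 ^+ ell)^-1*(- 2*nsq z) <= (2 ^+ ell)^-1*(2 ^+ ell * qform (xy y j.+1) z).
  by rewrite ler_wpM2l ?(ltW e0)// lra1.
 by rewrite !mulrA inv2 mul1r=> h2; apply: le_trans h2; rewrite [_ * -2]mulrC !mulNr.
- move=> j z jr zr; have := BS (r.+1 + j) _ z.
 pose G (p p' : T) := trm (cj (vmat (cs j)) (xy y j)) p p' - trm (xy y j.+1) p p'.
 pose k := (ell.+1 + nth 0 hs j).
 rewrite (eq_bigr (fun p=> \sum_p' z p*(2 ^+ k*G p p' + (p == p')%:R)*z p')); last first.
  move=> p _; apply: eq_bigr=> p' _; rewrite (hvT _ _ _ WE)//.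
  case: ifP=> // /negbT; rewrite negb_and=>/orP[] /zr ->; ring.
 rewrite qform_sum (_ : qform G z = qform (trm (cj (vmat (cs j)) (xy y j))) z - qform (trm (xy y j.+1)) z); last first.
  rewrite -sumrB; apply: eq_bigr=> p _; rewrite -sumrB; apply: eq_bigr=> p' _; rewrite /G; ring.
 set X := _ - _=> h; have {h} : - nsq z <= 2 ^+ k*X + nsq z by apply: h; lia.
 move=> h; have : (2 ^+ k)^-1*(- 2*nsq z) <= (2 ^+ k)^-1*(2 ^+ k*X).
  by rewrite ler_wpM2l ?invr_ge0 ?exprn_ge0// lra1.
 rewrite !mulrA inv2 mul1r=> h2; apply: le_trans h2; rewrite [_ * -2]mulrC !mulNr lerN2.
 apply: ler_wpM2r=> //; apply: ler_wpM2l=> //; rewrite lef_pV2 ?posrE ?exprn_gt0//.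
 by rewrite ler_eXn2l ?ltr1n; lia.
set S := \sum_(p : T | getq 0 p.1) xy y r.+1 p p.
have := BS (r + r.+2) _ (fun p=> (tO p == 0)%:R).
rewrite (eq_bigr (fun p=> \sum_p' ((p == p')%:R + 2 ^+ ell*(den%:~R*S - num%:~R))*((tO p == 0) && (tO p' == 0))%:R)); last first.
 move=> p _; apply: eq_bigr=> p' _; rewrite hvO (inj_eq (@tO_inj N)).
 by case: (tO p == 0); case: (tO p' == 0); rewrite ?mulr0 ?mul0r ?mul1r.
rewrite (sum_zero (fun p p'=> (p == p')%:R + 2 ^+ ell*(den%:~R*S - num%:~R))) eqxx.
have -> : nsq (fun p : T=> (tO p == 0%N)%:R : R) = 1.
 have z0: tO (zreg N, false) = 0%N := tO_zreg N false.
 rewrite /nsq (bigD1 (zreg N, false))//= z0 expr1n big1 ?addr0// => p pz.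
 by rewrite -z0 (inj_eq (@tO_inj N)) (negbTE pz) expr0n.
move=> h; have {h} : -1 <= 1 + 2 ^+ ell*(den%:~R*S - num%:~R) by apply: h; lia.
move=> h; have d1: 1 <= den%:~R :> R by rewrite ler1z.
have : (2 ^+ ell)^-1 * - 2 <= (2 ^+ ell)^-1*(2 ^+ ell*(den%:~R*S - num%:~R)).
 by rewrite ler_wpM2l ?(ltW e0)// lra2.
rewrite mulrA inv2=> h2; rewrite lerBlDr ler_pdivrMr ?(lt_le_trans _ d1)//.
have : 2*(2 ^+ ell)^-1 <= 2*(2 ^+ ell)^-1*den%:~R :> R by rewrite ler_peMr// mulr_ge0// ltW.
lra.
Qed.
Lemma gap_complete D Ps : (forall j, unitary (Ps j)) ->
 num%:~R / den%:~R <= acc0 (apply_circuit (cs r) (chain cs Ps r (@init_state nv nm D))) -> lmiD.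
move=> HPs acc; have [x [[xs x0] xb xpsd xtr xobj]] := sdp_complete HPs acc.
pose oT (o : nat) : T := odflt (zreg N, false) [pick p | tO p == o].
have oTK p: oT (tO p) = p.
 by rewrite /oT; case: pickP=>[p' /eqP/tO_inj//|/(_ p)]; rewrite eqxx.
(* Half of each state, because [sg] adds the unknowns of both orders. *)
pose y (u : nat*nat*nat) : R := x u.1.1.+1 (oT u.1.2) (oT u.2) / 2.
have xyE j p p': xy y j p p' = x j p p'.
 case: j=>[|j]; first by rewrite x0.
 by rewrite /xy /sg /y !oTK xs; field.
have xyE' j: xy y j = x j.
 by funext p; funext p'.
apply: (@lmi_complete R _ _ _ _ Tr0 lmiF_sym lmiF_le (fun l=> y (nth (0, 0, 0) Tr l)))=>[l lT|v].
 rewrite normrM; have := xb (nth (0, 0, 0) Tr l).1.1.+1 (oT (nth (0, 0, 0) Tr l).1.2) (oT (nth (0, 0, 0) Tr l).2).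
 by rewrite [`|2^-1|]ger0_norm; lra.
suff H b (z : T -> R) : (b < r + r + 3)%N -> nsq z <= \sum_p \sum_p' z p * hval r s q M ell num den mats hs (fun t=> y (nth (0, 0, 0) Tr (index t Tr))) b (tO p) (tO p')*z p'.
 exact: (@eq_ind R _ (fun Z=> _ <= Z) (block_complete H v) _ (esym (@lmiF_val R r s q M ell num den mats hs (fun l=> y (nth (0, 0, 0) Tr l)) v))).
move=> br.
set hv := hval _ _ _ _ _ _ _ _ _ _.
have hvE: hv = hval r s q M ell num den mats hs y.
 funext b'; funext o; funext o'.
 by congr (_ + _); apply: eq_big_seq=> u uT; rewrite nth_index.
rewrite {}hvE; case: (leqP b r)=> b1.
 rewrite (eq_bigr (fun p=> \sum_p' z p*(2 ^+ ell*x b.+1 p p' + (p == p')%:R)*z p')); last first.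
  by move=> p _; apply: eq_bigr=> p' _; rewrite hvX ?tO_lt// (inj_eq (@tO_inj N)) -(xyE b.+1).
 by rewrite qform_sum lerDr mulr_ge0 ?exprn_ge0.
case: (leqP b (r + r.+1))=> b2.
 have -> : b = (r.+1 + (b - r.+1))%N by lia.
 have {b1 b2 br hv}: (b - r.+1 <= r)%N by lia.
 move: (b - r.+1)%N=> j jr.
 (* The defect of an exact solution vanishes; the term with coefficient 0 only gives the sum the
    shape of [qform_sum]. *)
 rewrite (eq_bigr (fun p=> \sum_p' z p*(0*x 0 p p' + (p == p')%:R)*z p')); last first.
  move=> p _; apply: eq_bigr=> p' _; rewrite (hvT _ _ _ WE)// !xyE' xtr subrr mulr0 if_same mul0r//.
 by rewrite qform_sum mul0r add0r.
have -> : b = (r + r.+2) by lia.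
set S := \sum_(p | _) _ in xobj.
rewrite (eq_bigr (fun p=> \sum_p' (z p*(p == p')%:R*z p' + (z p*z p'*(2 ^+ ell*(den%:~R*S - num%:~R)))*((tO p == 0) && (tO p' == 0))%:R))); last first.
 move=> p _; apply: eq_bigr=> p' _; rewrite hvO (inj_eq (@tO_inj N)) xyE' -/S.
 by case: ((tO p == 0) && (tO p' == 0)); rewrite/=; ring.
under eq_bigr=> p _ do rewrite big_split/=.
rewrite big_split sum_id (sum_zero (fun p p'=> z p*z p'*(2 ^+ ell*(den%:~R*S - num%:~R)))) lerDl mulr_ge0 ?sqr_ge0// mulr_ge0 ?exprn_ge0// subr_ge0.
by move: xobj; rewrite ler_pdivrMr ?ltr0z// mulrC.
Qed.
End Relax.
Local Close Scope ring_scope.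
Ltac pt3 := match goal with
 | |- ptime (fun x => nat_of_bool (@?f x)) => apply: pt_b2
 | |- ptime (fun x => zb (@?f x)) => rewrite /zb
 | |- ptime (fun x => pw (@?f x) (@?g x)) => apply: pt_pw
 | |- ptime (fun x => hf (@?g x)) => apply: pt_hf
 | |- ptime (fun x => od (@?g x)) => apply: pt_od
 | |- ptime (fun x => bt (@?f x) (@?g x)) => apply: pt_bt
 | |- ptime (fun x => sb (@?f x) (@?g x) (@?v x) (@?o x)) => apply: pt_sb
 | |- ptime (fun x => en (@?f x) (@?g x) (@?o x)) => apply: pt_en
 | |- ptime (fun x => clampz (@?f x) (@?g x)) => apply: pt_clampz
 end.
Ltac ptb := repeat first [ pt1 | pt2 | pt3 ].

(** * Polynomial time of the construction in the padded size *)

Section PtLists.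
Variable E : encT.
Implicit Types (f : E -> nat).
Lemma pt_sel f1 f2 f3 f4 : ptime f1 -> ptime f2 -> ptime f3 -> ptime f4 -> ptime (fun e => sel (f1 e) (f2 e) (f3 e) (f4 e)).
by move=> *; rewrite /sel; ptb. Qed.
Lemma pt_wen (m : E -> seq (seq (seq int))) f1 f2 f3 : ptime m -> ptime f1 -> ptime f2 -> ptime f3 ->
 ptime (fun e => wen (m e) (f1 e) (f2 e) (f3 e)).
by move=> *; rewrite /wen; ptb. Qed.
Lemma pt_prs f1 f2 : ptime f1 -> ptime f2 -> ptime (fun e => prs (f1 e) (f2 e)).
move=> H1 H2; apply: pt_flatten; apply: pt_map; last by pt.
by apply: pt_map; pt.
Qed.
Lemma pt_trip f1 f2 : ptime f1 -> ptime f2 -> ptime (fun e => trip (f1 e) (f2 e)).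
move=> H1 H2; have P: ptime (fun e=> prs (f1 e).+1 (f2 e)) by apply: pt_prs; pt.
apply: pt_flatten; apply: pt_map=> //.
by apply: pt_map; pt.
Qed.
End PtLists.
Section PtLmi.
Variables (E : encT) (r s q M ell : E -> nat) (num den : E -> int) (mats : E -> seq (seq (seq int))) (hs : E -> seq nat).
Hypotheses (Hr : ptime r) (Hs : ptime s) (Hq : ptime q) (HM : ptime M) (Hl : ptime ell) (Hn : ptime num) (Hd : ptime den)
 (Hm : ptime mats) (Hh : ptime hs).
Lemma pt_coef (B : encT) h (t : B -> nat * nat * nat) (b o o' : B -> nat) : ptime h -> ptime t -> ptime b -> ptime o -> ptime o' ->
 ptime (fun x => coef (r (h x)) (q (h x)) (M (h x)) (ell (h x)) (den (h x)) (mats (h x)) (hs (h x)) (t x) (b x) (o x) (o' x)).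
move=> H T Hb O O'; rewrite /coef /cfX /cfT /cfO.
have Z1: ptime (fun x=> zsum (M (h x)) (fun c=> (wen (mats (h x)) (b x - (r (h x)).+1) (o x + q (h x)*c) (t x).1.2*wen (mats (h x)) (b x - (r (h x)).+1) (o' x + q (h x)*c) (t x).2
  + wen (mats (h x)) (b x - (r (h x)).+1) (o x + q (h x)*c) (t x).2*wen (mats (h x)) (b x - (r (h x)).+1) (o' x + q (h x)*c) (t x).1.2)%R)).
 apply: pt_zsum; first by pt.
 by apply: pt_addz; apply: pt_mulz; apply: pt_wen; ptb.
have Z2: ptime (fun x=> zsum (M (h x)) (fun c=> sel (t x).1.2 (t x).2 (o x + q (h x)*c) (o' x + q (h x)*c))).
 by apply: pt_zsum; [pt | apply: pt_sel; pt].
have S2: ptime (fun x=> sel (t x).1.2 (t x).2 (o x) (o' x)) by apply: pt_sel; pt.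
by ptb.
Qed.
Lemma pt_cst (B : encT) h (b o o' : B -> nat) : ptime h -> ptime b -> ptime o -> ptime o' ->
 ptime (fun x => cst (r (h x)) (q (h x)) (M (h x)) (ell (h x)) (num (h x)) (mats (h x)) (b x) (o x) (o' x)).
move=> H Hb O O'; rewrite /cst.
have Z1: ptime (fun x=> zsum (M (h x)) (fun c=> (wen (mats (h x)) 0 (o x + q (h x)*c) 0*wen (mats (h x)) 0 (o' x + q (h x)*c) 0
  + wen (mats (h x)) 0 (o x + q (h x)*c) 1*wen (mats (h x)) 0 (o' x + q (h x)*c) 1)%R)).
 apply: pt_zsum; first by pt.
 by apply: pt_addz; apply: pt_mulz; apply: pt_wen; ptb.
by ptb.
Qed.
Lemma pt_bmx (B : encT) h (f : B -> nat -> nat -> nat -> int) : ptime h -> ptime (fun x : B * nat * nat * nat => f x.1.1.1 x.1.1.2 x.1.2 x.2) ->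
 ptime (fun x => bmx (r (h x)) (s (h x)) (f x)).
move=> H F; have P: ptime (fun x=> prs (r (h x) + r (h x) + 3) (s (h x))) by apply: pt_prs; pt.
apply: pt_mx; [by pt | by pt |].
have P': ptime (fun x : B*nat*nat=> prs (r (h x.1.1) + r (h x.1.1) + 3) (s (h x.1.1))) by apply: pt_prs; pt.
apply: pt_if; [by pt | | by pt].
apply: (@pt_ext _ _ (fun x : B*nat*nat=> (fun y : B*nat*nat*nat=> f y.1.1.1 y.1.1.2 y.1.2 y.2)
 (x.1.1, (nth (0, 0) (prs (r (h x.1.1) + r (h x.1.1) + 3) (s (h x.1.1))) x.1.2).1, (nth (0, 0) (prs (r (h x.1.1) + r (h x.1.1) + 3) (s (h x.1.1))) x.1.2).2, (nth (0, 0) (prs (r (h x.1.1) + r (h x.1.1) + 3) (s (h x.1.1))) x.2).2)))=> //.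
by apply: (pt_app1 F); pt.
Qed.
Lemma pt_lmiF : ptime (fun e => lmiF (r e) (s e) (q e) (M e) (ell e) (num e) (den e) (mats e) (hs e)).
apply: pt_cat.
 apply: pt_map; last exact: pt_trip.
 apply: pt_bmx; [by pt | by apply: pt_coef; pt].
apply: pt_cons; last by pt.
by apply: pt_bmx; [by pt | by apply: pt_cst; pt].
Qed.
End PtLmi.
Section PtSim.
Variables (E : encT) (cap N wd : E -> nat).
Hypotheses (Hc : ptime cap) (HN : ptime N) (Hw : ptime wd).
Lemma pt_newv (B : encT) h (U : B -> seq int) (g : B -> seq nat) (o : B -> nat) : ptime h -> ptime U -> ptime g -> ptime o ->
 ptime (fun x => newv (cap (h x)) (N (h x)) (U x) (g x) (o x)).
by move=> H HU G O; rewrite /newv; ptb. Qed.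
Lemma pt_colz (s o0 : E -> nat) (c : E -> seq (seq nat)) : ptime s -> ptime o0 -> ptime c ->
 ptime (fun e => colz (cap e) (N e) (wd e) (s e) (c e) (o0 e)).
move=> S O C; apply: pt_foldl=> //.
- apply: pt_mkseq; last by pt.
 by have H: ptime (fun x : E * seq int * seq nat*nat=> newv (cap x.1.1.1) (N x.1.1.1) x.1.1.2 x.1.2 x.2); [apply: pt_newv; pt | ptb].
- by apply: pt_mkseq; ptb.
have [k1 H1] := pt_szb S; have [k2 H2] := pt_szb Hw.
exists (fun n=> ((n + 2) ^ k1)*(4*(n + 2) ^ k2 + 15) + 1); first by auto 20 with pol.
move=> e i _; set l := take i (c e).
have bd (U : seq int) : size U = s e -> (forall z, z \in U -> esz z <= 4*wd e + 14) -> esz U <= ((esz e + 2) ^ k1)*(4*(esz e + 2) ^ k2 + 15) + 1.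
 move=> sU bU; rewrite esz_sum addn1 ltnS; apply: (@leq_trans (s e*(4*wd e + 15))).
  rewrite -sU -sum1_size big_distrl/= !big_seq; apply: leq_sum=> z zU; have := bU _ zU; lia.
 have h1 := H1 e; have h2 := H2 e; rewrite !esz_nat in h1 h2; apply: leq_mul; lia.
have : size (foldl (rgz (cap e) (N e) (wd e)) (mkseq (fun o=> Posz (o == o0 e)) (s e)) l) = s e /\
  forall z, z \in foldl (rgz (cap e) (N e) (wd e)) (mkseq (fun o=> Posz (o == o0 e)) (s e)) l -> esz z <= 4*wd e + 14.
 elim/last_ind: l=>[|l g [IH1 IH2]].
  split=> [|z /mapP[o _ ->]]; first by rewrite size_mkseq.
  by case: eqP=> _; apply: leq_trans (leq_addl _ _).
 rewrite foldl_rcons size_mkseq; split=>// z /mapP[o _ ->]; apply: leq_trans (esz_clampz _ _) _; lia.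
by case=> h1 h2; apply: bd.
Qed.
End PtSim.
Lemma pt_pstep : ptime pstep.
apply: (@pt_ext _ _ (fun x : seq nat * seq (seq nat) * seq (seq (seq nat))=> let s := x.1.1 in
 if size s == 0 then x else
 if head 0 s == 0 then (behead s, [::], rev x.1.2 :: x.2) else
 if (head 0 s == 1) && (3 < size s) then (drop 4 s, take 4 s :: x.1.2, x.2) else
 if ((head 0 s == 2) || (head 0 s == 3)) && (1 < size s) then (drop 2 s, take 2 s :: x.1.2, x.2) else
 (behead s, x.1.2, x.2)))=>[[[[|a s] c] d]|]//.
by rewrite/=; pt.
Qed.
Lemma esz_pstep x : esz (pstep x) <= esz x + 4.
case: x=>[[s c] d]; rewrite /pstep/=; case: s=>[|a s]; first by lia.
have K n: esz (take n (a :: s)) + esz (drop n (a :: s)) = (esz (a :: s)).+1 by rewrite -esz_cat cat_take_drop.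
case: ifP=> _; first by rewrite !esz_pair/= !esz_cons esz_rev esz_nil; lia.
case: ifP=> _; first by have := K 4; rewrite !esz_pair [esz (take _ _ :: c)]esz_cons; lia.
case: ifP=> _; first by have := K 2; rewrite !esz_pair [esz (take _ _ :: c)]esz_cons; lia.
by rewrite !esz_pair/= esz_cons; lia.
Qed.
Lemma pt_parse (E : encT) (s : E -> seq nat) : ptime s -> ptime (fun e => parse (s e)).
move=> S; rewrite /parse /pfin; have P := pt_pstep.
have I: ptime (fun e=> iter (size (s e)) pstep (s e, [::], [::])).
 apply: pt_iter_le; pt.
 exists 2=> e x; apply: leq_trans (esz_pstep x) _; rewrite leq_add2l -[4]/(2 ^ 2) leq_exp2r//; exact: leq_addl.
pt.
Qed.
Definition decu w : seq nat := rev (foldl (fun c b => if b then (c.1.+1, c.2) else (0, c.1 :: c.2)) (0, [::]) w).2.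
Lemma decuE w : decu w = dec_unary 0 w.
rewrite /decu; suff H c l: rev (foldl (fun (c : nat * seq nat) (b : bool)=> if b then (c.1.+1, c.2) else (0, c.1 :: c.2)) (c, l) w).2 = rev l ++ dec_unary c w by [].
elim: w c l=>[|[] w IH] c l/=; rewrite ?cats0// IH rev_cons cat_rcons//.
Qed.
Lemma pt_decu (E : encT) (w : E -> seq bool) : ptime w -> ptime (fun e => decu (w e)).
move=> W; apply: pt_rev; apply: pt_snd.
apply: pt_foldl_add; pt.
exists 2=> e [c l] b; apply: (@leq_trans (esz (c, l) + 4)).
 have e0: esz (0 : nat) = 1 := erefl.
 by case: b; rewrite !esz_pair/= ?esz_S ?esz_cons; lia.
by lia.
Qed.
Lemma n2bE s : nat_of_bits s = b2n (rev s).
rewrite /nat_of_bits; elim/last_ind: s=> // s b IH; rewrite foldl_rcons rev_rcons IH addnC//.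
Qed.
Definition gcs w m := let L := parse (drop 2 (decu w)) in mkseq (fun j => nth [::] (if od m then [::] :: L else L) j) (hf m.+1).+1.
(** [ell] contains twice [2 ^ P] because the error in [sdp_sound] is proportional to
    [(1 + t^-1) / 2 ^+ ell], with [t] of the order of the gap; [r + N] absorbs the factors [r + 2]
    and [2 ^ N], and 12 the constants. *)
Definition gapF w nb db m P cap : bool :=
 let nv := nth 0 (decu w) 0 in let nm := nth 0 (decu w) 1 in let N := nv.+1 + nm in
 let r := hf m.+1 in let css := gcs w m in let g := size (flatten css) in
 let s := pw cap N.+1 in let q := pw cap nv.+2 in let M := pw cap nm in
 let ell := 2 * pw cap P + r + N + 12 in
 let mats := [seq [seq colz cap N g.+1 s c o | o <- iota 0 s] | c <- css] in
 let hs := [seq hads N c | c <- css] in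
 lmi (size (prs (r + r + 3) s)) (size (trip r s)) (ell + 2 * g + nm + (size nb + size db) + 4)
  (lmiF r s q M ell (Posz (b2n (rev nb))) (Posz (b2n (rev db))) mats hs).
Lemma pt_gapF (E : encT) (w nb db : E -> seq bool) (m P cap : E -> nat) : ptime w -> ptime nb -> ptime db -> ptime m -> ptime P -> ptime cap ->
 ptime (fun e => gapF (w e) (nb e) (db e) (m e) (P e) (cap e)).
move=> HW NB DB HM HP HC.
have D := pt_decu HW.
have NV: ptime (fun e=> nth 0 (decu (w e)) 0) by pt.
have NM: ptime (fun e=> nth 0 (decu (w e)) 1) by pt.
have RR: ptime (fun e=> hf (m e).+1) by ptb.
have CS: ptime (fun e=> gcs (w e) (m e)).
 have L: ptime (fun e=> parse (drop 2 (decu (w e)))) by apply: pt_parse; pt.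
 have O: ptime (fun e=> od (m e)) by ptb.
 apply: pt_mkseq; last by pt.
 apply: pt_nth; [by pt | | by pt].
 by apply: (@pt_app1 _ _ _ (fun e=> if od (m e) then [::] :: parse (drop 2 (decu (w e))) else parse (drop 2 (decu (w e)))) fst); pt.
have PW k: ptime k -> ptime (fun e=> pw (cap e) (k e)) by move=> ?; ptb.
pose nv e := nth 0 (decu (w e)) 0; pose nm e := nth 0 (decu (w e)) 1; pose N e := (nv e).+1 + nm e.
have HN: ptime N by rewrite /N; pt.
pose g e := size (flatten (gcs (w e) (m e))); have G: ptime g by rewrite /g; pt.
pose s e := pw (cap e) (N e).+1; have S: ptime s by apply: PW; pt.
pose q e := pw (cap e) (nv e).+2; have Q: ptime q by apply: PW; pt.
pose M e := pw (cap e) (nm e); have HMM: ptime M by apply: PW.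
pose r e := hf (m e).+1.
pose ell e := 2 * pw (cap e) (P e) + r e + N e + 12; have EL: ptime ell by have := PW _ HP=> ?; rewrite /ell; pt.
pose mats e := [seq [seq colz (cap e) (N e) (g e).+1 (s e) c o | o <- iota 0 (s e)] | c <- gcs (w e) (m e)].
have MT: ptime mats.
 apply: pt_map=> //.
 apply: pt_map; last by pt.
 apply: pt_colz; pt.
pose hs e := [seq hads (N e) c | c <- gcs (w e) (m e)].
have HS: ptime hs.
 apply: pt_map=> //.
 apply: (@pt_ext _ _ (fun x : E * seq (seq nat)=> size (filter (had (N x.1)) x.2)))=>[x|]; first by rewrite size_filter.
 by apply: pt_size; apply: pt_filter; rewrite /had; pt.
have ZB b: ptime b -> ptime (fun e=> Posz (b2n (rev (b e)))).
 by move=> B; apply: (@pt_ext _ _ (fun e=> zof false (b2n (rev (b e)))))=> //; apply: pt_zof; pt.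
apply: pt_lmi.
- by apply: pt_size; apply: pt_prs; pt.
- by apply: pt_size; apply: pt_trip.
- by pt.
- by apply: pt_lmiF=> //; apply: ZB.
Qed.
Lemma lra4 (a v A B : R) : (B <= v / 4096 -> A <= v * (5 / 256) -> 0 < v -> a - v < a - 2 * B - v / 4 - A)%R. lra. Qed.
Section GapSpec.
Variables (w nb db : seq bool) (m P cap : nat).
Let nv := vd_nv w.
Let nm := vd_nm w.
Let N := nv.+1 + nm.
Hypotheses (capN : 2 ^ N.+1 <= cap) (capP : 2 ^ P <= cap) (db0 : 0 < nat_of_bits db).
Let T := (basis N * bool)%type.
Let r := uphalf m.
Let css := gcs w m.
Let g := size (flatten css).
Let s := 2 ^ N.+1.
Let ell := 2 * 2 ^ P + r + N + 12.
Let mats := [seq [seq colz cap N g.+1 s c o | o <- iota 0 s] | c <- css].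
Let hs := [seq hads N c | c <- css].
Let cs := cseq m (vd_circ w).
Lemma hf_up : hf m.+1 = r. by rewrite hfE. Qed.
Lemma size_css : size css = r.+1. by rewrite size_mkseq hf_up. Qed.
Lemma css_cs j : j <= r -> map gate_of (nth [::] css j) = cs j.
move=> jr; rewrite nth_mkseq ?hf_up// odE decuE /cs /cseq /vd_circ -parseE.
have H (L : seq (seq (seq nat))) : map gate_of (nth [::] L j) = nth [::] (map (map gate_of) L) j.
 by case: (ltnP j (size L))=> h; [rewrite (nth_map [::]) | rewrite !nth_default ?size_map].
by case: odd.
Qed.
Lemma size_c j : size (nth [::] css j) <= g.
rewrite /g; elim: (css) j=>[|c l IH] [|j]//=; rewrite size_cat ?leq_addr//; exact: leq_trans (IH j) (leq_addl _ _).
Qed.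
Lemma tO_surj i : i < s -> exists p : T, tO p = i.
move=> is'; have := @sum_tO N nat (fun o=> (o == i)).
rewrite (bigD1 (Ordinal is'))//= eqxx=> e.
case: (pickP (fun p : T=> tO p == i))=>[p /eqP <-|H]; first by exists p.
by move: e; rewrite [RHS]big1// => p _; rewrite H.
Qed.
Lemma wenE j i o : j <= r -> i < s -> wen mats j o i = nth 0%R (colz cap N g.+1 s (nth [::] css j) i) o.
move=> jr is'; rewrite /wen /en (nth_map [::]) ?size_css// (nth_map 0) ?size_iota// nth_iota//.
Qed.
Lemma WE0 j (p p' : T) : j <= r -> ((wen mats j (tO p) (tO p'))%:~R = s2 ^+ nth 0%N hs j * vmat (cs j) p p')%R.
move=> jr; rewrite wenE ?tO_lt// (nth_map [::]) ?size_css// -css_cs//.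
by have [_ ->] := @colz_spec cap N g.+1 capN (nth [::] css j) p' (size_c j).
Qed.
Lemma Wb0 j o i : j <= r -> (`|wen mats j o i| <= (2 ^ g)%:Z)%R.
move=> jr; case: (ltnP i s)=> is'.
 have [p' <-] := tO_surj is'; rewrite wenE ?tO_lt//.
 have [h _] := @colz_spec cap N g.+1 capN (nth [::] css j) p' (size_c j); apply: le_trans (h o) _.
 by rewrite lez_nat leq_exp2l// size_c.
rewrite /wen /en (nth_map [::]) ?size_css// [nth [::] _ i]nth_default ?size_map ?size_iota// nth_nil//.
Qed.
Lemma hg0 j : nth 0 hs j <= g.
case: (ltnP j (size css))=> jc; last first.
 rewrite nth_default; [exact: leq0n | by rewrite size_map].
rewrite (nth_map [::])//; exact: leq_trans (count_size _ _) (size_c j).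
Qed.
Lemma bitsb b k : size b <= k -> (`|Posz (b2n (rev b))| <= 2 ^+ k :> int)%R.
move=> bk; rewrite -p2; apply: (@leq_trans (2 ^ size b)); last by rewrite leq_exp2l.
by rewrite ltnW// -size_rev b2n_lt.
Qed.
Lemma gapFE : gapF w nb db m P cap = lmiD nv nm r ell g (size nb + size db) (Posz (b2n (rev nb))) (Posz (b2n (rev db))) mats hs.
have q1: 2 ^ nv.+2 <= cap by apply: leq_trans capN; rewrite leq_exp2l; lia.
have q2: 2 ^ nm <= cap by apply: leq_trans capN; rewrite leq_exp2l; lia.
rewrite /gapF decuE hf_up !pwE//.
Qed.
Let a : R := ((nat_of_bits nb)%:R / (nat_of_bits db)%:R)%R.
Lemma gapF_complete D Ps : (forall j, unitary (Ps j)) -> (a <= @acc_prob m w D Ps)%R -> gapF w nb db m P cap.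
move=> HPs acc; rewrite gapFE; apply: (@gap_complete nv nm r ell g (size nb + size db) (Posz (b2n (rev nb))) (Posz (b2n (rev db))) mats hs cs WE0 Wb0 hg0 _ _ _ D Ps HPs); try (by apply: bitsb; rewrite ?leq_addr ?leq_addl).
 by rewrite -n2bE.
by rewrite -accept_acc0 -!n2bE.
Qed.
Lemma gapF_sound : gapF w nb db m P cap -> exists D (Ps : nat -> prover_op (vd_nm w) D), (forall j, unitary (Ps j)) /\
 (a - (2 ^+ (2 ^ P)%N)^-1 < @acc_prob m w D Ps)%R.
rewrite gapFE=> L.
(* A quarter of the allowed gap is spent on [t]. *)
have [| | | |D [Ps [HPs acc]]] := gap_sound WE0 Wb0 hg0 _ _ _ L (t := ((2 ^+ (2 ^ P + 2)%N)^-1)%R); try (by apply: bitsb; rewrite ?leq_addr ?leq_addl).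
- by rewrite ltz_nat -n2bE.
- by rewrite invr_gt0 exprn_gt0.
exists D, Ps; split=>//; rewrite -accept_acc0 -!pmulrn -!n2bE in acc; apply: lt_le_trans acc.
rewrite -/a -/N; set Q := 2 ^ P; rewrite invrK.
set u : R := (2 ^+ Q)%R; have u1: (1 <= u)%R by rewrite exprn_ege1// ler1n.
have EL: ((2 ^+ ell) = u*u*2 ^+ r*2 ^+ N*4096 :> R)%R.
 by rewrite /ell mul2n -addnn !exprD -/u (_ : (2 ^+ 12 = 4096)%R)// -natrX.
have E2: ((2 ^+ (Q + 2)) = u*4 :> R)%R by rewrite exprD -/u -natrX.
rewrite EL E2 natrX; have hr: (r.+2%:R <= 4*2 ^+ r :> R)%R.
 have := ltn_expl r.+2 (isT : 1 < 2); rewrite -(ltr_nat R) natrX !exprS mulrA -natrM; exact: ltW.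
set x : R := (2 ^+ r)%R in hr *; set y : R := (2 ^+ N)%R.
have x1: (1 <= x)%R by rewrite exprn_ege1// ler1n.
have y1: (1 <= y)%R by rewrite exprn_ege1// ler1n.
have xp: (0 < x)%R by apply: lt_le_trans x1.
have yp: (0 < y)%R by apply: lt_le_trans y1.
have up: (0 < u)%R by apply: lt_le_trans u1.
have I1: ((u*u*x*y*4096)^-1 <= u^-1 / 4096)%R.
 by rewrite -invfM lef_pV2 ?posrE ?mulr_gt0// ler_wpM2r// -!mulrA ler_peMr ?(ltW up)// mulr_ege1// mulr_ege1.
have I2: ((1 + u*4)*(4*(u*u*x*y*4096)^-1 * r.+2%:R*y) <= u^-1*(5 / 256))%R.
 apply: (@le_trans _ _ ((5*u)*(4*(u*u*x*y*4096)^-1*(4*x)*y)))%R.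
  apply: ler_pM.
  - by rewrite addr_ge0// mulr_ge0// ltW.
  - by rewrite !mulr_ge0 ?invr_ge0 ?mulr_ge0 ?(ltW xp) ?(ltW yp) ?(ltW up).
  - lra.
  - by rewrite ler_wpM2r ?(ltW yp)// ler_wpM2l// mulr_ge0// invr_ge0 !mulr_ge0 ?ltW.
 rewrite le_eqVlt; apply/orP; left; apply/eqP; field; by rewrite !gt_eqF.
have ui: (0 < u^-1)%R by rewrite invr_gt0.
have -> : ((u*4)^-1 = u^-1 / 4)%R by rewrite invfM.
exact: lra4.
Qed.
End GapSpec.
(** Machines given by hypothesis are absorbed by simulation, so that verifiers and parameters become
    ordinary [ptime] functions. *)
Lemma polytime_ptime f : polytime_fun f -> ptime f.
case=> M [k H]; apply: (@pt_ext _ _ (fun x=> (fun xt : seq bool*nat=> tape_out (tm_run M xt.2 (tm_init xt.1)).2) (x, size x ^ k + k)))=>[x|].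
 by have := H x; rewrite /tm_outputs; case: (tm_run)=>[[q l] rr] [_ <-].
by apply: (pt_app1 (pt_tmrun M)); pt.
Qed.
Lemma ptime_unary M k f : (forall n, tm_outputs M (nseq n true) (n ^ k + k) (f n)) -> ptime f.
move=> H; apply: (@pt_ext _ _ (fun n=> (fun xt : seq bool*nat=> tape_out (tm_run M xt.2 (tm_init xt.1)).2) (nseq n true, n ^ k + k)))=>[n|].
 by have := H n; rewrite /tm_outputs; case: (tm_run)=>[[q l] rr] [_ <-].
by apply: (pt_app1 (pt_tmrun M)); pt.
Qed.
Lemma in_poly_ptime p : in_poly p -> ptime p.
case=> M [k /ptime_unary H]; apply: (@pt_ext _ _ (fun n=> size (nseq (p n) true)))=>[n|]; first by rewrite size_nseq.
exact: pt_size H.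
Qed.
Theorem gap_EXP A : in_QIP_poly_gap A -> in_EXP A.
case=> a [m [p [[Mn [Md [k [num [den H]]]]] [_ [/in_poly_ptime Hm [/in_poly_ptime Hp [V [/polytime_ptime HV HA]]]]]]]].
have Hnum: ptime num by apply: (@ptime_unary Mn k)=> n; have [] := H n.
have Hden: ptime den by apply: (@ptime_unary Md k)=> n; have [_ []] := H n.
have D := pt_decu HV.
(* The padding has to dominate the exponentials of the register sizes and of [p], since [gapF] cuts
   its powers of two at it. *)
have HB: ptime (fun x : seq bool=> nth 0 (decu (V x)) 0 + nth 0 (decu (V x)) 1 + p (size x) + 3) by pt.
have [k1 H1] := pt_szb HB.
have [k2 H2] : exists k, forall n, (4*n + 10) ^ k1 <= n ^ k + k by apply: pol_nk; auto 10 with pol.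
have cap x: nth 0 (decu (V x)) 0 + nth 0 (decu (V x)) 1 + p (size x) + 3 <= size x ^ k2 + k2.
 apply: leq_trans (H2 _); have := H1 x; rewrite esz_nat=> h; apply: leq_trans (leq_trans h _); first by lia.
 apply: leqX.
 rewrite esz_sum; have : \sum_(b <- x) (esz b).+1 <= \sum_(b <- x) 4 by apply: leq_sum=> b _; rewrite ltnS esz_bool.
 by rewrite big_const_seq count_predT iter_addn_0; move: (\sum_(b <- x) (esz b).+1)=> S; lia.
apply: (@ptime_EXP (fun xt=> gapF (V xt.1) (num (size xt.1)) (den (size xt.1)) (m (size xt.1)) (p (size xt.1)) xt.2) k2).
 by apply: pt_gapF; pt.
move=> x; have [HY HN] := HA x; have [_ [_ [d0 aE]]] := H (size x); have c := cap x; rewrite decuE -/(vd_nv _) -/(vd_nm _) in c.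
have c1: 2 ^ ((vd_nv (V x)).+1 + vd_nm (V x)).+1 <= 2 ^ (size x ^ k2 + k2) by rewrite leq_exp2l; lia.
have c2: 2 ^ p (size x) <= 2 ^ (size x ^ k2 + k2) by rewrite leq_exp2l; lia.
split=> [/HY [DD [Ps [HPs acc]]] | /HN acc].
 by apply: (gapF_complete c1 c2 d0 HPs); rewrite -aE.
apply/negP=>/(gapF_sound c1 c2 d0) [DD [Ps [HPs lt]]]; have := acc _ _ HPs; rewrite aE leNgt=>/negP; exact.
Qed.

(** * Reversible circuits for formulas *)
Notation rop := (nat * nat * nat)%type.
(** A triple with equal first and third components is no Toffoli gate and codes a NOT, built from
    the given gates by conjugating the sign flip [Ph], [Ph] with Hadamard gates. *)
Definition rg (o : rop) : seq gate := if o.1.1 == o.2 then [:: Had o.2; Ph o.2; Ph o.2; Had o.2] else [:: Tof o.1.1 o.1.2 o.2].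
Definition rgc ops := flatten (map rg (rev ops)).
Section Rev.
Variable N : nat.
Implicit Types (b : basis N) (ops : seq rop).
Definition flip i b := setq i (~~ getq i b) b.
Definition ract (o : rop) b := if o.1.1 == o.2 then flip o.2 b else
 if [&& o.1.1 < N, o.1.2 < N, o.2 < N, o.1.1 != o.1.2 & o.1.2 != o.2] then
  (if getq o.1.1 b && getq o.1.2 b then flip o.2 b else b) else b.
Definition rrun ops b := foldr ract b ops.
Lemma getq_flip i k b : i < N -> getq i (flip k b) = getq i b (+) (i == k).
by move=> iN; rewrite getq_setq//; case: eqP=>[->|_]; rewrite ?addbT ?addbF. Qed.
Lemma flipK k b : flip k (flip k b) = b.
by apply: basis_eq=> i iN; rewrite !getq_flip// addbK. Qed.
Lemma ractK o b : ract o (ract o b) = b.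
rewrite /ract; case: (eqVneq o.1.1 o.2)=> e; first exact: flipK.
set c := [&& _, _, _, _ & _]; case Hc : c=> //; case/and5P: Hc=> i1 i2 i3 i4 i5.
case E: (getq _ b && getq _ b); rewrite ?E ?flipK//.
by rewrite !getq_flip// (negbTE i5) (negbTE e) !addbF E.
Qed.
Lemma rrun_cat ops ops' b : rrun (ops ++ ops') b = rrun ops (rrun ops' b).
exact: foldr_cat. Qed.
Lemma rrunK ops b : rrun (rev ops) (rrun ops b) = b.
by elim: ops b=> // o ops IH b; rewrite rev_cons -cats1 rrun_cat/= ractK. Qed.
Local Open Scope ring_scope.
Lemma s2C : ((Num.sqrt (2 : R))^-1)%:C%C * ((Num.sqrt (2 : R))^-1)%:C%C = 2^-1 :> C.
by rewrite -rmorphM -expr2 exprVn sqr_sqrtr// fmorphV rmorph_nat. Qed.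
Lemma xalg (A : comPzRingType) (s i x y g : A) :
 s * (1 * (1 * (s * (x + 1 * y))) + g * (i * (i * (s * (x + -1 * y))))) = s * s * (x + y + g * (i * i) * (x - y)).
ring. Qed.
Lemma rg_apply D o (psi : qstate N D) : apply_circuit (rg o) psi = fun b e => psi (ract o b) e.
funext b; funext e; rewrite /rg /ract; case: (eqVneq o.1.1 o.2)=>[_|oo]; last first.
 by rewrite/= oo andbT; case: ifP.
rewrite/=; have [kN|kN] := boolP (o.2 < N)%N; last first.
 congr psi; apply: basis_eq=> i iN; rewrite getq_flip//.
 by lia.
rewrite /flip; set k := o.2; have g v b': getq k (setq k v b') = v by rewrite getq_setq// eqxx.
rewrite !g !setq_setq xalg s2C (_ : 'i%C * 'i%C = -1); last by rewrite -expr2 sqr_i.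
set x := psi (setq k false b) e; set y := psi (setq k true b) e.
have h: 2^-1*(2*x) = x by rewrite mulrA mulVf ?mul1r// pnatr_eq0.
have h': 2^-1*(2*y) = y by rewrite mulrA mulVf ?mul1r// pnatr_eq0.
case: getq; [rewrite -[RHS]h | rewrite -[RHS]h'].
 by rewrite mulrN1 opprK mul1r addrACA subrr addr0 mulr_natl.
ring.
Qed.
Lemma rgc_apply D ops (psi : qstate N D) : apply_circuit (rgc ops) psi = fun b e => psi (rrun (rev ops) b) e.
rewrite /rgc; elim: ops=> // o ops IH; rewrite rev_cons map_rcons -cats1 flatten_cat /apply_circuit foldl_cat/= cats0 -!/(apply_circuit _ _) IH rg_apply; funext e.
by rewrite -cats1 rrun_cat.
Qed.
End Rev.
(* A formula is a list of tokens (kind, j, k) in postfix order: kind 0 pushes true, kind 1 replaces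
  the two top entries of the stack by their NAND, any other kind pushes the variable (j, k). *)
Notation token := (nat * nat * nat)%type.
Definition tstep env st (t : token) : option (seq bool) :=
 if st is Some s then
  if t.1.1 == 0 then Some (true :: s)
  else if t.1.1 == 1 then (if s is u :: v :: s' then Some (~~ (u && v) :: s') else None)
  else Some (env t.1.2 t.2 :: s)
 else None.
Definition trun env f st := foldl (tstep env) st f.
Definition sem env f v := forall st, trun env f (Some st) = Some (v :: st).
Section Compile.
Variables (qv : nat -> nat -> nat) (one : nat).
(** The state is the next free qubit, the qubits holding the entries of the stack, and the gates so
    far, latest first. Every token takes a fresh qubit; qubit [one] holds the constant true, which
    turns a Toffoli gate into a copy. *)
Definition cstep x (t : token) : nat * seq nat * seq rop :=
 let n := x.1.1 in let st := x.1.2 in let ops := x.2 in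
 if t.1.1 == 0 then (n.+1, n :: st, (n, n, n) :: ops)
 else if t.1.1 == 1 then (n.+1, n :: drop 2 st, (nth 0 st 0, nth 0 st 1, n) :: (n, n, n) :: ops)
 else (n.+1, n :: st, (qv t.1.2 t.2, one, n) :: ops).
Definition comp f := foldl cstep (one.+1, [::], [:: (one, one, one)]) f.
Definition copies st tgs : seq rop := [seq (p.1, one, p.2) | p <- zip st (rev tgs)].
(** Compute, copy the results into the targets, uncompute: the scratch qubits return to zero and
    cannot destroy the coherence of a superposition. *)
Definition fcirc f tgs : seq rop :=
 let c := comp f in rev c.2 ++ copies c.1.2 tgs ++ c.2.
Section Correct.
Variables (N top : nat).
Hypotheses (topN : top <= N) (one_top : one < top).
Variable vars : nat -> nat -> bool.
Hypothesis qvN : forall j k, vars j k -> qv j k < N /\ ((qv j k < one) || (top <= qv j k)).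
Variable good : pred nat.
Hypothesis good_anc : forall i, one <= i < top -> good i.
Definition okt t := (1 < t.1.1) ==> vars t.1.2 t.2 && good (qv t.1.2 t.2).
Definition goodop o := [&& good o.1.1, good o.1.2 & good o.2].
Definition anc0 (b : basis N) := forall i, one <= i < top -> getq i b = false.
Lemma comp_size f : (comp f).1.1 = one.+1 + size f.
rewrite /comp; elim/last_ind: f=>[|f t IH]; first by rewrite addn0.
by rewrite foldl_rcons size_rcons addnS -IH /cstep; case: ifP=> // _; case: ifP.
Qed.
(** Stack entries occupy distinct scratch qubits above [one], and gates write only to fresh ones, so
    earlier entries are never disturbed. Distinctness matters, since a Toffoli gate with equal
    controls acts as the identity. *)
Lemma comp_ok f b vs : anc0 b -> all okt f -> one.+1 + size f <= top ->
 trun (fun j k => getq (qv j k) b) f (Some [::]) = Some vs ->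
 [/\ forall i, i < N -> (i < one) || ((comp f).1.1 <= i) -> getq i (rrun (comp f).2 b) = getq i b,
   getq one (rrun (comp f).2 b) = true,
   uniq (comp f).1.2, all (fun i => one < i < (comp f).1.1) (comp f).1.2 &
   all goodop (comp f).2 /\ map (fun i => getq i (rrun (comp f).2 b)) (comp f).1.2 = vs].
move=> b0; elim/last_ind: f vs=>[|f t IH] vs.
 have uN: one < N by apply: leq_trans topN.
 move=> _ _ [<-]; rewrite /comp/=; have r1: ract (one, one, one) b = flip one b by rewrite /ract eqxx.
 rewrite r1; split=>//.
 - by move=> i iN h; rewrite getq_flip// (_ : (i == one) = false) ?addbF//; clear -h; lia.
 - by rewrite getq_flip// eqxx b0// leqnn.
 - by rewrite /goodop !good_anc// leqnn.
rewrite all_rcons size_rcons addnS=>/andP[okt_ okf] sz; rewrite /trun foldl_rcons -/(trun _ _ _).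
case E : (trun _ f _)=>[us|]// ; have {IH} := IH us okf (ltnW sz) E.
rewrite {-1}/comp foldl_rcons -/(comp f); have := comp_size f; case: comp=>[[n st] ops]/= nE; set b1 := rrun ops b=> -[I1 I2 I3 I4 [I6 I5]].
have nt: n < top by lia.
have nN: n < N by lia.
have n1: one < n by lia.
have gn: good n by apply: good_anc; rewrite ltnW.
have gst i: i \in st -> good i by move/(allP I4)=> h; apply: good_anc; lia.
have fn: getq n b1 = false by rewrite I1 ?leqnn ?orbT// b0// ltnW.
have ns: n \notin st by apply/negP=>/(allP I4); rewrite ltnn andbF.
have st_ne i: i \in st -> i != n by apply: contraTneq=> ->.
have stN i: i \in st -> i < N by move/(allP I4)=> h; clear -h nN; lia.
have fl (b2 : basis N) v : (forall i, i < N -> getq i b2 = getq i b1 (+) ((i == n) && v)) ->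
 (forall i, i < N -> (i < one) || (n < i) -> getq i b2 = getq i b) /\ getq one b2 = true /\ getq n b2 = v /\ forall s, {subset s <= st} -> map (fun i=> getq i b2) s = map (fun i=> getq i b1) s.
 split=> [i iN h|]; first by rewrite H ?I1//; clear -h n1; lia.
 split; first by rewrite H ?(leq_trans one_top)// (_ : (one == n) = false) ?addbF//; clear -n1; lia.
 split; first by rewrite H// fn eqxx.
 by move=> s ss; apply/eq_in_map=> i /ss iu; rewrite H ?stN// (negbTE (st_ne _ iu)) addbF.
case: t okt_ {sz} => [[kd j] k]; rewrite /okt.
case: kd=>[|[|kd]]/= vok.
- case=> <-; have [|f1 [f2 [f3 f4]]] := fl (ract (n, n, n) b1) true.
  by move=> i iN; rewrite /ract eqxx getq_flip// andbT.
 split=>//; rewrite ?ns ?ltnSn ?n1 ?f3 ?f4 ?I5 /goodop ?gn//=.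
 by apply/allP=> i /(allP I4) h; clear -h; lia.
- case: us I5 {E} => [|u [|v us]]// I5 [<-].
 case: st I3 I4 I5 ns st_ne stN gst fl=>[|i1 [|i2 st]]//= /and3P[u1 u2 u3] /and3P[a1 a2 a3] [e1 e2 e3] ns st_ne stN gst fl; rewrite drop0.
 have N1 := stN i1; have N2 := stN i2; have M1 := st_ne i1; have M2 := st_ne i2; rewrite !inE !eqxx ?orbT in N1 N2 M1 M2.
 have {}N1 := N1 isT; have {}N2 := N2 isT; have {}M1 := M1 isT; have {}M2 := M2 isT.
 have g: ract (i1, i2, n) (ract (n, n, n) b1) = if u && v then flip n (flip n b1) else flip n b1.
  have i12: i1 != i2 by move: u1; rewrite negb_or=>/andP[].
  by rewrite {1}/ract N1 N2 nN i12 /ract eqxx !getq_flip// (negbTE M1) (negbTE M2) !addbF e1 e2.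
 have [|f1 [f2 [f3 f4]]] := fl (ract (i1, i2, n) (ract (n, n, n) b1)) (~~ (u && v)).
  by move=> i iN; rewrite g; case: (u && v); rewrite !getq_flip ?andbT ?andbF ?addbF// addbK.
 move: ns; rewrite !negb_or=>/and3P[ns1 ns2 ns].
 split=>//; rewrite ?ns ?ltnSn ?n1 ?f3 ?f4 ?e3 /goodop ?gn ?gst ?inE ?eqxx ?orbT//=; last by move=> i; rewrite !inE=> ->; rewrite !orbT.
 by apply/allP=> i /(allP a3) h; clear -h; lia.
- case=> <-; case/andP: vok=> vok gq; have [qN qo] := qvN vok.
 have [|f1 [f2 [f3 f4]]] := fl (ract (qv j k, one, n) b1) (getq (qv j k) b).
  move=> i iN; have q1: (qv j k == n) = false by clear -qo nt n1; lia.
  have q2: (qv j k == one) = false by clear -qo one_top; lia.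
  have q3: (one == n) = false by clear -n1; lia.
  have q4: getq (qv j k) b1 = getq (qv j k) b by apply: I1=> //; clear -qo nt; lia.
  rewrite /ract q1 qN nN (leq_trans one_top topN) q2 q3 q4 I2.
  by case: (getq (qv j k) b); rewrite ?getq_flip ?andbT ?andbF ?addbF.
 split=>//; rewrite ?ns ?n1 ?f3 ?f4 ?I5 /goodop ?gn ?gq ?(good_anc (i := one)) ?leqnn//=.
 by apply/allP=> i /(allP I4) h; clear -h; lia.
Qed.
(** Flips are counted modulo 2, which makes lists of targets additive under concatenation without
    any distinctness. *)
Definition par (l : seq (nat * bool)) i := odd (count (fun p => (p.1 == i) && p.2) l).
Definition flips l (b : basis N) : basis N := [ffun i => b i (+) par l (val i)].
Lemma getq_flips l b i : i < N -> getq i (flips l b) = getq i b (+) par l i.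
by move=> iN; rewrite /getq insubT ffunE. Qed.
Lemma copies_run st tg b : getq one b = true -> all (fun i => one < i < top) st -> all (fun t => (t < one) || (top <= t < N)) tg ->
 rrun [seq (p.1, one, p.2) | p <- zip st tg] b = flips (zip tg (map (fun i => getq i b) st)) b.
move=> b1; elim: st tg=>[|o st IH] [|t tg]//=; try by move=> *; apply: basis_eq=> i iN; rewrite getq_flips// addbF.
move=> /andP[o1 o2] /andP[t1 t2]; rewrite IH//; set l := zip tg _.
have par0 i: all (fun t=> (t < one) || (top <= t < N)) tg -> one <= i < top -> par l i = false.
 move=> H io; rewrite /par (_ : count _ l = 0)//; apply/eqP; rewrite -leqn0 leqNgt -has_count; apply/negP=>/hasP[[x v]/= xl /andP[/eqP xi _]].
 have : x \in tg.
  by move: xl; rewrite /l; move: map; clear; elim: tg=>[|a tg IH] [|c s]//=; rewrite !inE=>/orP[/eqP[-> _]|/IH ->]; rewrite ?eqxx ?orbT.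
 by move/(allP H); lia.
have tN: t < N by lia.
have oN: o < N by lia.
have uN: one < N by lia.
have q1: (o == t) = false by lia.
have q2: (o == one) = false by lia.
have q3: (one == t) = false by lia.
have p1: par l o = false by apply: par0=> //; lia.
have p2: par l one = false by apply: par0=> //; lia.
rewrite /ract q1 oN tN uN q2 q3 !getq_flips// b1 p1 p2 !addbF andbT.
apply: basis_eq=> i iN; have -> : getq i (if getq o b then flip t (flips l b) else flips l b) = getq i (flips l b) (+) ((i == t) && getq o b).
 by case: (getq o b); rewrite ?getq_flip ?andbT ?andbF ?addbF.
rewrite !getq_flips// /par oddD oddb eq_sym -addbA; congr (_ (+) _); exact: addbC.
Qed.
(** Gates that avoid the targets commute with flipping them; this lets the computation be undone
    after the copies. *)
Lemma ract_flips l o b : (forall i, good i -> par l i = false) -> goodop o -> ract o (flips l b) = flips l (ract o b).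
move=> H /and3P[g1 g2 g3].
have F k: good k -> k < N -> flip k (flips l b) = flips l (flip k b).
 move=> gk kN; apply: basis_eq=> i iN; rewrite !(getq_flips, getq_flip)// addbAC//.
rewrite /ract; case: eqP=>[_|_].
 case: (ltnP o.2 N)=> kN; first exact: F.
 have E (b' : basis N) : flip o.2 b' = b'.
  by apply: basis_eq=> i iN; rewrite getq_flip; clear -kN iN; lia.
 by rewrite !E.
case: ifP=> // /and5P[i1 i2 i3 _ _]; rewrite !getq_flips// !H// !addbF; case: ifP=> // _; exact: F.
Qed.
Lemma rrun_flips l ops b : (forall i, good i -> par l i = false) -> all goodop ops -> rrun ops (flips l b) = flips l (rrun ops b).
by move=> H; elim: ops=> //= o ops IH /andP[g1 g2]; rewrite IH// ract_flips. Qed.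
Lemma par_zip (tg : seq nat) vs i : i \notin tg -> par (zip tg vs) i = false.
move=> it; rewrite /par; elim: tg vs it=>[|t tg IH] [|v vs]//=; rewrite negb_or=>/andP[h1 h2].
by rewrite eq_sym (negbTE h1) IH.
Qed.
Variables (f : seq token) (tgs : seq nat).
Hypotheses (fok : all okt f) (fsz : one.+1 + size f <= top) (tgs_ok : all (fun t => (t < one) || (top <= t < N)) tgs) (tgs_good : forall i, good i -> i \notin tgs).
Definition anc0b (b : basis N) := all (fun i => ~~ getq i b) (iota one (top - one)).
Lemma anc0P b : reflect (anc0 b) (anc0b b).
apply: (iffP allP)=> H i; first by move=> h; apply/negbTE/H; rewrite mem_iota; clear -h; lia.
by rewrite mem_iota=> h; rewrite H; clear -h; lia.
Qed.
Variable bs : basis N -> seq bool.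
Hypothesis Hbs : forall b, anc0 b -> trun (fun j k => getq (qv j k) b) f (Some [::]) = Some (rev (bs b)) /\ size (bs b) = size tgs.
Lemma flips_anc0 b vs tg : all (fun t => (t < one) || (top <= t < N)) tg -> anc0 b -> anc0 (flips (zip tg vs) b).
move=> H b0 i io; rewrite getq_flips ?b0 ?par_zip//; last by clear -io topN; lia.
by apply/negP=>/(allP H); clear -io; lia.
Qed.
Lemma fcirc_core b st' tg' : anc0 b -> {subset st' <= (comp f).1.2} -> {subset tg' <= tgs} ->
 rrun (rev (comp f).2 ++ [seq (p.1, one, p.2) | p <- zip st' tg'] ++ (comp f).2) b = flips (zip tg' [seq getq i (rrun (comp f).2 b) | i <- st']) b.
move=> b0 S1 S2; have [Hr _] := Hbs b0; have [I1 I2 I3 I4 [I6 I5]] := comp_ok b0 fok fsz Hr.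
have T': all (fun t=> (t < one) || (top <= t < N)) tg' by apply/allP=> t /S2 /(allP tgs_ok).
rewrite !rrun_cat copies_run//; last first.
 by apply/allP=> i /S1 /(allP I4); rewrite comp_size=> h; lia.
rewrite rrun_flips ?rrunK ?all_rev// => i gi; apply: par_zip; apply: contra (tgs_good gi); exact: S2.
Qed.
Lemma fcirc_apply D (psi : qstate N D) : (forall b e, ~ anc0 b -> psi b e = 0%R) ->
 apply_circuit (rgc (fcirc f tgs)) psi = fun b e => if anc0b b then psi (flips (zip tgs (bs b)) b) e else 0%R.
move=> psi0; rewrite rgc_apply; funext b; funext e.
set ops := (comp f).2; set st := (comp f).1.2.
case: anc0P=> b0.
 have [Hr Hs] := Hbs b0; have [I1 I2 I3 I4 [I6 I5]] := comp_ok b0 fok fsz Hr.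
 have sst: size st = size tgs by rewrite -Hs -(size_rev (bs b)) -I5 size_map.
 rewrite !rev_cat revK -catA -map_rev rev_zip ?size_rev// revK fcirc_core//; last by move=> i; rewrite mem_rev.
 by rewrite map_rev I5 revK.
apply: psi0=> b1; apply: b0; rewrite -(rrunK (rev (rev ops ++ [seq (p.1, one, p.2) | p <- zip st (rev tgs)] ++ ops)) b) revK.
by rewrite fcirc_core// => [|i]; [apply: flips_anc0=> //; rewrite all_rev | rewrite mem_rev].
Qed.
End Correct.
End Compile.

(** * Local checks of a computation tableau *)
Definition fT : seq token := [:: (0, 0, 0)].
Definition fv j k : seq token := [:: (2, j, k)].
Definition fnd f g : seq token := g ++ f ++ [:: (1, 0, 0)].
Definition fnot f := fnd f fT.
Definition fand f g := fnot (fnd f g).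
Definition for_ f g := fnd (fnot f) (fnot g).
Definition fimp f g := fnd f (fnot g).
Definition feq f g := fnd (fnd f g) (for_ f g).
Definition fall l := foldr fand fT l.
Section Sem.
Variable env : nat -> nat -> bool.
Lemma sem_T : sem env fT true. by []. Qed.
Lemma sem_v j k : sem env (fv j k) (env j k). by []. Qed.
Lemma sem_nd f g a b : sem env f a -> sem env g b -> sem env (fnd f g) (~~ (a && b)).
by move=> F G st; rewrite /trun !foldl_cat -!/(trun _ _ _) G F. Qed.
Lemma sem_eq f v v' : sem env f v -> v = v' -> sem env f v'. by move=> F <-. Qed.
Lemma sem_not f a : sem env f a -> sem env (fnot f) (~~ a).
by move=> F; apply: sem_eq (sem_nd F sem_T) _; rewrite andbT. Qed.
Lemma sem_and f g a b : sem env f a -> sem env g b -> sem env (fand f g) (a && b).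
by move=> F G; apply: sem_eq (sem_not (sem_nd F G)) _; rewrite negbK. Qed.
Lemma sem_or f g a b : sem env f a -> sem env g b -> sem env (for_ f g) (a || b).
by move=> F G; apply: sem_eq (sem_nd (sem_not F) (sem_not G)) _; case: a {F}; case: b {G}. Qed.
Lemma sem_imp f g a b : sem env f a -> sem env g b -> sem env (fimp f g) (a ==> b).
by move=> F G; apply: sem_eq (sem_nd F (sem_not G)) _; case: a {F}; case: b {G}. Qed.
Lemma sem_feq f g a b : sem env f a -> sem env g b -> sem env (feq f g) (a == b).
by move=> F G; apply: sem_eq (sem_nd (sem_nd F G) (sem_or F G)) _; case: a {F}; case: b {G}. Qed.
Lemma sem_all A (l : seq A) g v : (forall x, sem env (g x) (v x)) -> sem env (fall (map g l)) (all v l).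
by move=> H; elim: l=>[|x l IH]//=; apply: sem_and. Qed.
End Sem.
Section Vars.
Variable P : nat -> nat -> bool.
Definition fok f := all (fun t : token => (1 < t.1.1) ==> P t.1.2 t.2) f.
Lemma fok_v j k : P j k -> fok (fv j k). by rewrite/= => ->. Qed.
Lemma fok_nd f g : fok f -> fok g -> fok (fnd f g).
by move=> F G; rewrite /fok !all_cat -!/(fok _) F G. Qed.
Lemma fok_not f : fok f -> fok (fnot f). by move=> F; apply: fok_nd. Qed.
Lemma fok_and f g : fok f -> fok g -> fok (fand f g). by move=> F G; apply/fok_not/fok_nd. Qed.
Lemma fok_or f g : fok f -> fok g -> fok (for_ f g). by move=> F G; apply: fok_nd; apply: fok_not. Qed.
Lemma fok_imp f g : fok f -> fok g -> fok (fimp f g). by move=> F G; apply: fok_nd=> //; apply: fok_not. Qed.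
Lemma fok_eq f g : fok f -> fok g -> fok (feq f g). by move=> F G; apply: fok_nd; [apply: fok_nd | apply: fok_or]. Qed.
Lemma fok_all (A : eqType) (l : seq A) g : (forall x, x \in l -> fok (g x)) -> fok (fall (map g l)).
by elim: l=> // x l IH H; apply: fok_and; [apply: H; rewrite mem_head | apply: IH=> y yl; apply: H; rewrite inE yl orbT]. Qed.
End Vars.
Definition feqs j1 j2 o n := fall (mkseq (fun k => feq (fv j1 (o + k)) (fv j2 (o + k))) n).
Definition fones j o n := fall (mkseq (fun k => fv j (o + k)) n).
(** Adding one changes bit [k] exactly when all lower bits are one; the overflow is dropped, so
    counting is cyclic. *)
Definition fsucc j1 j2 o n := fall (mkseq (fun k => feq (fv j1 (o + k)) (fnot (feq (fv j2 (o + k)) (fones j2 o k)))) n).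
(** [bt] skips bit 0 of its argument; doubling [a] makes up for it. *)
Definition fconst j o n a := fall (mkseq (fun k => if bt k (a + a) then fv j (o + k) else fnot (fv j (o + k))) n).
Section Num.
Variable env : nat -> nat -> bool.
Definition num j o n := b2n (mkseq (fun k => env j (o + k)) n).
Lemma num_lt j o n : num j o n < 2 ^ n.
by have := b2n_lt (mkseq (fun k=> env j (o + k)) n); rewrite size_mkseq. Qed.
Lemma bit_num j o n k : k < n -> odd (iter k half (num j o n)) = env j (o + k).
by move=> kn; rewrite bit_b2n nth_mkseq. Qed.
Lemma bits_inj n a b : a < 2 ^ n -> b < 2 ^ n -> (forall k, k < n -> odd (iter k half a) = odd (iter k half b)) -> a = b.
elim: n a b=>[|n IH] a b; first by lia.
move=> an bn H; rewrite -(odd_double_half a) -(odd_double_half b) (H 0 (ltn0Sn _)); congr (_ + _.*2).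
have hb c: c < 2 ^ n.+1 -> c./2 < 2 ^ n by rewrite expnS=> h; lia.
by apply: IH; rewrite ?hb// => k kn; have := H k.+1 kn; rewrite !iterSr.
Qed.
Lemma all_iotaP (p : pred nat) n : reflect (forall k, k < n -> p k) (all p (iota 0 n)).
by apply: (iffP allP)=> H k kn; apply: H; move: kn; rewrite mem_iota. Qed.
Lemma btD k a : bt k (a + a) = odd (iter k half a). by rewrite /bt (eq_iter hfE) iterSr addnn doubleK. Qed.
Lemma sem_eqs j1 j2 o n : sem env (feqs j1 j2 o n) (num j1 o n == num j2 o n).
apply: sem_eq (sem_all _ (fun k=> sem_feq (sem_v _ _ _) (sem_v _ _ _))) _.
apply/all_iotaP/eqP=>[H|H k kn]; last by rewrite -(bit_num j1 o kn) -(bit_num j2 o kn) H.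
by apply: (bits_inj (num_lt _ _ _) (num_lt _ _ _))=> k kn; rewrite !bit_num//; apply/eqP/H.
Qed.
Lemma sem_ones0 j o n : sem env (fones j o n) (all (fun k => env j (o + k)) (iota 0 n)).
by apply: sem_all=> k. Qed.
Lemma allones s : all id s = (b2n s == (2 ^ size s).-1).
elim: s=> // b s IH; rewrite [all _ _]/= IH expnS/=; have : 0 < 2 ^ size s by lia.
by move: b2n (2 ^ size s)=> x y; lia.
Qed.
Lemma sem_ones j o n : sem env (fones j o n) (num j o n == (2 ^ n).-1).
apply: sem_eq (sem_ones0 j o n) _; have := allones (mkseq (fun k=> env j (o + k)) n); rewrite size_mkseq all_map=> <-//.
Qed.
Fixpoint succs s := if s is b :: s' then if b then false :: succs s' else true :: s' else [::].
Lemma size_succs s : size (succs s) = size s. by elim: s=> // -[] s/= IH; rewrite ?IH. Qed.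
Lemma succsE s : b2n (succs s) = (b2n s).+1 %% 2 ^ size s.
elim: s=>[|[] s IH]//.
 rewrite/= IH expnS -!mul2n muln_modr; congr (_ %% _); lia.
rewrite modn_small; have := b2n_lt (false :: s); rewrite/= expnS; lia.
Qed.
Lemma nth_succs s k : k < size s -> nth false (succs s) k = nth false s k (+) all id (take k s).
elim: s k=> // -[] s IH [|k] ks//=; [exact: IH | by lia].
Qed.
Lemma sem_succ j1 j2 o n : sem env (fsucc j1 j2 o n) (num j1 o n == (num j2 o n).+1 %% 2 ^ n).
apply: sem_eq (sem_all _ (fun k=> sem_feq (sem_v _ _ _) (sem_not (sem_feq (sem_v _ _ _) (sem_ones0 _ _ _))))) _.
set s := mkseq (fun k=> env j2 (o + k)) n; have ss: size s = n by rewrite size_mkseq.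
have -> : (num j2 o n).+1 %% 2 ^ n = b2n (succs s) by rewrite succsE ss.
have E k: k < n -> ~~ (env j2 (o + k) == all (fun l=> env j2 (o + l)) (iota 0 k)) = nth false (succs s) k.
 move=> kn; rewrite nth_succs ?ss// nth_mkseq// -map_take take_iota (minn_idPl (ltnW kn)) all_map.
 by case: (env); case: (all).
apply/all_iotaP/eqP=>[H|H k kn].
 apply: (@bits_inj n); rewrite ?num_lt//; first by have := b2n_lt (succs s); rewrite size_succs ss.
 by move=> k kn; rewrite bit_num// bit_b2n -E//; apply/eqP/H.
by rewrite E// -(bit_num j1 o kn) H bit_b2n.
Qed.
Lemma sem_const j o n a : a < 2 ^ n -> sem env (fconst j o n a) (num j o n == a).
move=> an; apply: sem_eq (sem_all (v := fun k=> env j (o + k) == odd (iter k half a)) _ _) _=>[k|].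
 rewrite btD; case: (odd)=> /=; first by rewrite eqb_id.
 by apply: sem_eq (sem_not (sem_v _ _ _)) _.
apply/all_iotaP/eqP=>[H|<- k kn]; last by rewrite bit_num.
by apply: (bits_inj (num_lt _ _ _) an)=> k kn; rewrite bit_num//; apply/eqP/H.
Qed.
End Num.
Section Phi.
Variables (K L : nat) (ic : seq nat) (tab : seq token) (bad : nat).
Definition finit := fand (fall (mkseq (fun p => fimp (fconst 3 (K + L) L p) (fconst 3 0 K (nth 0 ic p))) (size ic)))
 (fimp (fall (mkseq (fun p => fnot (fconst 3 (K + L) L p)) (size ic))) (fconst 3 0 K 0)).
(** Cells 0, 1, 2 are neighbours in one row and cell 3 lies below cell 1 in the next; the fields of
    a cell are its content, its row and its position. A window starting in the last row has its cell
    3 in row 0, where it must show the initial content, while its cell 1 must not be rejecting. *)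
Definition fphi := fall [:: feqs 1 0 K L; feqs 2 0 K L; feqs 3 1 (K + L) L; fsucc 1 0 (K + L) L; fsucc 2 1 (K + L) L; fsucc 3 0 K L;
 fimp (fones 0 K L) (fand finit (fnot (fconst 1 0 K bad))); for_ (fones 0 K L) tab].
End Phi.
Definition ftab K rule := fall (mkseq (fun a0 => fall (mkseq (fun a1 => fall (mkseq (fun a2 =>
 fimp (fand (fconst 0 0 K a0) (fand (fconst 1 0 K a1) (fconst 2 0 K a2))) (fconst 3 0 K (rule a0 a1 a2))) (2 ^ K))) (2 ^ K))) (2 ^ K)).
Section PhiSem.
Variables (env : nat -> nat -> bool) (K L : nat) (ic : seq nat) (rule : nat -> nat -> nat -> nat) (bad : nat).
Hypotheses (rule_lt : forall a b c, rule a b c < 2 ^ K) (ic_lt : forall p, nth 0 ic p < 2 ^ K) (ic_size : size ic <= 2 ^ L) (bad_lt : bad < 2 ^ K).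
Let t j := num env j K L.
Let i j := num env j (K + L) L.
Let a j := num env j 0 K.
Definition phib := [&& t 1 == t 0, t 2 == t 0, i 3 == i 1, i 1 == (i 0).+1 %% 2 ^ L, i 2 == (i 1).+1 %% 2 ^ L, t 3 == (t 0).+1 %% 2 ^ L &
 if t 0 == (2 ^ L).-1 then (a 3 == nth 0 ic (i 3)) && (a 1 != bad) else a 3 == rule (a 0) (a 1) (a 2)].
Lemma sem_all_lt g v n : (forall k, k < n -> sem env (g k) (v k)) -> sem env (fall (mkseq g n)) (all v (iota 0 n)).
move=> H; rewrite /mkseq; have : forall k, k \in iota 0 n -> sem env (g k) (v k) by move=> k; rewrite mem_iota=>/andP[_]; apply: H.
elim: iota=> // k l IH H'; apply: sem_and; [apply: H'; exact: mem_head | apply: IH=> m ml; apply: H'; by rewrite inE ml orbT].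
Qed.
Lemma sem_tab : sem env (ftab K rule) (a 3 == rule (a 0) (a 1) (a 2)).
apply: sem_eq (sem_all_lt (fun a0 h0=> sem_all_lt (fun a1 h1=> sem_all_lt (fun a2 h2 =>
 sem_imp (sem_and (sem_const _ 0 0 h0) (sem_and (sem_const _ 1 0 h1) (sem_const _ 2 0 h2))) (sem_const _ 3 0 (rule_lt a0 a1 a2)))))) _.
apply/all_iotaP/idP=>[H|/eqP H a0 h0].
 have := H (a 0) (num_lt _ _ _ _)=>/all_iotaP/(_ (a 1) (num_lt _ _ _ _))/all_iotaP/(_ (a 2) (num_lt _ _ _ _)).
 by rewrite !eqxx.
apply/all_iotaP=> a1 h1; apply/all_iotaP=> a2 h2; apply/implyP=>/and3P[/eqP e0 /eqP e1 /eqP e2].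
by rewrite -e0 -e1 -e2 -/(a _) H.
Qed.
Lemma sem_init : sem env (finit K L ic) (a 3 == nth 0 ic (i 3)).
have lt p: p < size ic -> p < 2 ^ L by move=> h; apply: leq_trans ic_size.
have K0: 0 < 2 ^ K by rewrite expn_gt0.
apply: sem_eq (sem_and (sem_all_lt (fun p hp=> sem_imp (sem_const _ 3 (K + L) (lt _ hp)) (sem_const _ 3 0 (ic_lt p))))
 (sem_imp (sem_all_lt (fun p hp=> sem_not (sem_const _ 3 (K + L) (lt _ hp)))) (sem_const _ 3 0 K0))) _.
apply/andP/idP=>[[/all_iotaP H1 /implyP H2]|/eqP H].
 case: (ltnP (i 3) (size ic))=> h; first by have := H1 _ h; rewrite eqxx.
 rewrite nth_default//; apply: H2; apply/all_iotaP=> p hp; apply/negP=>/eqP e; move: h; rewrite /i e leqNgt hp//.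
split; first by apply/all_iotaP=> p hp; apply/implyP=>/eqP e; rewrite -/(a 3) H /i e.
apply/implyP=>/all_iotaP h; rewrite -/(a 3) H nth_default// leqNgt; apply/negP=> hp; have := h _ hp; by rewrite eqxx.
Qed.
Lemma sem_phi : sem env (fphi K L ic (ftab K rule) bad) phib.
apply: sem_eq.
 apply: sem_and (sem_eqs _ _ _ _ _) _; apply: sem_and (sem_eqs _ _ _ _ _) _; apply: sem_and (sem_eqs _ _ _ _ _) _.
 apply: sem_and (sem_succ _ _ _ _ _) _; apply: sem_and (sem_succ _ _ _ _ _) _; apply: sem_and (sem_succ _ _ _ _ _) _.
 apply: sem_and (sem_imp (sem_ones _ _ _ _) (sem_and sem_init (sem_not (sem_const _ 1 0 bad_lt)))) _.
 exact: sem_and (sem_or (sem_ones _ _ _ _) sem_tab) (sem_T _).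
do 6 congr (_ && _).
by case: (t 0 == _); rewrite ?andbT.
Qed.
End PhiSem.
Section PhiVars.
Variable P : nat -> nat -> bool.
Lemma fok_mk g n : (forall k, k < n -> fok P (g k)) -> fok P (fall (mkseq g n)).
by move=> H; apply: fok_all=> k; rewrite mem_iota=>/andP[_]; apply: H. Qed.
Lemma fok_const j o n a : (forall k, k < n -> P j (o + k)) -> fok P (fconst j o n a).
by move=> H; apply: fok_mk=> k kn; case: ifP=> _; apply: fok_v; apply: H. Qed.
Lemma fok_ones j o n : (forall k, k < n -> P j (o + k)) -> fok P (fones j o n).
by move=> H; apply: fok_mk=> k kn; apply: fok_v; apply: H. Qed.
Lemma fok_phi K L ic rule bad : (forall j k, j < 4 -> k < K + L + L -> P j k) -> fok P (fphi K L ic (ftab K rule) bad).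
move=> H; have C j o n a: j < 4 -> o + n <= K + L + L -> fok P (fconst j o n a).
 by move=> j4 h; apply: fok_const=> k kn; apply: H=> //; lia.
have O j o n: j < 4 -> o + n <= K + L + L -> fok P (fones j o n).
 by move=> j4 h; apply: fok_ones=> k kn; apply: H=> //; lia.
have V j k: j < 4 -> k < K + L + L -> fok P (fv j k) by move=> *; apply: fok_v; apply: H.
have E j1 j2 o n: j1 < 4 -> j2 < 4 -> o + n <= K + L + L -> fok P (feqs j1 j2 o n).
 by move=> h1 h2 h; apply: fok_mk=> k kn; apply: fok_eq; apply: V=> //; lia.
have S j1 j2 o n: j1 < 4 -> j2 < 4 -> o + n <= K + L + L -> fok P (fsucc j1 j2 o n).
 move=> h1 h2 h; apply: fok_mk=> k kn; apply: fok_eq; first by apply: V=> //; lia.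
 apply: fok_not; apply: fok_eq; [apply: V=> //; lia | apply: O=> //; lia].
have F: fok P (finit K L ic).
 apply: fok_and; first by apply: fok_mk=> p _; apply: fok_imp; apply: C=> //; lia.
 by apply: fok_imp; [apply: fok_mk=> p _; apply: fok_not; apply: C | apply: C]=> //; lia.
have T: fok P (ftab K rule).
 apply: fok_mk=> a0 _; apply: fok_mk=> a1 _; apply: fok_mk=> a2 _; apply: fok_imp; last by apply: C=> //; lia.
 by apply: fok_and; [|apply: fok_and]; apply: C=> //; lia.
have F8: fok P (fones 0 K L) by apply: O=> //; lia.
apply: fok_and; first by apply: E=> //; lia.
apply: fok_and; first by apply: E=> //; lia.
apply: fok_and; first by apply: E=> //.
apply: fok_and; first by apply: S=> //.
apply: fok_and; first by apply: S=> //.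
apply: fok_and; first by apply: S=> //; lia.
apply: fok_and; first by apply: fok_imp=> //; apply: fok_and=> //; apply: fok_not; apply: C=> //; lia.
by apply: fok_and=> //; apply: fok_or.
Qed.
End PhiVars.

(** * The cyclic tableau of a computation *)

Section Tableau.
Variables (M : TM) (x : seq bool).
Let Q := tm_Q M.
Let S := tm_S M.
Let n := size x.
Definition tst := (nat * (int -> nat) * int)%type.
Definition tnext (s : tst) : tst := let: (q, T, p) := s in if q == 1 then s else
 let: (q', b, mv) := tm_delta M (inord q, inord (T p)) in ((q' : nat), updt T p (b : nat), (p + (mv : nat)%:Z - 1)%R).
Definition st0 : tst := (0, (fun z : int => if (0 <= z)%R then nth 0 (map enc_bit x) (absz z) else 0), 0%R).
Definition st t := iter t tnext st0.
Definition sq t := (st t).1.1.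
Definition sT t := (st t).1.2.
Definition sp t := (st t).2.
Lemma st_eq t : st t = (sq t, sT t, sp t). by rewrite /sq /sT /sp; case: st=>[[]]. Qed.
Lemma st_rep t : rept (sq t) (sT t) (sp t) (tm_run M t (tm_init x)).
elim: t=>[|t IH].
 split=>// k; first by rewrite nth_nil /sT /sp/= ifF; lia.
have : st t.+1 = tnext (sq t, sT t, sp t) by rewrite -st_eq.
rewrite /sq /sT /sp=> -> /=; case: (eqVneq (sq t) 1)=> q1/=.
 by move: IH; case: tm_run=>[[q l] r] [h1 h2 h3]; rewrite h1 q1.
case D : (tm_delta M _)=>[[q' b] mv]/=; exact: rep_step IH q1 D.
Qed.
Lemma tnextE t : st t.+1 = tnext (sq t, sT t, sp t). by rewrite -st_eq. Qed.
Lemma st_bound t : [/\ sq t < Q.+2, forall z, sT t z < S.+3, (`|sp t| <= t%:Z)%R & forall z, (z < - t%:Z)%R \/ (n%:Z + t%:Z <= z)%R -> sT t z = 0].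
elim: t=>[|t [I1 I2 I3 I4]].
 split=>// z; first by rewrite /sT/=; case: ifP=> // _; case: (ltnP `|z| (size x))=> h; [rewrite (nth_map false)//; case: (nth) | rewrite nth_default ?size_map].
 rewrite /sT/= => -[h|h]; case: ifP=> // z0; first by lia.
 by rewrite nth_default// size_map; lia.
rewrite /sq /sT /sp tnextE/=; case: ifP=> q1/=.
 by split=>// [|z h]; [lia | apply: I4; lia].
case D : (tm_delta M _)=>[[q' b] mv]/=; split=>//.
- by move=> z; rewrite /updt; case: ifP=> // _.
- by have := ltn_ord mv; lia.
- by move=> z h; rewrite /updt ifF; [apply: I4; lia | lia].
Qed.
(* a cell is coded by its symbol and 1 + the state when the head is there, 0 otherwise *)
Definition code s h := s * Q.+3 + h.
Definition sym a := a %/ Q.+3.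
Definition hd a := a %% Q.+3.
Lemma symE s h : h < Q.+3 -> sym (code s h) = s. by move=> hQ; rewrite /sym divnMDl// divn_small// addn0. Qed.
Lemma hdE s h : h < Q.+3 -> hd (code s h) = h. by move=> hQ; rewrite /hd modnMDl modn_small. Qed.
(** What a cell passes to the next row: its symbol, the code of the head it emits, and the
    direction. Direction 3 means that there is no head; the halting state, of code 2, stays in
    place. *)
Definition dl a : nat * nat * nat := if hd a == 0 then (sym a, 0, 3) else if hd a == 2 then (sym a, 2, 1) else
 let: (q', b, mv) := tm_delta M (inord (hd a).-1, inord (sym a)) in ((b : nat), q'.+1, (mv : nat)).
(** The guard on the symbol keeps the result a code for arbitrary arguments. In a genuine row at
    most one of the three cells emits a head, so the order of the tests is immaterial. *)
Definition rule a0 a1 a2 := code (if (dl a1).1.1 < S.+3 then (dl a1).1.1 else 0)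
 (if (dl a1).2 == 1 then (dl a1).1.2 else if (dl a0).2 == 2 then (dl a0).1.2 else if (dl a2).2 == 0 then (dl a2).1.2 else 0).
Definition cell t z := code (sT t z) (if z == sp t then (sq t).+1 else 0).
(** A crude width: codes are below [Kb] itself, hence below [2 ^ Kb]. *)
Definition Kb := S.+3 * Q.+3.
Lemma code_lt s h : s < S.+3 -> h < Q.+3 -> code s h < 2 ^ Kb.
by move=> sS hQ; apply: leq_trans (ltnW (ltn_expl _ (isT : 1 < 2))); rewrite /Kb /code; nia. Qed.
Lemma dl_lt a : (dl a).1.2 < Q.+3.
by rewrite /dl; case: ifP=> // _; case: ifP=> // _; case: (tm_delta _ _)=>[[q b] mv]/=; have := ltn_ord q. Qed.
Lemma rule_lt a b c : rule a b c < 2 ^ Kb.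
by apply: code_lt; repeat case: ifP=> // _; exact: dl_lt. Qed.
Lemma cell_lt t z : cell t z < 2 ^ Kb.
by have [b1 b2 _ _] := st_bound t; apply: code_lt=> //; case: ifP. Qed.
Lemma cell_rule t z : cell t.+1 z = rule (cell t (z - 1)) (cell t z) (cell t (z + 1)).
have [b1 b2 _ _] := st_bound t.
have D z': dl (cell t z') = if z' == sp t then if sq t == 1 then (sT t z', 2, 1) else
   let: (q', b, mv) := tm_delta M (inord (sq t), inord (sT t z')) in ((b : nat), q'.+1, (mv : nat)) else (sT t z', 0, 3).
 by rewrite /dl /cell; case: (z' == sp t); rewrite hdE ?symE.
rewrite /rule !D {1}/cell /sq /sT /sp tnextE/= -/(sT t).
case: (eqVneq (sq t) 1)=> q1/=.
 rewrite q1; case: (eqVneq z (sp t))=>[->|zp]/=; first by rewrite b2.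
 by rewrite b2; case: (_ == sp t); case: (_ == sp t).
case E : (tm_delta M _)=>[[q' b] mv]/=; rewrite /updt.
have m3 := ltn_ord mv; case: (eqVneq z (sp t))=>[->|zp].
 rewrite E (_ : (sp t - 1 == sp t)%R = false); last by lia.
 rewrite (_ : (sp t + 1 == sp t)%R = false)/=; last by lia.
 rewrite ltn_ord (_ : (sp t == sp t + (mv : nat)%:Z - 1)%R = ((mv : nat) == 1)); lia.
rewrite b2; case: (eqVneq (z - 1)%R (sp t))=>[z1|z1].
 rewrite z1 E (_ : (z + 1 == sp t)%R = false)/=; last by lia.
 by rewrite (_ : (z == sp t + (mv : nat)%:Z - 1)%R = ((mv : nat) == 2)); lia.
case: (eqVneq (z + 1)%R (sp t))=>[z2|z2]/=.
 by rewrite z2 E/= (_ : (z == sp t + (mv : nat)%:Z - 1)%R = ((mv : nat) == 0)); lia.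
by rewrite ifF; lia.
Qed.
Variables (t0 H Z : nat) (y : seq bool).
Hypotheses (Hout : tm_outputs M x t0 y) (HL : n + t0 + 3 < H) (ZE : Z = H + H).
Lemma halted t : t0 <= t -> st t = st t0.
move=> h; rewrite -(subnK h); elim: (t - t0)=> // k IH; rewrite tnextE -st_eq IH.
have : sq t0 = 1.
 move: Hout (st_rep t0); rewrite /tm_outputs; case: (tm_run)=>[[q l] r] [-> _] [<- _ _]//.
by rewrite st_eq=> ->.
Qed.
Lemma far t z : (z < - t0%:Z - 1)%R \/ (n%:Z + t0%:Z < z)%R -> cell t z = 0.
have G t': t' <= t0 -> (z < - t0%:Z - 1)%R \/ (n%:Z + t0%:Z < z)%R -> cell t' z = 0.
 move=> tt h; have [_ _ b3 b4] := st_bound t'; rewrite /cell b4; last by lia.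
 by rewrite ifF//; lia.
case: (leqP t t0)=> tt; first exact: G.
by move/(G t0 (leqnn _)); rewrite /cell /sT /sq /sp halted// ltnW.
Qed.
(** The upper half of the cyclic row stands for the negative positions of the two-way infinite
    tape. *)
Definition ps i : int := if i < H then Posz i else (Posz i - Posz Z)%R.
Definition ctab t i := cell t (ps i).
(** The seam of the cycle lies about [H] cells away from the origin, where both sides are blank at
    all times, so the choice of a representative of a position is immaterial there. *)
Lemma ctab_ps t i z : i < Z -> (z = ps i \/ (z = ps i + Z%:Z)%R \/ (z = ps i - Z%:Z)%R) -> (- H%:Z - 1 <= z <= H%:Z)%R -> cell t z = ctab t i.
move=> iZ; case=> [-> //|e] zb; rewrite /ctab !far; move: e zb iZ; rewrite /ps; case: ifP=> h; lia.
Qed.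
Lemma ctab_rule t i : i < Z -> ctab t.+1 (i.+1 %% Z) = rule (ctab t i) (ctab t (i.+1 %% Z)) (ctab t ((i.+1 %% Z).+1 %% Z)).
move=> iZ.
have m k: k < Z -> k.+1 %% Z = if k.+1 == Z then 0 else k.+1.
 by move=> kZ; case: eqP=>[->|ne]; rewrite ?modnn// modn_small; lia.
set i1 := i.+1 %% Z; have i1Z: i1 < Z by lia.
set i2 := i1.+1 %% Z; have i2Z: i2 < Z by lia.
have e1: i1 = if i.+1 == Z then 0 else i.+1 := m _ iZ.
have e2: i2 = if i1.+1 == Z then 0 else i1.+1 := m _ i1Z.
clearbody i1 i2; rewrite {1}/ctab cell_rule; congr rule; apply: ctab_ps=> //; rewrite /ps.
- by move: e1; case: eqP=> ? e1; case: ifP=> ?; case: ifP=> ?; lia.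
- by case: ifP=> ?; lia.
- by move: e2; case: eqP=> ? e2; case: ifP=> ?; case: ifP=> ?; lia.
- by case: ifP=> ?; lia.
Qed.
Definition icodes := mkseq (fun p => code (if p < n then enc_bit (nth false x p) else 0) (p == 0)) n.+1.
Lemma ctab0 i : i < Z -> ctab 0 i = nth 0 icodes i.
move=> iZ; rewrite /ctab /ps; case: ifP=> h; last first.
 rewrite nth_default ?size_mkseq; last by lia.
 by rewrite /cell /sT /sp/= ?ifF//; lia.
rewrite /cell /sT /sp/=; case: (leqP n.+1 i)=> ni.
 rewrite [RHS]nth_default ?size_mkseq// nth_default ?size_map; last exact: ltnW.
 by rewrite ifF//; lia.
rewrite nth_mkseq// (_ : (if (Posz i == 0) then 1 else 0) = (i == 0 : nat))//.
by case: ltnP=> hi; [rewrite (nth_map false) | rewrite nth_default ?size_map].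
Qed.
Lemma icodes_lt p : nth 0 icodes p < 2 ^ Kb.
case: (ltnP p n.+1)=> h; last by rewrite nth_default ?size_mkseq// expn_gt0.
rewrite nth_mkseq//; apply: code_lt; last by case: eqP.
by case: ifP=> // _; case: (nth _ _ _).
Qed.
Lemma ctab_lt t i : ctab t i < 2 ^ Kb. exact: cell_lt. Qed.
(** The symbol of the bit false under a head in the halting state, that is, the answer no. *)
Definition bad := code 1 2.
Lemma bad_lt : bad < 2 ^ Kb. exact: code_lt. Qed.
Lemma last_state : [/\ sq Z.-1 = 1, sp Z.-1 = sp t0 & forall k, nth 0 (tm_run M t0 (tm_init x)).2 k = sT Z.-1 (sp t0 + k%:Z)].
have h: t0 <= Z.-1 by lia.
rewrite /sq /sp /sT halted// -/(sq t0); move: Hout (st_rep t0); rewrite /tm_outputs.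
by case: (tm_run)=>[[q l] r] [-> _] [<- _ h3].
Qed.
Lemma tape_sym : forall b, y = [:: b] -> sT Z.-1 (sp t0) = enc_bit b.
move=> b yb; have [_ _ /(_ 0)] := last_state; rewrite addr0=> <-; move: Hout; rewrite yb /tm_outputs.
by case: (tm_run)=>[[q l] r] [_]/=; case: r=>[|[|[|[|k]]] r]//= [] <-.
Qed.
Lemma ctab_yes i : y = [:: true] -> ctab Z.-1 i != bad.
move/tape_sym=> yt; have [l1 l2 _] := last_state; rewrite /ctab /cell l1 l2; case: (eqVneq (ps i) (sp t0))=>[->|_].
 by rewrite yt; apply/eqP=>/(congr1 sym); rewrite !symE.
by apply/eqP=>/(congr1 hd); rewrite !hdE.
Qed.
Lemma ctab_no : y = [:: false] -> exists2 i, i < Z & ctab Z.-1 i = bad.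
move/tape_sym=> yf; have [l1 l2 _] := last_state.
have [_ _ b3 _] := st_bound t0.
exists (if (0 <= sp t0)%R then absz (sp t0) else Z - absz (sp t0)); first by case: ifP=> ?; lia.
have -> : ctab Z.-1 (if (0 <= sp t0)%R then absz (sp t0) else Z - absz (sp t0)) = cell Z.-1 (sp t0).
 rewrite /ctab /ps; congr cell; case: (boolP (0 <= sp t0)%R)=> hp; case: ifP=> ?; lia.
by rewrite /cell l1 l2 eqxx yf.
Qed.
End Tableau.

(** * The three-message protocol *)
Lemma trun_ext P env env' f st : fok P f -> (forall j k, P j k -> env j k = env' j k) -> trun env f st = trun env' f st.
move=> F H; elim: f st F=> //= t f IH st /andP[t1 t2]; rewrite IH; case: st=> //= s.
case: t t1=>[[[|[|kd]] j] k]//= /H -> //.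
Qed.
Lemma sem_ext P env env' f v v' : fok P f -> (forall j k, P j k -> env j k = env' j k) -> sem env f v -> sem env' f v' -> v = v'.
by move=> F H /(_ [::]) S1 /(_ [::]); rewrite -(trun_ext _ F H) S1=> -[]. Qed.
Lemma trun_cat env f g st : trun env (f ++ g) st = trun env g (trun env f st).
exact: foldl_cat. Qed.
Lemma par_cons p l i : par (p :: l) i = ((p.1 == i) && p.2) (+) par l i.
by rewrite /par oddD oddb. Qed.
Lemma par_cat l l' i : par (l ++ l') i = par l i (+) par l' i.
by rewrite /par count_cat oddD. Qed.
Lemma par_iota a n g i : par (zip (iota a n) (mkseq g n)) i = (a <= i < a + n) && g (i - a).
elim: n a g=>[|n IH] a g; first by rewrite addn0 ltnNge andbN.
rewrite /mkseq -[iota 0 _]/(0 :: iota 1 n) map_cons par_cons (iotaDl 1 0) -map_comp IH; case: (eqVneq a i)=>[<-|ai].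
 have -> : (a <= a < a + n.+1) = true by lia.
 by rewrite ltnn addbF subnn.
rewrite (_ : (a < i < a.+1 + n) = (a <= i < a + n.+1)); last by lia.
by case: (boolP (_ <= _ < _))=> //= h; congr g; lia.
Qed.
Section Protocol.
Variables (w nv : nat) (phi : seq token) (pb : (nat -> nat -> bool) -> bool).
Let nm := 4 * w + 2.
Let N := nv.+1 + nm.
Let one := 4 + w.
(** For [j < 4] the variable is bit [k] of cell [j] in the message; for [j = 4] it is one of the
    private qubits 1, 2, 3, the two coins and the flag. Qubit 0 is the answer, the kept cell
    occupies [4..one - 1], the scratch space [one..nv], and the last two message qubits receive
    copies of the coins. *)
Definition qv j k := if j < 4 then nv.+1 + (j * w + k) else k.+1.
Definition vars j k := ((j < 4) && (k < w)) || ((j == 4) && (k < 3)).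
Hypotheses (Hphi : forall env, sem env phi (pb env)) (okphi : fok (fun j k => (j < 4) && (k < w)) phi).
Definition flit k v := if v then fv 4 k else fnot (fv 4 k).
Definition fsel j := fand (flit 0 (od j)) (flit 1 (1 < j)).
Definition fP k := for_ (for_ (fand (fsel 0) (fv 0 k)) (fand (fsel 1) (fv 1 k))) (for_ (fand (fsel 2) (fv 2 k)) (fand (fsel 3) (fv 3 k))).
Definition f0 := phi ++ flatten (mkseq fP w) ++ fv 4 0 ++ fv 4 1.
Definition f1 := fv 4 0 ++ fv 4 1.
Definition f2 := fand (fnot (fv 4 0)) (fand (fnot (fv 4 1)) (fv 4 2)).
Definition tg1 := [:: nv.+1 + 4 * w; (nv.+1 + 4 * w).+1].
Definition tg0 := 3 :: iota 4 w ++ tg1.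
Hypotheses (nv_f0 : one.+1 + size f0 <= nv.+1) (nv_f2 : one.+1 + size f2 <= nv.+1).
Definition V0 : seq gate := [:: Had 1; Had 2] ++ rgc (fcirc qv one f0 tg0).
(** The revealed copies of the coins are first removed from the message, as they would keep the
    branches from interfering. Acceptance then requires that both coins return to zero and that the
    flag of the window check is set. *)
Definition V1 : seq gate := rgc (fcirc qv one f1 tg1) ++ [:: Had 1; Had 2] ++ rgc (fcirc qv one f2 [:: 0]).
Definition jn (J : bool * bool) : nat := J.1 + J.2.*2.
Definition slot j (c : basis nm) : basis w := [ffun k : 'I_w => getq (j * w + val k) c].
Definition xJ J (c : basis nm) : basis nm := [ffun k => c k (+) par (zip [:: 4 * w; (4 * w).+1] [:: J.1; J.2]) (val k)].
(** Basis vectors with answer 0 and clean scratch space; until the answer is written, the states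
    between the stages of the protocol are supported on them. *)
Definition mkb J F (P : basis w) (c : basis nm) : basis N :=
 [ffun i => if val i < 4 then nth false [:: false; J.1; J.2; F] (val i) else if val i < one then getq (val i - 4) P else
   if val i < nv.+1 then false else getq (val i - nv.+1) c].
Lemma getq_mkb i J F P c : i < N -> getq i (mkb J F P c) = if i < 4 then nth false [:: false; J.1; J.2; F] i else if i < one then getq (i - 4) P else
   if i < nv.+1 then false else getq (i - nv.+1) c.
by move=> iN; rewrite {1}/getq insubT ffunE. Qed.
Lemma getq_ffun n g i : i < n -> getq i ([ffun k : 'I_n => g (val k)] : basis n) = g i.
by move=> h; rewrite /getq insubT ffunE. Qed.
Lemma one_nv : one < nv.+1. by apply: leq_trans nv_f0; rewrite leq_addr. Qed.
Lemma getq_slot j c k : k < w -> getq k (slot j c) = getq (j * w + k) c.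
exact: (getq_ffun (fun k=> getq (j*w + k) c)). Qed.
Lemma getq_xJ J c k : k < nm -> getq k (xJ J c) = getq k c (+) (((4 * w == k) && J.1) (+) (((4 * w).+1 == k) && J.2)).
by move=> h; rewrite {1}/getq insubT ffunE !par_cons addbF /getq insubT. Qed.
Lemma xJK J : involutive (xJ J).
by move=> c; apply: basis_eq=> k kn; rewrite !getq_xJ// -addbA addbb addbF. Qed.
Lemma slot_xJ J j c : j < 4 -> slot j (xJ J c) = slot j c.
move=> j4; apply: basis_eq=> k kw; rewrite !getq_slot//; have h: j*w + k < 4*w.
 by apply: (@leq_trans (j*w + w)); rewrite ?ltn_add2l// -mulSnr leq_mul2r j4 orbT.
rewrite getq_xJ; last by clear -h; lia.
by [clear -h; lia | rewrite addbF].
Qed.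
Definition pbm (c : basis nm) := pb (fun j k => getq (j * w + k) c).
Lemma pbm_xJ J c : pbm (xJ J c) = pbm c.
apply: (sem_ext okphi _ (Hphi _) (Hphi _))=> j k /andP[j4 kw].
by rewrite -!getq_slot// slot_xJ.
Qed.
Lemma mkb_setm J F P c c' : setm (mkb J F P c) c' = mkb J F P c'.
apply: basis_eq=> i iN; rewrite getq_setm// !getq_mkb//; case: ltnP=> h; last by have -> : (i < nv.+1) = true by [].
have h1 := one_nv; have -> : (i < 4) = false by move: h1; clear -h; lia.
have -> : (i < one) = false by move: h1; clear -h; lia.
by have -> : (i < nv.+1) = false by clear -h; lia.
Qed.
Lemma mpart_mkb J F P c : mpart (mkb J F P c) = c.
by rewrite -(mkb_setm J F P c) mpart_setm. Qed.
Lemma mkb_inj J F P c J' F' P' c' : mkb J F P c = mkb J' F' P' c' -> [/\ J = J', F = F', P = P' & c = c'].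
move=> E; have h1 := one_nv; have g i: getq i (mkb J F P c) = getq i (mkb J' F' P' c') by rewrite E.
have nN: nv.+1 <= N by rewrite leq_addr.
have g1 := g 1; have g2 := g 2; have g3 := g 3; rewrite !getq_mkb/= in g1 g2 g3; try by move: h1 nN; clear; lia.
split=>//; first by case: J J' g1 g2 {E g} => [a b] [a' b']/= -> ->.
 apply: basis_eq=> k kw; have := g (4 + k); have kN: 4 + k < N by move: h1 nN kw; clear; lia.
 rewrite !getq_mkb//; by rewrite ltnNge ltn_add2l kw addKn.
by have := congr1 (@mpart nv nm) E; rewrite !mpart_mkb.
Qed.
Definition Jof (b : basis N) := (getq 1 b, getq 2 b).
Definition Pof (b : basis N) : basis w := [ffun k : 'I_w => getq (4 + val k) b].
Definition okb (b : basis N) := ~~ getq 0 b && anc0b one nv.+1 b.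
Lemma okP b : okb b -> b = mkb (Jof b) (getq 3 b) (Pof b) (mpart b).
move=> /andP[o0 /anc0P a0]; apply: basis_eq=> i iN; rewrite getq_mkb//.
case: ltnP=> i4; first by case: i i4 iN=>[|[|[|[|i]]]]//= _ _; apply/negbTE.
case: ltnP=> i1; first by rewrite (getq_ffun (fun k=> getq (4 + k) b)) ?subnKC; move: i1 i4; clear; lia.
case: ltnP=> i2; first by apply: a0; rewrite i1.
rewrite (getq_ffun (fun k=> getq (nv.+1 + k) b)) ?subnKC; move: iN i2; clear; lia.
Qed.
Lemma ok_mkb J F P c : okb (mkb J F P c).
apply/andP; split; first by rewrite getq_mkb.
apply/anc0P=> i /andP[h1 h2]; have nN: nv.+1 <= N by rewrite leq_addr.
have iN: i < N by apply: leq_trans nN.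
rewrite getq_mkb// h2 ltnNge (_ : 4 <= i); last by move: h1; clear; lia.
by rewrite ltnNge h1.
Qed.
Lemma qvN j k : vars j k -> qv j k < N /\ ((qv j k < one) || (nv.+1 <= qv j k)).
have h1 := one_nv; rewrite /qv=>/orP[/andP[j4 kw]|/andP[/eqP -> k3]].
 rewrite j4 leq_addr orbT; split=>//; rewrite ltn_add2l; apply: (@leq_trans (j*w + w)); first by rewrite ltn_add2l.
 by rewrite -mulSnr -[X in X <= _]addn0 leq_add// leq_mul2r j4 orbT.
by rewrite/=; split; [move: h1 | apply/orP]; move: k3; clear; lia.
Qed.
Lemma qv_mkb J F P c j k : j < 4 -> k < w -> getq (qv j k) (mkb J F P c) = getq (j * w + k) c.
move=> j4 kw; have h1 := one_nv; have [|q1 _] := @qvN j k; first by rewrite /vars j4 kw.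
rewrite getq_mkb//; rewrite /qv j4 in q1 *; rewrite !ifF ?addKn//; apply/negbTE; rewrite -leqNgt; apply: leq_trans (leq_addr _ _)=> //.
 exact: ltnW.
by move: h1; clear; lia.
Qed.
Definition bs0 b : seq bool := pb (fun j k => getq (qv j k) b) ::
 mkseq (fun k => [|| (jn (Jof b) == 0) && getq (qv 0 k) b, (jn (Jof b) == 1) && getq (qv 1 k) b, (jn (Jof b) == 2) && getq (qv 2 k) b | (jn (Jof b) == 3) && getq (qv 3 k) b]) w ++ [:: getq 1 b; getq 2 b].
Lemma size_tg0 : size tg0 = (w + 2).+1. by rewrite/= size_cat size_iota. Qed.
Lemma sem_sel j b : j < 4 -> sem (fun j k => getq (qv j k) b) (fsel j) (jn (Jof b) == j).
move=> j4; have L k v: sem (fun j k=> getq (qv j k) b) (flit k v) (getq k.+1 b == v).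
 by case: v; [rewrite eqb_id | apply: sem_eq (sem_not (sem_v _ _ _)) _].
apply: sem_eq (sem_and (L 0 (od j)) (L 1 (1 < j))) _; rewrite /jn.
by case: j j4=>[|[|[|[|j]]]]//= _; case: getq; case: getq.
Qed.
Lemma run0 b : trun (fun j k => getq (qv j k) b) f0 (Some [::]) = Some (rev (bs0 b)) /\ size (bs0 b) = size tg0.
split; last by rewrite size_tg0/= size_cat size_mkseq.
rewrite trun_cat Hphi trun_cat.
have R n st: trun (fun j k=> getq (qv j k) b) (flatten (mkseq fP n)) (Some st) = Some (rev (mkseq (fun k=>[|| (jn (Jof b) == 0) && getq (qv 0 k) b, (jn (Jof b) == 1) && getq (qv 1 k) b, (jn (Jof b) == 2) && getq (qv 2 k) b | (jn (Jof b) == 3) && getq (qv 3 k) b]) n) ++ st).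
 elim: n=> // n IH; rewrite !mkseqS flatten_rcons trun_cat IH rev_rcons.
 apply: (sem_eq (sem_or (sem_or (sem_and (sem_sel b _) (sem_v _ 0 n)) (sem_and (sem_sel b _) (sem_v _ 1 n))) (sem_or (sem_and (sem_sel b _) (sem_v _ 2 n)) (sem_and (sem_sel b _) (sem_v _ 3 n)))))=> //.
 by rewrite !orbA.
by rewrite R rev_cons rev_cat -cats1.
Qed.
Lemma one_gt i : i < 4 + w -> (i < one) || (nv.+1 <= i < N). by rewrite /one=> ->. Qed.
Lemma tg1_ok : all (fun t => (t < one) || (nv.+1 <= t < N)) tg1.
apply/andP; clear; lia. Qed.
Lemma tg0_ok : all (fun t => (t < one) || (nv.+1 <= t < N)) tg0.
rewrite [all _ _]/= all_cat tg1_ok andbT.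
by apply/allP=> i; rewrite mem_iota=>/andP[_ h]; rewrite one_gt.
Qed.
Lemma tg2_ok : all (fun t => (t < one) || (nv.+1 <= t < N)) [:: 0]. by []. Qed.
Definition good tg i := i \notin (tg : seq nat).
Lemma good_anc tg i : all (fun t => (t < one) || (nv.+1 <= t < N)) tg -> one <= i < nv.+1 -> good tg i.
by move=> H h; apply/negP=>/(allP H); move: h; clear; lia. Qed.
Lemma good0 j k : (j < 4) && (k < w) || (j == 4) && (k < 2) -> good tg0 (qv j k).
move=> h; have h1 := one_nv; rewrite /good inE mem_cat mem_iota !inE.
case/orP: h=> [/andP[j4 kw]|/andP[/eqP -> k2]]; rewrite /qv/=; last by move: h1 k2; clear; lia.
rewrite j4; have h: j*w + k < 4*w by apply: (@leq_trans (j*w + w)); rewrite ?ltn_add2l// -mulSnr leq_mul2r j4 orbT.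
by move: h1 h; clear; lia.
Qed.
Lemma good1 k : k < 3 -> good tg1 (qv 4 k).
by move=> k3; have h1 := one_nv; rewrite /good !inE /qv/=; move: h1 k3; clear; lia. Qed.
Lemma fok_sub (P P' : nat -> nat -> bool) f : (forall j k, P j k -> P' j k) -> fok P f -> fok P' f.
by move=> H /allP F; apply/allP=> t /F /implyP h; apply/implyP=>/h /H. Qed.
Lemma fok_okt tg f (P : nat -> nat -> bool) : (forall j k, P j k -> vars j k && good tg (qv j k)) -> fok P f -> all (okt qv vars (good tg)) f.
by move=> H F; exact: (fok_sub H F). Qed.
Lemma ok_f0 : all (okt qv vars (good tg0)) f0.
pose P j k := (j < 4) && (k < w) || (j == 4) && (k < 2).
apply: (@fok_okt _ _ P)=>[j k h|].
 by rewrite good0// /vars; case/orP: h=>[->|/andP[-> k2]]//; rewrite (leq_trans k2 (isT : 2 <= 3)) orbT.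
have S j: fok P (fsel j).
 by apply: fok_and; rewrite /flit; case: ifP=> _.
have X: fok P phi by apply: fok_sub okphi=> j k; rewrite /P=> ->.
have fP_ok k: k < w -> fok P (fP k).
 by move=> kw; rewrite /P/= kw.
have Y: fok P (flatten (mkseq fP w)).
 suff H (ss : seq (seq token)) : (forall s, s \in ss -> fok P s) -> fok P (flatten ss).
  by apply: H=> s /mapP[k]; rewrite mem_iota=>/andP[_ kw] ->; apply: fP_ok.
 by elim: ss=> //= s ss IH H; rewrite /fok all_cat -!/(fok P _) H ?mem_head// IH// => t ts; apply: H; rewrite inE ts orbT.
by rewrite /fok !all_cat -!/(fok P _) X Y.
Qed.
Lemma ok_f1 : all (okt qv vars (good tg1)) f1.
apply: (@fok_okt _ _ (fun j k=> (j == 4) && (k < 3)))=> // j k /andP[/eqP -> k3].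
by rewrite good1// andbT.
Qed.
Lemma ok_f2 : all (okt qv vars (good [:: 0])) f2.
by []. Qed.
Lemma top_N : nv.+1 <= N. exact: leq_addr. Qed.
Local Open Scope ring_scope.
Section Circ.
Variable D : nat.
Implicit Types (psi : qstate N D).
Lemma fc0 psi : (forall b e, ~ anc0 one nv.+1 b -> psi b e = 0) -> apply_circuit (rgc (fcirc qv one f0 tg0)) psi = fun b e => if anc0b one nv.+1 b then psi (flips (zip tg0 (bs0 b)) b) e else 0.
move=> H; apply: (fcirc_apply top_N one_nv qvN (fun i=> good_anc tg0_ok) ok_f0 nv_f0 tg0_ok _ _ H)=> // b _; exact: run0.
Qed.
Lemma fc1 psi : (forall b e, ~ anc0 one nv.+1 b -> psi b e = 0) -> apply_circuit (rgc (fcirc qv one f1 tg1)) psi = fun b e => if anc0b one nv.+1 b then psi (flips (zip tg1 [:: getq 1 b; getq 2 b]) b) e else 0.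
move=> H; apply: (fcirc_apply top_N one_nv qvN (fun i=> good_anc tg1_ok) ok_f1 _ tg1_ok _ _ H)=> //.
by apply: leq_trans nv_f2; rewrite leq_add2l.
Qed.
Lemma fc2 psi : (forall b e, ~ anc0 one nv.+1 b -> psi b e = 0) -> apply_circuit (rgc (fcirc qv one f2 [:: 0%N])) psi = fun b e => if anc0b one nv.+1 b then psi (flips (zip [:: 0%N] [:: [&& ~~ getq 1 b, ~~ getq 2 b & getq 3 b]]) b) e else 0.
move=> H; apply: (fcirc_apply top_N one_nv qvN (fun i=> good_anc tg2_ok) ok_f2 nv_f2 tg2_ok _ _ H)=> // b _; split=>//.
exact: (sem_and (sem_not (sem_v _ 4 0)) (sem_and (sem_not (sem_v _ 4 1)) (sem_v _ 4 2)) [::]).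
Qed.
Lemma had2 psi b e : apply_circuit [:: Had 1; Had 2] psi b e = 2^-1 * \sum_(J : bool * bool)
  (if getq 1 b && J.1 then -1 else 1) * (if getq 2 b && J.2 then -1 else 1) * psi (setq 1 J.1 (setq 2 J.2 b)) e.
have h1 := one_nv; have n1: (1 < N)%N by clear; lia.
have n2: (2 < N)%N by clear; lia.
rewrite/= n1 n2 -(pair_bigA _ (fun x y=> (if getq 1 b && x then -1 else 1)*(if getq 2 b && y then -1 else 1) * psi (setq 1 x (setq 2 y b)) e)) !big_bool/= -s2C !getq_setq// !andbT !andbF.
move: (if getq 1 b then _ else _) (if getq 2 b then _ else _) psi (psi _ e) (psi _ e) (psi _ e)=> g1 g2 a1 a2 a3 a4.
ring.
Qed.
End Circ.
End Protocol.
Local Open Scope ring_scope.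
Lemma sum_supp (I J : finType) (h : J -> I) (g : I -> R) : injective h -> (forall i, (forall j, h j <> i) -> g i = 0) -> \sum_i g i = \sum_j g (h j).
move=> hi H; rewrite (bigID (mem [set h j | j : J]))/= [X in _ + X]big1 ?addr0=>[|i ni].
 by rewrite big_imset//= => a b _ _; apply: hi.
by apply: H=> j e; move/negP: ni; rewrite -e imset_f.
Qed.
Lemma apply_cat N D c c' (psi : qstate N D) : apply_circuit (c ++ c') psi = apply_circuit c' (apply_circuit c psi).
exact: foldl_cat. Qed.
Lemma normsq0 : normsq 0 = 0. by rewrite /normsq expr0n addr0. Qed.

(** * States along the protocol *)

Section States.
Variables (w nv : nat) (phi : seq token) (pb : (nat -> nat -> bool) -> bool).
Let nm := (4 * w + 2)%N.
Let N := (nv.+1 + nm)%N.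
Let one := (4 + w)%N.
Hypotheses (Hphi : forall env, sem env phi (pb env)) (okphi : fok (fun j k => (j < 4) && (k < w))%N phi) (nv_f0 : (one.+1 + size (f0 w phi) <= nv.+1)%N) (nv_f2 : (one.+1 + size f2 <= nv.+1)%N).
Local Notation mkb := (@mkb w nv).
Local Notation ok := (@okb w nv).
Local Notation slot := (@slot w).
Local Notation xJ := (@xJ w).
Local Notation pbm := (@pbm w pb).
Lemma onv : (one < nv.+1)%N. exact: one_nv nv_f0. Qed.
Lemma oN : (nv.+1 <= N)%N. exact: leq_addr. Qed.
Lemma setq_mkb x y J F P c : setq 1 x (setq 2 y (mkb J F P c)) = mkb (x, y) F P c.
apply: basis_eq=> i iN; rewrite !getq_setq// !getq_mkb; case: i iN=>[|[|[|i]]]//= iN.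
Qed.
Lemma ok_setq x y b : ok (setq 1 x (setq 2 y b)) = ok b.
have h1 := onv; have h2 := oN.
rewrite /okb !getq_setq//; congr (_ && _); apply: eq_in_all=> i; rewrite mem_iota=>/andP[i1 i2].
have e: (1 < i)%N by move: i1; clear; lia.
by rewrite !getq_setq ?(gtn_eqF e); [rewrite ifF; move: i1; clear; lia | move: i2 h1 h2; clear; lia..].
Qed.
Lemma ok_setm b c : ok (@setm nv nm b c) = ok b.
have h1 := onv; rewrite /okb getq_setm//.
congr (_ && _); apply: eq_in_all=> i; rewrite mem_iota=>/andP[i1 i2]; have iv: (i < nv.+1)%N by move: i2 h1; clear; lia.
rewrite getq_setm; last exact: leq_trans oN.
by rewrite leqNgt iv.
Qed.
Lemma nok_anc b : ~ anc0 one nv.+1 b -> ~~ ok b.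
by move=> H; apply/negP=>/andP[_ /anc0P]. Qed.
Lemma flips_out l b : (forall i, i = 0%N \/ (one <= i < nv.+1)%N -> par l i = false) -> ok (flips l b) = ok b.
move=> H; have h2 := oN; rewrite /okb getq_flips//.
rewrite H ?addbF; last by left.
congr (_ && _); apply: eq_in_all=> i; rewrite mem_iota=>/andP[i1 i2]; have h1 := onv.
have iv: (i < nv.+1)%N by move: i2 h1; clear; lia.
by rewrite getq_flips ?(leq_trans iv)// H ?addbF//; right; rewrite i1.
Qed.
Lemma par_tg tg vs i : all (fun t => (t < one)%N || (nv.+1 <= t < N)%N) tg -> 0%N \notin tg -> i = 0%N \/ (one <= i < nv.+1)%N -> par (zip tg vs) i = false.
move=> H t0 h; apply: par_zip; case: h=>[-> //|h]; apply/negP=>/(allP H); move: h; clear; lia.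
Qed.
Definition xorb_ (P P' : basis w) : basis w := [ffun k => P k (+) P' k].
Lemma getq_xorb k P P' : (k < w)%N -> getq k (xorb_ P P') = getq k P (+) getq k P'.
by move=> h; rewrite /getq insubT ffunE. Qed.
Lemma jn_lt J : (jn J < 4)%N. by case: J=>[[] []]. Qed.
Lemma par_J J i : par (zip (tg1 w nv) [:: J.1; J.2]) i = ((nv.+1 + 4 * w)%N == i) && J.1 (+) (((nv.+1 + 4 * w).+1 == i) && J.2).
by rewrite !par_cons addbF. Qed.
Lemma mkb_J J F P c : getq 1 (mkb J F P c) = J.1 /\ getq 2 (mkb J F P c) = J.2 /\ getq 3 (mkb J F P c) = F.
by have h1 := onv; have h2 := oN; rewrite !getq_mkb//; move: h1 h2; clear; lia. Qed.
Lemma flips1 J F P c : flips (zip (tg1 w nv) [:: getq 1 (mkb J F P c); getq 2 (mkb J F P c)]) (mkb J F P c) = mkb J F P (xJ J c).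
have [-> [-> _]] := mkb_J J F P c; have h1 := onv; apply: basis_eq=> i iN; rewrite getq_flips// par_J !getq_mkb//.
case: (ltnP i nv.+1)=> iv.
 by [clear -iv; lia | rewrite addbF].
have -> : (i < 4)%N = false by move: iv h1; clear; lia.
have -> : (i < one)%N = false by move: iv h1; clear; lia.
rewrite getq_xJ; last by move: iN iv; clear; lia.
clear -iv; lia.
Qed.
Lemma flips0 J F P c : flips (zip (tg0 w nv) (bs0 pb (mkb J F P c))) (mkb J F P c) = mkb J (F (+) pbm c) (xorb_ P (slot (jn J) c)) (xJ J c).
have [E1 [E2 E3]] := mkb_J J F P c; have h1 := onv.
have Z2 (a b : seq nat) (u v : seq bool) : size a = size u -> zip (a ++ b) (u ++ v) = zip a u ++ zip b v by exact: zip_cat.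
have -> : flips (zip (tg0 w nv) (bs0 pb (mkb J F P c))) (mkb J F P c) =
 flips ((3%N, pbm c) :: zip (iota 4 w) (mkseq (fun k=> getq k (slot (jn J) c)) w) ++ zip (tg1 w nv) [:: J.1; J.2]) (mkb J F P c).
 rewrite /tg0 /bs0 [zip (_ :: _) _]/= Z2 ?size_iota ?size_mkseq// E1 E2; congr (flips ((_, _) :: zip _ _ ++ _) _).
  by apply: (sem_ext okphi _ (Hphi _) (Hphi _))=> j k /andP[j4 kw]; rewrite (qv_mkb nv_f0).
 rewrite /mkseq; apply/eq_in_map=> k; rewrite mem_iota=>/andP[_ kw]; rewrite !(qv_mkb nv_f0)// getq_slot// /Jof E1 E2.
 by case: (J)=>[[] []]; rewrite /jn/= ?orbF.
apply: basis_eq=> i iN; rewrite getq_flips// par_cons par_cat par_iota par_J !getq_mkb//=.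
case: (ltnP i nv.+1)=> iv.
 have -> : ((nv.+1 + 4*w)%N == i) = false by clear -iv; lia.
 have -> : ((nv.+1 + 4*w).+1 == i) = false by clear -iv; lia.
 rewrite !addbF; case: (ltnP i 4)=> i4.
  by case: i i4 iN iv=>[|[|[|[|i]]]]//= _ _ _; rewrite ?addbF.
 have -> : (3 == i)%N = false by clear -i4; lia.
 by case: (ltnP i (4 + w))=> iw/=; rewrite// getq_xorb; move: iw i4; clear; lia.
have -> : (i < 4)%N = false by move: iv h1; clear; lia.
have -> : (i < 4 + w)%N = false by move: iv h1; clear; lia.
have -> : (3 == i) = false by move: iv h1; clear; lia.
rewrite getq_xJ; last by move: iN iv; clear; lia.
clear -iv; lia.
Qed.
Variables (D : nat) (U0 U1 : prover_op nm D).
Definition amp c e : C := U0 (c, e) (@zmsg nm, ord0).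
Definition Psi0 := @apply_prover nv nm D U0 (@init_state nv nm D).
Definition Psi1 := apply_circuit (V0 w nv phi) Psi0.
Definition Psi2 := @apply_prover nv nm D U1 Psi1.
Definition Psi3 := apply_circuit (V1 w nv) Psi2.
Definition P0_ : basis w := [ffun=> false].
Lemma mkb0 c : setm (zreg N) c = mkb (false, false) false P0_ c.
have z n i: getq i ([ffun=> false] : basis n) = false by rewrite /getq; case: insubP=> // k _ _; rewrite ffunE.
apply: basis_eq=> i iN; rewrite getq_setm// getq_mkb// !z; have h1 := onv; case: (ltnP i nv.+1)=> iv.
 by case: ltnP=> i4; [case: i i4 {iN iv} => [|[|[|[|i]]]] | case: ifP].
by rewrite !ifF//; move: iv h1; clear; lia.
Qed.
Lemma Psi0E b e : Psi0 b e = if b == mkb (false, false) false P0_ (mpart b) then amp (mpart b) e else 0.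
rewrite /Psi0 /apply_prover.
have I b' e': @init_state nv nm D b' e' = ((b' == zreg N) && (e' == ord0))%:R.
 rewrite /init_state (_ : [forall j, b' j == false] = (b' == zreg N)); first by case: ifP.
 by apply/forallP/eqP=>[H|-> j]; [apply/ffunP=> j; rewrite ffunE; apply/eqP | rewrite ffunE].
have zz: setm (zreg N) (@zmsg nm) = zreg N.
 rewrite -[RHS](@setm_mpart nv nm); congr setm; apply/ffunP=> j; rewrite !ffunE /getq; case: insubP=> // k _ _; by rewrite ffunE.
case: eqP=>[bE|nb].
 rewrite (bigD1 (@zmsg nm, ord0))//= big1 ?addr0=>[|[c e'] ce].
  by rewrite I bE -mkb0 setm_setm zz !eqxx mulr1.
 rewrite I; case: eqP=>[h|_]; last by rewrite mulr0.
 have : c = @zmsg nm by have := congr1 (@mpart nv nm) h; rewrite -zz !mpart_setm.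
 by move=> cE; move: ce; rewrite cE xpair_eqE eqxx=>/negbTE ->; rewrite mulr0.
apply: big1=> -[c e'] _; rewrite I; case: eqP=>[h|_]; last by rewrite mulr0.
case: nb; rewrite -mkb0 -h setm_setm setm_mpart//.
Qed.
Lemma Psi0_ok b e : ~~ ok b -> Psi0 b e = 0.
by rewrite Psi0E; case: eqP=> // ->; rewrite ok_mkb. Qed.
Lemma Psi0_mkb J F P c e : Psi0 (mkb J F P c) e = if [&& J == (false, false), ~~ F & P == P0_] then amp c e else 0.
rewrite Psi0E (mpart_mkb nv_f0); congr (if _ then _ else _); apply/eqP/and3P=> [/(mkb_inj nv_f0)[-> -> -> _]|[/eqP-> /negbTE-> /eqP->]]//.
Qed.
Definition H0 := apply_circuit [:: Had 1; Had 2] Psi0.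
Lemma H0_ok b e : ~~ ok b -> H0 b e = 0.
by move=> nb; rewrite /H0 (had2 nv_f0) big1 ?mulr0// => J _; rewrite Psi0_ok ?ok_setq ?mulr0. Qed.
Lemma H0_mkb J F P c e : H0 (mkb J F P c) e = if ~~ F && (P == P0_) then 2^-1 * amp c e else 0.
rewrite /H0 (had2 nv_f0) (bigD1 (false, false))//= big1 ?addr0=>[|[x y] xy].
 by rewrite !andbF !mul1r setq_mkb Psi0_mkb/=; case: ifP=> _; rewrite ?mulr0.
by rewrite setq_mkb Psi0_mkb (negbTE xy) mulr0.
Qed.
Lemma nin0 : 0%N \notin tg0 w nv. by rewrite inE mem_cat mem_iota. Qed.
Lemma nin1 : 0%N \notin tg1 w nv. by []. Qed.
Lemma Psi1_fc : Psi1 = fun b e => if anc0b one nv.+1 b then H0 (flips (zip (tg0 w nv) (bs0 pb b)) b) e else 0.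
rewrite /Psi1 apply_cat (fc0 Hphi okphi nv_f0)// => b e /nok_anc; exact: H0_ok.
Qed.
Lemma Psi1_ok b e : ~~ ok b -> Psi1 b e = 0.
move=> nb; rewrite Psi1_fc; case: ifP=> // _; rewrite H0_ok// flips_out// => i; exact: par_tg (tg0_ok _ _) nin0.
Qed.
Lemma Psi1_mkb J F P c e : Psi1 (mkb J F P c) e = if (F == pbm c) && (P == slot (jn J) c) then 2^-1 * amp (xJ J c) e else 0.
rewrite Psi1_fc; have /andP[_ ->] := @ok_mkb w nv J F P c; rewrite flips0 H0_mkb; congr (if _ && _ then _ else _).
 by case: F; case: pbm.
apply/eqP/eqP=> [/ffunP h|->]; apply/ffunP=> k; last by rewrite !ffunE addbb.
by have := h k; rewrite !ffunE; case: (P k); case: getq.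
Qed.
Lemma Psi2_ok b e : ~~ ok b -> Psi2 b e = 0.
by move=> nb; rewrite /Psi2 /apply_prover big1// => x _; rewrite Psi1_ok ?mulr0// ok_setm. Qed.
Lemma Psi2_mkb J F P c e : Psi2 (mkb J F P c) e = \sum_x U1 (c, e) x * Psi1 (mkb J F P x.1) x.2.
by rewrite /Psi2 /apply_prover (mpart_mkb nv_f0); apply: eq_bigr=> x _; rewrite (mkb_setm nv_f0). Qed.
Definition G2 := apply_circuit (rgc (fcirc (qv w nv) one f1 (tg1 w nv))) Psi2.
Lemma G2E : G2 = fun b e => if anc0b one nv.+1 b then Psi2 (flips (zip (tg1 w nv) [:: getq 1 b; getq 2 b]) b) e else 0.
rewrite /G2 (fc1 nv_f0 nv_f2)// => b e /nok_anc; exact: Psi2_ok. Qed.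
Lemma G2_ok b e : ~~ ok b -> G2 b e = 0.
move=> nb; rewrite G2E; case: ifP=> // _; rewrite Psi2_ok// flips_out// => i; exact: par_tg (tg1_ok _ _) nin1.
Qed.
Lemma G2_mkb J F P c e : G2 (mkb J F P c) e = Psi2 (mkb J F P (xJ J c)) e.
by rewrite G2E; have /andP[_ ->] := @ok_mkb w nv J F P c; rewrite flips1. Qed.
Definition H2 := apply_circuit [:: Had 1; Had 2] G2.
Lemma H2_ok b e : ~~ ok b -> H2 b e = 0.
by move=> nb; rewrite /H2 (had2 nv_f0) big1 ?mulr0// => J _; rewrite G2_ok ?ok_setq ?mulr0. Qed.
Lemma H2_mkb F P c e : H2 (mkb (false, false) F P c) e = 2^-1 * \sum_J Psi2 (mkb J F P (xJ J c)) e.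
rewrite /H2 (had2 nv_f0); congr (_ * _); apply: eq_bigr=> -[x y] _; have [-> [-> _]] := mkb_J (false, false) F P c.
by rewrite !mul1r setq_mkb G2_mkb.
Qed.
Lemma Psi3E : Psi3 = fun b e => if anc0b one nv.+1 b then H2 (flips (zip [:: 0%N] [:: [&& ~~ getq 1 b, ~~ getq 2 b & getq 3 b]]) b) e else 0.
have -> : Psi3 = apply_circuit (rgc (fcirc (qv w nv) one f2 [:: 0])) H2 by rewrite /Psi3 2!apply_cat.
rewrite (fc2 nv_f0 nv_f2)// => b e /nok_anc; exact: H2_ok.
Qed.
(** Projecting the coins on zero after the last Hadamard gates adds up the four branches, each with
    its revealed coins undone by [xJ]. *)
Lemma acc_E : acc0 Psi3 = \sum_(x : basis w * basis nm) \sum_e normsq (2^-1 * \sum_J Psi2 (mkb J true x.1 (xJ J x.2)) e).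
rewrite /acc0 big_mkcond; pose h (x : basis w*basis nm) := setq 0 true (mkb (false, false) true x.1 x.2).
have s0 J F P c: setq 0 false (mkb J F P c) = mkb J F P c.
 have g: getq 0 (mkb J F P c) = false by rewrite getq_mkb.
 by rewrite -g setq_id.
have fl v b: flips [:: (0, v)] b = setq 0 (getq 0 b (+) v) b.
 apply: basis_eq=> i iN; rewrite getq_flips// getq_setq// par_cons addbF eq_sym; case: eqP=>[->|_]//=; exact: addbF.
have gm x: [/\ getq 0 (h x), getq 1 (h x) = false, getq 2 (h x) = false, getq 3 (h x) = true & anc0b one nv.+1 (h x)].
 have [e1 [e2 e3]] := mkb_J (false, false) true x.1 x.2; rewrite !getq_setq; try by lia.
 split=>//; have /andP[_ /allP H] := @ok_mkb w nv (false, false) true x.1 x.2; apply/allP=> i ii; have := H i ii.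
 move: ii; rewrite mem_iota=>/andP[i1 i2]; rewrite getq_setq; last by lia.
 by rewrite ifF; lia.
rewrite (sum_supp (h := h))=>[|[P c] [P' c'] E|b nb].
- apply: eq_bigr=> x _; have [-> e1 e2 e3 a0] := gm x; apply: eq_bigr=> e _; rewrite Psi3E a0 e1 e2 e3 fl.
 have -> : setq 0 (getq 0 (h x) (+) true) (h x) = mkb (false, false) true x.1 x.2.
  by rewrite getq_setq// setq_setq.
 by rewrite H2_mkb.
- have : mkb (false, false) true P c = mkb (false, false) true P' c'.
  have := congr1 (setq 0 false) E; rewrite !setq_setq.
  by rewrite !s0.
 by case/(mkb_inj nv_f0)=> _ _ -> ->.
case: ifP=> // g0; apply: big1=> e _; rewrite Psi3E; case: ifP=> // a0; last by rewrite normsq0.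
rewrite fl g0; case V : [&& _, _ & _]; rewrite/=; last first.
 by rewrite -g0 setq_id H2_ok ?normsq0// /okb g0.
set b' := setq 0 false b; case: (boolP (ok b'))=> [/(@okP w nv) bE|nb']; last by rewrite H2_ok ?normsq0.
case: (nb (Pof b', mpart b')); rewrite /h; case/and3P: V=> v1 v2 v3.
have -> : mkb (false, false) true (Pof b') (mpart b') = b'.
 rewrite [RHS]bE /Jof !getq_setq ?(negbTE v1) ?(negbTE v2) ?v3//; by lia.
by rewrite setq_setq -{1}g0 setq_id.
Qed.
(** The prover cannot change the weight of given private contents, here the coins, the flag and the
    kept cell. *)
Lemma slice_norm J F P : unitary U1 -> \sum_c \sum_e normsq (Psi2 (mkb J F P c) e) = \sum_c \sum_e normsq (Psi1 (mkb J F P c) e).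
move=> HU; have G (psi : qstate N D) : (\sum_c \sum_e normsq (psi (mkb J F P c) e))%:C%C = gram psi (mkb J F P (@zmsg nm)) (mkb J F P (@zmsg nm)).
 rewrite pair_big rmorph_sum; apply: eq_bigr=> -[c e] _/=; rewrite (mkb_setm nv_f0) -normsqE//.
by apply: (fmorph_inj (real_complex R)); rewrite/= !G gram_prover.
Qed.
End States.
(** The variance of four complex numbers. *)
Lemma normsq4 (v : bool * bool -> C) : \sum_J normsq (v J - 4^-1 * \sum_K v K) = \sum_J normsq (v J) - 4 * normsq (4^-1 * \sum_K v K).
have e (K : nmodType) (f : bool*bool -> K) : \sum_J f J = f (true, true) + f (true, false) + (f (false, true) + f (false, false)).
 rewrite (eq_bigr (fun p=> f (p.1, p.2))); last by case.
 by rewrite -(pair_bigA _ (fun a b=> f (a, b))) !big_bool.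
rewrite !e; case: (v (true, true))=> a1 b1; case: (v (true, false))=> a2 b2; case: (v (false, true))=> a3 b3; case: (v (false, false))=> a4 b4.
by rewrite /normsq/=; field.
Qed.
Lemma normsq_close (v : bool * bool -> C) J J' s : 0 < s ->
 normsq (v J) <= (1 + s) * normsq (v J') + (1 + s^-1) * (2 * (\sum_K normsq (v K) - 4 * normsq (4^-1 * \sum_K v K))).
move=> s0; rewrite -normsq4; set m := 4^-1 * _.
have S0: 0 <= \sum_K normsq (v K - m) by apply: sumr_ge0=> K _; apply: normsq_ge0.
have si: 0 < s^-1 by rewrite invr_gt0.
case: (eqVneq J J')=>[<-|JJ].
 rewrite mulrDl mul1r -addrA lerDl addr_ge0// mulr_ge0 ?normsq_ge0 ?(ltW s0)//.
  by rewrite addr_ge0// ltW.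
 by rewrite mulr_ge0.
have -> : v J = v J' + (v J - v J') by rewrite addrC subrK.
apply: le_trans (normsq_add _ _ s0) _; rewrite lerD2l; apply: ler_wpM2l; first by rewrite addr_ge0// ltW.
apply: (@le_trans _ _ (2*(normsq (v J - m) + normsq (v J' - m)))).
 have -> : v J - v J' = (v J - m) - (v J' - m) by rewrite opprB addrA subrK.
 by rewrite -normsq_par lerDr normsq_ge0.
rewrite ler_wpM2l// (bigD1 J)//= (bigD1 J')/=; last by rewrite eq_sym.
by rewrite addrA lerDl; apply: sumr_ge0=> K _; apply: normsq_ge0.
Qed.

(** * Coherence of the four branches *)

Section QC.
Variables (X : finType) (v : bool * bool -> X -> C) (M d : R).
Hypotheses (HM : forall J, \sum_x normsq (v J x) = M) (M1 : M <= 1) (acc : 1 - d <= \sum_x normsq (4^-1 * \sum_J v J x)).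
Lemma qc_mass : 1 - d <= M.
apply: le_trans acc _; have : 4 * \sum_x normsq (4^-1 * \sum_J v J x) <= 4*M; last by lra.
have -> : 4*M = \sum_J \sum_x normsq (v J x) by under eq_bigr=> J _ do rewrite HM; rewrite sumr_const card_prod !card_bool mulr_natl.
rewrite exchange_big mulr_sumr; apply: ler_sum=> x _/=; rewrite -subr_ge0 -normsq4; apply: sumr_ge0=> J _; exact: normsq_ge0.
Qed.
(** The branches have equal mass at most 1 and their mean has mass at least [1 - d], so the total
    variance is at most [4 * d]; the weight [s] then compares two branches on any event. *)
Lemma qc_close (E : pred X) J J' s : 0 < s ->
 \sum_(x | E x) normsq (v J x) <= (1 + s) * \sum_(x | E x) normsq (v J' x) + (1 + s^-1) * (8 * d).
move=> s0; have si: 0 < s^-1 by rewrite invr_gt0.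
apply: (@le_trans _ _ (\sum_(x | E x) ((1 + s)*normsq (v J' x) + (1 + s^-1)*(2*(\sum_K normsq (v K x) - 4*normsq (4^-1 * \sum_K v K x)))))).
 by apply: ler_sum=> x _; apply: normsq_close.
rewrite big_split -mulr_sumr lerD2l -mulr_sumr; apply: ler_wpM2l; first by rewrite addr_ge0// ltW.
rewrite -mulr_sumr (_ : 8*d = 2*(4*d)); last by ring.
rewrite ler_wpM2l//; apply: (@le_trans _ _ (\sum_x (\sum_K normsq (v K x) - 4*normsq (4^-1 * \sum_K v K x)))).
 rewrite [X in _ <= X](bigID E) lerDl; apply: sumr_ge0=> x _; rewrite -normsq4; apply: sumr_ge0=> K _; exact: normsq_ge0.
rewrite sumrB exchange_big -mulr_sumr; under eq_bigr=> J0 _ do rewrite HM.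
rewrite sumr_const card_prod !card_bool; move: acc M1; lra.
Qed.
End QC.
Section Sound.
Variables (w nv : nat) (phi : seq token) (pb : (nat -> nat -> bool) -> bool).
Let nm := (4 * w + 2)%N.
Let one := (4 + w)%N.
Hypotheses (Hphi : forall env, sem env phi (pb env)) (okphi : fok (fun j k => (j < 4) && (k < w))%N phi) (nv_f0 : (one.+1 + size (f0 w phi) <= nv.+1)%N) (nv_f2 : (one.+1 + size f2 <= nv.+1)%N).
Variables (D : nat) (U0 U1 : prover_op nm D).
Hypotheses (HU0 : unitary U0) (HU1 : unitary U1).
Let P2 := @Psi2 w nv phi D U0 U1.
Definition mu (c : basis nm) := \sum_e normsq (@amp w D U0 c e).
(** The probability that a window measured in the first message is valid and that its cell selected
    by the coins [J] lies in [E]. *)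
Definition pr J (E : pred (basis w)) := \sum_(c | @pbm w pb c && E (@slot w (jn J) c)) mu c.
Lemma mu_ge0 c : 0 <= mu c. by apply: sumr_ge0=> e _; apply: normsq_ge0. Qed.
Lemma mu_sum : \sum_c mu c = 1.
apply: (fmorph_inj (real_complex R)); rewrite rmorph1; have H := HU0 (@zmsg nm, ord0) (@zmsg nm, ord0); rewrite eqxx in H.
rewrite -[RHS]/(true%:R) -H pair_big rmorph_sum; apply: eq_bigr=> -[c e] _/=; rewrite normsqE mulrC//.
Qed.
(** The factor 2 removes the amplitude 1/2 of a coin outcome, so that each branch has the mass of
    the valid windows. *)
Let v J (x : basis w * basis nm * 'I_D.+1) : C := 2 * P2 (@mkb w nv J true x.1.1 (@xJ w J x.1.2)) x.2.
Lemma v_pr J (E : pred (basis w)) : \sum_(x : basis w * basis nm * 'I_D.+1 | E x.1.1) normsq (v J x) = pr J E.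
transitivity (\sum_(P | E P) \sum_c \sum_e normsq (v J (P, c, e))).
 rewrite (pair_big E xpredT (fun P c=> \sum_e normsq (v J (P, c, e)))) (pair_big (fun x : basis w*basis nm=> E x.1 && true) xpredT (fun x e=> normsq (v J (x.1, x.2, e)))).
 by apply: eq_big=>[[[P c] e]|[[P c] e] _]//=; rewrite !andbT.
have n2 (z) : normsq (2*z) = 4*normsq z.
 by case: z=> a b; rewrite /normsq/=; ring.
have S P: \sum_c \sum_e normsq (v J (P, c, e)) = \sum_c (if @pbm w pb c && (P == @slot w (jn J) c) then mu (@xJ w J c) else 0).
 transitivity (4 * \sum_c \sum_e normsq (P2 (@mkb w nv J true P c) e)).
  rewrite mulr_sumr [RHS](reindex_inj (inv_inj (@xJK w J))); apply: eq_bigr=> c _; rewrite mulr_sumr; apply: eq_bigr=> e _.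
  by rewrite n2.
 rewrite (slice_norm nv_f0 U0 J true P HU1) mulr_sumr; apply: eq_bigr=> c _; rewrite mulr_sumr.
 under eq_bigr=> e _ do rewrite (Psi1_mkb Hphi okphi nv_f0) [true == _]eq_sym eqb_id.
 case: ifP=> _; last by rewrite big1// => e _; rewrite normsq0 mulr0.
 apply: eq_bigr=> e _; rewrite normsqM.
 by rewrite /normsq/=; field.
under eq_bigr=> P _ do rewrite S.
rewrite exchange_big [RHS](reindex_inj (inv_inj (@xJK w J))) [RHS]big_mkcond; apply: eq_bigr=> c _/=.
rewrite (pbm_xJ Hphi okphi) slot_xJ ?jn_lt//; case: pbm=> /=; last by rewrite big1.
rewrite -big_mkcondr; case: ifP=> Ec.
 by rewrite (big_pred1 (slot (jn J) c))// => P; rewrite/= andbC; case: eqP=>[->|]//.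
by apply: big1=> P /andP[EP /eqP PE]; rewrite -PE EP in Ec.
Qed.
Lemma pr_T J : pr J xpredT = pr (false, false) xpredT.
by []. Qed.
(** Acceptance close to 1 forces the four branches to be nearly equal as vectors. As the kept cell
    is private, its distribution is then nearly independent of which of the four cells was kept. *)
Theorem qsound d : 1 - d <= acc0 (@Psi3 w nv phi D U0 U1) ->
 1 - d <= pr (false, false) xpredT /\ forall J J' E s, 0 < s -> pr J E <= (1 + s) * pr J' E + (1 + s^-1) * (8 * d).
rewrite (acc_E Hphi okphi nv_f0 nv_f2)=> acc.
have acc': 1 - d <= \sum_x normsq (4^-1 * \sum_J v J x).
 apply: le_trans acc _; rewrite pair_big; apply: ler_sum=> -[[P c] e] _/=; rewrite -mulr_sumr mulrA.
 by rewrite (_ : 4^-1*2 = 2^-1)//; field.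
have HM J: \sum_x normsq (v J x) = pr (false, false) xpredT by rewrite -(pr_T J) -v_pr.
have M1: pr (false, false) xpredT <= 1.
 rewrite -mu_sum (bigID (fun c=> pbm pb c && true)) lerDl; apply: sumr_ge0=> c _; exact: mu_ge0.
split; first (first [exact: qc_mass HM acc' | exact: qc_mass HM M1 acc']).
move=> J J' E s s0; rewrite -!v_pr; exact: qc_close HM M1 acc' _ _ _ _ s0.
Qed.
End Sound.
Lemma lra5 (A B e : R) : B <= A -> 4 * e <= A -> 0 <= e -> 3 * (B + e) <= 4 * A. lra. Qed.
Lemma lra6 (a b c x y : R) : a <= b + x -> b <= c + x -> c <= y -> a <= y + 2 * x. lra. Qed.

(** * Propagation of errors through the table *)

Section Classical.
Variables (T : finType) (m : T -> R) (va : pred T) (dd : nat -> T -> nat * nat * nat) (Z : nat) (tab : nat -> nat -> nat) (bad : nat) (rule : nat -> nat -> nat -> nat) (eps dl : R).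
Hypotheses (m0 : forall c, 0 <= m c) (Z1 : (1 < Z)%N).
Local Notation tt j c := (dd j c).1.1.
Local Notation ii j c := (dd j c).1.2.
Local Notation aa j c := (dd j c).2.
Hypotheses (lt_t : forall j c, (tt j c < Z)%N) (lt_i : forall j c, (ii j c < Z)%N) (rel : forall c, va c -> (tt 1 c = tt 0 c /\ tt 2 c = tt 0 c) /\ [/\ ii 3 c = ii 1 c, ii 1 c = (ii 0 c).+1 %% Z, ii 2 c = (ii 1 c).+1 %% Z & tt 3 c = (tt 0 c).+1 %% Z]%N) (step : forall c, va c -> if tt 0 c == Z.-1 then (aa 3 c == tab 0 (ii 3 c)) && (aa 1 c != bad) else aa 3 c == rule (aa 0 c) (aa 1 c) (aa 2 c)) (tab_rule : forall t i, (i < Z)%N -> tab t.+1 (i.+1 %% Z) = rule (tab t i) (tab t (i.+1 %% Z)) (tab t ((i.+1 %% Z).+1 %% Z))).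
Variable ib : nat.
Hypotheses (ibZ : (ib < Z)%N) (tab_bad : tab Z.-1 ib = bad).
Definition q j (E : pred (nat * nat * nat)) := \sum_(c | va c && E (dd j c)) m c.
Hypotheses (eps0 : 0 <= eps) (close : forall j j' E, (j < 4)%N -> (j' < 4)%N -> q j E <= q j' E + eps) (mass : 1 - dl <= \sum_(c | va c) m c).
Definition wrong t (x : nat * nat * nat) := (x.1.1 == t) && (x.2 != tab t x.1.2).
Lemma q_mono (A B : pred T) : (forall c, va c -> A c -> B c) -> \sum_(c | va c && A c) m c <= \sum_(c | va c && B c) m c.
move=> H; rewrite [X in _ <= X](bigID A) -[X in X <= _]addr0; apply: lerD; last by apply: sumr_ge0.
by rewrite le_eqVlt; apply/orP; left; apply/eqP; apply: eq_bigl=> c; case V : va=> //=; case Ac : A; rewrite ?andbF// H.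
Qed.
Lemma q_union (A B C' : pred T) : \sum_(c | va c && [|| A c, B c | C' c]) m c <= \sum_(c | va c && A c) m c + \sum_(c | va c && B c) m c + \sum_(c | va c && C' c) m c.
rewrite !big_mkcondr -!big_split; apply: ler_sum=> c _/=.
have := m0 c; by case: A; case: B; case: C'=> /=; lra.
Qed.
Lemma wrong0 : q 3 (wrong 0) = 0.
apply: big1=> c /andP[vc /andP[/eqP t3 a3]]; have [_ [_ _ _ e3]] := rel vc; have := step vc.
have := lt_t 0 c; case: eqP=>[_ _ /andP[/eqP e _]|ne lt _]; first by move: a3; rewrite e eqxx.
by move: t3; rewrite e3 modn_small; lia.
Qed.
(** In a valid window a wrong content of cell 3 at time [t + 1] comes with a wrong content of cell
    0, 1 or 2 at time [t]; each of these events is transferred to cell 3 at the cost [eps]. *)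
Lemma wrongS t : (t.+1 < Z)%N -> q 3 (wrong t.+1) <= 3 * (q 3 (wrong t) + eps).
move=> tZ; apply: (@le_trans _ _ (q 0 (wrong t) + q 1 (wrong t) + q 2 (wrong t))); last first.
 have := close (wrong t) (isT : (0 < 4)%N) (isT : (3 < 4)%N); have := close (wrong t) (isT : (1 < 4)%N) (isT : (3 < 4)%N).
 by have := close (wrong t) (isT : (2 < 4)%N) (isT : (3 < 4)%N); lra.
apply: le_trans (q_union _ _ _); apply: q_mono=> c vc /andP[/eqP t3 a3]; have [[e1 e2] [e3 e4 e5 e6]] := rel vc.
have t0: tt 0 c = t.
 have := lt_t 0 c; move: e6; rewrite t3; case: (ltnP (tt 0 c).+1 Z)=> h; first by rewrite modn_small// => -[].
 by move=> E h2; move: E; rewrite (_ : (tt 0 c).+1 = Z) ?modnn; lia.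
have := step vc; rewrite ifF; last by lia.
rewrite /wrong e1 e2 t0 eqxx; apply: contraLR; rewrite !negb_or !negbK=>/and3P[/eqP-> /eqP-> /eqP->].
by rewrite e5 e4 -(tab_rule t (lt_i 0 c)) -e4 -e3.
Qed.
(** The base 4 in place of 3 absorbs the additive [eps] of every step. *)
Lemma wrong_le t : (t < Z)%N -> q 3 (wrong t) <= (4 ^ t)%:R * eps.
elim: t=>[|t IH] tZ; first by rewrite wrong0 mulr_ge0.
apply: le_trans (wrongS tZ) _; case: t IH tZ=>[|t] IH tZ; first by rewrite wrong0 add0r ler_wpM2r// ler_nat.
have := IH (ltnW tZ); rewrite natrM=> h.
have h4: 4*eps <= (4 ^ t.+1)%:R*eps by rewrite ler_wpM2r// ler_nat expnS leq_pmulr// expn_gt0.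
by rewrite -mulrA; exact: lra5 h h4 eps0.
Qed.
Definition f t i := q 1 (fun x => (x.1.1 == t) && (x.1.2 == i)).
(** The true content of cell [ib] in the last row is forbidden there, so a valid window having this
    cell in place 1 shows a wrong content. *)
Lemma f_bad : f Z.-1 ib <= ((4 ^ Z)%:R + 1) * eps.
apply: (@le_trans _ _ (q 1 (wrong Z.-1))).
 apply: q_mono=> c vc /andP[/eqP t1 /eqP i1]; rewrite /wrong i1 tab_bad; have [[e1 _] _] := rel vc; have := step vc.
 by rewrite -e1 t1 eqxx=>/andP[].
apply: le_trans (close (wrong Z.-1) (isT : (1 < 4)%N) (isT : (3 < 4)%N)) _; rewrite mulrDl mul1r lerD2r.
apply: le_trans (wrong_le _) _; first by lia.
by rewrite ler_wpM2r// ler_nat leq_exp2l; lia.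
Qed.
Lemma f_t t i : (t < Z)%N -> f t i <= f (t.+1 %% Z)%N i + eps.
move=> tZ; apply: le_trans (close _ (isT : (3 < 4)%N) (isT : (1 < 4)%N)); apply: q_mono=> c vc /andP[/eqP t1 /eqP i1].
by have [[e1 _] [e3 _ _ e6]] := rel vc; rewrite e6 e3 i1 -e1 t1 !eqxx.
Qed.
Lemma f_i t i : (i < Z)%N -> f t i <= f t (i.+1 %% Z)%N + eps.
move=> iZ; apply: le_trans (close _ (isT : (2 < 4)%N) (isT : (1 < 4)%N)); apply: q_mono=> c vc /andP[/eqP t1 /eqP i1].
by have [[e1 e2] [_ _ e5 _]] := rel vc; rewrite e5 i1 e2 -e1 t1 !eqxx.
Qed.
(** A one-sided comparison of neighbours suffices on a cycle, where any index is reached within [Z]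
    steps. *)
Lemma walk (g : nat -> R) : (forall i, (i < Z)%N -> g i <= g (i.+1 %% Z)%N + eps) -> forall i j, (i < Z)%N -> (j < Z)%N -> g i <= g j + Z%:R * eps.
move=> H i j iZ jZ; have K k: g i <= g ((i + k) %% Z)%N + k%:R*eps.
 elim: k=>[|k IH]; first by rewrite addn0 modn_small// mul0r addr0.
 have := H ((i + k) %% Z)%N (ltn_pmod _ (ltnW Z1)); rewrite -addn1 modnDml addn1 -addnS=> h.
 lra.
have := K (Z - i + j)%N; rewrite addnA subnKC ?(ltnW iZ)// modnDl modn_small// => h.
case: (ltnP j i)=> ji.
 by apply: le_trans h _; rewrite lerD2l ler_wpM2r// ler_nat; lia.
have := K (j - i)%N; rewrite subnKC// modn_small// => h'; apply: le_trans h' _; rewrite lerD2l ler_wpM2r// ler_nat; lia.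
Qed.
(** Each cell is nearly as light as the forbidden one, by a walk in space followed by a walk in
    time; adding up the [Z * Z] cells bounds the mass of all valid windows. *)
Theorem csound : 1 - dl <= (Z * Z)%:R * (((4 ^ Z)%:R + 1 + 2 * Z%:R) * eps).
apply: le_trans mass _.
have -> : \sum_(c | va c) m c = \sum_(t < Z) \sum_(i < Z) f t i.
 rewrite pair_big /f /q; under [RHS]eq_bigr=> p _ do rewrite big_mkcondr/=.
 rewrite exchange_big; apply: eq_bigr=> c vc/=.
 rewrite (bigD1 (Ordinal (lt_t 1 c), Ordinal (lt_i 1 c)))//= !eqxx big1 ?addr0// => -[a b] ab/=.
 case: ifP=> // /andP[/eqP h1 /eqP h2]; move: ab; rewrite xpair_eqE -!(inj_eq val_inj)/= h1 h2 !eqxx//.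
apply: (@le_trans _ _ (\sum_(t < Z) \sum_(i < Z) (((4 ^ Z)%:R + 1 + 2*Z%:R)*eps))); last first.
 by rewrite !sumr_const !card_ord -mulrnA -[X in X <= _]mulr_natl.
apply: ler_sum=> t _; apply: ler_sum=> i _.
have h1 := walk (fun j jZ=> f_i t jZ) (ltn_ord i) ibZ; have h2 := walk (fun k kZ=> f_t ib kZ) (ltn_ord t) (_ : Z.-1 < Z)%N.
have ZZ: (Z.-1 < Z)%N by lia.
by rewrite mulrDl -mulrA; exact: lra6 h1 (h2 ZZ) f_bad.
Qed.
End Classical.
(** Here [4 ^ Z = u ^ 2] for [Z = 2 ^ L], while [s = u ^ -8] and [d = s ^ 2], a choice that balances
    [s] against [8 * d / s]. The right-hand side is then of order [u ^ 4 * s], far below 1. *)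
Lemma exp_gap (L : nat) (u z s d : R) : (1 < L)%N -> z = (2 ^ L)%N%:R -> u = 2 ^+ (2 ^ L)%N -> s = (2 ^+ (2 ^ (L + 3))%N)^-1 -> d = (2 ^+ (2 ^ (L + 4))%N)^-1 ->
 1 - d <= z * z * ((u * u + 1 + 2 * z) * (s + (1 + s^-1) * (8 * d))) -> False.
move=> L1 -> uE sE dE; set zz : R := (2 ^ L)%N%:R=> H.
have Z4: (4 <= 2 ^ L)%N by rewrite -[4%N]/(2 ^ 2)%N leq_exp2l.
have u16: 16 <= u.
 have h: 2 ^+ 4 <= u by rewrite uE -!natrX ler_nat leq_exp2l.
 by apply: le_trans h; rewrite -natrX.
have up: 0 < u by lra.
have zu: zz <= u by rewrite uE /zz -natrX ler_nat ltnW// ltn_expl.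
have z0: 0 <= zz by rewrite ler0n.
have s8: s = (u ^+ 8)^-1 by rewrite sE uE -exprM expnD.
have d16: d = s * s by rewrite dE sE -invfM -exprD addnn -mul2n -expnS addnS.
have sp: 0 < s by rewrite s8 invr_gt0 exprn_gt0.
have e1: s + (1 + s^-1)*(8*d) = 9 * s + 8*(s * s) by rewrite d16; field; rewrite gt_eqF.
have u4: u ^+ 4*u ^+ 4 * s = 1 by rewrite s8 -exprD mulfV// gt_eqF// exprn_gt0.
have u2p: 256 <= u*u by have : 16*16 <= u*u; [rewrite ler_pM//; lra | lra].
have u4p: 256*256 <= u ^+ 4 by rewrite (_ : u ^+ 4 = (u*u)*(u*u)); [rewrite ler_pM//; lra | ring].
have s1: s <= 1 / 256.
 have : u ^+ 4*u ^+ 4 * s >= 256*1 * s by rewrite ler_wpM2r ?(ltW sp)// ler_pM//; lra.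
 by rewrite u4; lra.
have S1: s * s <= s by rewrite ler_piMl ?(ltW sp)//; lra.
have b1: zz*zz <= u*u by apply: ler_pM.
have uu: 2*u <= u*u by rewrite ler_wpM2r ?(ltW up)//; lra.
have b2: u*u + 1 + 2*zz <= 3*(u*u) by lra.
have b3: zz*zz*((u*u + 1 + 2*zz)*(9 * s + 8*(s * s))) <= (u*u)*(3*(u*u)*(17 * s)).
 apply: ler_pM=> //; [exact: mulr_ge0 | | ]; last first.
  apply: ler_pM=> //; [ | | lra]; last by have := mulr_ge0 (ltW sp) (ltW sp); lra.
  by have := mulr_ge0 (ltW up) (ltW up); lra.
 by apply: mulr_ge0; [have := mulr_ge0 (ltW up) (ltW up); lra | have := mulr_ge0 (ltW sp) (ltW sp); lra].
have b4: (u*u)*(3*(u*u)*(17 * s)) = 51*(u ^+ 4 * s) by ring.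
have b5: u ^+ 4 * s <= 1 / 256.
 have : 256*(u ^+ 4 * s) <= u ^+ 4*(u ^+ 4 * s) by rewrite ler_wpM2r//; [rewrite mulr_ge0 ?(ltW sp)// exprn_ge0// ltW | lra].
 by have -> : u ^+ 4*(u ^+ 4 * s) = 1; [rewrite mulrA | lra].
move: H; rewrite e1 d16; have := mulr_ge0 (ltW sp) (ltW sp); lra.
Qed.
Lemma sum_inj_le (I J : finType) (h : J -> I) (g : I -> R) : injective h -> (forall i, 0 <= g i) -> \sum_j g (h j) <= \sum_i g i.
move=> hi g0; rewrite (bigID (mem [set h j | j : J])) big_imset; last by move=> a b _ _; apply: hi.
by rewrite lerDl; apply: sumr_ge0.
Qed.

(** * The protocol for a given machine and input *)

Section Instance.
Variables (M : TM) (x y : seq bool) (t0 L1 nv : nat).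
Let L := L1.+1.
Let H := (2 ^ L1)%N.
Let Z := (2 ^ L)%N.
Let K := Kb M.
Let w := (K + L + L)%N.
Let nm := (4 * w + 2)%N.
Hypotheses (Hout : tm_outputs M x t0 y) (HL : (size x + t0 + 3 < H)%N).
Definition phiM := fphi K L (icodes M x) (ftab K (rule M)) (bad M).
Definition pbM env := phib env K L (icodes M x) (rule M) (bad M).
Hypotheses (nv_f0 : ((4 + w).+1 + size (f0 w phiM) <= nv.+1)%N) (nv_f2 : ((4 + w).+1 + size f2 <= nv.+1)%N).
Lemma ZH : Z = (H + H)%N. by rewrite /Z expnS mul2n addnn. Qed.
Lemma icZ : (size (icodes M x) <= 2 ^ L)%N.
by rewrite size_mkseq -/Z ZH; have := HL; clear; lia. Qed.
Lemma HphiM env : sem env phiM (pbM env).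
by apply: sem_phi; [exact: rule_lt | exact: icodes_lt | exact: icZ | exact: bad_lt]. Qed.
Lemma okphiM : fok (fun j k => (j < 4) && (k < w))%N phiM.
by apply: fok_phi=> j k -> ->. Qed.
Definition nd o n (P : basis w) := b2n (mkseq (fun k => getq (o + k) P) n).
Definition dec P : nat * nat * nat := (nd K L P, nd (K + L) L P, nd 0 K P).
Definition dd j (c : basis nm) := dec (@slot w j c).
Lemma num_nd c j o n : (o + n <= w)%N -> num (fun j k => getq (j * w + k) c) j o n = nd o n (@slot w j c).
move=> h; congr b2n; apply/eq_in_map=> k; rewrite mem_iota=>/andP[_ kn]; rewrite getq_slot//.
by apply: leq_trans h; rewrite ltn_add2l.
Qed.
Lemma nd_lt o n P : (nd o n P < 2 ^ n)%N. by have := b2n_lt (mkseq (fun k=> getq (o + k) P) n); rewrite size_mkseq. Qed.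
Lemma pbE c : @pbm w pbM c = [&& (dd 1 c).1.1 == (dd 0 c).1.1, (dd 2 c).1.1 == (dd 0 c).1.1, (dd 3 c).1.2 == (dd 1 c).1.2,
 (dd 1 c).1.2 == ((dd 0 c).1.2.+1 %% Z)%N, (dd 2 c).1.2 == ((dd 1 c).1.2.+1 %% Z)%N, (dd 3 c).1.1 == ((dd 0 c).1.1.+1 %% Z)%N &
 if (dd 0 c).1.1 == Z.-1 then ((dd 3 c).2 == ctab M x H Z 0 (dd 3 c).1.2) && ((dd 1 c).2 != bad M) else (dd 3 c).2 == rule M (dd 0 c).2 (dd 1 c).2 (dd 2 c).2].
have h1: (K + L <= w)%N by rewrite leq_addr.
have h3: (0 + K <= w)%N by rewrite /w -addnA leq_addr.
by rewrite /pbm /pbM /phib !num_nd// (ctab0 M HL ZH (nd_lt _ _ _)).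
Qed.
Section No.
Hypothesis Hno : y = [:: false].
Theorem no_sound D (U0 U1 : prover_op nm D) : unitary U0 -> unitary U1 -> (1 < L)%N ->
 acc0 (@Psi3 w nv phiM D U0 U1) <= 1 - (2 ^+ (2 ^ (L + 4)))^-1.
move=> HU0 HU1 L2; rewrite leNgt; apply/negP=>/ltW acc; set d : R := (_)^-1 in acc.
have [mass close] := qsound HphiM okphiM nv_f0 nv_f2 HU0 HU1 acc.
have [ib ibZ tb] := ctab_no Hout HL ZH Hno.
set s : R := (2 ^+ (2 ^ (L + 3)))^-1; have s0: 0 < s by rewrite invr_gt0 exprn_gt0.
have d0: 0 < d by rewrite invr_gt0 exprn_gt0.
have pr1 J E: pr pbM U0 J E <= 1.
 rewrite -(mu_sum HU0) (bigID (fun c=> pbm pbM c && E (slot (jn J) c))) lerDl; apply: sumr_ge0=> c _; exact: mu_ge0.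
have Jof_ j: (j < 4)%N -> exists J, jn J = j.
 case: j=>[|[|[|[|]]]]// _; by [exists (false, false) | exists (true, false) | exists (false, true) | exists (true, true)].
have cl j j' E: (j < 4)%N -> (j' < 4)%N -> q (mu U0) (pbm pbM) dd j E <= q (mu U0) (pbm pbM) dd j' E + (s + (1 + s^-1)*(8*d)).
 move=> /Jof_[J jE] /Jof_[J' jE']; have := close J J' (fun P=> E (dec P)) s s0; rewrite /pr jE jE'.
 move=> h; apply: le_trans h _; rewrite addrA lerD2r mulrDl mul1r lerD2l ler_piMr ?(ltW s0)//.
 by have := pr1 J' (fun P=> E (dec P)); rewrite /pr jE'.
have eps0: 0 <= s + (1 + s^-1)*(8*d).
 apply: addr_ge0; first exact: ltW.
 by apply: mulr_ge0; [rewrite addr_ge0// invr_ge0 ltW | rewrite mulr_ge0// ltW].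
have Z1: (1 < Z)%N by rewrite -[1%N]/(2 ^ 0)%N ltn_exp2l.
have mass': 1 - d <= \sum_(c | pbm pbM c) mu U0 c.
 by apply: le_trans mass _; rewrite le_eqVlt; apply/orP; left; apply/eqP; apply: eq_bigl=> c; rewrite andbT.
have := @csound _ (mu U0) (pbm pbM) dd Z (ctab M x H Z) (bad M) (rule M) _ d (fun c=> mu_ge0 U0 c) Z1 (fun j c=> nd_lt _ _ _) (fun j c=> nd_lt _ _ _) _ _ _ ib ibZ tb eps0 cl mass'.
move=> CS; apply: (@exp_gap L (2 ^+ Z) Z%:R s d)=> //.
have -> : 2 ^+ Z*2 ^+ Z = (4 ^ Z)%:R :> R by rewrite -expr2 -exprM mulnC exprM -natrX -natrX.
rewrite -natrM; apply: CS=>[c|c|t i iZ].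
- by rewrite pbE=>/and5P[/eqP-> /eqP-> /eqP-> /eqP e4 /and3P[/eqP e5 /eqP-> _]].
- by rewrite pbE=>/and5P[_ _ _ _ /and3P[_ _]].
- exact: ctab_rule Hout HL ZH _ _ iZ.
Qed.
End No.
Section Yes.
Hypothesis Hyes : y = [:: true].
Local Notation I2 := ('I_Z * 'I_Z)%type.
Lemma Z0 : (0 < Z)%N. by rewrite expn_gt0. Qed.
Definition enc t i : basis w := [ffun k : 'I_w => let k := val k in if (k < K)%N then odd (iter k half (ctab M x H Z t i)) else
 if (k < K + L)%N then odd (iter (k - K) half t) else odd (iter (k - (K + L)) half i)].
Lemma b2n_bits n a : (a < 2 ^ n)%N -> b2n (mkseq (fun k => odd (iter k half a)) n) = a.
move=> an; apply: (@bits_inj n)=> // [|k kn]; first by have := b2n_lt (mkseq (fun k=> odd (iter k half a)) n); rewrite size_mkseq.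
by rewrite bit_b2n nth_mkseq.
Qed.
Lemma dec_enc t i : (t < Z)%N -> (i < Z)%N -> dec (enc t i) = (t, i, ctab M x H Z t i).
move=> tZ iZ; congr (_, _, _).
- rewrite -[RHS](b2n_bits tZ); congr b2n; apply/eq_in_map=> k; rewrite mem_iota=>/andP[_ kn].
 rewrite (getq_ffun (fun k=> if (k < K)%N then odd (iter k half (ctab M x H Z t i)) else if (k < K + L)%N then odd (iter (k - K) half t) else odd (iter (k - (K + L)) half i))).
  by rewrite ltnNge leq_addr ltn_add2l kn addKn.
 by rewrite /w -addnA ltn_add2l; apply: leq_trans kn (leq_addr _ _).
- rewrite -[RHS](b2n_bits iZ); congr b2n; apply/eq_in_map=> k; rewrite mem_iota=>/andP[_ kn].
 rewrite (getq_ffun (fun k=> if (k < K)%N then odd (iter k half (ctab M x H Z t i)) else if (k < K + L)%N then odd (iter (k - K) half t) else odd (iter (k - (K + L)) half i))).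
  by rewrite ltnNge -addnA leq_addr addnA ltnNge leq_addr addKn.
 by rewrite ltn_add2l.
- rewrite -(b2n_bits (ctab_lt M x H Z t i)); congr b2n; apply/eq_in_map=> k; rewrite mem_iota=>/andP[_ kn].
 rewrite (getq_ffun (fun k=> if (k < K)%N then odd (iter k half (ctab M x H Z t i)) else if (k < K + L)%N then odd (iter (k - K) half t) else odd (iter (k - (K + L)) half i))).
  by rewrite kn.
 by rewrite /w -addnA; apply: leq_trans kn (leq_addr _ _).
Qed.
Definition encI (p : I2) := enc p.1 p.2.
Lemma encI_inj : injective encI.
move=> [a b] [a' b'] /(congr1 dec); rewrite !dec_enc// => -[h1 h2 _].
by congr (_, _); apply: val_inj.
Qed.
Definition mkc (s : nat -> basis w) : basis nm := [ffun k : 'I_nm => if (val k < 4 * w)%N then getq (val k %% w) (s (val k %/ w)%N) else false].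
Lemma slot_mkc j s : (j < 4)%N -> slot j (mkc s) = s j.
move=> j4; apply: basis_eq=> k kw; rewrite getq_slot//.
have h: (j*w + k < 4*w)%N by apply: (@leq_trans (j*w + w)); rewrite ?ltn_add2l// -mulSnr leq_mul2r.
rewrite (getq_ffun (fun k=> if (k < 4*w)%N then getq (k %% w) (s (k %/ w)%N) else false)); last by apply: leq_trans h (leq_addr _ _).
by rewrite h modnMDl modn_small// divnMDl// divn_small// addn0.
Qed.
Definition sZ (i : 'I_Z) : 'I_Z := Ordinal (ltn_pmod i.+1 Z0).
Lemma sZ_inj : injective sZ.
move=> i j /(congr1 val)/= e; apply: val_inj=> /=; have iZ := ltn_ord i; have jZ := ltn_ord j.
case: (ltnP i.+1 Z) e=> hi; case: (ltnP j.+1 Z)=> hj.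
- by rewrite !modn_small// => -[].
- by rewrite modn_small// (_ : j.+1 = Z) ?modnn; lia.
- by rewrite [in RHS]modn_small// (_ : i.+1 = Z) ?modnn; lia.
lia.
Qed.
(** For each place of a window this is a bijection of the cyclic table, which makes the four
    marginals uniform. *)
Definition wj (j : nat) p : I2 := if j == 0%N then p else if j == 1%N then (p.1, sZ p.2) else if j == 2%N then (p.1, sZ (sZ p.2)) else (sZ p.1, sZ p.2).
Lemma wj_inj j : injective (wj j).
move=> [a b] [a' b']; rewrite /wj; case: ifP=> // _; case: ifP=>[_|_].
 by move=> h; congr (_, _); [exact: (congr1 fst h) | apply: sZ_inj; exact: (congr1 snd h)].
case: ifP=>[_|_] h; congr (_, _).
- exact: (congr1 fst h).
- by apply/sZ_inj/sZ_inj; exact: (congr1 snd h).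
- by apply/sZ_inj; exact: (congr1 fst h).
- by apply/sZ_inj; exact: (congr1 snd h).
Qed.
Definition win p : basis nm := mkc (fun j => encI (wj j p)).
Lemma slot_win j p : (j < 4)%N -> slot j (win p) = encI (wj j p). exact: slot_mkc. Qed.
Lemma win_inj : injective win.
by move=> p p' /(congr1 (@slot w 0)); rewrite !slot_win// => /encI_inj/wj_inj. Qed.
Lemma pb_win p : pbm pbM (win p).
rewrite pbE /dd !slot_win// !dec_enc ?ltn_ord//= !eqxx; case: p=> t i/=.
case: eqP=>[tE|tn]; last first.
 have tZ := ltn_ord t; rewrite modn_small; last by move: tZ tn; clear; lia.
 by rewrite (ctab_rule Hout HL ZH).
rewrite tE prednK ?Z0// modnn eqxx; exact: ctab_yes Hout HL ZH _ Hyes.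
Qed.
Let kap : C := (Z%:R)^-1.
Definition amp0 (c : basis nm * 'I_1) : C := if c.1 \in codom win then kap else 0.
Lemma sum_amp0 : ip amp0 amp0 = 1.
have kc: kap^* = kap by rewrite rmorphV ?unitfE ?pnatr_eq0 ?gtn_eqF ?Z0//= conjC_nat.
rewrite /ip -(pair_bigA _ (fun c (e : 'I_1) => amp0 (c, ord0)*(amp0 (c, ord0))^*)); under eq_bigr=> c _ do rewrite big_ord1.
rewrite (bigID (mem (codom win)))/= [X in _ + X]big1; last by move=> c /negbTE nc; rewrite /amp0 nc mul0r.
rewrite (eq_bigr (fun _=> kap*kap)); last by move=> c cw; rewrite /amp0 cw kc.
rewrite sumr_const card_codom; last exact: win_inj.
rewrite card_prod card_ord /kap; field; by rewrite pnatr_eq0 gtn_eqF ?Z0.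
Qed.
Definition dlt (c : basis nm) : basis nm * 'I_1 -> C := fun x => (x == (c, ord0))%:R.
Lemma app_dlt U c : app U (dlt c) = fun i => U i (c, ord0).
by funext i; rewrite /app; under eq_bigr=> j _ do rewrite mulrC; rewrite sum_delta. Qed.
Lemma ip_dlt c c' : ip (dlt c) (dlt c') = (c == c')%:R.
by rewrite /ip sum_delta conjC_nat xpair_eqE andbT. Qed.
Definition famx k := dlt (@xJ w k.1 (win k.2)).
(** What the honest prover sends back: a message determined by the kept cell alone, so that nothing
    else of the window survives. *)
Definition rep_ p := mkc (fun _ => encI p).
Definition famy k := dlt (@xJ w k.1 (rep_ (wj (jn k.1) k.2))).
Lemma xJ_inj J J' s s' : @xJ w J (mkc s) = @xJ w J' (mkc s') -> J = J' /\ mkc s = mkc s'.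
move=> E; have z k: (4*w <= k < nm)%N -> getq k (mkc s) = false /\ getq k (mkc s') = false.
 move=> /andP[h1 h2]; split; rewrite (getq_ffun (fun k=> if (k < 4*w)%N then getq (k %% w) (_ (k %/ w)%N) else false))// ltnNge h1//.
have JJ: J = J'.
 have r1: (4*w <= 4*w < nm)%N by clear; lia.
 have r2: (4*w <= (4*w).+1 < nm)%N by clear; lia.
 have e1 := congr1 (getq (4*w)) E; have e2 := congr1 (getq (4*w).+1) E; move: e1 e2; rewrite !getq_xJ; try by clear; lia.
 have [-> ->] := z _ r1; have [-> ->] := z _ r2; have q1: ((4*w).+1 == 4*w) = false by clear; lia.
 have q2: (4*w == (4*w).+1) = false by clear; lia.
 rewrite !eqxx q1 q2.
 by case: J J' {E} => [a b] [a' b']; rewrite/= !addbF=> -> ->.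
by split=>//; rewrite -[LHS](@xJK w J) E JJ xJK.
Qed.
Lemma fam_ip k k' : ip (famx k) (famx k') = ip (famy k) (famy k').
rewrite !ip_dlt; congr (nat_of_bool _)%:R; apply/eqP/eqP=> [/xJ_inj[<- /win_inj <-]//|/xJ_inj[<- E]].
have := congr1 (@slot w 0) E; rewrite !slot_mkc// => /encI_inj.
by move=> h; rewrite (wj_inj h).
Qed.
(** For fixed coins the kept cell determines the window, so erasing the rest is an injective map of
    basis vectors and extends to a unitary. Afterwards the branches differ only in the coins and
    interfere completely. A private space of dimension 1 suffices. *)
Theorem yes_complete : exists U0 U1 : prover_op nm 0, [/\ unitary U0, unitary U1 & 1 <= acc0 (@Psi3 w nv phiM 0 U0 U1)].
have [|U0 HU0 E0] := @gram_unitary _ (basis nm * 'I_1)%type unit [:: tt] (fun _=> dlt (@zmsg nm)) (fun _=> amp0).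
 by rewrite ip_dlt eqxx sum_amp0.
have [|U1 HU1 E1] := @gram_unitary _ (basis nm * 'I_1)%type _ (enum {: (bool*bool)*I2}) famx famy.
 by move=> k k' _ _; apply: fam_ip.
exists U0, U1; split=>//; rewrite (acc_E HphiM okphiM nv_f0 nv_f2).
have ampE c e: amp U0 c e = amp0 (c, e).
 have := E0 tt (mem_head _ _); rewrite app_dlt=>/(congr1 (fun f=> f (c, e))) <-; by [].
have U1E J p c e: U1 (c, e) (@xJ w J (win p), ord0) = (c == @xJ w J (rep_ (wj (jn J) p)))%:R.
 have := E1 (J, p) (mem_enum _ _); rewrite app_dlt=>/(congr1 (fun f=> f (c, e)))/= ->; by rewrite /famy /dlt xpair_eqE ord1 andbT.
have P2 J p: Psi2 phiM U0 U1 (@mkb w nv J true (encI p) (@xJ w J (rep_ p))) ord0 = 2^-1*kap.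
 (* The unique window that has the cell [p] in place [jn J]. *)
 pose b := invF (@wj_inj (jn J)) p; have bE: wj (jn J) b = p by rewrite f_invF.
 rewrite (Psi2_mkb nv_f0) (bigD1 (@xJ w J (win b), ord0))//= U1E bE eqxx mul1r big1 ?addr0=>[|[c e] ce].
  by rewrite (Psi1_mkb HphiM okphiM nv_f0) (pbm_xJ HphiM okphiM) pb_win slot_xJ ?jn_lt// slot_win ?jn_lt// bE xJK ampE /amp0/= eqxx codom_f.
 rewrite (Psi1_mkb HphiM okphiM nv_f0); case: ifP=> [/andP[_ /eqP PE]|_]; last by rewrite mulr0.
 rewrite ampE /amp0; case: ifP=> [/codomP[b' bE']|_]; last by rewrite !mulr0.
 case/negP: ce; rewrite ord1 xpair_eqE andbT; have cE: c = @xJ w J (win b') by rewrite -bE' xJK.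
 move: PE; rewrite cE slot_xJ ?jn_lt// slot_win ?jn_lt// => /encI_inj pE.
 by rewrite /b pE invF_f.
(* The vectors [(encI p, rep_ p)] alone contribute [Z * Z] terms, each equal to the square of
   [1 / Z]. *)
apply: le_trans; last first.
 have g0 (z : basis w*basis nm) : 0 <= \sum_(e : 'I_1) normsq (2^-1 * \sum_J Psi2 phiM U0 U1 (@mkb w nv J true z.1 (@xJ w J z.2)) e).
  by apply: sumr_ge0=> e _; apply: normsq_ge0.
 by apply: (sum_inj_le (h := fun p=> (encI p, rep_ p)) _ g0)=> p p' [/encI_inj].
under eq_bigr=> p _ do rewrite big_ord1.
under eq_bigr=> p _ do under eq_bigr=> J _ do rewrite P2.
have -> : 2^-1*(\sum_(J : bool*bool) 2^-1*kap) = (Z%:R^-1)%:C%C.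
 rewrite sumr_const card_prod !card_bool fmorphV rmorph_nat -/kap; by field.
have nr (r) : normsq (r%:C%C) = r ^+ 2 by rewrite /normsq expr0n addr0.
rewrite nr sumr_const card_prod card_ord le_eqVlt; apply/orP; left; apply/eqP; field; by rewrite pnatr_eq0 gtn_eqF ?Z0.
Qed.
End Yes.
End Instance.

(** * The verifier is polynomial-time *)
Local Close Scope ring_scope.
Section Formulas.
Variable E : encT.
Implicit Types (f g : E -> seq token) (a o n j k : E -> nat).
Lemma pt_fv j k : ptime j -> ptime k -> ptime (fun e => fv (j e) (k e)).
by move=> J K; rewrite /fv; pt. Qed.
Lemma pt_fnd f g : ptime f -> ptime g -> ptime (fun e => fnd (f e) (g e)).
by move=> F G; rewrite /fnd; pt. Qed.
Lemma pt_fnot f : ptime f -> ptime (fun e => fnot (f e)).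
by move=> F; apply: pt_fnd=> //; apply: pt_const. Qed.
Lemma pt_fand f g : ptime f -> ptime g -> ptime (fun e => fand (f e) (g e)).
by move=> F G; apply/pt_fnot/pt_fnd. Qed.
Lemma pt_for f g : ptime f -> ptime g -> ptime (fun e => for_ (f e) (g e)).
by move=> F G; apply: pt_fnd; apply: pt_fnot. Qed.
Lemma pt_fimp f g : ptime f -> ptime g -> ptime (fun e => fimp (f e) (g e)).
by move=> F G; apply: pt_fnd=> //; apply: pt_fnot. Qed.
Lemma pt_feq f g : ptime f -> ptime g -> ptime (fun e => feq (f e) (g e)).
by move=> F G; apply: pt_fnd; [apply: pt_fnd | apply: pt_for]. Qed.
Lemma pt_fall (l : E -> seq (seq token)) : ptime l -> ptime (fun e => fall (l e)).
move=> Hl; apply: pt_foldr_add=> //; [by rewrite /fand /fnot /fnd; pt | by apply: pt_const | exists 6=> e s x].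
apply: (@leq_trans (esz s + (esz x + 64))); last first.
 by lia.
have e1: esz fT = 7 by []; have e2: esz [:: (1, 0, 0)] = 9 by [].
move: (esz_cat fT ((s ++ x ++ [:: (1, 0, 0)]) ++ [:: (1, 0, 0)])) (esz_cat (s ++ x ++ [:: (1, 0, 0)]) [:: (1, 0, 0)]) (esz_cat s (x ++ [:: (1, 0, 0)])) (esz_cat x [:: (1, 0, 0)]).
by rewrite e1 e2; move: (esz) (esz) (esz) (esz) (esz) (esz _)=> a1 a2 a3 a4 a5 a6; lia.
Qed.
End Formulas.
Ltac ptf1 := match goal with
 | |- ptime (fun x => fv (@?f x) (@?g x)) => apply: pt_fv
 | |- ptime (fun x => fnot (@?f x)) => apply: pt_fnot
 | |- ptime (fun x => fand (@?f x) (@?g x)) => apply: pt_fand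
 | |- ptime (fun x => for_ (@?f x) (@?g x)) => apply: pt_for
 | |- ptime (fun x => fimp (@?f x) (@?g x)) => apply: pt_fimp
 | |- ptime (fun x => feq (@?f x) (@?g x)) => apply: pt_feq
 | |- ptime (fun x => fall (@?f x)) => apply: pt_fall
 | |- ptime (fun x => mkseq _ _) => apply: pt_mkseq
 end.
Ltac ptf := repeat first [ptf1 | pt1 | pt3].
Section Formulas2.
Variable E : encT.
Implicit Types (f g : E -> seq token) (a o n j k : E -> nat).
Lemma pt_feqs j k o n : ptime j -> ptime k -> ptime o -> ptime n -> ptime (fun e => feqs (j e) (k e) (o e) (n e)).
by move=> *; rewrite /feqs; ptf. Qed.
Lemma pt_fones j o n : ptime j -> ptime o -> ptime n -> ptime (fun e => fones (j e) (o e) (n e)).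
by move=> *; rewrite /fones; ptf. Qed.
Lemma pt_fconst j o n a : ptime j -> ptime o -> ptime n -> ptime a -> ptime (fun e => fconst (j e) (o e) (n e) (a e)).
by move=> *; rewrite /fconst; ptf. Qed.
End Formulas2.
Lemma pt_fsucc (E : encT) (j k o n : E -> nat) : ptime j -> ptime k -> ptime o -> ptime n -> ptime (fun e => fsucc (j e) (k e) (o e) (n e)).
by move=> *; rewrite /fsucc; ptf; apply: pt_fones; ptf. Qed.
Lemma pt_fphi (E : encT) K (L : E -> nat) (ic : E -> seq nat) tab bad : ptime L -> ptime ic -> ptime (fun e => fphi K (L e) (ic e) tab bad).
move=> HL HI.
rewrite /fphi /finit; ptf; try (first [apply: pt_feqs | apply: pt_fsucc | apply: pt_fones | apply: pt_fconst]; ptf).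
Qed.
Section Circuits.
Variable E : encT.
Lemma pt_f0 (w : E -> nat) (phi : E -> seq token) : ptime w -> ptime phi -> ptime (fun e => f0 (w e) (phi e)).
move=> HW HP; rewrite /f0 /fP; ptf.
Qed.
Lemma esz_mem (A : encT) (s : seq A) B : (forall i x0, i < size s -> esz (nth x0 s i) <= B) -> esz s <= (size s * B.+1).+1.
elim: s=> // a s IH H; rewrite esz_cons/=; have h0: esz a <= B := H 0 a isT.
have h1: esz s <= (size s*B.+1).+1 by apply: IH=> i x0 h; apply: (H i.+1).
lia.
Qed.
Lemma comp_bd (qv : nat -> nat -> nat) one (f : seq token) B : (forall t, t \in f -> qv t.1.2 t.2 <= B) -> one.+1 + size f <= B ->
 let c := comp qv one f in [/\ c.1.1 = one.+1 + size f, all (leq^~ B) c.1.2, size c.1.2 <= size f,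
  all (fun o : rop => [&& o.1.1 <= B, o.1.2 <= B & o.2 <= B]) c.2 & size c.2 <= 2 * size f + 1].
elim/last_ind: f=>[|f t IH] H.
 by rewrite/= addn0=> h; rewrite !(ltnW h).
rewrite size_rcons=> h; have [||c1 c2 c3 c4 c5] := IH; first by move=> u uf; apply: H; rewrite mem_rcons inE uf orbT.
 lia.
rewrite /comp foldl_rcons -/(comp qv one f); case: comp c1 c2 c3 c4 c5=>[[n st] ops]/= c1 c2 c3 c4 c5.
have nB: n <= B by lia.
have sB i: nth 0 st i <= B by case: (ltnP i (size st))=> hi; [apply: (allP c2); rewrite mem_nth | rewrite nth_default].
have tB: qv t.1.2 t.2 <= B by apply: H; rewrite mem_rcons mem_head.
rewrite /cstep; case: ifP=> _/=; [|case: ifP=> _/=]; rewrite ?nB ?sB; split=>//; try by lia.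
- by apply/allP=> i /mem_drop; move: i; apply/allP.
- by rewrite size_drop; lia.
Qed.
(** Qubit names are bounded in terms of the register sizes and the formula, and there are at most
    two gates per token and one more; this bounds the state of the compilation. *)
Lemma pt_compile (w nv one : E -> nat) (f : E -> seq token) : ptime w -> ptime nv -> ptime one -> ptime f ->
 ptime (fun e => comp (qv (w e) (nv e)) (one e) (f e)).
move=> HW HN HO HF; apply: pt_foldl.
- by rewrite /cstep /qv; pt.
- by pt.
- by [].
have HB: ptime (fun e=> (one e).+1 + size (f e) + (nv e).+1 + 4*w e + 1) by pt.
have [k1 h1] := pt_szb HB; have [k2 h2] := pt_szb HF.
pose Bd n := (n + 2) ^ k1 + (n + 2) ^ k2.
exists (fun n=> 40*(Bd n + 2)*(Bd n + 2) + 40); first by rewrite /Bd; auto 25 with pol.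
move=> e i il; set g := take i (f e); rewrite -/(comp _ _ g); set B := Bd (esz e).
have f1 := h1 e; have f2 := h2 e; rewrite esz_nat in f1.
have gf: size g <= size (f e) by rewrite size_take_min geq_minr.
have gs: size g <= B by rewrite /B /Bd; lia.
have [||c1 c2 c3 c4 c5] := @comp_bd (qv (w e) (nv e)) (one e) g B.
- move=> t /mem_take tf; have : esz t < esz (f e) by move: tf; elim: (f e)=> // a s IH; rewrite esz_cons=>/orP[/eqP->|/IH]; lia.
 case: t tf=>[[a j] k] _; rewrite !esz_pair !esz_nat /qv/= => tz.
 have jw: j < 4 -> j*w e <= 4*w e by move=> h; rewrite leq_mul2r (ltnW h) orbT.
 rewrite /B /Bd.
 by case: ifP=> [/jw|_]; lia.
- by rewrite /B /Bd; lia.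
case: comp c1 c2 c3 c4 c5=>[[n st] ops]/= c1 c2 c3 c4 c5; rewrite !esz_pair esz_nat.
have nB: n <= B by rewrite /B /Bd; lia.
have s1: esz st <= (size st*(2*B + 1).+1).+1.
 by apply: esz_mem=> j x0 js; rewrite esz_nat; have := allP c2 _ (mem_nth x0 js); move: nth=> v; lia.
have s2: esz ops <= (size ops*(6*B + 5).+1).+1.
 apply: esz_mem=> j x0 js; have := allP c4 _ (mem_nth x0 js); case: nth=>[[a b] c]/= /and3P[]; rewrite !esz_pair !esz_nat; lia.
have m1: size st*(2*B + 1).+1 <= B*(2*B + 2) by rewrite leq_mul//; [exact: leq_trans gs | lia].
have m2: size ops*(6*B + 5).+1 <= (2*B + 1)*(6*B + 6) by rewrite leq_mul; lia.
nia.
Qed.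
Lemma zip_mkseq A B (a : A) (b : B) s t : zip s t = mkseq (fun i => (nth a s i, nth b t i)) (if size s <= size t then size s else size t).
have e: minn (size s) (size t) = if size s <= size t then size s else size t by case: ltngtP.
rewrite -e; apply: (@eq_from_nth _ (a, b)); rewrite ?size_mkseq size_zip// => i h.
by rewrite nth_zip_cond size_zip h nth_mkseq.
Qed.
Lemma pt_copies (one : E -> nat) (st tgs : E -> seq nat) : ptime one -> ptime st -> ptime tgs -> ptime (fun e => copies (one e) (st e) (tgs e)).
move=> HO HS HT; apply: pt_map; first by pt.
apply: (@pt_ext _ _ (fun e=> mkseq (fun i=> (nth 0 (st e) i, nth 0 (rev (tgs e)) i)) (if size (st e) <= size (rev (tgs e)) then size (st e) else size (rev (tgs e)))))=>[e|]; first by rewrite -zip_mkseq.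
by ptf.
Qed.
Lemma pt_fcirc (w nv one : E -> nat) (f : E -> seq token) (tgs : E -> seq nat) : ptime w -> ptime nv -> ptime one -> ptime f -> ptime tgs ->
 ptime (fun e => fcirc (qv (w e) (nv e)) (one e) (f e) (tgs e)).
move=> HW HN HO HF HT; have P := pt_compile HW HN HO HF; apply: pt_cat; first by pt.
by apply: pt_cat; [apply: pt_copies; pt | pt].
Qed.
Definition gcode g : seq nat := match g with Tof i j k => [:: 1; i; j; k] | Had i => [:: 2; i] | Ph i => [:: 3; i] end.
Definition ccode c : seq nat := flatten (map gcode c).
Definition rgn (o : rop) : seq nat := if o.1.1 == o.2 then [:: 2; o.2; 3; o.2; 3; o.2; 2; o.2] else [:: 1; o.1.1; o.1.2; o.2].
Lemma ccode_cat c c' : ccode (c ++ c') = ccode c ++ ccode c'.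
by rewrite /ccode map_cat flatten_cat. Qed.
Lemma ccode_rgc ops : ccode (rgc ops) = flatten (map rgn (rev ops)).
rewrite /rgc; elim: rev=> // o s IH; rewrite ccode_cat IH; congr (_ ++ _).
by rewrite /rg /rgn; case: ifP.
Qed.
Lemma pt_rgc (ops : E -> seq rop) : ptime ops -> ptime (fun e => ccode (rgc (ops e))).
move=> H; apply: pt_ext=>[e|]; first by rewrite ccode_rgc.
by apply: pt_flatten; apply: pt_map; [rewrite /rgn; pt | pt].
Qed.
Lemma ccode_had c c' : ccode (c ++ [:: Had 1; Had 2] ++ c') = ccode c ++ [:: 2; 1; 2; 2] ++ ccode c'.
by rewrite !ccode_cat. Qed.
Lemma pt_V0 (w nv : E -> nat) (phi : E -> seq token) : ptime w -> ptime nv -> ptime phi -> ptime (fun e => ccode (V0 (w e) (nv e) (phi e))).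
move=> HW HN HP; have Ho: ptime (fun e=> 4 + w e) by pt.
have Ht: ptime (fun e=> tg0 (w e) (nv e)) by rewrite /tg0 /tg1; pt.
have H := pt_rgc (pt_fcirc HW HN Ho (pt_f0 HW HP) Ht).
exact: pt_cat (pt_const _ _) (pt_cat (pt_const _ _) H).
Qed.
Lemma pt_V1 (w nv : E -> nat) : ptime w -> ptime nv -> ptime (fun e => ccode (V1 (w e) (nv e))).
move=> HW HN; have Ho: ptime (fun e=> 4 + w e) by pt.
have Ht: ptime (fun e=> tg1 (w e) (nv e)) by rewrite /tg1; pt.
have H1 := pt_rgc (pt_fcirc HW HN Ho (pt_const _ f1) Ht).
have H2 := pt_rgc (pt_fcirc HW HN Ho (pt_const _ f2) (pt_const _ [:: 0])).
by apply: (pt_ext (fun e=> esym (ccode_had _ _))); apply: pt_cat=> //; apply: pt_cat=> //; apply: pt_const.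
Qed.
End Circuits.
Definition encu s : seq bool := flatten (map (fun n => nseq n true ++ [:: false]) s).
Lemma encuK s : dec_unary 0 (encu s) = s.
have H n c t: dec_unary c (nseq n true ++ false :: t) = (c + n) :: dec_unary 0 t by elim: n c=>[|n IH] c/=; rewrite ?addn0// IH addSnnS.
by elim: s=> // n s IH; rewrite /encu/= -catA H IH.
Qed.
Lemma pt_encu (E : encT) (s : E -> seq nat) : ptime s -> ptime (fun e => encu (s e)).
by move=> H; apply/pt_flatten; apply: pt_map; pt. Qed.
Lemma parse_ccode c t : parse_circuits (ccode c ++ 0 :: t) [::] = c :: parse_circuits t [::].
suff H cur: parse_circuits (ccode c ++ 0 :: t) cur = (rev cur ++ c) :: parse_circuits t [::] by [].
by elim: c cur=>[|[i j k|i|i] c IH] cur; rewrite ?cats0//= IH rev_cons cat_rcons.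
Qed.
Section Verifier.
Variables (M : TM) (k : nat).
(** [2 ^ vL1 n] exceeds the running time [2 ^ (n ^ k + k)] by enough to leave blank margins on both
    sides of the tape. *)
Definition vL1 n := n ^ k + k + n + 3.
Definition vw n := Kb M + (vL1 n).+1 + (vL1 n).+1.
Definition vphi x := phiM M x (vL1 (size x)).
(** Scratch space for either formula, obtained by measuring the formulas themselves. *)
Definition vnv x := 4 + vw (size x) + size (f0 (vw (size x)) (vphi x)) + size f2.
Definition verifier x : seq bool :=
 encu (vnv x :: 4 * vw (size x) + 2 :: ccode (V0 (vw (size x)) (vnv x) (vphi x)) ++ 0 :: ccode (V1 (vw (size x)) (vnv x)) ++ [:: 0]).
Lemma pt_verifier : ptime verifier.
have HL: ptime (fun x : seq bool=> vL1 (size x)) by rewrite /vL1; pt.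
have HW: ptime (fun x : seq bool=> vw (size x)).
 have HK: ptime (fun _ : seq bool=> Kb M) by apply: pt_const.
 apply: pt_addn; [apply: pt_addn | ]; [exact: HK | exact: pt_S | exact: pt_S].
have HP: ptime vphi.
 apply: pt_fphi; first exact: pt_S.
 apply: pt_mkseq; last by pt.
 apply: pt_addn; last by apply: pt_b2; pt.
 by rewrite /enc_bit; pt.
have HN: ptime vnv.
 have H0 := pt_f0 HW HP.
 by rewrite /vnv; pt.
have P0 := pt_V0 HW HN HP; have P1 := pt_V1 HW HN.
apply: pt_encu; pt.
Qed.
Lemma verifier_parts x : [/\ vd_nv (verifier x) = vnv x, vd_nm (verifier x) = 4 * vw (size x) + 2 &
 vd_circ (verifier x) = [:: V0 (vw (size x)) (vnv x) (vphi x); V1 (vw (size x)) (vnv x); [::]]].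
rewrite /vd_nv /vd_nm /vd_circ encuK; set v0 := V0 _ _ _; set v1 := V1 _ _; set nm := 4 * _ + 2; clearbody v0 v1 nm.
by rewrite/= drop0 !parse_ccode.
Qed.
End Verifier.
Theorem EXP_QIP3 A : in_EXP A -> in_QIP3_perfect A.
(* The rows and positions have [L = vL1 + 1] bits, and [L + 4] is the exponent reached in
   [no_sound]. *)
case=> M [k H]; exists (fun n=> (vL1 k n).+1 + 4); split; first by apply: ptime_in_poly; rewrite /vL1; pt.
exists (verifier M k); split; first exact/ptime_polytime/pt_verifier.
move=> x; have [y [Hout [Hy Hn]]] := H x; have [e1 e2 e3] := verifier_parts M k x.
rewrite /acc_prob; move: (vd_nv) (vd_nm) (vd_circ) e1 e2 e3=> nv nm Vs -> -> ->.
have HL: size x + 2 ^ (size x ^ k + k) + 3 < 2 ^ vL1 k (size x).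
 rewrite /vL1 -[in X in _ < X]addnA [X in _ < X]expnD.
 have h: size x + 5 <= 2 ^ (size x + 3) by have := @ltn_expl 2 (size x + 2) isT; rewrite [size x + 3]addnS expnS; lia.
 nia.
have L2: 1 < (vL1 k (size x)).+1 by rewrite /vL1 addnS.
have n0: (4 + vw M k (size x)).+1 + size (f0 (vw M k (size x)) (vphi M k x)) <= (vnv M k x).+1 by rewrite /vnv; lia.
have n2: (4 + vw M k (size x)).+1 + size f2 <= (vnv M k x).+1 by rewrite /vnv; lia.
split=> [/Hy ye|/Hn ye].
 have [U0 [U1 [HU0 HU1 acc]]] := yes_complete Hout HL n0 n2 ye.
 exists 0, (fun j=> if j == 0 then U0 else U1); split; first by move=> j; case: (j == 0).
 exact: acc.
move=> D Ps HPs.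
exact: (no_sound Hout HL n0 n2 ye (HPs 0) (HPs 1) L2).
Qed.
Lemma QIP3_gap A : in_QIP3_perfect A -> in_QIP_poly_gap A.
case=> p [pp HA]; exists (fun _=> 1%R), (fun _=> 3), p; split.
 have [M [k H]] : polytime_fun (fun _=>[:: true]) by apply/ptime_polytime/pt_const.
 exists M, M, k, (fun _=>[:: true]), (fun _=>[:: true])=> n; have := H (nseq n true); rewrite size_nseq=> h.
 by do 3![split=>//]; rewrite divff// oner_neq0.
split; first by move=> n; rewrite ltr01 lexx.
by split; first by apply/ptime_in_poly/pt_const.
Qed.

Theorem theorem1 :
  forall A : promise, is_promise_problem A ->
    (in_QIP_poly_gap A <-> in_QIP3_perfect A) /\ (in_QIP3_perfect A <-> in_EXP A).
Proof.
move=> A _; split; split.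
- by move=> /gap_EXP /EXP_QIP3.
- exact: QIP3_gap.
- by move=> /QIP3_gap /gap_EXP.
- exact: EXP_QIP3.
Qed.
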